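(* Let $n$ be the dimension, let $\alpha>0$, and let $u\in C^{1,1}(B_1)$ solve the obstacle problem $\Delta u=f\chi_{\{u>0\}}$, $u\ge 0$ in $B_1\subset\mathbb{R}^n$, for some positive right-hand side $f\in C^{1,\alpha}(B_1)$ with $\inf_{B_1}f>0$. Then $\partial\{u>0\}$ has mean curvature bounded above in $B_{1/2}$, in the viscosity sense, by a constant $C_0$ depending only on $n$, $\inf_{B_1}f$, $\alpha$ and $\|f\|_{C^{1,\alpha}(B_1)}$. That is: for every $z\in\partial\{u>0\}\cap B_{1/2}$, every open set $E$ with $\partial E\in C^2$ and every $\rho>0$ such that $z\in\partial E$ and $\{u>0\}\cap B_\rho(z)\subset E$, one has $$H_{\partial E}(z):=\operatorname{div}\nu_E(z)\le C_0,$$ where $\nu_E$ is the outer unit normal to $E$.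
   Context: $B_r(z)$ is the open ball of radius $r$ centered at $z$, $B_r=B_r(0)$. The equation is understood a.e. in $B_1$. Sign convention: where $\partial\{u>t\}$ is a regular surface its mean curvature is $-\operatorname{div}(\nabla u/|\nabla u|)$, so it is positive if $\{u>t\}$ is convex. In general the bound on the mean curvature of $\partial\{u>0\}$ is understood in the viscosity sense written out in the claim. *)

(* Defs.v *)
From HB Require Import structures.
From mathcomp Require Import all_boot all_order all_algebra.
From mathcomp Require Import all_classical all_reals all_analysis.
Set Implicit Arguments.
Unset Strict Implicit.
Unset Printing Implicit Defensive.
Import Order.TTheory GRing.Theory Num.Theory.
Import numFieldNormedType.Exports.
Local Open Scope classical_set_scope.
Local Open Scope ring_scope.

(** Euclidean structure. The library norm of ['rV[R]_n] is the sup norm: it is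
    used only through the topology and the notion of differentiability, which
    do not depend on the choice of a norm. *)

Definition enorm (R : realType) (n : nat) (x : 'rV[R]_n) : R :=
  Num.sqrt (\sum_i x 0 i ^+ 2).

Definition eball (R : realType) (n : nat) (z : 'rV[R]_n) (r : R) :
  set 'rV[R]_n := [set x | enorm (x - z) < r].

Definition boundary (T : topologicalType) (A : set T) : set T :=
  closure A `\` interior A.

(** Differential operators. ['D_v] is a total operator; every use below comes
    with the differentiability that makes its value meaningful. *)

Definition partial (R : realType) (n : nat) (i : 'I_n) (f : 'rV[R]_n -> R)
  (x : 'rV[R]_n) : R := 'D_(delta_mx 0 i) f x.

Definition grad (R : realType) (n : nat) (f : 'rV[R]_n -> R) (x : 'rV[R]_n) :
  'rV[R]_n := \row_i partial i f x.

Definition div (R : realType) (n : nat) (F : 'rV[R]_n -> 'rV[R]_n)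
  (x : 'rV[R]_n) : R := \sum_i partial i (fun y => F y 0 i) x.

Definition laplacian (R : realType) (n : nat) (f : 'rV[R]_n -> R) :
  'rV[R]_n -> R := div (grad f).

(** Function spaces on an open set [A]. *)

Definition C1_on (R : realType) (n : nat) (A : set 'rV[R]_n)
  (f : 'rV[R]_n -> R) : Prop :=
  forall x, A x -> differentiable f x /\ {for x, continuous (grad f)}.

Definition C2_on (R : realType) (n : nat) (A : set 'rV[R]_n)
  (f : 'rV[R]_n -> R) : Prop :=
  C1_on A f /\ forall i, C1_on A (partial i f).

(** [sup |f| + sup |grad f| + [grad f]_alpha] *)
Definition C1alpha_norm (R : realType) (n : nat) (A : set 'rV[R]_n) (alpha : R)
  (f : 'rV[R]_n -> R) : \bar R :=
  (ereal_sup [set `|f x|%:E | x in A]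
   + ereal_sup [set (enorm (grad f x))%:E | x in A]
   + ereal_sup [set (enorm (grad f p.1 - grad f p.2)
                     / enorm (p.1 - p.2) `^ alpha)%:E
               | p in [set p : 'rV[R]_n * 'rV[R]_n
                      | [/\ A p.1, A p.2 & p.1 <> p.2]]])%E.

Definition C1alpha (R : realType) (n : nat) (A : set 'rV[R]_n) (alpha : R)
  (f : 'rV[R]_n -> R) : Prop :=
  C1_on A f /\ (C1alpha_norm A alpha f < +oo)%E.

(** Sets of Lebesgue measure zero in R^n: for every [eps > 0] there is a
    countable cover by boxes of total volume at most [eps]. *)
Definition lebesgue_null (R : realType) (n : nat) (N : set 'rV[R]_n) : Prop :=
  forall eps : R, 0 < eps ->
  exists a b : nat -> 'rV[R]_n,
    [/\ forall k i, a k 0 i <= b k 0 i,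
        N `<=` \bigcup_k [set x | forall i, a k 0 i <= x 0 i <= b k 0 i] &
        (\sum_(0 <= k <oo) (\prod_i (b k 0 i - a k 0 i))%:E <= eps%:E)%E].

Definition ae_on (R : realType) (n : nat) (A : set 'rV[R]_n)
  (P : 'rV[R]_n -> Prop) : Prop :=
  lebesgue_null [set x | A x /\ ~ P x].

Definition positivity_set (R : realType) (n : nat) (A : set 'rV[R]_n)
  (u : 'rV[R]_n -> R) : set 'rV[R]_n := [set x | A x /\ 0 < u x].

(** The pure second derivatives of a [C^{1,1}] function exist almost
    everywhere, so requiring their existence in the equation is no restriction;
    it prevents the total operator ['D_v] from being read at points where they
    do not exist. *)
Definition obstacle_solution (R : realType) (n : nat) (A : set 'rV[R]_n)
  (f u : 'rV[R]_n -> R) : Prop :=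
  (forall x, A x -> 0 <= u x) /\
  ae_on A (fun x =>
    (forall i, derivable (partial i u) x (delta_mx 0 i)) /\
    laplacian u x = f x * \1_(positivity_set A u) x).

(** Sets with [C^2] boundary: near each boundary point, [E] is the sublevel set
    [{phi < 0}] of a [C^2] function with nonvanishing gradient, and the outer
    unit normal is [grad phi / |grad phi|]. *)

Definition C2_defining (R : realType) (n : nat) (E U : set 'rV[R]_n)
  (phi : 'rV[R]_n -> R) : Prop :=
  [/\ open U, C2_on U phi, forall x, U x -> grad phi x <> 0 &
      E `&` U = [set x | phi x < 0] `&` U].

Definition C2_boundary (R : realType) (n : nat) (E : set 'rV[R]_n) : Prop :=
  forall x, boundary E x -> exists U phi, U x /\ C2_defining E U phi.

Definition outer_unit_normal (R : realType) (n : nat) (E : set 'rV[R]_n)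
  (x nu : 'rV[R]_n) : Prop :=
  exists U phi, [/\ U x, C2_defining E U phi &
                    nu = (enorm (grad phi x))^-1 *: grad phi x].

(** The outer unit normal of [E] lives on the boundary only; its divergence at
    [z] is computed on an extension by unit vectors to a neighborhood of [z].
    The result is the tangential divergence, hence the same for all such
    extensions: differentiating [|nu|^2 = 1] kills the normal contribution. *)
Definition outer_unit_normal_field (R : realType) (n : nat)
  (E : set 'rV[R]_n) (z : 'rV[R]_n) (nu : 'rV[R]_n -> 'rV[R]_n) : Prop :=
  [/\ \forall x \near z, enorm (nu x) = 1,
      \forall x \near z, boundary E x -> outer_unit_normal E x (nu x) &
      differentiable nu z].

Lemma outer_unit_normal_field_exists (R : realType) (n : nat)
  (E : set 'rV[R]_n) (z : 'rV[R]_n) :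
  C2_boundary E -> boundary E z -> exists nu, outer_unit_normal_field E z nu.
Proof.
move=> C2E /C2E[U [phi [Uz defU]]].
have [oU [C1phi C2phi] g0 _] := defU.
pose S (x : 'rV[R]_n) : R := \sum_i grad phi x 0 i ^+ 2.
have S0 x : U x -> 0 < S x.
  move=> Ux; have S_ge0 : 0 <= S x by apply: sumr_ge0 => i _; rewrite sqr_ge0.
  rewrite lt_neqAle S_ge0 andbT eq_sym; apply/negP => /eqP Sx0.
  apply: (g0 x Ux); apply/rowP => i; rewrite [RHS]mxE.
  move/psumr_eq0P: Sx0 => /(_ (fun i _ => sqr_ge0 _))/(_ i isT)/eqP.
  by rewrite sqrf_eq0 => /eqP.
exists (fun x => (enorm (grad phi x))^-1 *: grad phi x); split.
- near=> x; have Ux : U x by near: x; exact: open_nbhs_nbhs.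
  have sS : 0 < Num.sqrt (S x) by rewrite sqrtr_gt0 S0.
  rewrite /enorm -/(S x).
  under eq_bigr do rewrite mxE exprMn.
  rewrite -mulr_sumr -/(S x) exprVn sqr_sqrtr ?ltW ?S0//.
  by rewrite mulVf ?sqrtr1// gt_eqF ?S0.
- near=> x; have Ux : U x by near: x; exact: open_nbhs_nbhs.
  by move=> _; exists U, phi.
- have dg i : differentiable (partial i phi) z by have [] := C2phi i z Uz.
  have gE : grad phi = fun x => \sum_i partial i phi x *: 'e_i.
    by apply/funext => x; rewrite [LHS]row_sum_delta; apply: eq_bigr => i _; rewrite mxE.
  have dG : differentiable (grad phi) z.
    rewrite gE (_ : (fun _ => _) =
      \sum_i (fun x => partial i phi x *: ('e_i : 'rV[R]_n))); last first.
      by apply/funext => x; rewrite fct_sumE.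
    by apply: differentiable_sum => i; apply: differentiableZl.
  have dS : differentiable S z.
    rewrite /S (_ : (fun _ => _) = \sum_i (partial i phi) ^+ 2); last first.
      apply/funext => x; rewrite fct_sumE; apply: eq_bigr => i _.
      by rewrite mxE !expr2.
    by apply: differentiable_sum => i; apply: differentiableX.
  have dsS : differentiable (Num.sqrt \o S) z.
    apply: differentiable_comp => //.
    by apply/derivable1_diffP; have [] := is_derive1_sqrt (S0 _ Uz).
  have dinv : differentiable (fun x => (enorm (grad phi x))^-1) z.
    apply: (@differentiableV _ _ (Num.sqrt \o S)) => //.
    by rewrite gt_eqF //= sqrtr_gt0 S0.
  rewrite (_ : (fun _ => _) = fun x =>
    \sum_i ((enorm (grad phi x))^-1 * partial i phi x) *: 'e_i); last first.
    apply/funext => x; rewrite {2}gE scaler_sumr.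
    by apply: eq_bigr => i _; rewrite scalerA.
  rewrite (_ : (fun _ => _) = \sum_i (fun x =>
     ((enorm (grad phi x))^-1 * partial i phi x) *: ('e_i : 'rV[R]_n))); last first.
    by apply/funext => x; rewrite fct_sumE.
  apply: differentiable_sum => i; apply: differentiableZl.
  exact: differentiableM.
Unshelve. all: by end_near. Qed.

(** The boundary of [A] has mean curvature at most [C] in [V], in the viscosity
    sense: [H_{bd E}(z) = div nu_E (z) <= C] whenever [E] touches [A] from
    outside at [z]. *)
Definition mean_curvature_le (R : realType) (n : nat) (A V : set 'rV[R]_n)
  (C : R) : Prop :=
  forall (z : 'rV[R]_n) (E : set 'rV[R]_n) (rho : R),
    boundary A z -> V z ->
    open E -> C2_boundary E -> 0 < rho ->
    boundary E z -> A `&` eball z rho `<=` E ->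
    forall nu, outer_unit_normal_field E z nu -> div nu z <= C.

(* Main.v *)
(** The proof uses no regularity theory of the free boundary. Let [w = sqrt (2 u)]. As [u] is C^{1,1},
    Jensen's lemma lets the a.e. equation be tested at maxima of [w x - w y - |x - y| Phi x y], where
    [x] and [y] are displaced by the same vector, so that the singular term [|x - y|] does not enter
    at second order. Three choices of the weight [Phi] give, near a zero [x0] of [u] and with constants
    depending on the data of [f] only: a Lipschitz bound for [w]; its improvement to the sharp constant
    [sqrt ((1 + eps) f x0)] on a small ball; and finally the one-sided bound
    [u x <= f x0 / 2 |x - x0|^2 + C |x - x0|^3].

    Now let [E] touch [{u > 0}] from outside at [z], and let [d] be minus the signed distance to the
    boundary of [E]. Points just outside [E] are zeros of [u], so the cubic bound gives
    [u <= f / 2 d^2 + C d^3] up to small errors. If the mean curvature of [E] at [z] exceeded a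
    universal constant, then for a suitable quadratic perturbation [D] of [d] the function
    [la / 2 D_+^2 + K D_+^3] would be a strict supersolution above [u] on the boundary of a small ball
    around [z] while vanishing near [z], so that [z] would not be in the boundary of [{u > 0}]. *)

Require Import Defs.
From mathcomp Require Import all_boot all_order all_algebra.
From mathcomp Require Import all_classical all_reals all_analysis.
From mathcomp Require Import ring lra.
Set Implicit Arguments.
Unset Strict Implicit.
Unset Printing Implicit Defensive.
Import Order.TTheory GRing.Theory Num.Theory.
Import numFieldNormedType.Exports.
Local Open Scope classical_set_scope.
Local Open Scope ring_scope.

(** * Euclidean algebra and topology *)

(** If [u = B(om)] with [B] increasing, the equation reads Delta om = (f - B'' |grad om|^2) / B'.
    For B(w) = w^2 / 2 the right side is (f - |grad w|^2) / w, which increases with [w] wherever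
    |grad w|^2 exceeds [f]. A positive two-point maximum has w x > w y, so it would give Delta w (x)
    > Delta w (y) against maximality; the gain and all errors from the weight carry the same factor
    |x - y|, which cancels. The obstacle is that [w] is merely Lipschitz across zeros of [u]. Every
    test is therefore made on [u], with a one-sided quadratic approximation of the inverse of [B] as
    change of variable, and where w y = 0 the second-order test gives way to the bound |p|^2 <= f y
    for slopes at a zero. The C^{1,1} norm of [u] must not enter the constants. It only starts a
    doubling argument, in which a steep point would make [u] large on a ball close to a zero,
    against a Hopf barrier. At the sharp constant the excess of |grad w|^2 over [f] disappears, and
    the gain with it. Hence the corrected profile [prof], whose second derivative produces a new
    gain, and a weight slightly above the average of sqrt (f / f x0) at the two points. *)

Lemma pos_lower (R : realDomainType) (s : seq R) : all (fun t => 0 < t) s ->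
  exists2 r : R, 0 < r & all (fun t => r <= t) s.
Proof.
elim: s => [|a s IH] /=; first by exists 1.
move=> /andP[a0 /IH[r r0 rs]]; exists (Num.min a r); first by rewrite lt_min a0.
rewrite ge_min lexx /=; apply: sub_all rs => t; apply: le_trans.
by rewrite ge_min lexx orbT.
Qed.

Lemma addrBK (V : zmodType) (x h : V) : x + h - x = h.
Proof. by rewrite addrC addKr. Qed.

Section Euclid.
Context {R : realType} {n : nat}.
Implicit Types (x y z h k l : 'rV[R]_n) (Q S : 'M[R]_n) (a b : R).

Definition dot x y : R := \sum_i x 0 i * y 0 i.

Lemma dotC x y : dot x y = dot y x.
Proof. by apply: eq_bigr => i _; rewrite mulrC. Qed.

Lemma dotDl x y z : dot (x + y) z = dot x z + dot y z.
Proof. by rewrite -big_split; apply: eq_bigr => i _; rewrite mxE mulrDl. Qed.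

Lemma dotZl a x y : dot (a *: x) y = a * dot x y.
Proof. by rewrite mulr_sumr; apply: eq_bigr => i _; rewrite mxE mulrA. Qed.

Lemma dotDr x y z : dot x (y + z) = dot x y + dot x z.
Proof. by rewrite dotC dotDl !(dotC _ x). Qed.

Lemma dotZr a x y : dot x (a *: y) = a * dot x y.
Proof. by rewrite dotC dotZl dotC. Qed.

Lemma dotNl x y : dot (- x) y = - dot x y.
Proof. by rewrite -scaleN1r dotZl mulN1r. Qed.

Lemma dotNr x y : dot x (- y) = - dot x y.
Proof. by rewrite dotC dotNl dotC. Qed.

Lemma dot0l x : dot 0 x = 0.
Proof. by rewrite -(scale0r x) dotZl mul0r. Qed.

Lemma dot0r x : dot x 0 = 0.
Proof. by rewrite dotC dot0l. Qed.

Definition dotE := (dotDl, dotDr, dotNl, dotNr, dotZl, dotZr, dot0l, dot0r).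

Lemma dot_ge0 x : 0 <= dot x x.
Proof. by apply: sumr_ge0 => i _; rewrite -expr2 sqr_ge0. Qed.

Lemma enormE x : enorm x = Num.sqrt (dot x x).
Proof. by congr Num.sqrt; apply: eq_bigr => i _; rewrite expr2. Qed.

Lemma enorm_ge0 x : 0 <= enorm x.
Proof. exact: sqrtr_ge0. Qed.

Lemma enorm_sqr x : enorm x ^+ 2 = dot x x.
Proof. by rewrite enormE sqr_sqrtr // dot_ge0. Qed.

Lemma enormN x : enorm (- x) = enorm x.
Proof. by rewrite !enormE !dotE opprK. Qed.

Lemma enormB x y : enorm (x - y) = enorm (y - x).
Proof. by rewrite -enormN opprB. Qed.

Lemma enormZ a x : enorm (a *: x) = `|a| * enorm x.
Proof. by rewrite !enormE !dotE mulrA -expr2 sqrtrM ?sqr_ge0 // sqrtr_sqr. Qed.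

Lemma enorm0 : enorm (0 : 'rV[R]_n) = 0.
Proof. by rewrite enormE dot0l sqrtr0. Qed.

Lemma coord_le_enorm x i : `|x 0 i| <= enorm x.
Proof.
rewrite /enorm -sqrtr_sqr ler_wsqrtr // (bigD1 i) //= lerDl.
by apply: sumr_ge0 => j _; rewrite sqr_ge0.
Qed.

Lemma enorm_eq0 x : enorm x = 0 -> x = 0.
Proof.
move=> x0; apply/rowP => i; rewrite mxE; apply/eqP.
by rewrite -normr_le0 -x0 coord_le_enorm.
Qed.

Lemma enorm_gt0 x : x != 0 -> 0 < enorm x.
Proof.
move=> xn0; rewrite lt_neqAle enorm_ge0 andbT eq_sym.
by apply: contraNN xn0 => /eqP x0; apply/eqP; exact: enorm_eq0.
Qed.

Lemma dot_le x y : dot x y <= enorm x * enorm y.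
Proof.
have [->|x0] := eqVneq x 0; first by rewrite dot0l enorm0 mul0r.
have [->|y0] := eqVneq y 0; first by rewrite dot0r enorm0 mulr0.
have := dot_ge0 (enorm y *: x - enorm x *: y).
rewrite !dotE -!enorm_sqr (dotC y x).
have := enorm_gt0 x0; have := enorm_gt0 y0.
set p := enorm x; set q := enorm y; set d := dot x y => q0 p0.
rewrite (_ : _ + _ = 2 * (p * q) * (p * q - d)); last by ring.
by rewrite pmulr_rge0 ?subr_ge0 // !mulr_gt0.
Qed.

Lemma dot_norm x y : `|dot x y| <= enorm x * enorm y.
Proof. by rewrite ler_norml dot_le andbT -lerN2 opprK -dotNl -(enormN x) dot_le. Qed.

Lemma enormD x y : enorm (x + y) <= enorm x + enorm y.
Proof.
rewrite -(@ler_pXn2r _ 2) ?nnegrE ?addr_ge0 ?enorm_ge0 //.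
rewrite enorm_sqr !dotE sqrrD !enorm_sqr (dotC y x).
have := dot_le x y; lra.
Qed.

Lemma enorm_triangle y x z : enorm (x - z) <= enorm (x - y) + enorm (y - z).
Proof. by have := enormD (x - y) (y - z); rewrite addrA subrK. Qed.

Lemma enorm_lipschitz x y : `|enorm x - enorm y| <= enorm (x - y).
Proof.
rewrite ler_norml; have := enormD (x - y) y; have := enormD (y - x) x.
rewrite !subrK enormB; lra.
Qed.

(** With s = |x|, this is |x + h| <= (s^2 + |x + h|^2) / (2 s), expanded. It is an exact upper
    bound, so no smallness of [h] is involved. *)
Lemma enorm_expand x h : 0 < enorm x ->
  enorm (x + h) <= enorm x + dot x h / enorm x + enorm h ^+ 2 / (2 * enorm x).
Proof.
set s := enorm x => s0.
have := sqr_ge0 (enorm (x + h) - s).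
rewrite sqrrB [enorm (x + h) ^+ 2]enorm_sqr !dotE -!enorm_sqr -/s (dotC h x) => H.
rewrite -(ler_pM2r (_ : 0 < 2 * s)) ?mulr_gt0 //.
rewrite (_ : (s + _ + _) * (2 * s) = 2 * s ^+ 2 + 2 * dot x h + enorm h ^+ 2); first lra.
by field; rewrite gt_eqF.
Qed.

(** Vectors are rows, so matrices act on the right. [Q] may be non-symmetric, whence the [Q + Q^T]
    in first-order terms. *)
Definition qf Q h := dot (h *m Q) h.

Lemma dot_mulmx x y : dot x y = (x *m y^T) 0 0.
Proof. by rewrite mxE; apply: eq_bigr => i _; rewrite mxE. Qed.

Lemma dot_mul_tr x Q y : dot (x *m Q) y = dot x (y *m Q^T).
Proof. by rewrite !dot_mulmx trmx_mul trmxK mulmxA. Qed.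

Lemma qfD Q x h : qf Q (x + h) = qf Q x + dot (x *m (Q + Q^T)) h + qf Q h.
Proof.
rewrite /qf mulmxDl !dotE mulmxDr !dotE (dot_mul_tr h) (dotC h); ring.
Qed.

Lemma qfDM Q S h : qf (Q + S) h = qf Q h + qf S h.
Proof. by rewrite /qf mulmxDr dotE. Qed.

Lemma qfZM a Q h : qf (a *: Q) h = a * qf Q h.
Proof. by rewrite /qf -scalemxAr dotE. Qed.

Lemma qfZ a Q h : qf Q (a *: h) = a ^+ 2 * qf Q h.
Proof. by rewrite /qf -scalemxAl !dotE mulrA expr2. Qed.

Lemma qf1 a h : qf a%:M h = a * enorm h ^+ 2.
Proof. by rewrite /qf mul_mx_scalar dotZl enorm_sqr. Qed.

Lemma qf_outer l h : qf (l^T *m l) h = dot l h ^+ 2.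
Proof.
rewrite /qf mulmxA [h *m l^T]mx11_scalar mul_scalar_mx dotZl -dot_mulmx.
by rewrite (dotC h) expr2.
Qed.

Lemma tr_outer l : \tr (l^T *m l) = enorm l ^+ 2.
Proof. by rewrite mxtrace_mulC trace_mx11 -dot_mulmx enorm_sqr. Qed.

Lemma enorm_le_norm x : enorm x <= n%:R * `|x|.
Proof.
rewrite -(@ler_pXn2r _ 2) ?nnegrE ?enorm_ge0 ?mulr_ge0 ?ler0n //.
rewrite enorm_sqr /dot (@le_trans _ _ (\sum_(i < n) `|x| ^+ 2)) //.
  apply: ler_sum => i _; rewrite -expr2 -real_normK ?num_real // ler_pXn2r ?nnegrE //.
  by rewrite [leRHS]mx_normrE; apply: le_trans (le_bigmax _ _ (0, i)).
rewrite sumr_const card_ord -[_ *+ _]mulr_natl exprMn ler_wpM2r ?sqr_ge0 //.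
by rewrite -natrX ler_nat; case: (n) => // m; rewrite expnS leq_pmulr.
Qed.

Lemma norm_le_enorm x : `|x| <= enorm x.
Proof.
rewrite [leLHS]mx_normrE; apply/bigmax_leP; split=> [|[i j] _] /=.
  exact: enorm_ge0.
by rewrite (ord1 i) coord_le_enorm.
Qed.

Lemma qf_bound Q : exists2 C, 0 <= C & forall x y, `|dot (x *m Q) y| <= C * enorm x * enorm y.
Proof.
pose C := \sum_i \sum_j `|Q i j|; exists C.
  by apply: sumr_ge0 => i _; apply: sumr_ge0.
move=> x y; rewrite /dot (@le_trans _ _ (\sum_j \sum_i enorm x * enorm y * `|Q i j|)) //.
  apply: le_trans (ler_norm_sum _ _ _) _; apply: ler_sum => j _.
  rewrite mxE mulr_suml; apply: le_trans (ler_norm_sum _ _ _) _.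
  apply: ler_sum => i _; rewrite !normrM mulrAC ler_wpM2r //.
  by rewrite ler_pM // coord_le_enorm.
rewrite exchange_big /= /C -mulrA mulr_suml; apply: ler_sum => i _.
by rewrite mulr_suml; apply: ler_sum => j _; rewrite mulrC.
Qed.

(** The two norms are equivalent, so neighborhoods of the ambient topology can be handled through
    Euclidean balls. *)
Lemma nbhs_eball x (A : set 'rV[R]_n) :
  nbhs x A <-> exists2 e, 0 < e & eball x e `<=` A.
Proof.
split.
  move=> /nbhs_ballP[e /= e0 eA]; exists e => // y xy; apply: eA.
  rewrite -ball_normE /= distrC; exact: le_lt_trans (norm_le_enorm _) xy.
case=> e e0 eA; apply/nbhs_ballP; exists (e / n.+1%:R) => /=; first exact: divr_gt0.
move=> y; rewrite -ball_normE /= distrC => xy; apply: eA.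
apply: le_lt_trans (enorm_le_norm _) _.
apply: (@le_lt_trans _ _ (n.+1%:R * `|y - x|)).
  by rewrite ler_wpM2r // ler_nat.
by rewrite mulrC -ltr_pdivlMr.
Qed.

Lemma open_eball x e : open (eball x e : set 'rV[R]_n).
Proof.
rewrite openE => y xy; apply/nbhs_eball; exists (e - enorm (y - x)).
  by rewrite subr_gt0.
move=> t ty; apply: le_lt_trans (enorm_triangle y _ _) _.
by rewrite -ltrBrDr.
Qed.

Lemma enorm_continuous : continuous (@enorm R n).
Proof.
move=> x A /nbhs_ballP[e /= e0 eA]; apply/nbhs_eball; exists e => // y xy /=.
apply: eA; rewrite -ball_normE /=; apply: le_lt_trans (enorm_lipschitz _ _) _.
by rewrite enormB.
Qed.

Definition cball x e : set 'rV[R]_n := [set y | enorm (y - x) <= e].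

Lemma compact_cball x e : compact (cball x e).
Proof.
apply: bounded_closed_compact.
  exists (`|x| + e); split; first exact: num_real.
  move=> M /ltW le y /= xy; apply: le_trans le.
  rewrite -[y](subrK x) addrC; apply: le_trans (ler_normD _ _) _.
  by rewrite lerD2l; apply: le_trans (norm_le_enorm _) xy.
rewrite (_ : cball x e = (fun y => enorm (y - x)) @^-1` [set t | t <= e]) //.
apply: closed_comp; last exact: closed_le.
move=> y _; apply: (@continuous_comp _ _ _ (fun y => y - x)); last exact: enorm_continuous.
by move=> A /nbhs_eball[r r0 rA]; apply/nbhs_eball; exists r => // t ty /=; apply: rA;
  rewrite /eball /= opprB addrA subrK.
Qed.

Lemma dot_delta x i : dot x 'e_i = x 0 i.
Proof.
rewrite /dot (bigD1 i) //= big1 ?addr0; first by rewrite mxE !eqxx mulr1.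
by move=> j ji; rewrite mxE (negbTE ji) andbF mulr0.
Qed.

Lemma enorm_delta i : enorm ('e_i : 'rV[R]_n) = 1.
Proof. by rewrite enormE dot_delta mxE !eqxx sqrtr1. Qed.

Lemma qf_delta Q i : qf Q 'e_i = Q i i.
Proof. by rewrite /qf dot_delta -rowE mxE. Qed.

(** On a small multiple of [l] itself the linear side wins unless [l] vanishes. One-sided quadratic
    touching identifies gradients in this way. *)
Lemma lin_le_quad0 l C r : 0 < r ->
  (forall h, enorm h < r -> dot l h <= C * enorm h ^+ 2) -> l = 0.
Proof.
move=> r0 H; apply/eqP; case: (eqVneq l 0) => // /enorm_gt0 l0; exfalso.
pose t := Num.min (r / (2 * enorm l)) (1 / (2 * (`|C| + 1))).
have C1 : 0 < 2 * (`|C| + 1) by rewrite mulr_gt0 // ltr_wpDl.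
have t0 : 0 < t by rewrite lt_min !divr_gt0 // mulr_gt0.
have t1 : t * (2 * enorm l) <= r by rewrite -ler_pdivlMr ?mulr_gt0 // ge_min lexx.
have t2 : t * (2 * (`|C| + 1)) <= 1 by rewrite -ler_pdivlMr // ge_min lexx orbT.
have tl : 0 < t * enorm l by rewrite mulr_gt0.
have := H (t *: l); rewrite enormZ gtr0_norm // dotZr -enorm_sqr exprMn.
have -> : t * enorm l < r by lra.
move=> /(_ isT).
have := ler_norm C; set b := enorm l ^+ 2 => Cl.
have b0 : 0 < b by rewrite exprn_gt0.
rewrite (_ : C * _ = t * b * (t * C)); last by ring.
have tb : 0 < t * b by rewrite mulr_gt0.
have tC : t * C <= 1 / 2 by nra.
by nra.
Qed.

End Euclid.

(** * Null sets and contact points *)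

Section NullSets.
Context {R : realType} {n : nat}.
Implicit Types (x y z p : 'rV[R]_n) (a b : nat -> 'rV[R]_n) (N K : set 'rV[R]_n).

Definition vol x y : R := \prod_i (y 0 i - x 0 i).

Definition obox x y : set 'rV[R]_n := [set z | forall i, x 0 i < z 0 i < y 0 i].

(** A form of [lebesgue_null] suited to compactness: the boxes are open and nondegenerate, and the
    total volume is controlled through finite partial sums instead of a series in the extended
    reals. *)
Definition thin N : Prop := forall eps : R, 0 < eps -> exists a b,
  [/\ forall k i, a k 0 i < b k 0 i, N `<=` \bigcup_k obox (a k) (b k) &
      forall m, \sum_(k < m) vol (a k) (b k) <= eps].

Lemma prod_fatten (l : 'I_n -> R) : (forall i, 0 <= l i) ->
  forall d, 0 < d -> exists2 e, 0 < e &
    \prod_i (l i + 2 * e) <= \prod_i l i + d.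
Proof.
move=> l0 d d0; suff [C C0 HC] : exists2 C, 0 <= C & forall e, 0 <= e <= 1 ->
    \prod_i (l i + 2 * e) <= \prod_i l i + C * e.
  exists (Num.min 1 (d / (C + 1))).
    by rewrite lt_min ltr01 divr_gt0 // ltr_wpDl.
  have h0 : 0 <= d / (C + 1) by rewrite divr_ge0 ?ltW // ltr_wpDl.
  apply: le_trans (HC _ _) _; first by rewrite ge_min lexx le_min h0 ler01.
  rewrite lerD2l (@le_trans _ _ (C * (d / (C + 1)))) //.
    by rewrite ler_wpM2l // ge_min lexx orbT.
  by rewrite mulrA ler_pdivrMr ?ltr_wpDl // mulrDr mulr1 mulrC lerDl ltW.
elim: (index_enum _) => [|i s [C C0 HC]].
  by exists 0 => // e _; rewrite !big_nil mul0r addr0.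
have P0 : 0 <= \prod_(j <- s) l j by apply: prodr_ge0.
exists (l i * C + 2 * \prod_(j <- s) l j + 2 * C).
  by rewrite !addr_ge0 ?mulr_ge0.
move=> e /[dup] e01 /andP[e0 e1]; rewrite !big_cons.
have := HC e e01; set P := \prod_(j <- s) l j in P0 *; set P' := \prod_(j <- s) _ => HP.
have := l0 i => li.
apply: le_trans (ler_wpM2l _ HP) _; first lra.
have : e * e * C <= e * C by rewrite ler_wpM2r // ler_piMr.
lra.
Qed.

Lemma lebesgue_null_thin N : lebesgue_null N -> thin N.
Proof.
move=> nN eps eps0.
have [|a [b [ab Nab S]]] := nN (eps / 2); first by rewrite divr_gt0.
have w0 k : 0 < eps / 2 / 2 ^+ k.+1 by rewrite !divr_gt0 // exprn_gt0.
have lk k i : 0 <= b k 0 i - a k 0 i by rewrite subr_ge0.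
pose e k := sval (cid2 (prod_fatten (lk k) (w0 k))).
have e0 k : 0 < e k by rewrite /e; case: cid2.
have eP k : \prod_i (b k 0 i - a k 0 i + 2 * e k) <= vol (a k) (b k) + eps / 2 / 2 ^+ k.+1.
  by rewrite /e; case: cid2.
exists (fun k => \row_i (a k 0 i - e k)), (fun k => \row_i (b k 0 i + e k)); split.
- by move=> k i; rewrite !mxE; have := ab k i; have := e0 k; lra.
- move=> x /Nab[k _ xk]; exists k => // i; rewrite !mxE.
  by have := xk i; have := e0 k; lra.
- move=> m; apply: (@le_trans _ _ (\sum_(k < m) (vol (a k) (b k) + eps / 2 / 2 ^+ k.+1))).
    apply: ler_sum => k _; apply: le_trans (eP k); rewrite le_eqVlt; apply/orP; left.
    by apply/eqP; apply: eq_bigr => i _; rewrite !mxE; ring.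
  rewrite big_split /= [leRHS]splitr lerD //.
    have v0 k : 0 <= vol (a k) (b k) by apply: prodr_ge0 => i _; rewrite subr_ge0.
    rewrite -lee_fin; apply: le_trans S.
    apply: le_trans (nneseries_lim_ge m _); last by move=> k _ _; rewrite lee_fin; exact: v0.
    by rewrite sumEFin big_mkord.
  have E : \sum_(i < m) (2 ^+ i.+1)^-1 = 1 - (2 ^+ m)^-1 :> R.
    elim: m => [|m IH]; first by rewrite big_ord0 expr0 invr1 subrr.
    rewrite big_ord_recr /= IH exprS invfM; lra.
  rewrite -mulr_sumr E ler_piMr // ?gerBl ?invr_ge0 ?exprn_ge0 //.
  by rewrite divr_ge0 // ltW.
Qed.

Lemma thin_sub N N' : N `<=` N' -> thin N' -> thin N.
Proof.
move=> NN tN eps /tN[a [b [ab Nab S]]]; exists a, b; split => //.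
exact: subset_trans Nab.
Qed.

Lemma thin_shift N x : thin N -> thin [set h | N (x + h)].
Proof.
move=> tN eps /tN[a [b [ab Nab S]]].
exists (fun k => a k - x), (fun k => b k - x); split.
- by move=> k i; rewrite !mxE ltrD2r.
- move=> h /Nab[k _ hk]; exists k => // i; have := hk i; rewrite !mxE; lra.
- move=> m; apply: le_trans (S m); apply: ler_sum => k _.
  rewrite le_eqVlt; apply/orP; left; apply/eqP; apply: eq_bigr => i _.
  by rewrite !mxE; ring.
Qed.

Lemma thinU N N' : thin N -> thin N' -> thin (N `|` N').
Proof.
move=> tN tN' eps e0; have e2 : 0 < eps / 2 by rewrite divr_gt0.
have [a [b [ab Nab S]]] := tN _ e2; have [a' [b' [ab' Nab' S']]] := tN' _ e2.
pose mix (c c' : nat -> 'rV[R]_n) k := if odd k then c' k./2 else c k./2.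
exists (mix a a'), (mix b b'); split.
- by move=> k i; rewrite /mix; case: odd.
- move=> x [/Nab[k _ xk]|/Nab'[k _ xk]].
    by exists k.*2 => //; rewrite /mix odd_double doubleK.
  by exists k.*2.+1 => //; rewrite /mix /= odd_double uphalf_double.
- move=> m.
  have v0 k : 0 <= vol (mix a a' k) (mix b b' k).
    by rewrite /mix; case: odd; apply: prodr_ge0 => i _; rewrite subr_ge0 ltW.
  apply: (@le_trans _ _ (\sum_(k < m.*2) vol (mix a a' k) (mix b b' k))).
    rewrite -addnn big_split_ord /= lerDl; exact: sumr_ge0.
  suff -> : \sum_(k < m.*2) vol (mix a a' k) (mix b b' k) =
     \sum_(k < m) vol (a k) (b k) + \sum_(k < m) vol (a' k) (b' k).
    by rewrite [leRHS]splitr lerD.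
  elim: m {v0} => [|m IH]; first by rewrite !big_ord0 addr0.
  rewrite doubleS !big_ord_recr /= IH /mix /= odd_double doubleK uphalf_double /=.
  ring.
Qed.

Lemma open_obox x y : open (obox x y).
Proof.
rewrite openE => z xyz.
have [e e0 He] : exists2 e, 0 < e &
    forall i, i \in index_enum 'I_n -> e <= z 0 i - x 0 i /\ e <= y 0 i - z 0 i.
  elim: (index_enum _) => [|i s [e e0 IH]]; first by exists 1.
  exists (Num.min e (Num.min (z 0 i - x 0 i) (y 0 i - z 0 i))).
    by have /andP[? ?] := xyz i; rewrite !lt_min e0 !subr_gt0; apply/and3P; split.
  move=> j; rewrite inE => /orP[/eqP ->|/IH[H1 H2]].
    by rewrite !ge_min !lexx !orbT.
  by rewrite !ge_min H1 H2.
apply/nbhs_eball; exists e => // t tz i.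
have [H1 H2] := He i (mem_index_enum i).
have := le_lt_trans (coord_le_enorm (t - z) i) tz; rewrite !mxE ltr_norml; lra.
Qed.

Lemma pos_lower_bound (m : nat) (l : nat -> 'I_n -> R) : (forall k i, 0 < l k i) ->
  exists2 d, 0 < d & forall k i, (k < m)%N -> d <= l k i.
Proof.
move=> l0; elim: m => [|m [d d0 IH]]; first by exists 1.
have [e e0 He] : exists2 e, 0 < e & forall i, i \in index_enum 'I_n -> e <= l m i.
  elim: (index_enum _) => [|i s [e e0 IHs]]; first by exists 1.
  exists (Num.min e (l m i)); first by rewrite lt_min e0 l0.
  move=> j; rewrite inE => /orP[/eqP ->|/IHs H]; first by rewrite ge_min lexx orbT.
  by rewrite ge_min H.
exists (Num.min d e); first by rewrite lt_min d0.
move=> k i; rewrite ltnS leq_eqVlt => /orP[/eqP ->|/IH H].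
  by rewrite ge_min He ?orbT ?mem_index_enum.
by rewrite ge_min H.
Qed.

(** Contact points belonging to the slopes of a fine grid are separated, so
    that their number is controlled by the volume of any box cover. *)
Lemma grid_count (G : 'rV[R]_n -> 'rV[R]_n) K (r L : R) m a b (M : nat) :
  0 < r -> 0 < L -> (0 < M)%N ->
  (forall x y, K x -> K y -> `|G x - G y| <= L * `|x - y|) ->
  (forall p, (forall i, 0 <= p 0 i <= r) -> exists2 x, K x & G x = p) ->
  (forall x, K x -> exists2 k, (k < m)%N & obox (a k) (b k) x) ->
  (forall k i, (k < m)%N -> r <= M%:R * L * (b k 0 i - a k 0 i)) ->
  1 <= (2 * L / r) ^+ n * \sum_(k < m) vol (a k) (b k).
Proof.
move=> r0 L0 M0 GL Gs Kab ML.
have M0' : 0 < M%:R :> R by rewrite ltr0n.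
(* Distinct grid slopes differ by at least r / M in some coordinate, so the corresponding contact
   points are at sup distance at least [t]. *)
pose t := r / (M%:R * L); have t0 : 0 < t by rewrite divr_gt0 // mulr_gt0.
pose slope (q : {ffun 'I_n -> 'I_M}) : 'rV[R]_n := \row_i (r * (q i)%:R / M%:R).
have slopeP q i : 0 <= slope q 0 i <= r.
  rewrite mxE ler_pdivrMr // ler_pM2l // ler_nat (ltnW (ltn_ord _)) andbT.
  by rewrite divr_ge0 // mulr_ge0 // ltW.
pose X q := s2val (cid2 (Gs (slope q) (slopeP q))).
have XK q : K (X q) by rewrite /X; case: cid2.
have GX q : G (X q) = slope q by rewrite /X; case: cid2.
have sep q q' : `|X q - X q'| < t -> q = q'.
  move=> lt_t; apply/ffunP => i; apply/val_inj.
  have : `|slope q 0 i - slope q' 0 i| < r / M%:R.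
    rewrite -!GX; apply: (@le_lt_trans _ _ (L * `|X q - X q'|)).
      apply: le_trans (GL _ _ (XK q) (XK q')).
      rewrite [leRHS]mx_normrE; apply: le_trans (le_bigmax _ _ (0, i)).
      by rewrite /= !mxE.
    rewrite mulrC -ltr_pdivlMr // -mulrA -invfM; exact: lt_t.
  rewrite !mxE -mulrBl -mulrBr -mulrA normrM (gtr0_norm r0) ltr_pM2l // normrM.
  rewrite [`|M%:R^-1|]gtr0_norm ?invr_gt0 // ltr_pdivrMr // mulVf ?gt_eqF //.
  have := leq_total (q i) (q' i); case/orP=> le; last first.
    rewrite -natrB // ger0_norm // (_ : 1 = 1%:R) // ltr_nat ltnS leqn0 subn_eq0 => le'.
    by apply/eqP; rewrite eqn_leq le le'.
  rewrite distrC -natrB // ger0_norm // (_ : 1 = 1%:R) // ltr_nat ltnS leqn0 subn_eq0.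
  by move=> le'; apply/eqP; rewrite eqn_leq le le'.
pose kk q : 'I_m := Ordinal (s2valP (cid2 (Kab _ (XK q)))).
have kkP q : obox (a (kk q)) (b (kk q)) (X q) by exact: (s2valP' (cid2 (Kab _ (XK q)))).
pose cell k q i := Num.trunc ((X q 0 i - a k 0 i) / t).
pose W (k : 'I_m) i := (Num.trunc ((b k 0 i - a k 0 i) / t)).+1.
(* The side of a box is at least [t], so rounding the number of cells up to [W] costs at most a
   factor 2. *)
have WP (k : 'I_m) i : (W k i)%:R <= 2 * L / r * M%:R * (b k 0 i - a k 0 i).
  have bt : 1 <= (b k 0 i - a k 0 i) / t.
    rewrite ler_pdivlMr // mul1r ler_pdivrMr ?mulr_gt0 // mulrC; exact: ML.
  rewrite /W -natr1; have bt0 : 0 <= (b k 0 i - a k 0 i) / t by lra.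
  have := bt0; rewrite -truncn_le => bt1.
  apply: le_trans (lerD bt1 bt) _; rewrite le_eqVlt; apply/orP; left; apply/eqP.
  by rewrite /t; field; rewrite !gt_eqF.
pose Q := \max_(k < m) \max_i W k i.
have WQ k i : (W k i <= Q)%N.
  by rewrite /Q (bigD1 k) //= (bigD1 i) //= -maxnA leq_maxl.
(* Two selected points in the same cell of side [t] are closer than [t], hence have the same slope:
   the slopes belonging to one box inject into its cells. *)
have card k : (#|[pred q | kk q == k]| <= \prod_i W k i)%N.
  pose cf q : {ffun 'I_n -> 'I_Q.+1} := [ffun i => inord (cell k q i)].
  have cl q i : kk q == k -> (cell k q i < W k i)%N.
    move=> /eqP <-; have /andP[ax xb] := kkP q i.
    by rewrite ltnS le_truncn // ler_pM2r ?invr_gt0 // lerD2r ltW.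
  have cfE q i : kk q == k -> cf q i = cell k q i :> nat.
    move=> qk; rewrite ffunE inordK // ltnS.
    exact: leq_trans (ltnW (cl q i qk)) (WQ k i).
  have cf_inj : {in [pred q | kk q == k] &, injective cf}.
    move=> q q'; rewrite !inE => qk q'k E; apply: sep.
    rewrite [ltLHS]mx_normrE; apply: bigmax_lt => // -[j i] _ /=; rewrite (ord1 j) !mxE.
    have Ec : cell k q i = cell k q' i by rewrite -!cfE // E.
    have pos q0 : kk q0 == k -> 0 <= (X q0 0 i - a k 0 i) / t.
      move=> /eqP <-; have /andP[ax xb] := kkP q0 i.
      by rewrite divr_ge0 ?ltW // subr_gt0.
    have := truncn_itv (pos _ qk); have := truncn_itv (pos _ q'k).
    rewrite -/(cell k q i) -/(cell k q' i) -Ec -natr1.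
    rewrite !(ler_pdivlMr, ltr_pdivrMr) // mulrDl mul1r ltr_norml.
    by set w := _ * t; lra.
  rewrite -(card_in_image cf_inj).
  pose F i : pred 'I_Q.+1 := [pred j : 'I_Q.+1 | (j < W k i)%N].
  apply: (@leq_trans #|family F|).
    apply: subset_leq_card; apply/fintype.subsetP => c /fintype.imageP[q qk ->].
    by apply/familyP => i; rewrite inE /= cfE // cl.
  rewrite card_family foldrE big_map big_enum /=; apply: leq_prod => i _.
  rewrite -sum1_card -(@big_ord_widen _ _ _ _ _ (fun=> 1%N)) ?sum1_card ?card_ord //.
  exact/leqW.
have cM : (M ^ n <= \sum_(k < m) \prod_i W k i)%N.
  rewrite -[M in (M ^ _)%N]card_ord -[n in (_ ^ n)%N]card_ord -card_ffun -sum1_card.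
  rewrite (partition_big kk predT) //=; apply: leq_sum => k _.
  by rewrite sum1_card card.
(* The factor M^n occurs on both sides and cancels, so the final bound does not see how fine the
   grid is. *)
have : M%:R ^+ n <= (2 * L / r * M%:R) ^+ n * \sum_(k < m) vol (a k) (b k) :> R.
  rewrite -natrX; apply: le_trans (_ : (\sum_(k < m) \prod_i W k i)%:R <= _).
    by rewrite ler_nat.
  rewrite natr_sum mulr_sumr; apply: ler_sum => k _.
  rewrite natr_prod -[n in _ ^+ n]card_ord -prodr_const /vol -big_split /=.
  by apply: ler_prod => i _; rewrite ler0n WP.
rewrite exprMn mulrAC -{1}[_ ^+ n]mul1r ler_pM2r ?exprn_gt0 //.
Qed.

(** A Lipschitz map cannot send a null set onto a cube. Compactness reduces the cover to finitely
    many boxes, and the counting bound then keeps their volume above a fixed positive number, which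
    a cover of half that volume violates. *)
Lemma not_thin_of_cube (G : 'rV[R]_n -> 'rV[R]_n) K (r L : R) :
  0 < r -> 0 < L -> compact K ->
  (forall x y, K x -> K y -> `|G x - G y| <= L * `|x - y|) ->
  (forall p, (forall i, 0 <= p 0 i <= r) -> exists2 x, K x & G x = p) ->
  ~ thin K.
Proof.
move=> r0 L0 cK GL Gs tK.
have c0 : 0 < (2 * L / r) ^+ n by rewrite exprn_gt0 // divr_gt0 // mulr_gt0.
have [|a [b [ab Kab S]]] := tK (((2 * L / r) ^+ n)^-1 / 2).
  by rewrite divr_gt0 // invr_gt0.
have [D _ KD] : finite_subset_cover setT (fun k => obox (a k) (b k)) K.
  move: cK; rewrite compact_cover; apply => // k _; exact: open_obox.
pose m := (\max_(k <- finmap.enum_fset D) k).+1.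
have [d d0 Hd] := @pos_lower_bound m (fun k i => b k 0 i - a k 0 i)
  (fun k i => eqbRL (subr_gt0 _ _) (ab k i)).
(* The grid is taken fine enough that its separation [t] is below every side of the finitely many
   boxes. *)
pose M := (Num.trunc (r / (L * d))).+1.
have Mr : r / (L * d) <= M%:R.
  have /truncn_itv/andP[_ /ltW //] : 0 <= r / (L * d).
  by rewrite divr_ge0 ?ltW // mulr_gt0.
have := @grid_count G K r L m a b M r0 L0 isT GL Gs.
apply/not_implyP; split; last (apply/not_implyP; split) => /=.
- move=> x /KD[k kD xk]; exists k => //; rewrite ltnS.
  by rewrite (big_rem k) //= leq_maxl.
- move=> k i km; move: Mr; rewrite ler_pdivrMr ?mulr_gt0 // => Mr.
  apply: le_trans Mr _; rewrite mulrA ler_pM2l ?mulr_gt0 ?ltr0n //; exact: Hd.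
- apply/negP; rewrite -ltNge.
  apply: le_lt_trans (ler_wpM2l (ltW c0) (S m)) _.
  by rewrite mulrA mulfV ?gt_eqF // mul1r; lra.
Qed.

End NullSets.

Section Jensen.
Context {R : realType} {n : nat}.
Implicit Types (x y z h p : 'rV[R]_n).

Lemma lip_max (A : set 'rV[R]_n) (f : 'rV[R]_n -> R) (C : R) :
  A !=set0 -> compact A ->
  (forall x y, A x -> A y -> `|f x - f y| <= C * enorm (x - y)) ->
  exists2 c, A c & forall x, A x -> f x <= f c.
Proof.
move=> A0 cA H; have [|c cA' cmax] := @EVT_max_rV R n f A A0 cA.
  apply/subspace_continuousP => x Ax B /nbhs_ballP[e /= e0 eB].
  apply/nbhs_eball; exists (e / (`|C| + 1)); first by rewrite divr_gt0 // ltr_wpDl.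
  move=> y xy Ay; apply: eB; rewrite -ball_normE /=.
  apply: le_lt_trans (H _ _ Ax Ay) _; rewrite enormB.
  move: xy; rewrite /eball /= ltr_pdivlMr ?ltr_wpDl // => xy.
  apply: le_lt_trans xy; have := ler_norm C; have := enorm_ge0 (y - x); nra.
by exists c; [exact: set_mem|move=> x Ax; apply: cmax; exact: mem_set].
Qed.

(** The standard way of passing to a limit below: an inequality holds with an error linear in a free
    small parameter, and the error is dropped. *)
Lemma le_of_approx (a b C : R) : (forall d, 0 < d < 1 -> a <= b + C * d) -> a <= b.
Proof.
move=> H; rewrite leNgt; apply/negP => ba.
pose d := Num.min (1 / 2) ((a - b) / (2 * (`|C| + 1))).
have C1 : 0 < 2 * (`|C| + 1) by rewrite mulr_gt0 // ltr_wpDl.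
have d0 : 0 < d by rewrite lt_min !divr_gt0 // subr_gt0.
have d1 : d <= 1 / 2 by rewrite ge_min lexx.
have d2 : d * (2 * (`|C| + 1)) <= a - b by rewrite -ler_pdivlMr // ge_min lexx orbT.
have d11 : d < 1 by lra.
have := H d; rewrite d0 d11 => /(_ isT); have := ler_norm C; nra.
Qed.

(** Every slope of a small cube is attained at a contact point, and the
    gradient is Lipschitz; hence the contact set cannot be negligible. *)
Lemma jensen (v : 'rV[R]_n -> R) (G : 'rV[R]_n -> 'rV[R]_n) (r L e : R)
    (N : set 'rV[R]_n) : 0 < r -> 0 < L -> 0 < e ->
  (forall x y, cball 0 r x -> cball 0 r y ->
    `|v y - v x - dot (G x) (y - x)| <= L * enorm (y - x) ^+ 2) ->
  (forall x y, cball 0 r x -> cball 0 r y -> enorm (G y - G x) <= L * enorm (y - x)) ->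
  (forall x, cball 0 r x -> v x <= v 0 - e * enorm x ^+ 2) ->
  thin N ->
  exists h, [/\ enorm h < r, ~ N h &
    forall y, cball 0 r y -> v y <= v h + dot (G h) (y - h)].
Proof.
move=> r0 L0 e0 vT GL vmax tN.
(* Slopes from a cube of side [rho] have norm below e r, while [v] drops by e r^2 on the sphere of
   radius [r]; tilting [v] by such a slope leaves its maximum in the interior. *)
pose rho := e * r / (2 * n.+1%:R).
have rho0 : 0 < rho by rewrite divr_gt0 ?mulr_gt0 ?ltr0n.
pose contact h := forall y, cball 0 r y -> v y <= v h + dot (G h) (y - h).
pose K : set 'rV[R]_n :=
  [set h | [/\ cball 0 r h, forall i, 0 <= G h 0 i <= rho & contact h]].
have z0 : cball 0 r (0 : 'rV[R]_n) by rewrite /cball /= subr0 enorm0 ltW.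
have G0 := enorm_ge0 (G 0).
pose v0 := v 0; have vmax' x : cball 0 r x -> v x <= v0 - e * enorm x ^+ 2 := vmax x.
have sub0 p h : v 0 <= v h + dot p (0 - h) -> v0 <= v h - dot p h.
  by rewrite sub0r dotNr.
have cbE x : cball 0 r x = (enorm x <= r) :> Prop by rewrite /cball /= subr0.
have Gbd x : cball 0 r x -> enorm (G x) <= enorm (G 0) + L * r.
  move=> xr; rewrite -[G x](subrK (G 0)) addrC; apply: le_trans (enormD _ _) _.
  rewrite lerD2l; apply: le_trans (GL _ _ z0 xr) _.
  by rewrite subr0 ler_pM2l // -cbE.
have dist2 x y : cball 0 r x -> cball 0 r y -> enorm (y - x) <= 2 * r.
  rewrite !cbE => xr yr; apply: le_trans (enormD _ _) _; rewrite enormN; lra.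
pose C := enorm (G 0) + 3 * L * r.
have Lr0 : 0 < L * r by rewrite mulr_gt0.
have C0 : 0 <= C by rewrite /C; lra.
have vL x y : cball 0 r x -> cball 0 r y -> `|v y - v x| <= C * enorm (y - x).
  move=> xr yr; rewrite -[v y - v x](subrK (dot (G x) (y - x))).
  apply: le_trans (ler_normD _ _) _; apply: le_trans (lerD (vT _ _ xr yr) (dot_norm _ _)) _.
  have := enorm_ge0 (y - x); have := dist2 _ _ xr yr; have := Gbd _ xr; rewrite /C.
  set d := enorm (y - x); set g := enorm (G x); set g0 := enorm (G 0) => H1 H2 H3.
  have : L * d * d <= L * (2 * r) * d by rewrite ler_wpM2r // ler_wpM2l // ltW.
  have : g * d <= (g0 + L * r) * d by rewrite ler_wpM2r.
  rewrite expr2; lra.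
have slope_small p : (forall i, 0 <= p 0 i <= rho) -> enorm p < e * r.
  move=> pr; apply: le_lt_trans (enorm_le_norm _) _.
  have : `|p| <= rho.
    rewrite [leLHS]mx_normrE; apply/bigmax_leP; split=> [|[j i] _] /=; first exact: ltW.
    by rewrite (ord1 j); have /andP[? ?] := pr i; rewrite ger0_norm.
  have er : 0 < e * r by rewrite mulr_gt0.
  have n0 : (0 : R) < n.+1%:R by rewrite ltr0n.
  have -> : e * r = rho * (2 * n.+1%:R) by rewrite /rho divfK // gt_eqF // mulr_gt0.
  have := normr_ge0 p; have := ler0n R n; rewrite -natr1; nra.
have Kint h : K h -> enorm h < r.
  case=> hr /slope_small pr ch; have := sub0 _ _ (ch 0 z0); have := vmax' h hr.
  have hr' : enorm h <= r by rewrite -cbE.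
  have := dot_le (- G h) h; rewrite dotNl enormN lt_neqAle hr' andbT => H1 H2 H3.
  apply/eqP => hE; have : enorm (G h) * r < e * r * r by rewrite ltr_pM2r.
  move: H1 H2; rewrite hE; lra.
(* Maximize v x - dot p x over the closed ball. The maximum point is interior, so the gradient there
   is [p], and maximality is the contact condition. *)
have Kattain p : (forall i, 0 <= p 0 i <= rho) -> exists2 x, K x & G x = p.
  move=> pr; have pe := slope_small _ pr.
  have [|||h hr hmax] := @lip_max (cball 0 r) (fun x => v x - dot p x) (C + enorm p).
  - by exists 0.
  - exact: compact_cball.
  - move=> x y xr yr; rewrite (_ : _ - _ = v x - v y - dot p (x - y)); last first.
      by rewrite !dotE; ring.
    apply: le_trans (ler_normB _ _) _; rewrite mulrDl lerD // ?vL // dot_norm //.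
  have hmax' y : cball 0 r y -> v y <= v h + dot p (y - h).
    by move=> /hmax; rewrite !dotE; lra.
  have hlt : enorm h < r.
    have := sub0 _ _ (hmax' 0 z0); have := vmax' h hr.
    have hr' : enorm h <= r by rewrite -cbE.
    have := dot_le (- p) h; rewrite dotNl enormN lt_neqAle hr' andbT => H1 H2 H3.
    apply/eqP => hE; have : enorm p * r < e * r * r by rewrite ltr_pM2r.
    move: H1 H2; rewrite hE; lra.
  have Gh : G h = p.
    apply/eqP; rewrite -subr_eq0; apply/eqP.
    apply: (@lin_le_quad0 _ _ _ L (r - enorm h)); first by rewrite subr_gt0.
    move=> k kr; have kr' : cball 0 r (h + k).
      by rewrite cbE; apply: le_trans (enormD _ _) _; lra.
    have := hmax' _ kr'; have := vT _ _ hr kr'; rewrite ler_norml addrC addKr !dotE.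
    lra.
  by exists h; rewrite ?Gh //; split => //; rewrite ?Gh // /contact Gh.
have KL x y : K x -> K y -> `|G x - G y| <= (L * n.+1%:R) * `|x - y|.
  move=> [xr _ _] [yr _ _]; apply: le_trans (norm_le_enorm _) _.
  apply: le_trans (GL _ _ yr xr) _; rewrite -mulrA ler_pM2l //.
  apply: le_trans (enorm_le_norm _) _; rewrite ler_wpM2r // ler_nat //.
(* The slope bounds and the contact inequality pass to limits because [v] and [G] are Lipschitz.
   Compactness is what turns countable covers into finite ones. *)
have cK : compact K.
  apply: (subclosed_compact _ (@compact_cball _ _ 0 r)); last by move=> h [].
  rewrite closure_id; apply/seteqP; split; first exact: subset_closure.
  move=> h hK.
  have app d : 0 < d -> exists2 k, K k & enorm (k - h) < d.
    move=> d0; have [k [Kk kh]] := hK (eball h d) (iffRL (nbhs_eball _ _) (ex_intro2 _ _ d d0 (fun _ => id))).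
    by exists k.
  have hr : cball 0 r h.
    rewrite cbE; apply: (@le_of_approx _ _ 1) => d /andP[d0 _].
    have [k [kr _ _] kh] := app d d0; move: kr; rewrite cbE => kr.
    rewrite -(subrK k h); apply: le_trans (enormD _ _) _.
    rewrite enormB; lra.
  split => //.
    move=> i; apply/andP; split.
      apply: (@le_of_approx _ _ L) => d /andP[d0 _].
      have [k [kr /(_ i) ki _] kh] := app d d0.
      have := coord_le_enorm (G k - G h) i; have := GL _ _ hr kr.
      rewrite !mxE ler_norml; have : L * enorm (k - h) <= L * d by rewrite ler_pM2l // ltW.
      lra.
    apply: (@le_of_approx _ _ L) => d /andP[d0 _].
    have [k [kr /(_ i) ki _] kh] := app d d0.
    have := coord_le_enorm (G k - G h) i; have := GL _ _ hr kr.
    rewrite !mxE ler_norml; have : L * enorm (k - h) <= L * d by rewrite ler_pM2l // ltW.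
    lra.
  move=> y yr; apply: (@le_of_approx _ _ (C + L * (2 * r) + (enorm (G 0) + L * r))).
  move=> d /andP[d0 _]; have [k [kr _ ck] kh] := app d d0.
  have := ck y yr; have := vL _ _ hr kr; rewrite ler_norml => H1 H2.
  have -> : dot (G h) (y - h) = dot (G k) (y - k) - dot (G k - G h) (y - k) + dot (G h) (k - h).
    by rewrite !dotE; ring.
  have := dot_norm (G k - G h) (y - k); have := dot_norm (G h) (k - h).
  rewrite !ler_norml; have := GL _ _ hr kr; have := Gbd _ hr.
  have := dist2 _ _ kr yr; have := enorm_ge0 (y - k); have := enorm_ge0 (k - h).
  have := enorm_ge0 (G k - G h).
  set d1 := enorm (k - h) in kh H1 *; set d2 := enorm (y - k); set g := enorm (G h).
  set g1 := enorm (G k - G h); set g0 := enorm (G 0).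
  move=> q1 q2 q3 q4 q5 q6 q7 q8.
  have t1 : C * d1 <= C * d by rewrite ler_wpM2l // ltW.
  have t2 : g1 * d2 <= L * d * (2 * r).
    rewrite ler_pM //; apply: le_trans q6 _; rewrite ler_pM2l //; exact: ltW.
  have t3 : g * d1 <= (g0 + L * r) * d.
    rewrite ler_pM ?enorm_ge0 //; exact: ltW.
  lra.
have [h Kh Nh] : exists2 h, K h & ~ N h.
  apply: contrapT => H; apply: (not_thin_of_cube rho0 _ cK KL Kattain).
    by rewrite mulr_gt0 // ltr0n.
  apply: thin_sub tN => h Kh; apply: contrapT => Nh; apply: H; by exists h.
by exists h; split => //; [exact: Kint|case: Kh].
Qed.

End Jensen.

(** * Testing the equation *)

Section Viscosity.
Context {R : realType} {n : nat}.
Implicit Types (x y z h q : 'rV[R]_n) (Q : 'M[R]_n).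

(** The gradient is carried as data and the constant is existential, so membership is stable under
    sums, multiples and squares without any bookkeeping of constants. *)
Definition C11 (r : R) (v : 'rV[R]_n -> R) (G : 'rV[R]_n -> 'rV[R]_n) : Prop :=
  exists2 L, 0 <= L & forall x y, cball 0 r x -> cball 0 r y ->
    `|v y - v x - dot (G x) (y - x)| <= L * enorm (y - x) ^+ 2 /\
    enorm (G y - G x) <= L * enorm (y - x).

Lemma C11D r v G v' G' : C11 r v G -> C11 r v' G' ->
  C11 r (fun x => v x + v' x) (fun x => G x + G' x).
Proof.
move=> [L L0 H] [L' L0' H']; exists (L + L'); first exact: addr_ge0.
move=> x y xr yr; have [A B] := H _ _ xr yr; have [A' B'] := H' _ _ xr yr.
split.
  rewrite (_ : _ - _ - _ = (v y - v x - dot (G x) (y - x)) + (v' y - v' x - dot (G' x) (y - x))).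
    by apply: le_trans (ler_normD _ _) _; rewrite mulrDl lerD.
  by rewrite dotDl; ring.
rewrite (_ : _ - _ = (G y - G x) + (G' y - G' x)); last by rewrite opprD addrACA.
by apply: le_trans (enormD _ _) _; rewrite mulrDl lerD.
Qed.

Lemma C11Z r a v G : C11 r v G -> C11 r (fun x => a * v x) (fun x => a *: G x).
Proof.
move=> [L L0 H]; exists (`|a| * L); first exact: mulr_ge0.
move=> x y xr yr; have [A B] := H _ _ xr yr; split.
  rewrite dotZl -!mulrBr normrM -mulrA; exact: ler_wpM2l.
by rewrite -scalerBr enormZ -mulrA ler_wpM2l.
Qed.

Lemma C11lin r q : C11 r (dot q) (fun=> q).
Proof.
exists 0 => // x y _ _; split; last by rewrite subrr enorm0 mul0r.
by rewrite !dotE subrr normr0 mul0r.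
Qed.

Lemma C11qf r Q : C11 r (qf Q) (fun x => x *m (Q + Q^T)).
Proof.
have [C C0 HC] := qf_bound Q; have [C' C0' HC'] := qf_bound (Q + Q^T).
have CC : 0 <= C + C' by exact: addr_ge0.
exists (C + C') => // x y _ _; have d0 := enorm_ge0 (y - x); split.
  rewrite (_ : _ - _ = qf Q (y - x)); last first.
    have {1}-> : y = x + (y - x) by rewrite addrC subrK.
    by rewrite (qfD _ x); ring.
  apply: le_trans (HC _ _) _; rewrite -mulrA -expr2 ler_wpM2r ?sqr_ge0 //; lra.
rewrite -mulmxBl; set z := y - x.
have [->|/enorm_gt0 z0] := eqVneq (z *m (Q + Q^T)) 0.
  by rewrite enorm0 mulr_ge0.
rewrite -(ler_pM2r z0) -expr2 enorm_sqr; apply: le_trans (ler_norm _) _.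
apply: le_trans (HC' _ _) _; rewrite ler_wpM2r ?(ltW z0) // ler_wpM2r //; lra.
Qed.

Lemma C11_lip r v G : C11 r v G -> 0 <= r -> exists2 C, 0 <= C &
  forall x y, cball 0 r x -> cball 0 r y ->
  [/\ enorm (G x) <= C, `|v y - v x| <= C * enorm (y - x) & `|v x| <= C].
Proof.
move=> [L L0 H] r0; have z0 : cball 0 r (0 : 'rV[R]_n) by rewrite /cball /= subr0 enorm0.
have cbE x : cball 0 r x = (enorm x <= r) :> Prop by rewrite /cball /= subr0.
pose g := enorm (G 0); have g0 : 0 <= g := enorm_ge0 _.
have Lr0 : 0 <= L * r by exact: mulr_ge0.
pose C1 := g + 3 * (L * r).
have GB x : cball 0 r x -> enorm (G x) <= g + L * r.
  move=> xr; have [_] := H _ _ z0 xr; rewrite subr0 => B.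
  rewrite -(subrK (G 0) (G x)); apply: le_trans (enormD _ _) _; rewrite addrC lerD2l.
  apply: le_trans B _; rewrite ler_wpM2l // -cbE //.
have vL x y : cball 0 r x -> cball 0 r y -> `|v y - v x| <= C1 * enorm (y - x).
  move=> xr yr; have [A _] := H _ _ xr yr.
  rewrite -[v y - v x](subrK (dot (G x) (y - x))).
  apply: le_trans (ler_normD _ _) _; apply: le_trans (lerD A (dot_norm _ _)) _.
  have d2 : enorm (y - x) <= 2 * r.
    move: xr yr; rewrite !cbE => xr yr; apply: le_trans (enormD _ _) _; rewrite enormN; lra.
  have d0 := enorm_ge0 (y - x); have := GB _ xr.
  move: d2 d0; set d := enorm (y - x); set k := enorm (G x) => d2 d0 k1.
  have : L * d * d <= L * (2 * r) * d by rewrite ler_wpM2r // ler_wpM2l.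
  have : k * d <= (g + L * r) * d by rewrite ler_wpM2r.
  rewrite /C1 expr2; lra.
have C10 : 0 <= C1 by rewrite /C1; lra.
have C1r : 0 <= C1 * r by exact: mulr_ge0.
have v00 := normr_ge0 (v 0).
exists (C1 + (`|v 0| + C1 * r)); first lra.
move=> x y xr yr; split.
- have C1E : C1 = g + 3 * (L * r) by []; have := GB _ xr; lra.
- apply: le_trans (vL _ _ xr yr) _; rewrite ler_wpM2r ?enorm_ge0 //; lra.
- have := vL _ _ z0 xr; rewrite subr0 => B.
  have xr' : enorm x <= r by rewrite -cbE.
  rewrite -[v x](subrK (v 0)); apply: le_trans (ler_normD _ _) _.
  have : C1 * enorm x <= C1 * r by rewrite ler_wpM2l.
  lra.
Qed.

Lemma C11sq r v G : 0 <= r -> C11 r v G ->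
  C11 r (fun x => v x ^+ 2) (fun x => (2 * v x) *: G x).
Proof.
move=> r0 vG; have [C C0 HC] := C11_lip vG r0; have [L L0 H] := vG.
have CL0 : 0 <= C * L by exact: mulr_ge0.
have CC0 : 0 <= C * C by exact: mulr_ge0.
exists (2 * (C * L) + 2 * (C * C)); first lra.
move=> x y xr yr; have [A B] := H _ _ xr yr; have [G1 V1 V2] := HC _ _ xr yr.
have [_ _ V3] := HC _ _ yr xr; have d0 := enorm_ge0 (y - x); split.
  rewrite dotZl (_ : _ - _ - _ = 2 * (v x * (v y - v x - dot (G x) (y - x))) +
    (v y - v x) * (v y - v x)); last by ring.
  apply: le_trans (ler_normD _ _) _; rewrite [leRHS]mulrDl lerD //.
    rewrite normrM ger0_norm // -[leRHS]mulrA ler_pM2l // normrM -mulrA ler_pM //.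
  rewrite normrM expr2 [leRHS](_ : _ = 2 * ((C * enorm (y - x)) * (C * enorm (y - x)))); last by ring.
  apply: le_trans (ler_pM (normr_ge0 _) (normr_ge0 _) V1 V1) _.
  by rewrite ler_peMl ?mulr_ge0 // ler1n.
rewrite (_ : _ - _ = (2 * v y) *: (G y - G x) + (2 * (v y - v x)) *: G x); last first.
  by rewrite scalerBr mulrBr scalerBl addrA subrK.
apply: le_trans (enormD _ _) _; rewrite !enormZ !normrM ger0_norm // [leRHS]mulrDl lerD //.
  by rewrite -!mulrA ler_pM2l // mulrA -[leRHS]mulrA ler_pM // enorm_ge0.
rewrite -!mulrA ler_pM2l // (mulrC C (enorm _)) [leRHS]mulrA ler_pM ?enorm_ge0 //.
Qed.

Lemma C11_eq r v G v' G' : v =1 v' -> G =1 G' -> C11 r v G -> C11 r v' G'.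
Proof. by move=> /funext -> /funext ->. Qed.

(** A Lipschitz bound between [0] and nearby points only: enough to carry an inequality found at a
    perturbed point [h] back to the centre. *)
Definition lipat (r : R) (a : 'rV[R]_n -> R) : Prop :=
  exists C, forall h, enorm h <= r -> `|a h - a 0| <= C * enorm h.

Lemma lipat_cst r (c : R) : lipat r (fun=> c).
Proof. by exists 0 => h _; rewrite subrr normr0 mul0r. Qed.

Lemma lipatD r a b : lipat r a -> lipat r b -> lipat r (fun h => a h + b h).
Proof.
move=> [C H] [C' H']; exists (C + C') => h hr.
rewrite (_ : _ - _ = (a h - a 0) + (b h - b 0)); last by ring.
by apply: le_trans (ler_normD _ _) _; rewrite mulrDl lerD ?H ?H'.
Qed.

Lemma lipatN r a : lipat r a -> lipat r (fun h => - a h).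
Proof. by move=> [C H]; exists C => h hr; rewrite -opprD normrN H. Qed.

Lemma lipatM r a b : lipat r a -> lipat r b -> lipat r (fun h => a h * b h).
Proof.
move=> [C H] [C' H']; exists ((`|a 0| + `|C| * `|r|) * `|C'| + `|b 0| * `|C|) => h hr.
have h0 := enorm_ge0 h; have := H _ hr; have := H' _ hr.
rewrite (_ : _ * _ - _ = a h * (b h - b 0) + b 0 * (a h - a 0)); last by ring.
move=> B A; apply: le_trans (ler_normD _ _) _; rewrite !normrM [leRHS]mulrDl lerD //.
  rewrite -mulrA ler_pM //; last first.
    by apply: le_trans B _; rewrite ler_wpM2r // ler_norm.
  rewrite -[a h](subrK (a 0)) addrC; apply: le_trans (ler_normD _ _) _.
  rewrite lerD2l; apply: le_trans A _; apply: le_trans (ler_norm _) _.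
  rewrite normrM ler_wpM2l // ger0_norm //; apply: le_trans hr (ler_norm _).
rewrite -mulrA ler_wpM2l //; apply: le_trans A _; rewrite ler_wpM2r // ler_norm.
by [].
Qed.


(** What the viscosity arguments use of the equation. Only [F] is a universal
    constant; the Lipschitz constant of the gradient [Du] is existential. *)
Record osol (F : R) (u f : 'rV[R]_n -> R) (Du : 'rV[R]_n -> 'rV[R]_n) : Prop := OSol {
  os_ge0 : forall x, eball 0 1 x -> 0 <= u x;
  os_C11 : exists2 L, 0 <= L & forall x y, eball 0 1 x -> eball 0 1 y ->
    `|u y - u x - dot (Du x) (y - x)| <= L * enorm (y - x) ^+ 2 /\
    enorm (Du y - Du x) <= L * enorm (y - x);
  os_lip : forall x y, eball 0 1 x -> eball 0 1 y -> `|f x - f y| <= F * enorm (x - y);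
  os_gt0 : forall x, eball 0 1 x -> 0 < f x;
  os_le : forall x, eball 0 1 x -> f x <= F;
  os_ae : exists2 N, thin N & forall x, eball 0 1 x -> ~ N x ->
    exists w : 'I_n -> R, [/\ forall i (e : R), 0 < e -> exists2 d : R, 0 < d &
        forall t : R, `|t| < d ->
        `|u (x + t *: 'e_i) + u (x - t *: 'e_i) - 2 * u x - w i * t ^+ 2| <= e * t ^+ 2,
      0 < u x -> \sum_i w i = f x & \sum_i w i <= f x] }.

Lemma osol_lipat F u f Du x : osol F u f Du -> eball 0 1 x ->
  exists2 r, 0 < r <= 1 & [/\ forall h, enorm h <= r -> eball 0 1 (x + h),
    lipat r (fun h => u (x + h)), lipat r (fun h => f (x + h)),
    lipat r (fun h => enorm (Du (x + h))) &
    C11 r (fun h => u (x + h)) (fun h => Du (x + h))].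
Proof.
move=> os; rewrite /eball /= subr0 => x1.
have r0 : 0 < (1 - enorm x) / 2 by rewrite divr_gt0 // subr_gt0.
have [L L0 H] := os_C11 os.
have x0 := enorm_ge0 x.
exists ((1 - enorm x) / 2); first lra.
have B1 h : enorm h <= (1 - enorm x) / 2 -> eball 0 1 (x + h).
  by move=> hr; rewrite /eball /= subr0; apply: le_lt_trans (enormD _ _) _; lra.
have Bx : eball 0 1 x by rewrite /eball /= subr0.
have xK h : x + h - x = h by rewrite addrC addKr.
split => //.
- exists (enorm (Du x) + L) => h hr; rewrite addr0.
  have [A _] := H _ _ Bx (B1 _ hr); move: A; rewrite xK => A.
  rewrite -[_ - u x](subrK (dot (Du x) h)).
  apply: le_trans (ler_normD _ _) _; rewrite addrC mulrDl lerD ?dot_norm //.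
  apply: le_trans A _; rewrite ler_wpM2l // expr2.
  by rewrite ler_piMl ?enorm_ge0 //; lra.
- exists F => h hr; rewrite addr0; apply: le_trans (os_lip os (B1 _ hr) Bx) _.
  by rewrite xK.
- exists L => h hr; rewrite addr0; have [_ A] := H _ _ Bx (B1 _ hr).
  by apply: le_trans (enorm_lipschitz _ _) _; move: A; rewrite xK.
- exists L => // y z; rewrite /cball /= !subr0 => yr zr.
  have := H _ _ (B1 _ yr) (B1 _ zr).
  by rewrite opprD addrACA subrr add0r.
Qed.

(** Second-order chain rule for a quadratic polynomial in [v]: the second derivative of A v - gm (v
    - v 0)^2 at 0 is A w - 2 gm g^2. Only a first-order Taylor bound and a second difference of [v]
    are available, so the rule is proved in that form. *)
Lemma second_difference_sq (v : R -> R) (g w L s0 : R) : 0 <= L -> 0 < s0 <= 1 ->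
  (forall t, `|t| <= s0 -> `|v t - v 0 - g * t| <= L * t ^+ 2) ->
  (forall e : R, 0 < e -> exists2 d : R, 0 < d & forall t, `|t| < d ->
     `|v t + v (- t) - 2 * v 0 - w * t ^+ 2| <= e * t ^+ 2) ->
  forall (A gm e : R), 0 < e -> exists2 d : R, 0 < d & forall t, `|t| < d ->
   `|A * (v t + v (- t) - 2 * v 0) - gm * ((v t - v 0) ^+ 2 + (v (- t) - v 0) ^+ 2)
     - (A * w - 2 * gm * g ^+ 2) * t ^+ 2| <= e * t ^+ 2.
Proof.
move=> L0 /andP[s00 s01] T S A gm e e0.
have A1 : 0 < 2 * (`|A| + 1) by rewrite mulr_gt0 // ltr_wpDl.
have [d d0 Hd] := S (e / (2 * (`|A| + 1))) (divr_gt0 e0 A1).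
pose C := `|gm| * (2 * (2 * `|g| * L + L ^+ 2)).
have C0 : 0 <= C by rewrite !mulr_ge0 // addr_ge0 ?sqr_ge0 // !mulr_ge0.
have C1 : 0 < 2 * (C + 1) by rewrite mulr_gt0 // ltr_wpDl.
exists (Num.min d (Num.min s0 (e / (2 * (C + 1))))).
  by rewrite !lt_min d0 s00 divr_gt0.
move=> t; rewrite !lt_min => /and3P[td t1 tC].
have sqb s : `|s| <= s0 -> `|(v s - v 0) ^+ 2 - g ^+ 2 * s ^+ 2| <= (2 * `|g| * L + L ^+ 2) * `|s| * s ^+ 2.
  move=> s1; have := T s s1; set r := v s - v 0 - g * s => rb.
  rewrite (_ : _ - _ = 2 * g * s * r + r * r); last by rewrite /r; ring.
  apply: le_trans (ler_normD _ _) _; rewrite !normrM mulrDl mulrDl.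
  have s2 : `|s| * `|s| = s ^+ 2 by rewrite -normrM -expr2 ger0_norm // sqr_ge0.
  apply: lerD.
    rewrite normr_nat [leRHS](_ : _ = 2 * `|g| * `|s| * (L * s ^+ 2)); last by ring.
    by apply: ler_wpM2l => //; rewrite !mulr_ge0.
  apply: le_trans (ler_pM _ _ rb rb) _ => //.
  rewrite [leLHS](_ : _ = L ^+ 2 * s ^+ 2 * s ^+ 2); last by ring.
  rewrite ler_wpM2r ?sqr_ge0 // ler_wpM2l ?sqr_ge0 // -s2 ler_piMl //.
  exact: le_trans s01.
have t1' := ltW t1; have tn : `|- t| <= s0 by rewrite normrN.
have := sqb _ t1'; have := sqb _ tn; rewrite normrN sqrrN => q1 q2.
set D := v t + v (- t) - 2 * v 0; have := Hd _ td; rewrite -/D => q3.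
rewrite (_ : _ - _ = A * (D - w * t ^+ 2) -
  gm * (((v t - v 0) ^+ 2 - g ^+ 2 * t ^+ 2) + ((v (- t) - v 0) ^+ 2 - g ^+ 2 * t ^+ 2))); last first.
  by rewrite /D; ring.
apply: le_trans (ler_normB _ _) _; rewrite !normrM.
have t20 : 0 <= t ^+ 2 := sqr_ge0 t.
have -> : e * t ^+ 2 = e / 2 * t ^+ 2 + e / 2 * t ^+ 2 by clear; lra.
apply: lerD.
  apply: le_trans (ler_wpM2l (normr_ge0 _) q3) _; rewrite mulrA ler_wpM2r //.
  rewrite mulrCA ler_pM2l // invfM mulrCA ler_piMr ?invr_ge0 //.
  by rewrite ler_pdivrMr ?mul1r ?lerDl // ltr_wpDl.
apply: le_trans (ler_wpM2l (normr_ge0 _) (ler_normD _ _)) _.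
apply: le_trans (ler_wpM2l (normr_ge0 _) (lerD q2 q1)) _.
rewrite [leLHS](_ : _ = C * `|t| * t ^+ 2); last by rewrite /C; ring.
rewrite ler_wpM2r //.
have : `|t| * (2 * (C + 1)) <= e by rewrite -ler_pdivlMr // ltW.
have := normr_ge0 t; clear; lra.
Qed.

(** Adding the contact inequality at [t] and [-t] removes the unknown linear term [b]. The
    polynomials are centred at the values [ux], [uy] of the original points, whereas the expansion
    is made at the contact point, whence the corrected coefficients a - 2 g (p 0 - ux). *)
Lemma contact_second_order (p s : R -> R) (ux uy a1 g1 a2 g2 b c gp wp gs ws L s0 : R) :
  0 <= L -> 0 < s0 <= 1 ->
  (forall t, `|t| <= s0 -> `|p t - p 0 - gp * t| <= L * t ^+ 2) ->
  (forall e : R, 0 < e -> exists2 d : R, 0 < d & forall t, `|t| < d ->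
     `|p t + p (- t) - 2 * p 0 - wp * t ^+ 2| <= e * t ^+ 2) ->
  (forall t, `|t| <= s0 -> `|s t - s 0 - gs * t| <= L * t ^+ 2) ->
  (forall e : R, 0 < e -> exists2 d : R, 0 < d & forall t, `|t| < d ->
     `|s t + s (- t) - 2 * s 0 - ws * t ^+ 2| <= e * t ^+ 2) ->
  (forall t, `|t| <= s0 ->
    (a1 * (p t - ux) - g1 * (p t - ux) ^+ 2) - (a2 * (s t - uy) - g2 * (s t - uy) ^+ 2)
      - c * t ^+ 2 <=
    (a1 * (p 0 - ux) - g1 * (p 0 - ux) ^+ 2) - (a2 * (s 0 - uy) - g2 * (s 0 - uy) ^+ 2)
      + b * t) ->
  ((a1 - 2 * g1 * (p 0 - ux)) * wp - 2 * g1 * gp ^+ 2) -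
  ((a2 - 2 * g2 * (s 0 - uy)) * ws - 2 * g2 * gs ^+ 2) <= 2 * c.
Proof.
move=> L0 s01 Tp Sp Ts Ss H.
have Dp := second_difference_sq L0 s01 Tp Sp; have Ds := second_difference_sq L0 s01 Ts Ss.
apply: (@le_of_approx _ _ _ 2) => e /andP[e0 _].
have [d1 d10 H1] := Dp (a1 - 2 * g1 * (p 0 - ux)) g1 e e0.
have [d2 d20 H2] := Ds (a2 - 2 * g2 * (s 0 - uy)) g2 e e0.
have [s0p _] := andP s01.
have [|t t0 /and4P[ts td1 td2 _]] := @pos_lower _ [:: s0; d1 / 2; d2 / 2].
  by rewrite /= s0p !divr_gt0.
have [tn1 tn2 tn3] : [/\ `|t| < d1, `|t| < d2 & `|t| <= s0] by rewrite gtr0_norm //; split; clear -td2 td1 ts t0; lra.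
have t20 : 0 < t ^+ 2 by rewrite exprn_gt0.
rewrite -(ler_pM2r t20).
have := H1 _ tn1; have := H2 _ tn2; rewrite !ler_norml => /andP[_ q2] /andP[q1 _].
have := H _ tn3; have := H (- t); rewrite normrN sqrrN => /(_ tn3).
move: q1 q2; clear; lra.
Qed.

(** The polynomials a t - g t^2 are changes of variable to second order. Subtracting the quadratic
    bound with [d] added to the matrix gives a function with a strict maximum at 0; Jensen's lemma
    yields a nearby contact point at which the equation may be used at both displaced points, and
    [d] tends to 0. The sign conditions reflect that the equation is an equality where [u] is
    positive and only Delta u <= f elsewhere. *)
Lemma two_point (F : R) u f Du x y (a1 g1 a2 g2 : R) q Q :
  osol F u f Du -> eball 0 1 x -> eball 0 1 y ->
  0 < u x \/ (a1 = 0 /\ g1 = 0) -> 0 < u y \/ (0 <= a2 /\ g2 = 0) ->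
  (exists2 rho, 0 < rho & forall h, enorm h < rho ->
    (a1 * (u (x + h) - u x) - g1 * (u (x + h) - u x) ^+ 2) -
    (a2 * (u (y + h) - u y) - g2 * (u (y + h) - u y) ^+ 2) <= dot q h + qf Q h) ->
  a1 * f x - 2 * g1 * enorm (Du x) ^+ 2 - a2 * f y + 2 * g2 * enorm (Du y) ^+ 2
    <= 2 * \tr Q.
Proof.
move=> os Bx By ux uy [rho rho0 touch].
have [rx /andP[rx0 rx1] [Ix lux lfx lgx cux]] := osol_lipat os Bx.
have [ry /andP[ry0 ry1] [Iy luy lfy lgy cuy]] := osol_lipat os By.
have pos z r : 0 < u z -> lipat r (fun h => u (z + h)) ->
    exists2 p : R, 0 < p & forall h, enorm h <= r -> enorm h <= p -> 0 < u (z + h).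
  move=> uz [C HC]; exists (u z / (2 * (`|C| + 1))).
    by rewrite divr_gt0 // mulr_gt0 // ltr_wpDl.
  move=> h hr; rewrite ler_pdivlMr ?mulr_gt0 ?ltr_wpDl // => hp.
  have := HC h hr; rewrite addr0 ler_norml => /andP[H _].
  have := ler_norm C; have := enorm_ge0 h => h0 C1.
  have : C * enorm h <= `|C| * enorm h by rewrite ler_wpM2r.
  clear -h0 H hp uz; lra.
have [px px0 Hpx] : exists2 p : R, 0 < p & forall h, enorm h <= rx -> enorm h <= p ->
    0 < u (x + h) \/ (a1 = 0 /\ g1 = 0).
  case: ux => [/pos/(_ lux)[p p0 Hp]|]; last by exists 1 => // *; right.
  by exists p => // h h1 h2; left; exact: Hp.
have [py py0 Hpy] : exists2 p : R, 0 < p & forall h, enorm h <= ry -> enorm h <= p ->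
    0 < u (y + h) \/ (0 <= a2 /\ g2 = 0).
  case: uy => [/pos/(_ luy)[p p0 Hp]|]; last by exists 1 => // *; right.
  by exists p => // h h1 h2; left; exact: Hp.
pose r0 := Num.min rx ry.
have sub r r' a : r <= r' -> lipat r' a -> lipat r a.
  by move=> rr [C HC]; exists C => h hr; apply: HC; exact: le_trans rr.
have r0x : r0 <= rx by rewrite ge_min lexx.
have r0y : r0 <= ry by rewrite ge_min lexx orbT.
(* The derivative of the change of variable at the displaced point; it multiplies the Laplacian of
   [u] there. *)
pose A1 h := a1 - 2 * g1 * (u (x + h) - u x).
pose A2 h := a2 - 2 * g2 * (u (y + h) - u y).
pose LH h := A1 h * f (x + h) - 2 * g1 * enorm (Du (x + h)) ^+ 2
           - A2 h * f (y + h) + 2 * g2 * enorm (Du (y + h)) ^+ 2.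
have [C HC] : lipat r0 LH.
  have lA a g z : lipat r0 (fun h => u (z + h)) -> lipat r0 (fun h => a - 2 * g * (u (z + h) - u z)).
    move=> l; apply: lipatD; first exact: lipat_cst.
    apply: lipatN; apply: lipatM; first exact: lipat_cst.
    by apply: lipatD => //; exact: lipat_cst.
  have lx := sub _ _ _ r0x lux; have ly := sub _ _ _ r0y luy.
  have lgx2 := sub _ _ _ r0x lgx; have lgy2 := sub _ _ _ r0y lgy.
  apply: lipatD; last first.
    by apply: lipatM; [exact: lipat_cst|apply: lipatM].
  apply: lipatD; last first.
    by apply: lipatN; apply: lipatM; [exact: lA|exact: sub lfy].
  apply: lipatD; first by apply: lipatM; [exact: lA|exact: sub lfx].
  by apply: lipatN; apply: lipatM; [exact: lipat_cst|apply: lipatM].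
have LH0 : LH 0 = a1 * f x - 2 * g1 * enorm (Du x) ^+ 2 - a2 * f y + 2 * g2 * enorm (Du y) ^+ 2.
  by rewrite /LH /A1 /A2 !addr0 !subrr !mulr0 !subr0.
rewrite -LH0; apply: (@le_of_approx _ _ _ (2 * n%:R + `|C|)) => d /andP[d0 d1].
pose r := Num.min (Num.min r0 d) (Num.min (rho / 2) (Num.min px py)).
have [rr0 rd rrho rpx rpy] : [/\ r <= r0, r <= d, r <= rho / 2, r <= px & r <= py].
  have := lexx r; rewrite {2}/r /r0 !le_min -!andbA => /andP[r1 /and5P[r2 -> -> -> ->]].
  by rewrite r1 r2.
have rpos : 0 < r by rewrite !lt_min rx0 ry0 d0 divr_gt0 // px0 py0.
suff [h hr Hh] : exists2 h, enorm h <= r & LH h <= 2 * \tr Q + 2 * n%:R * d.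
  have := HC _ (le_trans hr rr0); rewrite ler_norml => /andP[H1 _].
  have : C * enorm h <= `|C| * d.
    apply: le_trans (_ : `|C| * enorm h <= _); first by rewrite ler_wpM2r ?enorm_ge0 // ler_norm.
    by rewrite ler_wpM2l // (le_trans hr).
  clear -H1 Hh; lra.
have C11sub z rz : C11 rz (fun h => u (z + h)) (fun h => Du (z + h)) -> r <= rz ->
    C11 r (fun h => u (z + h)) (fun h => Du (z + h)).
  move=> [L L0 H] le; exists L => // a b ar br; apply: H; exact: le_trans le.
have cst c : C11 r (fun=> c) (fun=> 0).
  by exists 0 => // a b _ _; rewrite dot0l !subrr normr0 enorm0 !mul0r.
have cP z a g : C11 r (fun h => u (z + h)) (fun h => Du (z + h)) -> exists G,
    C11 r (fun h => a * (u (z + h) - u z) - g * (u (z + h) - u z) ^+ 2) G.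
  move=> /C11D/(_ (cst (- u z))) c1.
  have c2 := C11D (C11Z a c1) (C11Z (- g) (C11sq (ltW rpos) c1)).
  eexists; apply: C11_eq c2; last by move=> ?; reflexivity.
  by move=> h /=; rewrite mulNr.
have [Gx cGx] := cP x a1 g1 (C11sub _ _ cux (le_trans rr0 r0x)).
have [Gy cGy] := cP y a2 g2 (C11sub _ _ cuy (le_trans rr0 r0y)).
(* Adding [d] to the matrix lowers the touching function by d |h|^2, which supplies the strict
   maximum that [jensen] requires. *)
pose v h := (a1 * (u (x + h) - u x) - g1 * (u (x + h) - u x) ^+ 2) +
  -1 * (a2 * (u (y + h) - u y) - g2 * (u (y + h) - u y) ^+ 2) +
  -1 * (dot q h + qf (Q + d%:M) h).
have [G [L L0 vG]] : exists G, C11 r v G.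
  eexists; apply: C11D; first by apply: C11D; [exact: cGx|apply: C11Z; exact: cGy].
  by apply: C11Z; apply: C11D; [exact: C11lin|exact: C11qf].
have [N tN HN] := os_ae os.
(* Both x + h and y + h must avoid the exceptional set of the equation, so the excluded set is a
   union of two translates of it. *)
have [h [hr hN ct]] : exists h, [/\ enorm h < r, ~ (N (x + h) \/ N (y + h)) &
    forall y0, cball 0 r y0 -> v y0 <= v h + dot (G h) (y0 - h)].
  apply: (@jensen _ _ v G r (L + 1) d [set h | N (x + h) \/ N (y + h)]) => //.
  - by rewrite ltr_wpDl.
  - move=> a b ar br; apply: le_trans (vG _ _ ar br).1 _.
    by rewrite ler_wpM2r ?sqr_ge0 // lerDl.
  - move=> a b ar br; apply: le_trans (vG _ _ ar br).2 _.
    by rewrite ler_wpM2r ?enorm_ge0 // lerDl.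
  - move=> h; rewrite /cball /= subr0 => hr.
    have v00 : v 0 = 0.
      rewrite /v !addr0 !subrr dot0r /qf mul0mx dot0l; ring.
    have hrho : enorm h < rho by clear -hr rpos rrho; lra.
    have := touch h hrho; rewrite v00 /v qfDM qf1; clear; lra.
  - exact: thinU (thin_shift x tN) (thin_shift y tN).
exists h; first exact: ltW.
have hr0 := le_trans (ltW hr) rr0.
have [hrx hry] : enorm h <= rx /\ enorm h <= ry by split; exact: le_trans hr0 _.
have [w [Sw wE wle]] := HN _ (Ix _ hrx) (fun H => hN (or_introl H)).
have [w' [Sw' wE' wle']] := HN _ (Iy _ hry) (fun H => hN (or_intror H)).
(* Only traces occur in the conclusion, so pure second differences along the coordinate axes
   suffice; mixed derivatives never appear. *)
have key i : (A1 h * w i - 2 * g1 * Du (x + h) 0 i ^+ 2) -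
   (A2 h * w' i - 2 * g2 * Du (y + h) 0 i ^+ 2) <= 2 * (Q i i + d).
  have [L' L0' HL'] := os_C11 os.
  pose s0 := r - enorm h.
  have s00 : 0 < s0 <= 1 by move: hr rr0 r0x rx1 (enorm_ge0 h); rewrite /s0; clear; lra.
  have line t : `|t| <= s0 -> enorm (h + t *: 'e_i) <= r.
    move=> ts; apply: le_trans (enormD _ _) _; rewrite enormZ enorm_delta mulr1.
    by rewrite addrC -lerBrDr.
  have T z rz : r <= rz -> (forall k, enorm k <= rz -> eball 0 1 (z + k)) -> forall t, `|t| <= s0 ->
      `|u (z + (h + t *: 'e_i)) - u (z + (h + 0 *: 'e_i)) - Du (z + h) 0 i * t| <= L' * t ^+ 2.
    move=> rz' Iz t ts; rewrite scale0r addr0.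
    have B0 : eball 0 1 (z + h) by apply: Iz; exact: le_trans (ltW hr) rz'.
    have Bt : eball 0 1 (z + (h + t *: 'e_i)).
      by apply: Iz; exact: le_trans (line _ ts) rz'.
    have [A _] := HL' _ _ B0 Bt; move: A.
    have -> : z + (h + t *: 'e_i) - (z + h) = t *: 'e_i by rewrite addrA [z + h + _]addrC addrK.
    by rewrite dotZr dot_delta enormZ enorm_delta mulr1 real_normK ?num_real // mulrC.
  have S z w0 : (forall e : R, 0 < e -> exists2 d : R, 0 < d & forall t : R, `|t| < d ->
      `|u (z + h + t *: 'e_i) + u (z + h - t *: 'e_i) - 2 * u (z + h) - w0 * t ^+ 2| <= e * t ^+ 2) ->
      forall e : R, 0 < e -> exists2 d : R, 0 < d & forall t : R, `|t| < d ->
      `|u (z + (h + t *: 'e_i)) + u (z + (h + (- t) *: 'e_i)) - 2 * u (z + (h + 0 *: 'e_i)) - w0 * t ^+ 2| <= e * t ^+ 2.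
    by move=> H e /H[d' d'0 Hd']; exists d' => // t /Hd'; rewrite scaleNr scale0r addr0 !addrA.
  have := @contact_second_order (fun t => u (x + (h + t *: 'e_i)))
    (fun t => u (y + (h + t *: 'e_i))) (u x) (u y) a1 g1 a2 g2
    (dot q 'e_i + dot (h *m (Q + d%:M + (Q + d%:M)^T)) 'e_i + dot (G h) 'e_i) (Q i i + d)
    (Du (x + h) 0 i) (w i) (Du (y + h) 0 i) (w' i) L' s0 L0' s00
    (T _ _ (le_trans rr0 r0x) Ix) (S _ _ (Sw i)) (T _ _ (le_trans rr0 r0y) Iy) (S _ _ (Sw' i)).
  rewrite /A1 /A2 scale0r !addr0; apply => t ts.
  have cb : cball 0 r (h + t *: 'e_i) by rewrite /cball /= subr0; exact: line.
  have := ct _ cb; rewrite (addrC h) addrK -(addrC h) /v dotDr (qfD _ h) qfZ qf_delta !mxE eqxx !dotZr.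
  rewrite -[d *+ true]/(d *+ 1) mulr1n.
  by clear; lra.
have : \sum_i ((A1 h * w i - 2 * g1 * Du (x + h) 0 i ^+ 2) -
   (A2 h * w' i - 2 * g2 * Du (y + h) 0 i ^+ 2)) <= \sum_i (2 * (Q i i + d)).
  by apply: ler_sum => i _; exact: key.
have -> : \sum_i (2 * (Q i i + d)) = 2 * (\tr Q + n%:R * d).
  by rewrite -mulr_sumr big_split /= sumr_const card_ord -[d *+ n]mulr_natl.
rewrite !sumrB -!mulr_sumr.
have sqE z : \sum_i Du z 0 i ^+ 2 = enorm (Du z) ^+ 2.
  by rewrite enorm_sqr; apply: eq_bigr => i _; rewrite expr2.
rewrite !sqE.
(* Either [u] stays positive near [x] and the equation holds there, or the coefficient is
   identically zero. At [y] the coefficient is nonnegative, and the inequality Delta u <= f points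
   the right way. *)
have -> : A1 h * \sum_i w i = A1 h * f (x + h).
  case: (Hpx h hrx (le_trans (ltW hr) rpx)) => [/wE -> //|[a0 g0]].
  by rewrite /A1 a0 g0 !(mulr0, mul0r) subrr !mul0r.
have : A2 h * \sum_i w' i <= A2 h * f (y + h).
  case: (Hpy h hry (le_trans (ltW hr) rpy)) => [/wE' -> //|[a0 g0]].
  by rewrite ler_wpM2l // /A2 g0 !(mulr0, mul0r) subr0.
rewrite /LH; clear; lra.
Qed.

End Viscosity.

(** * One-sided tests of the equation by quadratics and by barriers *)

Section Touching.
Context {R : realType} {n : nat}.
Implicit Types (x y z h k p q l : 'rV[R]_n) (Q S : 'M[R]_n).

Variables (F : R) (u f : 'rV[R]_n -> R) (Du : 'rV[R]_n -> 'rV[R]_n).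
Hypothesis os : osol F u f Du.

Lemma touch_above x q Q : eball 0 1 x -> 0 < u x ->
  (exists2 rho : R, 0 < rho & forall h, enorm h < rho ->
     u (x + h) - u x <= dot q h + qf Q h) ->
  f x <= 2 * \tr Q.
Proof.
move=> Bx ux [rho rho0 H].
have := @two_point _ _ F u f Du x x 1 0 0 0 q Q os Bx Bx (or_introl ux) (or_introl ux).
rewrite !(mulr0, mul0r, mul1r, subr0, addr0); apply.
by exists rho => // h /H; rewrite !mul0r !subr0 mul1r.
Qed.

(** Valid at zeros of [u] as well, since Delta u <= f almost everywhere in the ball. This is the
    case of [two_point] in which only the second point carries a term. *)
Lemma touch_below x q Q : eball 0 1 x ->
  (exists2 rho : R, 0 < rho & forall h, enorm h < rho ->
     dot q h + qf Q h <= u (x + h) - u x) ->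
  2 * \tr Q <= f x.
Proof.
move=> Bx [rho rho0 H].
have := @two_point _ _ F u f Du x x 0 0 1 0 (- q) (- Q) os Bx Bx
  (or_intror (conj erefl erefl)) (or_intror (conj ler01 erefl)).
rewrite !(mulr0, mul0r, mul1r, subr0, addr0) sub0r linearN mulrN lerN2; apply.
exists rho => // h /H; rewrite !mul0r !subr0 mul1r dotNl -[- Q]scaleN1r qfZM sub0r mulN1r.
lra.
Qed.

(** [s] is a sign, so that upper and lower expansions are treated at once. *)
Lemma comp_expand (g : R -> R) (D : R) l S (s g1 g2 e : R) : 0 < e ->
  (exists2 d : R, 0 < d & forall t, `|t| < d -> s * (g (D + t) - g D) <= g1 * t + g2 * t ^+ 2) ->
  exists2 rho : R, 0 < rho & forall h, enorm h < rho ->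
    s * (g (D + (dot l h + qf S h)) - g D) <=
    dot (g1 *: l) h + qf (g1 *: S + g2 *: (l^T *m l) + e%:M) h.
Proof.
move=> e0 [d d0 H]; have [C C0 HC] := qf_bound S.
pose a := enorm l; have a0 : 0 <= a := enorm_ge0 l.
pose K := `|g2| * (2 * a * C + C ^+ 2).
have K0 : 0 <= K by rewrite mulr_ge0 // addr_ge0 ?sqr_ge0 // !mulr_ge0.
have [|rho rho0 /and4P[r1 r2 r3 _]] := @pos_lower _ [:: 1; d / (2 * (a + C + 1)); e / (K + 1)].
  by rewrite /= ltr01 !divr_gt0 ?mulr_gt0 ?ltr_wpDl // addr_ge0.
exists rho => // h hr; have h0 := enorm_ge0 h.
set t := dot l h + qf S h.
have lb : `|dot l h| <= a * enorm h := dot_norm l h.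
have qb : `|qf S h| <= C * enorm h ^+ 2 by rewrite expr2 mulrA HC.
have hh : enorm h ^+ 2 <= enorm h by rewrite expr2 ler_piMl //; lra.
have td : `|t| < d.
  apply: le_lt_trans (ler_normD _ _) _.
  apply: (@le_lt_trans _ _ ((a + C) * enorm h)).
    by rewrite mulrDl lerD // (le_trans qb) // ler_wpM2l.
  apply: (@le_lt_trans _ _ ((a + C + 1) * rho)).
    by rewrite ler_pM ?addr_ge0 // ?lerDl // ltW.
  move: r2; rewrite ler_pdivlMr ?mulr_gt0 ?ltr_wpDl ?addr_ge0 // => r2.
  by rewrite mulrC; lra.
apply: le_trans (H t td) _.
rewrite dotZl !qfDM !qfZM qf_outer qf1.
suff : g2 * t ^+ 2 <= g2 * dot l h ^+ 2 + e * enorm h ^+ 2 by rewrite /t; lra.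
rewrite -lerBlDl -mulrBr; apply: le_trans (ler_norm _) _; rewrite normrM.
have -> : t ^+ 2 - dot l h ^+ 2 = 2 * dot l h * qf S h + qf S h * qf S h by rewrite /t; ring.
have Cb : `|qf S h| <= C * enorm h by rewrite (le_trans qb) // ler_wpM2l.
apply: (@le_trans _ _ (K * enorm h * enorm h ^+ 2)).
  rewrite /K -!mulrA ler_wpM2l //; apply: le_trans (ler_normD _ _) _.
  rewrite [leRHS]mulrDl lerD // normrM.
    rewrite normrM ger0_norm // -mulrA -[leRHS](_ : 2 * ((a * enorm h) * (C * enorm h ^+ 2)) = _); last by ring.
    by rewrite ler_pM2l // ler_pM.
  rewrite -[leRHS](_ : (C * enorm h) * (C * enorm h ^+ 2) = _); last by ring.
  by rewrite ler_pM.
rewrite ler_wpM2r ?sqr_ge0 //.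
have : (K + 1) * enorm h <= e.
  by rewrite mulrC -ler_pdivlMr ?ltr_wpDl //; lra.
lra.
Qed.

Lemma tr_comp (g1 g2 e : R) l S :
  \tr (g1 *: S + g2 *: (l^T *m l) + e%:M) = g1 * \tr S + g2 * enorm l ^+ 2 + n%:R * e.
Proof. by rewrite !linearD !linearZ /= tr_outer mxtrace_scalar mulr_natl. Qed.

(** Barriers have the form g(D). Here [l] is the gradient of D, [S] half its Hessian and [g2] half
    of g'', so the right side is the Laplacian of g(D). *)
Lemma touch_above_comp x (g : R -> R) (D : R) l S (g1 g2 : R) : eball 0 1 x -> 0 < u x ->
  (exists2 d : R, 0 < d & forall t, `|t| < d -> g (D + t) - g D <= g1 * t + g2 * t ^+ 2) ->
  (exists2 rho : R, 0 < rho & forall h, enorm h < rho ->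
     u (x + h) - u x <= g (D + (dot l h + qf S h)) - g D) ->
  f x <= 2 * (g1 * \tr S + g2 * enorm l ^+ 2).
Proof.
move=> Bx ux Hg [rho rho0 H].
apply: (@le_of_approx _ _ _ (2 * n%:R)) => e /andP[e0 _].
have [|r r0 Hr] := @comp_expand g D l S 1 g1 g2 e e0.
  by case: Hg => d d0 Hd; exists d => // t /Hd; rewrite mul1r.
have := @touch_above x (g1 *: l) (g1 *: S + g2 *: (l^T *m l) + e%:M) Bx ux
  (ex_intro2 _ _ (Num.min rho r) _ _).
rewrite lt_min rho0 r0 tr_comp => /(_ isT) W.
suff /W : forall h, enorm h < Num.min rho r -> u (x + h) - u x <=
    dot (g1 *: l) h + qf (g1 *: S + g2 *: (l^T *m l) + e%:M) h by lra.
move=> h; rewrite lt_min => /andP[h1 h2]; apply: le_trans (H _ h1) _.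
by have := Hr h h2; rewrite mul1r.
Qed.

Lemma touch_below_comp x (g : R -> R) (D : R) l S (g1 g2 : R) : eball 0 1 x ->
  (exists2 d : R, 0 < d & forall t, `|t| < d -> g1 * t + g2 * t ^+ 2 <= g (D + t) - g D) ->
  (exists2 rho : R, 0 < rho & forall h, enorm h < rho ->
     g (D + (dot l h + qf S h)) - g D <= u (x + h) - u x) ->
  2 * (g1 * \tr S + g2 * enorm l ^+ 2) <= f x.
Proof.
move=> Bx Hg [rho rho0 H].
apply: (@le_of_approx _ _ _ (2 * n%:R)) => e /andP[e0 _].
have [|r r0 Hr] := @comp_expand g D l S (-1) (- g1) (- g2) e e0.
  case: Hg => d d0 Hd; exists d => // t /Hd; lra.
pose T := - g1 *: S + - g2 *: (l^T *m l) + e%:M.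
have := @touch_below x (g1 *: l) (- T) Bx (ex_intro2 _ _ (Num.min rho r) _ _).
have trT : \tr T = - g1 * \tr S + - g2 * enorm l ^+ 2 + n%:R * e by exact: tr_comp.
rewrite lt_min rho0 r0 linearN /= trT => /(_ isT) W.
suff /W : forall h, enorm h < Num.min rho r -> dot (g1 *: l) h + qf (- T) h <= u (x + h) - u x.
  by lra.
move=> h; rewrite lt_min => /andP[h1 h2]; apply: le_trans _ (H _ h1).
have := Hr h h2; rewrite -[- T]scaleN1r qfZM -/T !scaleNr dotNl; lra.
Qed.

Lemma compact_superlevel (g : 'rV[R]_n -> R) (r c C : R) :
  (forall x y, cball 0 r x -> cball 0 r y -> `|g x - g y| <= C * enorm (x - y)) ->
  compact [set x : 'rV[R]_n | cball 0 r x /\ c <= g x].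
Proof.
move=> gL; apply: (subclosed_compact _ (@compact_cball _ _ 0 r)); last by move=> h [].
rewrite closure_id; apply/seteqP; split; first exact: subset_closure.
move=> h hK.
have app d : 0 < d -> exists k, [/\ cball 0 r k, c <= g k & enorm (k - h) < d].
  move=> d0; have [k [[kr ck] kh]] :=
    hK (eball h d) (iffRL (nbhs_eball _ _) (ex_intro2 _ _ d d0 (fun _ => id))).
  by exists k.
have hr : cball 0 r h.
  rewrite /cball /= subr0; apply: (@le_of_approx _ _ _ 1) => d /andP[d0 _].
  have [k [kr _ kh]] := app d d0; move: kr; rewrite /cball /= subr0 => kr.
  rewrite -(subrK k h); apply: le_trans (enormD _ _) _.
  rewrite enormB; lra.
split => //; apply: (@le_of_approx _ _ _ `|C|) => d /andP[d0 _].
have [k [kr ck kh]] := app d d0; have := gL _ _ kr hr; rewrite ler_norml => /andP[_ H].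
have : C * enorm (k - h) <= `|C| * d.
  by rewrite (le_trans (ler_norm _)) // normrM ler_wpM2l // ger0_norm ?enorm_ge0 // ltW.
lra.
Qed.

(** The lower bound on [u] is a slightly bent half-space solution with second derivative k0 |p|^2.
    Raising it a little makes it positive at the zero [y], so it crosses [u] and touches it from
    below after subtraction of the maximum; Delta u <= f bounds its Laplacian. *)
Lemma slope_at_zero y p (k0 C : R) : eball 0 1 y -> u y = 0 -> 0 < k0 -> 0 <= C ->
  (exists2 rho : R, 0 < rho & forall k, enorm k < rho ->
     0 <= dot p k - C * enorm k ^+ 2 ->
     k0 / 2 * (dot p k - C * enorm k ^+ 2) ^+ 2 <= u (y + k)) ->
  k0 * enorm p ^+ 2 <= f y.
Proof.
move=> By uy k00 C0 [rho rho0 H].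
have [ry /andP[ry0 ry1] [Iy luy lfy lgy cuy]] := osol_lipat os By.
pose C' := C + 1; pose P := enorm p; have P0 : 0 <= P := enorm_ge0 p.
have F0 : 0 <= F := le_trans (ltW (os_gt0 os By)) (os_le os By).
have C'0 : 0 <= C' by rewrite addr_ge0.
apply: (@le_of_approx _ _ _ (k0 * 4 * P * C' + n%:R * C' * k0 * (2 * P + 2) + F)).
move=> d /andP[d0 d1].
have [|r r0 /and4P[rd rry rrho _]] := @pos_lower _ [:: d; ry; rho / 2].
  by rewrite /= d0 ry0 divr_gt0.
(* Replacing [C] by C + 1 lowers the inner quadratic on the sphere |k| = r by r^2 = 2 tau, so on
   that sphere the raised barrier still lies below the assumed lower bound for [u]. *)
pose tau := r ^+ 2 / 2; have tau0 : 0 < tau by rewrite divr_gt0 // exprn_gt0.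
pose q k := dot p k + qf (- C')%:M k.
have qE k : q k = dot p k - C' * enorm k ^+ 2 by rewrite /q qf1 mulNr.
(* It equals k0 tau^2 > 0 at t = 0, where [u] vanishes, and 0 at t = - tau. Hence g(q) - u has a
   positive maximum in the interior of the region q >= - tau. *)
pose g (t : R) := k0 / 2 * (t + tau) * (t + 2 * tau).
have cq : C11 r q _ := C11D (@C11lin _ _ r p) (@C11qf _ _ r (- C')%:M).
have cst c : C11 r (fun=> c : R) (fun=> (0 : 'rV[R]_n)).
  by exists 0 => // a b _ _; rewrite dot0l !subrr normr0 enorm0 !mul0r.
have [G cG] : exists G, C11 r (fun k => g (q k) + -1 * u (y + k)) G.
  have cu : C11 r (fun h => u (y + h)) (fun h => Du (y + h)).
    by have [L L0 HL] := cuy; exists L => // a b ar br; apply: HL; exact: le_trans rry.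
  have c1 := C11D (C11Z (k0 / 2) (C11sq (ltW r0) cq)) (C11D (C11Z (k0 / 2 * 3 * tau) cq)
     (cst (k0 * tau ^+ 2))).
  eexists; apply: C11_eq (C11D c1 (C11Z (-1) cu)); last by move=> ?; reflexivity.
  by move=> k /=; rewrite /g; lra.
have [Lq Lq0 HLq] := C11_lip cq (ltW r0); have [Lg Lg0 HLg] := C11_lip cG (ltW r0).
have cS : compact [set k : 'rV[R]_n | cball 0 r k /\ - tau <= q k].
  apply: (@compact_superlevel _ _ _ Lq) => a b ar br.
  by have [_ + _] := HLq _ _ br ar.
have z0 : cball 0 r (0 : 'rV[R]_n) /\ - tau <= q 0.
  by rewrite /cball /= subr0 enorm0 qE dot0r enorm0; split; [exact: ltW|clear -tau0; lra].
have [||k [kr kq] kmax] := @lip_max _ _ _ (fun k => g (q k) + -1 * u (y + k)) Lg _ cS.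
- by exists 0.
- by move=> a b [ar _] [br _]; have [_ + _] := HLg _ _ br ar.
have kr' : enorm k <= r by move: kr; rewrite /cball /= subr0.
have uk0 : 0 <= u (y + k) by apply: (os_ge0 os); apply: Iy; exact: le_trans rry.
have gk : u (y + k) < g (q k).
  have := kmax 0 z0; rewrite addr0 uy qE dot0r enorm0 /g.
  have : 0 < k0 * tau ^+ 2 by rewrite mulr_gt0 // exprn_gt0.
  by clear; lra.
have kq' : - tau < q k.
  rewrite lt_neqAle kq andbT; apply/eqP => E; move: gk; rewrite /g -E addNr mulr0 mul0r.
  by rewrite ltNge uk0.
have klt : enorm k < r.
  rewrite lt_neqAle kr' andbT; apply/eqP => E; move: gk; apply/negP; rewrite -leNgt.
  have qq : dot p k - C * enorm k ^+ 2 = q k + r ^+ 2 by rewrite qE /C' E; ring.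
  have krho : enorm k < rho by clear -kr' rrho r0 d1; lra.
  have tE : r ^+ 2 = 2 * tau by rewrite /tau; clear -os; lra.
  have := H k krho; rewrite qq tE => H'; apply: le_trans (H' _); last lra.
  rewrite /g -mulrA ler_pM2l ?divr_gt0 // expr2 ler_wpM2r //; clear -kq tau0; lra.
have Dlt : q k <= P * r.
  rewrite qE; have := dot_le p k; have : 0 <= C' * enorm k ^+ 2 by rewrite mulr_ge0 ?sqr_ge0.
  have : P * enorm k <= P * r by rewrite ler_wpM2l.
  rewrite -/P; clear; lra.
pose l : 'rV[R]_n := p + k *m ((- C')%:M + (- C')%:M^T).
have Bk : eball 0 1 (y + k) by apply: Iy; exact: le_trans rry.
have := @touch_below_comp (y + k) g (q k) l (- C')%:M (k0 / 2 * (2 * q k + 3 * tau)) (k0 / 2) Bk.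
move=> /(_ _ _)/le_trans W.
have lE : l = p - (2 * C') *: k.
  by rewrite /l tr_scalar_mx mulmxDr mul_mx_scalar -scalerDl -scaleNr; congr (_ + _ *: _); ring.
have lP : P ^+ 2 - 4 * P * C' * r <= enorm l ^+ 2.
  rewrite lE enorm_sqr !dotE -enorm_sqr -/P (dotC k p) -enorm_sqr.
  have := dot_le p k; rewrite -/P => pk.
  have : 0 <= (2 * C' * enorm k) ^+ 2 by exact: sqr_ge0.
  have : C' * dot p k <= C' * (P * r).
    by rewrite ler_wpM2l // (le_trans pk) // ler_wpM2l.
  clear; lra.
have fk : f (y + k) <= f y + F * d.
  have := os_lip os Bk By; rewrite addrBK ler_norml => /andP[_].
  have : F * enorm k <= F * d by rewrite ler_wpM2l //; clear -uk0 kr' rd r0; lra.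
  clear; lra.
have t1 : tau <= r / 2.
  by rewrite /tau ler_pM2r ?invr_gt0 // expr2 ler_piMl ?ltW //; clear -os rd d1; lra.
rewrite -/P; suff : k0 * P ^+ 2 - (k0 * 4 * P * C' + n%:R * C' * k0 * (2 * P + 2)) * d <= f y + F * d by clear; lra.
have E1 : exists2 d : R, 0 < d & forall t, `|t| < d ->
    k0 / 2 * (2 * q k + 3 * tau) * t + k0 / 2 * t ^+ 2 <= g (q k + t) - g (q k).
  by exists 1 => // t _; rewrite /g; clear; lra.
have E2 : exists2 rho : R, 0 < rho & forall h, enorm h < rho ->
    g (q k + (dot l h + qf (- C')%:M h)) - g (q k) <= u (y + k + h) - u (y + k).
  have [|rr rr0 /and3P[rr1 rr2 _]] := @pos_lower _ [:: r - enorm k; (q k + tau) / (Lq + 1)].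
    have qt : 0 < q k + tau by clear -kq'; lra.
    by rewrite /= subr_gt0 klt divr_gt0 // ltr_wpDl.
  exists rr => // h hr.
  have khr : cball 0 r (k + h) by rewrite /cball /= subr0; apply: le_trans (enormD _ _) _; clear -hr rr1; lra.
  have qkh : q (k + h) = q k + (dot l h + qf (- C')%:M h).
    by rewrite /q qfD /l !dotE; ring.
  suff Sk : cball 0 r (k + h) /\ - tau <= q (k + h).
    by have := kmax _ Sk; rewrite addrA qkh; clear; lra.
  split => //; have [_ + _] := HLq _ _ kr khr; rewrite addrBK ler_norml.
  move: rr2; rewrite ler_pdivlMr ?ltr_wpDl // => rr2.
  have : (Lq + 1) * enorm h <= (Lq + 1) * rr by rewrite ler_wpM2l ?addr_ge0 // ltW.
  have := enorm_ge0 h; clear -rr2; lra.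
apply: le_trans (W _ E1 E2 fk).
rewrite mxtrace_scalar -[_ *+ n]mulr_natl.
have n0 : 0 <= n%:R * C' by rewrite mulr_ge0.
have : 2 * q k + 3 * tau <= (2 * P + 2) * d.
  have : P * r <= P * d by rewrite ler_wpM2l.
  clear -n0 t1 lE Dlt rd r0 d1 d0; lra.
move=> /(ler_wpM2l n0)/(ler_wpM2l (ltW k00)).
have : P * C' * r <= P * C' * d by rewrite ler_wpM2l // mulr_ge0.
move=> /(ler_wpM2l (ltW k00)); have := ler_wpM2l (ltW k00) lP; clear; lra.
Qed.

End Touching.

(** * Second-order Peano expansions in one variable *)

Section Expansion.
Context {R : realType}.

(** The mean value theorem, applied to [g] minus its quadratic, leaves only the first-order error of
    [g'] at the one point [a]. *)
Lemma peano2 (g g' : R -> R) (a g2 : R) :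
  (exists2 r : R, 0 < r & forall t, `|t| < r -> is_derive (a + t) 1 g (g' (a + t))) ->
  is_derive a 1 g' g2 ->
  forall e : R, 0 < e -> exists2 d : R, 0 < d & forall t, `|t| < d ->
    `|g (a + t) - g a - g' a * t - g2 / 2 * t ^+ 2| <= e * t ^+ 2.
Proof.
move=> [r r0 Dg] Dg' e e0.
have [d d0 Hd] : exists2 d : R, 0 < d & forall t, `|t| < d ->
    `|g' (a + t) - g' a - g2 * t| <= e * `|t|.
  have [dg' E] := Dg'; move: dg'; rewrite /derivable => /cvg_ex[l Hl].
  have {}E : l = g2 by rewrite -E; apply/esym/cvg_lim.
  move: Hl; rewrite E => /cvgrPdist_le/(_ e e0)/nbhs_ballP[d /= d0 Hd].
  exists d => // t td; have [->|t0] := eqVneq t 0.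
    by rewrite addr0 subrr mulr0 subr0 !normr0 mulr0.
  have := Hd t; rewrite /ball /= sub0r normrN => /(_ td t0).
  rewrite -[t%:A]/(t * 1) mulr1 (addrC t) distrC => H.
  rewrite -(ler_pM2l (_ : 0 < `|t|^-1)) ?invr_gt0 ?normr_gt0 //.
  rewrite mulrCA mulVf ?normr_eq0 // mulr1 -normfV -normrM.
  by rewrite mulrBr (mulrCA _ g2) mulVf // mulr1.
have [|s s0 /and3P[sr sd _]] := @pos_lower _ [:: r; d]; first by rewrite /= r0 d0.
exists s => // t ts.
pose phi x := g x - g' a * (x - a) - g2 / 2 * (x - a) ^+ 2.
pose dphi x := g' x - g' a - g2 * (x - a).
have Dphi x : `|x - a| < s -> is_derive x 1 phi (dphi x).
  move=> xs; have Dx : is_derive x 1 g (g' x).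
    by rewrite -[x](subrK a) addrC; apply: Dg; exact: lt_le_trans sr.
  rewrite /phi /dphi; apply: is_derive_eq.
  by rewrite subr0 /GRing.scale /=; lra.
have fin c : `|c - a| <= `|t| -> `|dphi c * t| <= e * t ^+ 2.
  move=> ct; have cs : `|c - a| < d by apply: le_lt_trans ct (lt_le_trans ts sd).
  have := Hd _ cs; rewrite [a + _]addrC subrK -/(dphi c) => H.
  rewrite normrM -(@real_normK _ t) ?num_real // expr2 mulrA ler_wpM2r //.
  by apply: le_trans H _; rewrite ler_pM2l.
have phiE : g (a + t) - g a - g' a * t - g2 / 2 * t ^+ 2 = phi (a + t) - phi a.
  by rewrite /phi addrBK subrr; ring.
have bnd x : `|x - a| <= `|t| -> `|x - a| < s by move=> /le_lt_trans; apply.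
have cont x : `|x - a| <= `|t| -> {for x, continuous phi}.
  move=> /bnd/Dphi[dx _]; apply: differentiable_continuous; exact/derivable1_diffP.
rewrite phiE; have [t0|t0|->] := ltgtP t 0; last by rewrite addr0 subrr normr0 expr0n mulr0.
  have [|||c] := @MVT R phi dphi (a + t) a; first by rewrite gtrDl.
  - move=> x; rewrite in_itv /= => /andP[x1 x2]; apply/Dphi/bnd.
    by rewrite !ltr0_norm ?subr_lt0 //; lra.
  - apply: continuous_in_subspaceT => x; rewrite inE /= in_itv /= => /andP[x1 x2]; apply: cont.
    by rewrite ler0_norm ?subr_le0 // ltr0_norm //; lra.
  rewrite in_itv /= => /andP[c1 c2] H; rewrite distrC H opprD addrA subrr sub0r mulrN normrN.
  by apply: fin; rewrite !ltr0_norm ?subr_lt0 //; lra.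
have [|||c] := @MVT R phi dphi a (a + t); first by rewrite ltrDl.
- move=> x; rewrite in_itv /= => /andP[x1 x2]; apply/Dphi/bnd.
  by rewrite !gtr0_norm ?subr_gt0 //; clear -x2; lra.
- apply: continuous_in_subspaceT => x; rewrite inE /= in_itv /= => /andP[x1 x2]; apply: cont.
  by rewrite ger0_norm ?subr_ge0 // gtr0_norm //; clear -x2; lra.
rewrite in_itv /= => /andP[c1 c2] H; rewrite H addrBK.
by apply: fin; rewrite !gtr0_norm ?subr_gt0 //; clear -c2; lra.
Qed.

Definition peano_at (g : R -> R) (a g1 g2 : R) : Prop :=
  forall e : R, 0 < e -> exists2 d : R, 0 < d & forall t, `|t| < d ->
    `|g (a + t) - g a - g1 * t - g2 / 2 * t ^+ 2| <= e * t ^+ 2.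

(** [s] is a sign. *)
Lemma peano_inverse (B : R -> R) (a b1 b2 s : R) : 0 < b1 -> s ^+ 2 = 1 -> peano_at B a b1 b2 ->
  forall e d0 : R, 0 < e -> 0 < d0 -> exists2 d : R, 0 < d & forall t, `|t| < d ->
    let tau := t / b1 - (b2 / (2 * b1 ^+ 3) + s * e) * t ^+ 2 in
    `|tau| < d0 /\ s * (B (a + tau) - B a) <= s * t.
Proof.
move=> b10 s1 P e d0 e0 d00.
(* To leading order tau^2 is t^2 / b1^2, so this error costs e b1 t^2 / 2, half of the gain e b1 t^2
   that the shift of the quadratic coefficient by [e] produces. *)
have [d d1 Hd] := P (e * b1 ^+ 3 / 2) (ltac:(by rewrite !mulr_gt0 // ?exprn_gt0 // invr_gt0)).
pose m := b2 / (2 * b1 ^+ 3) + s * e.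
pose C := `|s * b2 / 2 + e * b1 ^+ 3 / 2| * (2 * `|m| / b1 + m ^+ 2).
have m0 : 0 <= `|m| by [].
have ib0 : 0 < b1^-1 by rewrite invr_gt0.
have C0 : 0 <= C.
  by rewrite mulr_ge0 // addr_ge0 ?sqr_ge0 // mulr_ge0 ?(ltW ib0) // mulr_ge0.
have q1 : 0 < b1^-1 + `|m| + 1 by rewrite ltr_wpDl // addr_ge0 // ltW.
have q2 : 0 < C + 1 by rewrite ltr_wpDl.
have q3 : 0 < e * b1 / 2 by rewrite !mulr_gt0 // invr_gt0.
have [|r r0 /and5P[r1 rd rd0 re _]] := @pos_lower _ [:: 1; d / (b1^-1 + `|m| + 1);
    d0 / (b1^-1 + `|m| + 1); (e * b1 / 2) / (C + 1)].
  by rewrite /= ltr01 (divr_gt0 d1 q1) (divr_gt0 d00 q1) (divr_gt0 q3 q2).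
exists r => // t tr tau; rewrite -/m in tau *.
have t0 := normr_ge0 t.
have tt : `|t| * `|t| = t ^+ 2 by rewrite -normrM -expr2 ger0_norm // sqr_ge0.
have t1 : t ^+ 2 <= `|t| by rewrite -tt ler_piMl //; clear -tr r1; lra.
have t2n : `|t ^+ 2| = t ^+ 2 by rewrite ger0_norm // sqr_ge0.
have taub : `|tau| <= (b1^-1 + `|m|) * `|t|.
  apply: le_trans (ler_normB _ _) _.
  rewrite [`|t / b1|]normrM [`|m * _|]normrM t2n (gtr0_norm ib0).
  by rewrite [leRHS]mulrDl mulrC lerD // ler_wpM2l.
have taub' : `|tau| < (b1^-1 + `|m| + 1) * r.
  apply: le_lt_trans taub _; apply: (@le_lt_trans _ _ ((b1^-1 + `|m| + 1) * `|t|)).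
    by rewrite ler_wpM2r // lerDl.
  by rewrite ltr_pM2l.
have td0 : `|tau| < d0 by move: rd0; rewrite ler_pdivlMr // mulrC => /(lt_le_trans taub').
have td : `|tau| < d by move: rd; rewrite ler_pdivlMr // mulrC => /(lt_le_trans taub').
split=> //.
have sn : `|s| = 1 by apply/eqP; rewrite -(@eqrXn2 _ 2) // -normrX s1 normr1 expr1n.
have H : s * (B (a + tau) - B a) <= s * (b1 * tau + b2 / 2 * tau ^+ 2) + e * b1 ^+ 3 / 2 * tau ^+ 2.
  rewrite -lerBlDl -mulrBr; apply: le_trans (ler_norm _) _; rewrite normrM sn mul1r.
  apply: le_trans (Hd tau td); rewrite le_eqVlt; apply/orP; left; apply/eqP.
  by congr `|_|; ring.
apply: le_trans H _.
have E : tau ^+ 2 - t ^+ 2 / b1 ^+ 2 = - 2 * m / b1 * t * t ^+ 2 + m ^+ 2 * t ^+ 2 * t ^+ 2.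
  by rewrite /tau; field; rewrite gt_eqF.
have E' : s * (b1 * tau) = s * t - s * b2 / 2 * (t ^+ 2 / b1 ^+ 2) - s ^+ 2 * e * b1 * t ^+ 2.
  by rewrite /tau /m; field; rewrite gt_eqF.
have E2 : e * b1 ^+ 3 / 2 * (t ^+ 2 / b1 ^+ 2) = e * b1 / 2 * t ^+ 2.
  by field; rewrite gt_eqF.
have t20 := sqr_ge0 t.
have Eb : `|(s * b2 / 2 + e * b1 ^+ 3 / 2) * (tau ^+ 2 - t ^+ 2 / b1 ^+ 2)| <= (e * b1 / 2) * t ^+ 2.
  rewrite normrM E; apply: (@le_trans _ _ (C * `|t| * t ^+ 2)).
    rewrite [leRHS](_ : _ = `|s * b2 / 2 + e * b1 ^+ 3 / 2| *
       (2 * `|m| / b1 * `|t| * t ^+ 2 + m ^+ 2 * `|t| * t ^+ 2)); last by rewrite /C; ring.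
    rewrite ler_wpM2l //; apply: le_trans (ler_normD _ _) _; apply: lerD.
      by rewrite !normrM normrN normr_nat (gtr0_norm ib0) tt.
    have mm : `|m| * `|m| = m ^+ 2 by rewrite -normrM -expr2 ger0_norm // sqr_ge0.
    by rewrite !normrM tt mm ler_wpM2r // ler_wpM2l ?sqr_ge0.
  rewrite ler_wpM2r //; move: re; rewrite ler_pdivlMr // => re.
  have : `|t| * (C + 1) <= r * (C + 1) by rewrite ler_pM2r // ltW.
  clear -re t0; lra.
move: Eb; rewrite ler_norml s1 in E' * => /andP[_]; move: E' E2; clear; lra.
Qed.

End Expansion.

(** * The two-point maximum principle *)

Section TwoPointMax.
Context {R : realType} {n : nat}.
Implicit Types (x y z h k p g l : 'rV[R]_n).

Variables (F : R) (u f : 'rV[R]_n -> R) (Du : 'rV[R]_n -> 'rV[R]_n).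
Hypothesis os : osol F u f Du.

Lemma du_le x p (C rho : R) : eball 0 1 x -> 0 < rho ->
  (forall h, enorm h < rho -> u (x + h) - u x <= dot p h + C * enorm h ^+ 2) -> Du x = p.
Proof.
move=> Bx rho0 H; have [L L0 HL] := os_C11 os.
have [r /andP[r0 _] [Ix _ _ _ _]] := osol_lipat os Bx.
apply/eqP; rewrite -subr_eq0; apply/eqP; apply: (@lin_le_quad0 _ _ _ (C + L) (Num.min r rho)).
  by rewrite lt_min r0.
move=> h; rewrite lt_min => /andP[hr hrho]; have := H h hrho.
have [+ _] := HL _ _ Bx (Ix h (ltW hr)); rewrite addrBK ler_norml dotDl dotNl; lra.
Qed.

Lemma du_ge x p (C rho : R) : eball 0 1 x -> 0 < rho ->
  (forall h, enorm h < rho -> dot p h - C * enorm h ^+ 2 <= u (x + h) - u x) -> Du x = p.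
Proof.
move=> Bx rho0 H; have [L L0 HL] := os_C11 os.
have [r /andP[r0 _] [Ix _ _ _ _]] := osol_lipat os Bx.
apply/eqP; rewrite -subr_eq0 -opprB oppr_eq0; apply/eqP.
apply: (@lin_le_quad0 _ _ _ (C + L) (Num.min r rho)).
  by rewrite lt_min r0.
move=> h; rewrite lt_min => /andP[hr hrho]; have := H h hrho.
have [+ _] := HL _ _ Bx (Ix h (ltW hr)); rewrite addrBK ler_norml dotDl dotNl; lra.
Qed.


(** Product rule for the distance times the weight, as an upper bound. The constant [K] may be large
    when |a| is small; only the linear part [p] is used quantitatively, the quadratic one merely
    qualitatively. *)
Lemma expand_dist (a p g : 'rV[R]_n) (c th rho : R) (psi : 'rV[R]_n -> R) :
  0 < enorm a -> 0 < c -> 0 < rho -> p = (c / enorm a) *: a + enorm a *: g ->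
  (forall h, enorm h < rho -> psi h <= c + dot g h + th * enorm h ^+ 2) ->
  exists K r : R, [/\ 0 <= K, 0 < r & forall h, enorm h < r ->
    enorm (a + h) * psi h <= enorm a * c + dot p h + K * enorm h ^+ 2].
Proof.
set s := enorm a => s0 c0 rho0 pE H.
pose G := enorm g; have G0 : 0 <= G := enorm_ge0 g.
have th0 : 0 <= `|th| by [].
pose K := s * `|th| + G + `|th| + (c + G + `|th|) / (2 * s).
have X0 : 0 <= (c + G + `|th|) / (2 * s) by rewrite divr_ge0 ?mulr_ge0 ?(ltW s0) //; lra.
have K0 : 0 <= K by rewrite /K !addr_ge0 // mulr_ge0 // ltW.
have q : 0 < G + `|th| + 1 by lra.
have [|r r0 /and4P[r1 rr rc _]] := @pos_lower _ [:: 1; rho; c / (G + `|th| + 1)].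
  by rewrite /= ltr01 rho0 divr_gt0.
exists K, r; split => // h hr; have h0 := enorm_ge0 h; set d := enorm h in hr h0 *.
have U := H h (lt_le_trans hr rr).
have g1 : `|dot g h| <= G * d := dot_norm g h.
have d2 : d ^+ 2 <= d by rewrite expr2 ler_piMl //; clear -hr r1; lra.
have d20 : 0 <= d ^+ 2 := sqr_ge0 d.
have t1 : `|th * d ^+ 2| <= `|th| * d ^+ 2 by rewrite normrM [`|d ^+ 2|]ger0_norm.
have t2 : `|th| * d ^+ 2 <= `|th| * d by rewrite ler_wpM2l.
set V := c + dot g h + th * d ^+ 2 in U.
have V0 : 0 <= V.
  have : (G + `|th|) * d <= c.
    have : d * (G + `|th| + 1) <= c by rewrite -ler_pdivlMr //; clear -hr rc; lra.
    clear -d20 d2; lra.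
  by move: g1 t1; rewrite !ler_norml /V; clear -t2; lra.
have VM : V <= c + G + `|th|.
  have : G * d <= G * 1 by rewrite ler_wpM2l //; clear -hr r1; lra.
  have : `|th| * d <= `|th| * 1 by rewrite ler_wpM2l //; clear -hr r1; lra.
  by move: g1 t1; rewrite !ler_norml /V; clear -t2; lra.
apply: le_trans (ler_wpM2l (enorm_ge0 _) U) _.
apply: le_trans (ler_wpM2r V0 (enorm_expand h s0)) _; rewrite -/s -/d.
have -> : (s + dot a h / s + d ^+ 2 / (2 * s)) * V =
   s * V + dot a h / s * c + dot a h / s * (V - c) + d ^+ 2 * (V / (2 * s)).
  by field; rewrite gt_eqF.
have Vb : d ^+ 2 * (V / (2 * s)) <= d ^+ 2 * ((c + G + `|th|) / (2 * s)).
  by rewrite ler_wpM2l // ler_pM2r // invr_gt0 mulr_gt0.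
have ab : `|dot a h / s| <= d.
  rewrite normrM normfV (gtr0_norm s0) ler_pdivrMr // mulrC; exact: dot_norm.
have Vc : `|V - c| <= (G + `|th|) * d.
  rewrite /V (_ : _ - c = dot g h + th * d ^+ 2); last by ring.
  apply: le_trans (ler_normD _ _) _; rewrite mulrDl lerD //; exact: le_trans t1 t2.
have : dot a h / s * (V - c) <= (G + `|th|) * d ^+ 2.
  apply: le_trans (ler_norm _) _; rewrite normrM.
  by apply: le_trans (ler_pM _ _ ab Vc) _ => //; rewrite expr2; clear; lra.
have : s * (th * d ^+ 2) <= s * `|th| * d ^+ 2.
  by rewrite -mulrA ler_pM2l // (le_trans (ler_norm _)).
have -> : dot p h = dot a h / s * c + s * dot g h.
  by rewrite pE !dotE; field; rewrite gt_eqF.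
move: Vb; rewrite /K /V; clear; lra.
Qed.

(** First-order maximality gives [om] the gradients [px] and [py]. From u = B(om), the Laplacian of
    [om] would be (f - B'' |p|^2) / B', and equal displacements bound its difference at the two
    points by the trace 4 n s th of the weight. As [om] need not be twice differentiable,
    [two_point] is applied to [u] instead, through quadratic approximations of the inverse of [B].
    If om y = 0, the linear lower bound on [om] at [y] is fed to [slope_at_zero]. *)
Lemma two_point_max x y (om : 'rV[R]_n -> R) (Phi : 'rV[R]_n -> 'rV[R]_n -> R)
    (B : R -> R) (b1x b2x b1y b2y k0 W c th rho : R) g1 g2 :
  eball 0 1 x -> eball 0 1 y -> 0 < k0 -> 0 < rho -> 0 < c -> B 0 = 0 ->
  {in `[0, W] &, {mono B : a b / a <= b}} ->
  (forall a, 0 <= a <= W -> k0 / 2 * a ^+ 2 <= B a) ->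
  (forall h, enorm h < rho -> 0 <= om (x + h) <= W /\ u (x + h) = B (om (x + h))) ->
  (forall h, enorm h < rho -> 0 <= om (y + h) <= W /\ u (y + h) = B (om (y + h))) ->
  om x < W ->
  0 < b1x -> peano_at B (om x) b1x b2x ->
  (0 < om y -> 0 < b1y /\ peano_at B (om y) b1y b2y) ->
  Phi x y = c ->
  (forall h k, enorm h < rho -> enorm k < rho ->
     Phi (x + h) (y + k) <= c + dot g1 h + dot g2 k + th * (enorm h ^+ 2 + enorm k ^+ 2)) ->
  (forall h k, enorm h < rho -> enorm k < rho ->
     om (x + h) - om (y + k) - enorm (x + h - (y + k)) * Phi (x + h) (y + k)
     <= om x - om y - enorm (x - y) * c) ->
  0 < om x - om y - enorm (x - y) * c ->
  let s := enorm (x - y) in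
  let px := (c / s) *: (x - y) + s *: g1 in
  let py := (c / s) *: (x - y) - s *: g2 in
  (om y = 0 -> k0 * enorm py ^+ 2 <= f y) /\
  (0 < om y -> (f x - b2x * enorm px ^+ 2) / b1x - (f y - b2y * enorm py ^+ 2) / b1y
     <= 4 * n%:R * s * th).
Proof.
move=> Bx By k00 rho0 c0 B0 Bm Bk Ox Oy xW b1x0 Px Py PhiE PhiT Zmax Z0 s px py.
have E0 : enorm (0 : 'rV[R]_n) < rho by rewrite enorm0.
have [omx uxE] : 0 <= om x <= W /\ u x = B (om x) by have := Ox 0 E0; rewrite addr0.
have [omy uyE] : 0 <= om y <= W /\ u y = B (om y) by have := Oy 0 E0; rewrite addr0.
have s0 : 0 < s.
  apply: enorm_gt0; apply/eqP => xy; move: Z0; rewrite xy enorm0 (subr0_eq xy).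
  lra.
have sc0 : 0 < s * c by rewrite mulr_gt0.
have ox0 : 0 < om x by move: Z0; rewrite -/s; clear -sc0 omy; lra.
have yW : om y < W by move: Z0; rewrite -/s; clear -sc0 omx; lra.
have bd (h k : 'rV[R]_n) : enorm h < rho -> enorm k < rho -> om (x + h) - om x - (om (y + k) - om y) <=
    enorm (x + h - (y + k)) * Phi (x + h) (y + k) - s * c.
  by move=> hr kr; have := Zmax h k hr kr; rewrite -/s; clear; lra.
have n0 : enorm (0 : 'rV[R]_n) ^+ 2 = 0 by rewrite enorm0 expr0n.
have [K [r [K0 r0 HK]]] : exists K r : R, [/\ 0 <= K, 0 < r & forall h, enorm h < r ->
    enorm (x - y + h) * Phi (x + h) y <= s * c + dot px h + K * enorm h ^+ 2].
  apply: (@expand_dist (x - y) px g1 c th rho (fun h => Phi (x + h) y)) => // h hr.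
  have := PhiT h 0 hr E0; rewrite addr0 dot0r n0; clear; lra.
have [K' [r' [K'0 r'0 HK']]] : exists K r : R, [/\ 0 <= K, 0 < r & forall h, enorm h < r ->
    enorm (x - y + h) * Phi x (y - h) <= s * c + dot py h + K * enorm h ^+ 2].
  apply: (@expand_dist (x - y) py (- g2) c th rho (fun h => Phi x (y - h))) => //.
    by rewrite scalerN.
  by move=> h hr; have := PhiT 0 (- h) E0; rewrite enormN => /(_ hr); rewrite addr0 dot0r n0 !dotE; clear; lra.
have omxU h : enorm h < Num.min r rho -> om (x + h) - om x <= dot px h + K * enorm h ^+ 2.
  rewrite lt_min => /andP[hr hrho]; have := bd h 0 hrho E0; rewrite addr0.
  have := HK h hr; rewrite [x + h - y]addrAC; clear; lra.
have omyL k : enorm k < Num.min r' rho -> dot py k - K' * enorm k ^+ 2 <= om (y + k) - om y.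
  rewrite lt_min => /andP[kr krho]; have := bd 0 k E0 krho; rewrite addr0.
  have := HK' (- k); rewrite enormN opprK dotNr => /(_ kr).
  rewrite (opprD y k) addrA; clear; lra.
split=> [oy0|oy0].
  apply: (@slope_at_zero _ _ F u f Du os y py k0 K') => //; first by rewrite uyE oy0 B0.
  exists (Num.min r' rho); first by rewrite lt_min r'0.
  move=> k kr V0; have := omyL k kr; rewrite oy0 subr0 => H.
  have kr2 : enorm k < rho by move: kr; rewrite lt_min => /andP[].
  case: (Oy k kr2) => /andP[v1 v2] ->.
  apply: le_trans (Bk _ _); last by rewrite v1.
  by rewrite ler_pM2l ?divr_gt0 // ler_pXn2r ?nnegrE.
have {Py}[b1y0 Py] := Py oy0.
pose D := Num.min (om x) (Num.min (W - om x) (Num.min (om y) (W - om y))).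
have D0 : 0 < D by rewrite !lt_min ox0 oy0 !subr_gt0 xW.
have inx t : `|t| < D -> (om x + t) \in `[0, W].
  by rewrite !lt_min in_itv /= !ltr_norml => /and4P[]; clear; lra.
have iny t : `|t| < D -> (om y + t) \in `[0, W].
  by rewrite !lt_min in_itv /= !ltr_norml => /and4P[]; clear; lra.
have inO z h : 0 <= om (z + h) <= W -> om (z + h) \in `[0, W] by rewrite in_itv.
(* Chain rule from one side: [om] lies below its linear part plus a quadratic at [x], [B] is
   monotone, and [u] is differentiable, so this bound determines the gradient. *)
have Dux : Du x = b1x *: px.
  have [d d0 Hd] := Px 1 ltr01.
  pose P := enorm px; have P0 : 0 <= P := enorm_ge0 _.
  have q0 : 0 < P + K + 1 by clear -P0 K0; lra.
  have [|r1 r10 /and5P[a1 a2 a3 a4 /andP[a5 _]]] := @pos_lower _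
      [:: 1; r; rho; d / (P + K + 1); D / (P + K + 1)].
    by rewrite /= ltr01 r0 rho0 !divr_gt0.
  apply: (@du_le x _ (b1x * K + (`|b2x / 2| + 1) * (P + K) ^+ 2) r1) => // h hr.
  have h0 := enorm_ge0 h; have hh : enorm h ^+ 2 <= enorm h by rewrite expr2 ler_piMl //; clear -hr a1; lra.
  pose de := dot px h + K * enorm h ^+ 2.
  have deb : `|de| <= (P + K) * enorm h.
    apply: le_trans (ler_normD _ _) _; rewrite mulrDl lerD ?dot_norm // normrM !ger0_norm ?sqr_ge0 //.
    by rewrite ler_wpM2l.
  have deb' : `|de| < (P + K + 1) * r1.
    apply: le_lt_trans deb _; apply: (@le_lt_trans _ _ ((P + K + 1) * enorm h)).
      by rewrite ler_wpM2r // lerDl.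
    by rewrite ltr_pM2l.
  have de1 : `|de| < d by move: a4; rewrite ler_pdivlMr // mulrC; exact: lt_le_trans.
  have de2 : `|de| < D by move: a5; rewrite ler_pdivlMr // mulrC; exact: lt_le_trans.
  have hrho : enorm h < rho by exact: lt_le_trans hr a3.
  have [v1 ->] := Ox h hrho; rewrite uxE.
  have le1 : om (x + h) <= om x + de.
    by rewrite -lerBlDl; apply: omxU; rewrite lt_min hrho (lt_le_trans hr a2).
  have : B (om (x + h)) <= B (om x + de) by rewrite Bm // ?inx // inO.
  have := Hd de de1; rewrite ler_norml => /andP[_ q1] q2.
  have sq : de ^+ 2 <= (P + K) ^+ 2 * enorm h ^+ 2.
    rewrite -exprMn -(@real_normK _ de) ?num_real // ler_pXn2r ?nnegrE ?mulr_ge0 ?addr_ge0 //.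
  have q3 : b2x / 2 * de ^+ 2 <= `|b2x / 2| * de ^+ 2 by rewrite ler_wpM2r ?sqr_ge0 // ler_norm.
  have q4 : (`|b2x / 2| + 1) * de ^+ 2 <= (`|b2x / 2| + 1) * ((P + K) ^+ 2 * enorm h ^+ 2).
    by rewrite ler_wpM2l // addr_ge0.
  rewrite dotZl; have dE : b1x * de = b1x * dot px h + b1x * (K * enorm h ^+ 2).
    by rewrite /de; ring.
  move: q1 q2 q3 q4 dE; clear; lra.
have Duy : Du y = b1y *: py.
  have [d d0 Hd] := Py 1 ltr01.
  pose P := enorm py; have P0 : 0 <= P := enorm_ge0 _.
  have q0 : 0 < P + K' + 1 by clear -P0 K'0; lra.
  have [|r1 r10 /and5P[a1 a2 a3 a4 /andP[a5 _]]] := @pos_lower _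
      [:: 1; r'; rho; d / (P + K' + 1); D / (P + K' + 1)].
    by rewrite /= ltr01 r'0 rho0 !divr_gt0.
  apply: (@du_ge y _ (b1y * K' + (`|b2y / 2| + 1) * (P + K') ^+ 2) r1) => // h hr.
  have h0 := enorm_ge0 h; have hh : enorm h ^+ 2 <= enorm h by rewrite expr2 ler_piMl //; clear -hr a1; lra.
  pose de := dot py h - K' * enorm h ^+ 2.
  have deb : `|de| <= (P + K') * enorm h.
    apply: le_trans (ler_normB _ _) _; rewrite mulrDl lerD ?dot_norm // normrM !ger0_norm ?sqr_ge0 //.
    by rewrite ler_wpM2l.
  have deb' : `|de| < (P + K' + 1) * r1.
    apply: le_lt_trans deb _; apply: (@le_lt_trans _ _ ((P + K' + 1) * enorm h)).
      by rewrite ler_wpM2r // lerDl.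
    by rewrite ltr_pM2l.
  have de1 : `|de| < d by move: a4; rewrite ler_pdivlMr // mulrC; exact: lt_le_trans.
  have de2 : `|de| < D by move: a5; rewrite ler_pdivlMr // mulrC; exact: lt_le_trans.
  have hrho : enorm h < rho by exact: lt_le_trans hr a3.
  have [v1 ->] := Oy h hrho; rewrite uyE.
  have le1 : om y + de <= om (y + h).
    by rewrite addrC -lerBrDr; apply: omyL; rewrite lt_min hrho (lt_le_trans hr a2).
  have : B (om y + de) <= B (om (y + h)) by rewrite Bm // ?iny // inO.
  have := Hd de de1; rewrite ler_norml => /andP[q1 _] q2.
  have sq : de ^+ 2 <= (P + K') ^+ 2 * enorm h ^+ 2.
    rewrite -exprMn -(@real_normK _ de) ?num_real // ler_pXn2r ?nnegrE ?mulr_ge0 ?addr_ge0 //.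
  have q3 : - (`|b2y / 2| * de ^+ 2) <= b2y / 2 * de ^+ 2.
    by rewrite -mulNr ler_wpM2r ?sqr_ge0 // lerNl -normrN ler_norm.
  have q4 : (`|b2y / 2| + 1) * de ^+ 2 <= (`|b2y / 2| + 1) * ((P + K') ^+ 2 * enorm h ^+ 2).
    by rewrite ler_wpM2l // addr_ge0.
  rewrite dotZl; have dE : b1y * de = b1y * dot py h - b1y * (K' * enorm h ^+ 2).
    by rewrite /de; ring.
  move: q1 q2 q3 q4 dE; clear; lra.
have ux0 : 0 < u x.
  rewrite uxE; apply: lt_le_trans (Bk _ omx); rewrite mulr_gt0 ?divr_gt0 // exprn_gt0 //.
have uy0 : 0 < u y.
  rewrite uyE; apply: lt_le_trans (Bk _ omy); rewrite mulr_gt0 ?divr_gt0 // exprn_gt0 //.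
apply: (@le_of_approx _ _ _ (2 * b1x ^+ 2 * enorm px ^+ 2 + 2 * b1y ^+ 2 * enorm py ^+ 2)).
move=> e /andP[e0 _].
have s11 : (1 : R) ^+ 2 = 1 by rewrite expr1n.
have sn1 : (-1 : R) ^+ 2 = 1 by rewrite sqrrN expr1n.
have [dx dx0 Hx] := peano_inverse b1x0 s11 Px e0 D0.
have [dy dy0 Hy] := peano_inverse b1y0 sn1 Py e0 D0.
have [rx /andP[rx0 _] [_ [Cx HCx] _ _ _]] := osol_lipat os Bx.
have [ry /andP[ry0 _] [_ [Cy HCy] _ _ _]] := osol_lipat os By.
(* t / b1 - b2 / (2 b1^3) t^2 is the inverse of [B] to second order. The shift by [e] puts it below
   the true inverse at [x] and above it at [y], as the maximum inequality requires. *)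
pose gx := b2x / (2 * b1x ^+ 3) + 1 * e; pose gy := b2y / (2 * b1y ^+ 3) + -1 * e.
have := @two_point _ _ F u f Du x y b1x^-1 gx b1y^-1 gy (s *: (g1 + g2)) (2 * s * th)%:M
  os Bx By (or_introl ux0) (or_introl uy0) (ex_intro2 _ _ (Num.min (Num.min rho (Num.min rx ry))
    (Num.min (dx / (`|Cx| + 1)) (dy / (`|Cy| + 1)))) _ _).
have Cx1 : 0 < `|Cx| + 1 by rewrite ltr_wpDl.
have Cy1 : 0 < `|Cy| + 1 by rewrite ltr_wpDl.
rewrite !lt_min rho0 rx0 ry0 !divr_gt0 // => /(_ isT).
have trE : \tr ((2 * s * th)%:M : 'M[R]_n) = n%:R * (2 * s * th).
  by rewrite mxtrace_scalar -[LHS]mulr_natl.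
have Nx : enorm (Du x) ^+ 2 = b1x ^+ 2 * enorm px ^+ 2.
  by rewrite Dux enormZ gtr0_norm // exprMn.
have Ny : enorm (Du y) ^+ 2 = b1y ^+ 2 * enorm py ^+ 2.
  by rewrite Duy enormZ gtr0_norm // exprMn.
rewrite trE Nx Ny => H.
suff {}/H : forall h, enorm h < Num.min (Num.min rho (Num.min rx ry))
     (Num.min (dx / (`|Cx| + 1)) (dy / (`|Cy| + 1))) ->
   b1x^-1 * (u (x + h) - u x) - gx * (u (x + h) - u x) ^+ 2 -
   (b1y^-1 * (u (y + h) - u y) - gy * (u (y + h) - u y) ^+ 2) <=
   dot (s *: (g1 + g2)) h + qf (2 * s * th)%:M h.
  rewrite /gx /gy.
  have -> : (f x - b2x * enorm px ^+ 2) / b1x = b1x^-1 * f x -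
     2 * (b2x / (2 * b1x ^+ 3)) * (b1x ^+ 2 * enorm px ^+ 2) by field; rewrite gt_eqF.
  have -> : (f y - b2y * enorm py ^+ 2) / b1y = b1y^-1 * f y -
     2 * (b2y / (2 * b1y ^+ 3)) * (b1y ^+ 2 * enorm py ^+ 2) by field; rewrite gt_eqF.
  by clear; lra.
move=> h; rewrite !lt_min => /andP[/and3P[h1 h2 h3] /andP[h4 h5]].
have tb z C rz d : 0 < `|C| + 1 -> enorm h < rz -> enorm h < d / (`|C| + 1) ->
   (forall h, enorm h <= rz -> `|u (z + h) - u (z + 0)| <= C * enorm h) -> `|u (z + h) - u z| < d.
  move=> C1 hr hd /(_ h (ltW hr)); rewrite addr0 => /le_lt_trans; apply.
  move: hd; rewrite ltr_pdivlMr // => /(le_lt_trans _); apply.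
  by rewrite mulrC ler_wpM2l ?enorm_ge0 // (le_trans (ler_norm C)) // lerDl.
have [ox1 ox2] := Ox h h1; have [oy1 oy2] := Oy h h1.
have [tx1 tx2] := Hx _ (tb _ _ _ _ Cx1 h2 h4 HCx).
have [ty1 ty2] := Hy _ (tb _ _ _ _ Cy1 h3 h5 HCy).
move: tx1 tx2 ty1 ty2; rewrite -/gx -/gy !mul1r !mulN1r lerN2.
set Tx := _ / b1x - _; set Ty := _ / b1y - _ => tx1 tx2 ty1 ty2.
have H1 : om x + Tx <= om (x + h) by rewrite -Bm ?inx ?inO //; move: tx2; rewrite ox2 uxE lerD2r.
have H2 : om (y + h) <= om y + Ty by rewrite -Bm ?iny ?inO //; move: ty2; rewrite oy2 uyE lerD2r.
(* Under a common displacement only the weight varies; the distance remains the constant factor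
   [s]. *)
have xyh : x + h - (y + h) = x - y by rewrite opprD addrACA subrr addr0.
have := bd h h h1 h1; rewrite xyh -/s => H3.
have := PhiT h h h1 h1 => H4; have := ler_wpM2l (ltW s0) H4.
rewrite qf1 dotZl dotDl [b1x^-1 * _]mulrC [b1y^-1 * _]mulrC -/Tx -/Ty; move: H1 H2 H3; clear; lra.
Qed.


End TwoPointMax.

(** * Continuity of composite functions *)

Section Continuity.
Context {R : realType}.

Lemma cont_sub (T : topologicalType) (f g : T -> R) x : {for x, continuous f} ->
  {for x, continuous g} -> {for x, continuous (fun t => f t - g t)}.
Proof. exact: continuousB. Qed.

Lemma cont_add (T : topologicalType) (f g : T -> R) x : {for x, continuous f} ->
  {for x, continuous g} -> {for x, continuous (fun t => f t + g t)}.
Proof. exact: continuousD. Qed.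

Lemma cont_mul (T : topologicalType) (f g : T -> R) x : {for x, continuous f} ->
  {for x, continuous g} -> {for x, continuous (fun t => f t * g t)}.
Proof. exact: continuousM. Qed.

Lemma cont_cst (T : topologicalType) (c : R) (x : T) : {for x, continuous (fun=> c)}.
Proof. exact: cst_continuous. Qed.

Lemma cont_comp (S T : topologicalType) (f : S -> T) (g : T -> R) x : {for x, continuous f} ->
  {for f x, continuous g} -> {for x, continuous (fun t => g (f t))}.
Proof. exact: continuous_comp. Qed.

Lemma is_derive_cont (g : R -> R) (a g' : R) : is_derive a (1 : R) g g' -> {for a, continuous g}.
Proof. by case=> dg _; apply: differentiable_continuous; exact/derivable1_diffP. Qed.

Lemma cont_fst (S T : topologicalType) (g : S -> R) (p : S * T) : {for p.1, continuous g} ->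
  {for p, continuous (fun q : S * T => g q.1)}.
Proof. move=> cg; apply: (@cont_comp _ _ fst) => //; exact: cvg_fst. Qed.

Lemma cont_snd (S T : topologicalType) (g : T -> R) (p : S * T) : {for p.2, continuous g} ->
  {for p, continuous (fun q : S * T => g q.2)}.
Proof. move=> cg; apply: (@cont_comp _ _ snd) => //; exact: cvg_snd. Qed.

Lemma compact_max (T : topologicalType) (A : set T) (f : T -> R) : A !=set0 -> compact A ->
  (forall x, A x -> {for x, continuous f}) ->
  exists2 c, A c & forall x, A x -> f x <= f c.
Proof.
move=> A0 cA cf; have [|c Ac cm] := @compact_EVT_max _ _ f A A0 cA.
  by apply: continuous_in_subspaceT => x; rewrite inE; exact: cf.
by exists c; [exact: set_mem|move=> x Ax; apply: cm; exact: mem_set].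
Qed.

End Continuity.

(** * Interior two-point maxima and the square root of [2 u] *)

Section Barrier.
Context {R : realType} {n : nat}.
Implicit Types (x y z h k p g l : 'rV[R]_n).

Lemma cont_enormB z x : {for x, continuous (fun y : 'rV[R]_n => enorm (y - z))}.
Proof.
move=> A /nbhs_ballP[e /= e0 eA]; apply/nbhs_eball; exists e => // y xy /=.
apply: eA; rewrite -ball_normE /=; apply: le_lt_trans (enorm_lipschitz _ _) _.
by rewrite opprB addrA subrK enormB.
Qed.

Lemma cont_dist (p : 'rV[R]_n * 'rV[R]_n) :
  {for p, continuous (fun q : 'rV[R]_n * 'rV[R]_n => enorm (q.1 - q.2))}.
Proof.
apply: (@cont_comp _ _ _ (fun q : 'rV[R]_n * 'rV[R]_n => q.1 - q.2) (@enorm R n)).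
  apply: (@continuousB _ _ _ fst snd); [exact: cvg_fst|exact: cvg_snd].
exact: enorm_continuous.
Qed.

Lemma cont_lip (f : 'rV[R]_n -> R) x (r C : R) : 0 < r ->
  (forall y, enorm (y - x) < r -> `|f y - f x| <= C * enorm (y - x)) -> {for x, continuous f}.
Proof.
move=> r0 H A /nbhs_ballP[e /= e0 eA]; apply/nbhs_eball.
exists (Num.min r (e / (`|C| + 1))); first by rewrite lt_min r0 divr_gt0 // ltr_wpDl.
move=> y; rewrite /eball /= lt_min => /andP[yr ye]; apply: eA; rewrite -ball_normE /= distrC.
apply: le_lt_trans (H y yr) _; move: ye; rewrite ltr_pdivlMr ?ltr_wpDl //.
apply: le_lt_trans; rewrite mulrC ler_wpM2l ?enorm_ge0 //.
by apply: le_trans (ler_norm C) _; rewrite lerDl.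
Qed.

Lemma interior_max x0 (r : R) (om : 'rV[R]_n -> R) (Phi : 'rV[R]_n -> 'rV[R]_n -> R) :
  0 < r -> (forall x, cball x0 r x -> {for x, continuous om}) ->
  (forall p : 'rV[R]_n * 'rV[R]_n, cball x0 r p.1 -> cball x0 r p.2 ->
     {for p, continuous (fun q : 'rV[R]_n * 'rV[R]_n => Phi q.1 q.2)}) ->
  (forall x y, cball x0 r x -> cball x0 r y -> enorm (x - x0) = r \/ enorm (y - x0) = r ->
     om x - om y - enorm (x - y) * Phi x y <= 0) ->
  (exists x y, [/\ cball x0 r x, cball x0 r y & 0 < om x - om y - enorm (x - y) * Phi x y]) ->
  exists x y, [/\ enorm (x - x0) < r, enorm (y - x0) < r,
    0 < om x - om y - enorm (x - y) * Phi x y &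
    forall x' y', cball x0 r x' -> cball x0 r y' ->
      om x' - om y' - enorm (x' - y') * Phi x' y' <= om x - om y - enorm (x - y) * Phi x y].
Proof.
move=> r0 co cP bdry [x1 [y1 [x1r y1r Z1]]].
have [|||[x y] /= [xr yr] zmax] := @compact_max R _ (cball x0 r `*` cball x0 r)
    (fun p : 'rV[R]_n * 'rV[R]_n => om p.1 - om p.2 - enorm (p.1 - p.2) * Phi p.1 p.2).
- by exists (x1, y1).
- by apply: compact_setX; exact: compact_cball.
- move=> p [p1 p2]; apply: cont_sub; last by apply: cont_mul; [exact: cont_dist|exact: cP].
  by apply: cont_sub; [apply: cont_fst; exact: co|apply: cont_snd; exact: co].
have Z0 : 0 < om x - om y - enorm (x - y) * Phi x y.
  by apply: lt_le_trans Z1 _; exact: (zmax (x1, y1)).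
exists x, y; split => //.
- rewrite lt_neqAle xr andbT; apply/negP => /eqP E; move: Z0; apply/negP; rewrite -leNgt.
  by apply: bdry => //; left.
- rewrite lt_neqAle yr andbT; apply/negP => /eqP E; move: Z0; apply/negP; rewrite -leNgt.
  by apply: bdry => //; right.
- by move=> x' y' x'r y'r; exact: (zmax (x', y')).
Qed.

Variables (F : R) (u f : 'rV[R]_n -> R) (Du : 'rV[R]_n -> 'rV[R]_n).
Hypothesis os : osol F u f Du.

Lemma u_cont x : eball 0 1 x -> {for x, continuous u}.
Proof.
move=> Bx; have [r /andP[r0 r1] [_ [C HC] _ _ _]] := osol_lipat os Bx.
apply: (@cont_lip _ _ r C) => // y yr; have := HC (y - x) (ltW yr).
by rewrite addr0 (_ : x + (y - x) = y) ?addr0 // addrC subrK.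
Qed.

Lemma du_eq0 z : eball 0 1 z -> u z = 0 -> Du z = 0.
Proof.
move=> Bz uz; have [r /andP[r0 _] [Iz _ _ _ _]] := osol_lipat os Bz.
apply: (@du_ge _ _ _ _ _ _ os _ _ 0 r) => // h hr.
rewrite dot0l mul0r uz !subr0; apply: (os_ge0 os); apply: Iz; exact: ltW.
Qed.

(** The usual estimate for a nonnegative function with Lipschitz gradient: compare with the point x
    - t Du x for t = 1 / (2 L). The choice of [L] keeps the step below 1/16, hence inside the unit
    ball when |x| <= 7/8. *)
Lemma du_sqr_le : exists2 L : R, 0 < L & forall x, enorm x <= 7 / 8 ->
  enorm (Du x) ^+ 2 <= L * u x.
Proof.
have [L0 L00 HL] := os_C11 os.
have B0 : eball 0 1 (0 : 'rV[R]_n) by rewrite /eball /= subr0 enorm0.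
have Bx x : enorm x <= 7 / 8 -> eball 0 1 x by rewrite /eball /= subr0; lra.
pose M := enorm (Du 0) + L0; have M0 : 0 <= M by rewrite addr_ge0 ?enorm_ge0.
have DM x : enorm x <= 7 / 8 -> enorm (Du x) <= M.
  move=> xr; have [_] := HL _ _ B0 (Bx x xr); rewrite subr0 => H.
  rewrite -(subrK (Du 0) (Du x)); apply: le_trans (enormD _ _) _.
  rewrite addrC lerD2l; apply: le_trans H _; rewrite ler_piMr //; lra.
pose L := L0 + 8 * M + 1; have L1 : 0 < L by rewrite /L; lra.
exists (4 * L); first by rewrite mulr_gt0.
move=> x xr; pose t := (2 * L)^-1.
have t0 : 0 < t by rewrite invr_gt0 mulr_gt0.
have Bh : eball 0 1 (x - t *: Du x).
  rewrite /eball /= subr0; apply: le_lt_trans (enormD _ _) _.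
  rewrite enormN enormZ gtr0_norm //.
  have : t * enorm (Du x) <= 1 / 16.
    rewrite /t mulrC ler_pdivrMr ?mulr_gt0 //; have := DM x xr; rewrite /L; lra.
  lra.
have [+ _] := HL _ _ (Bx x xr) Bh; have := os_ge0 os Bh.
have -> : x - t *: Du x - x = - (t *: Du x) by rewrite addrAC subrr add0r.
have -> : enorm (- (t *: Du x)) = t * enorm (Du x) by rewrite enormN enormZ gtr0_norm.
have -> : dot (Du x) (- (t *: Du x)) = - (t * enorm (Du x) ^+ 2) by rewrite dotNr dotZr enorm_sqr.
rewrite ler_norml => H1 /andP[_ H2].
have LE : L0 * (t * enorm (Du x)) ^+ 2 <= L * (t * enorm (Du x)) ^+ 2.
  by rewrite ler_wpM2r ?sqr_ge0 // /L; lra.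
have E : L * (t * enorm (Du x)) ^+ 2 = t * enorm (Du x) ^+ 2 / 2.
  by rewrite /t; field; rewrite gt_eqF.
have : t * enorm (Du x) ^+ 2 <= 2 * u x by lra.
rewrite /t mulrC ler_pdivrMr ?mulr_gt0 // => H; lra.
Qed.

Definition ww x := Num.sqrt (2 * u x).

Lemma ww_ge0 x : 0 <= ww x. Proof. exact: sqrtr_ge0. Qed.

Lemma ww_sqr x : eball 0 1 x -> u x = ww x ^+ 2 / 2.
Proof. move=> Bx; rewrite sqr_sqrtr ?mulr_ge0 ?(os_ge0 os) //; lra. Qed.

Lemma ww_eq0 x : u x = 0 -> ww x = 0.
Proof. by rewrite /ww => ->; rewrite mulr0 sqrtr0. Qed.

(** Since |Du| is bounded by a multiple of [ww], the Taylor bound for [u] is at most half the square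
    of ww y + sqrt (2 C) |x - y|. The constant depends on the C^{1,1} norm of [u], so it serves only
    for continuity, finiteness and the start of the doubling. *)
Lemma ww_lip : exists2 L : R, 0 < L & forall x y, enorm x <= 7 / 8 -> enorm y <= 7 / 8 ->
  `|ww x - ww y| <= L * enorm (x - y).
Proof.
have [L L0 HL] := du_sqr_le; have [L1 L10 HL1] := os_C11 os.
have Bx x : enorm x <= 7 / 8 -> eball 0 1 x by rewrite /eball /= subr0; lra.
pose C := L + L1; have C0 : 0 < C by rewrite /C; lra.
exists (Num.sqrt (2 * C)); first by rewrite sqrtr_gt0 mulr_gt0.
suff H x y : enorm x <= 7 / 8 -> enorm y <= 7 / 8 ->
    ww x - ww y <= Num.sqrt (2 * C) * enorm (x - y).
  move=> x y xr yr; rewrite ler_norml H // andbT lerNl opprB enormB; exact: H.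
move=> xr yr; rewrite lerBlDr; set s := enorm (x - y); have s0 : 0 <= s := enorm_ge0 _.
have q0 := sqrtr_ge0 (2 * C).
rewrite -(@ler_pXn2r _ 2) ?nnegrE ?addr_ge0 ?mulr_ge0 ?ww_ge0 //.
rewrite sqrrD [(_ * s) ^+ 2]exprMn [Num.sqrt (2 * C) ^+ 2]sqr_sqrtr ?mulr_ge0 ?(ltW C0) //.
have := ww_sqr (Bx x xr); have := ww_sqr (Bx y yr).
have [+ _] := HL1 _ _ (Bx y yr) (Bx x xr); rewrite -/s ler_norml => /andP[_ H1].
have H2 := HL y yr; have := dot_le (Du y) (x - y); rewrite -/s => H3 E1 E2.
have H4 : enorm (Du y) <= Num.sqrt (2 * C) * ww y.
  rewrite -(@ler_pXn2r _ 2) ?nnegrE ?enorm_ge0 ?mulr_ge0 ?ww_ge0 //.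
  rewrite [(_ * ww y) ^+ 2]exprMn [Num.sqrt (2 * C) ^+ 2]sqr_sqrtr ?mulr_ge0 ?(ltW C0) //.
  apply: le_trans H2 _.
  have : 0 <= u y by apply: (os_ge0 os); exact: Bx.
  rewrite E1 /C => u0; have := mulr_ge0 L10 u0; have := mulr_ge0 (ltW L0) u0; clear; lra.
have H5 : enorm (Du y) * s <= Num.sqrt (2 * C) * ww y * s by rewrite ler_wpM2r.
have : L1 * s ^+ 2 <= C * s ^+ 2 by rewrite ler_wpM2r ?sqr_ge0 // /C; clear -os L0; lra.
move: H5 E1 E2 H1 H3; rewrite -mulr_natr; clear; lra.
Qed.

Lemma ww_cont x : enorm x < 7 / 8 -> {for x, continuous ww}.
Proof.
move=> xr; have [L L0 HL] := ww_lip.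
apply: (@cont_lip _ _ (7 / 8 - enorm x) L); first by rewrite subr_gt0.
move=> y yr; apply: HL; last exact: ltW.
by rewrite -(subrK x y); apply: le_trans (enormD _ _) _; lra.
Qed.

End Barrier.

(** * Universal Lipschitz bound for the square root *)

Lemma is_derive_invX (R : realType) (m : nat) (s : R) : s != 0 ->
  is_derive s (1 : R) (fun t : R => t^-1 ^+ m) (- (m%:R * s^-1 ^+ m.+1)).
Proof.
move=> s0; have dV : is_derive s (1 : R) (fun t : R => t^-1) (- s ^- 2).
  have := @is_deriveV R (@id R) s 1 1 s0 (is_derive_id _ _).
  by move=> d; apply: is_derive_eq d _; rewrite scaler1.
have := @is_deriveX R _ (fun t : R => t^-1) m s 1 _ dV.
have -> : (fun t : R => t^-1) ^+ m = (fun t : R => t^-1 ^+ m).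
  by apply/funext => t; elim: (m) => // k IH; rewrite !exprS -IH.
move=> d; apply: is_derive_eq; rewrite -[_ *: _]/(_ * _) mulrN; congr (- _); case: (m) => [|k]; first by rewrite !mul0r.
by rewrite [k.+1.-1]/= -mulrA -exprVn -exprD addn2.
Qed.

(** * Hopf-type growth from a zero *)

Section Hopf.
Context {R : realType} {n : nat}.
Implicit Types (x y z h : 'rV[R]_n).
Variables (F : R) (u f : 'rV[R]_n -> R) (Du : 'rV[R]_n -> 'rV[R]_n).
Hypothesis os : osol F u f Du.

Lemma enormD_sqr x h : enorm (x + h) ^+ 2 = enorm x ^+ 2 + 2 * dot x h + enorm h ^+ 2.
Proof. rewrite !enorm_sqr !dotE (dotC h); ring. Qed.

(** The radial function |y - x|^(-2n), in place of the fundamental solution, treats all dimensions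
    alike: its Laplacian is 2 n (n + 2) |y - x|^(-2n-2), so in the annulus the barrier has Laplacian
    above a > F >= f and cannot touch [u] from below. *)
Lemma barrier_below x (kap del a : R) : (0 < n)%N -> 0 < kap < del -> del <= 1 ->
  enorm x + del < 1 -> F < a ->
  (forall y, enorm (y - x) = kap -> a * (kap ^- 2 ^+ n - del ^- 2 ^+ n) <= u y) ->
  forall y, kap <= enorm (y - x) <= del ->
    a * ((enorm (y - x) ^+ 2)^-1 ^+ n - del ^- 2 ^+ n) <= u y.
Proof.
move=> n0 /andP[k0 kd] d1 xd Fa Hk.
have d0 : 0 < del by exact: lt_trans kd.
pose g (s : R) := a * (s^-1 ^+ n - del ^- 2 ^+ n).
pose A := cball x del `&` [set y | kap <= enorm (y - x)].
have BA y : enorm (y - x) <= del -> eball 0 1 y.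
  move=> yx; rewrite /eball /= subr0 -(subrK x y); apply: le_lt_trans (enormD _ _) _; lra.
have cA : compact A.
  apply: compact_closedI; first exact: compact_cball.
  have : closed ((fun y : 'rV[R]_n => enorm (y - x)) @^-1` [set t | kap <= t]).
    by apply: closed_comp; [move=> y _; exact: cont_enormB|exact: closed_ge].
  by [].
have dg (s : R) : 0 < s -> is_derive s (1 : R) g (- (a * n%:R) * s^-1 ^+ n.+1).
  move=> s0; rewrite /g.
  have -> : (fun s => a * (s^-1 ^+ n - del ^- 2 ^+ n)) =
      a *: ((fun s => s^-1 ^+ n) - cst (del ^- 2 ^+ n)) by [].
  have d := @is_derive_invX R n s (lt0r_neq0 s0).
  by apply: is_derive_eq; rewrite subr0 -[_ *: _]/(_ * _); ring.
have cg y : A y -> {for y, continuous (fun y => g (enorm (y - x) ^+ 2) - u y)}.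
  move=> [yd yk]; apply: cont_sub; last by apply: (u_cont os); exact: BA.
  apply: (@cont_comp _ _ _ (fun y => enorm (y - x) ^+ 2) g).
    by apply: (@cont_mul R _ (fun y => enorm (y - x))); exact: cont_enormB.
  apply: is_derive_cont (dg _ _); rewrite exprn_gt0 //; exact: lt_le_trans yk.
suff H : forall y, A y -> g (enorm (y - x) ^+ 2) - u y <= 0.
  by move=> y /andP[y1 y2]; have := H y (conj y2 y1); rewrite subr_le0.
move=> y0 Ay0.
have [|y [yd yk] ym] := compact_max _ cA cg; first by exists y0.
apply: le_trans (ym _ Ay0) _; rewrite leNgt; apply/negP => pos.
have {}yk : kap < enorm (y - x).
  rewrite lt_neqAle yk andbT; apply/negP => /eqP E; have := Hk y (esym E).
  by move: pos; rewrite -E /g; lra.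
have By := BA y yd.
have {}yd : enorm (y - x) < del.
  rewrite lt_neqAle yd andbT; apply/negP => /eqP E; move: pos.
  rewrite E /g subrr mulr0 sub0r oppr_gt0; apply/negP; rewrite -leNgt; exact: (os_ge0 os).
set D := enorm (y - x) ^+ 2.
have D0 : 0 < D by rewrite exprn_gt0 //; exact: lt_trans yk.
have D1 : D <= 1 by rewrite expr_le1 //; [lra|exact: enorm_ge0].
have F0 : 0 < F by have := os_gt0 os By; have := os_le os By; lra.
pose X := a * D^-1 ^+ n.+1.
have aX : a <= X.
  by rewrite /X ler_peMr ?(ltW (lt_trans F0 Fa)) // exprn_ege1 // invf_ge1.
pose g2 := X * (n * n.+1)%:R / D.
have pk := @peano2 R g (fun s => - (a * n%:R) * s^-1 ^+ n.+1) D g2.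
have {}pk : peano_at g D (- (a * n%:R) * D^-1 ^+ n.+1) g2.
  apply: pk.
    exists D => // t; rewrite ltr_norml => /andP[t1 _]; apply: dg; lra.
  have d := @is_derive_invX R n.+1 D (lt0r_neq0 D0).
  have -> : (fun s => - (a * n%:R) * s^-1 ^+ n.+1) = (- (a * n%:R)) *: (fun s : R => s^-1 ^+ n.+1) by [].
  apply: is_derive_eq; rewrite -[_ *: _]/(_ * _) /g2 /X natrM [_ ^+ n.+2]exprSr; ring.
(* The squared distance expands exactly, with gradient 2 (y - x) and half-Hessian the identity. The
   summand X / (8 D) is room for the Peano error. *)
have := @touch_below_comp _ _ F u f Du os y g D (2 *: (y - x)) 1%:M (- (a * n%:R) * D^-1 ^+ n.+1)
  (g2 / 2 - X / (8 * D)) By.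
have X0 : 0 < X by lra.
have e0 : 0 < X / (8 * D) by apply: divr_gt0 => //; rewrite mulr_gt0.
have [e e1 He] := pk _ e0.
have -> : enorm (2 *: (y - x)) ^+ 2 = 4 * D by rewrite enormZ normr_nat exprMn /D; ring.
rewrite mxtrace1 => H.
have {}H : 2 * (- (a * n%:R) * D^-1 ^+ n.+1 * n%:R + (g2 / 2 - X / (8 * D)) * (4 * D)) <= f y.
  apply: H.
    by exists e => // t /He; rewrite ler_norml => /andP[+ _]; clear; lra.
  exists (Num.min (del - enorm (y - x)) (enorm (y - x) - kap)); first by rewrite lt_min !subr_gt0 yd.
  move=> h; rewrite lt_min => /andP[h1 h2].
  have -> : D + (dot (2 *: (y - x)) h + qf 1%:M h) = enorm (y + h - x) ^+ 2.
    by rewrite dotZl qf1 mul1r /D (_ : y + h - x = y - x + h) ?enormD_sqr ?addrA // addrAC.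
  have Ayh : A (y + h).
    have := enorm_lipschitz (y + h - x) (y - x).
    rewrite (_ : y + h - x - (y - x) = h); last by rewrite opprB addrA subrK addrBK.
    by rewrite ler_norml => /andP[q1 q2]; split; rewrite /cball /=; lra.
  by have := ym _ Ayh; rewrite /= -/D; clear; lra.
have fF := os_le os By.
have E1 : g2 * D = X * (n%:R * (n%:R + 1)) by rewrite /g2 divfK ?gt_eqF // natrM -[n.+1%:R]natr1.
have E2 : X / (8 * D) * D = X / 8 by field; rewrite gt_eqF.
have n1 : 1 <= n%:R :> R by rewrite ler1n.
have E3 : X * n%:R >= X by rewrite ler_peMr //; clear -X0; lra.
have E4 : X * n%:R * n%:R >= X * n%:R by rewrite ler_peMr //; clear -E3 X0; lra.
have E5 : - (a * n%:R) * D^-1 ^+ n.+1 = - (X * n%:R) by rewrite mulNr mulrAC.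
rewrite E5 in H; clear -H E5 E4 E3 n1 E2 E1 fF X0 aX d0 Fa; lra.
Qed.

(** If the product exceeded [F], it could serve as the amplitude of [barrier_below], and [u] would
    grow linearly from [z] towards [x]; but [u] and its gradient vanish at [z]. *)
Lemma hopf x z (kap T0 : R) : (0 < n)%N -> u z = 0 -> 0 < kap < enorm (x - z) ->
  enorm (x - z) <= 1 -> enorm x + enorm (x - z) < 1 -> 0 < T0 ->
  (forall y, enorm (y - x) <= kap -> T0 <= u y) -> T0 * kap ^+ (2 * n) <= F.
Proof.
set del := enorm (x - z) => n0 uz /andP[k0 kd] d1 xd T00 uT; rewrite leNgt; apply/negP => Fa.
have d0 : 0 < del by exact: lt_trans kd.
have Bz : eball 0 1 z.
  rewrite /eball /= subr0 -(subrK x z); apply: le_lt_trans (enormD _ _) _.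
  by rewrite enormB -/del addrC.
set a := T0 * _ in Fa; have kk : 0 < kap ^+ 2 by rewrite exprn_gt0.
have dd : 0 < del ^+ 2 by rewrite exprn_gt0.
have a0 : 0 < a by rewrite mulr_gt0 // exprn_gt0.
have aE : a * kap ^- 2 ^+ n = T0 by rewrite /a exprM -mulrA -exprMn mulfV ?gt_eqF // expr1n mulr1.
have kds : 0 < kap < del by rewrite k0.
have H := @barrier_below x kap del a n0 kds d1 xd Fa _.
have {}H : forall y, kap <= enorm (y - x) <= del ->
    a * ((enorm (y - x) ^+ 2)^-1 ^+ n - del ^- 2 ^+ n) <= u y.
  apply: H => y yk; apply: le_trans (uT y _); last by rewrite yk.
  by rewrite mulrBr aE lerBlDr lerDl mulr_ge0 ?exprn_ge0 ?invr_ge0 ?(ltW dd) // ltW.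
have Duz := du_eq0 os Bz uz.
have [L L0 HL] := os_C11 os.
pose c := a * del ^- 2 ^+ n; have c0 : 0 < c by rewrite mulr_gt0 // exprn_gt0 // invr_gt0.
have Ld : 0 <= L * del ^+ 2 by rewrite mulr_ge0 // ltW.
have [|t t0 /and4P[t1 t2 t3 _]] := @pos_lower _ [:: 1 / 2; (del - kap) / del; c / (2 * (L * del ^+ 2 + 1))].
  by rewrite /= !divr_gt0 ?subr_gt0 // mulr_gt0 // ltr_wpDl.
(* At distance t del from [z] the barrier is at least c t, whereas [u] is at most L (t del)^2; the
   bounds on [t] make these incompatible. *)
pose y := z + t *: (x - z).
have tz : enorm (y - z) = t * del by rewrite /y addrC addKr enormZ gtr0_norm.
have yx : enorm (y - x) = (1 - t) * del.
  have -> : y - x = (t - 1) *: (x - z).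
    by rewrite /y scalerBl scale1r opprB addrAC addrC.
  rewrite enormZ distrC ger0_norm //; clear -os t1; lra.
have By : eball 0 1 y.
  rewrite /eball /= subr0 -(subrK x y); apply: le_lt_trans (enormD _ _) _; rewrite yx.
  have : 0 <= t * del by rewrite mulr_ge0 ?ltW.
  clear -xd; lra.
have [+ _] := HL _ _ Bz By; rewrite Duz dot0l uz !subr0 tz ler_norml => /andP[_ H1].
have tk : t * del <= del - kap by rewrite -ler_pdivlMr.
have H2 := H y _; rewrite yx in H2.
have {}H2 : a * (((1 - t) * del) ^+ 2)^-1 ^+ n - c <= u y.
  rewrite -mulrBr; apply: H2; apply/andP; split; first lra.
  by rewrite ler_piMl ?ltW //; clear -os t0; lra.
have q : 0 < (1 - t) ^+ 2 by rewrite exprn_gt0 //; clear -os t1; lra.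
have H3 : c * (1 + t) <= a * (((1 - t) * del) ^+ 2)^-1 ^+ n.
  rewrite exprMn invfM exprMn mulrCA mulrC /c ler_wpM2r ?(ltW c0) //.
  apply: (@le_trans _ _ ((1 + t) ^+ n)).
    case: (n) n0 => // m _; rewrite exprS ler_peMr ?exprn_ege1 //; clear -os t0; lra.
  apply: lerXn2r; rewrite ?nnegrE ?invr_ge0 ?(ltW q) //; first lra.
  rewrite -(ler_pM2r q) mulVf ?gt_eqF //.
  have : 0 <= t * t * (1 / 2 - t) by rewrite !mulr_ge0 ?subr_ge0 // ltW.
  have : 0 <= t * t by rewrite mulr_ge0 // ltW.
  clear -os t0; lra.
have H4 : c * t <= L * (t * del) ^+ 2 by clear -H3 H2 H1; lra.
have H5 : t * (2 * (L * del ^+ 2 + 1)) <= c by rewrite -ler_pdivlMr // mulr_gt0 // ltr_wpDl.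
have H6 : t * (t * (2 * (L * del ^+ 2 + 1))) <= t * c by rewrite ler_wpM2l // ltW.
have : 0 < t * t by rewrite mulr_gt0.
have : 0 < c * t by rewrite mulr_gt0.
have : 0 <= t * t * (L * del ^+ 2) by rewrite !mulr_ge0 // ltW.
move: H4 H6; clear; nra.
Qed.

End Hopf.

(** * The two-point inequality for the square root *)

Section Doubling.
Context {R : realType} {n : nat}.
Implicit Types (x y z h k g : 'rV[R]_n).
Variables (F : R) (u f : 'rV[R]_n -> R) (Du : 'rV[R]_n -> 'rV[R]_n).
Hypothesis os : osol F u f Du.
Local Notation w := (ww u).

Lemma dot_sqrB x y : enorm x ^+ 2 - enorm y ^+ 2 = dot (x - y) (x + y).
Proof. rewrite !enorm_sqr !dotE (dotC y x); ring. Qed.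

Lemma ww_bounded : exists2 W : R, 0 < W & forall x, enorm x <= 7 / 8 -> w x < W.
Proof.
have [L L0 HL] := ww_lip os; exists (w 0 + L + 1).
  by have := ww_ge0 u 0; lra.
move=> x xr; have := HL x 0 xr; rewrite enorm0 subr0 => /(_ ltac:(lra)).
rewrite ler_norml => /andP[_]; have : L * enorm x <= L by rewrite ler_piMr ?ltW //; lra.
lra.
Qed.

(** [two_point_max] for B(w) = w^2 / 2, with P = |py|. The excess P^2 - f y at the lower point is
    multiplied by w x - w y, while the slope and right-hand side differences contribute terms of
    order [s]. *)
Lemma ww_max x y (Phi : 'rV[R]_n -> 'rV[R]_n -> R) (c th rho : R) g1 g2 :
  enorm x < 7 / 8 -> enorm y < 7 / 8 -> 0 < rho -> 0 < c -> Phi x y = c ->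
  (forall h k, enorm h < rho -> enorm k < rho ->
     Phi (x + h) (y + k) <= c + dot g1 h + dot g2 k + th * (enorm h ^+ 2 + enorm k ^+ 2)) ->
  (forall h k, enorm h < rho -> enorm k < rho ->
     w (x + h) - w (y + k) - enorm (x + h - (y + k)) * Phi (x + h) (y + k)
     <= w x - w y - enorm (x - y) * c) ->
  0 < w x - w y - enorm (x - y) * c ->
  let s := enorm (x - y) in let G := enorm g1 + enorm g2 in
  exists P : R, [/\ 0 < s, 0 <= P, c - s * enorm g2 <= P & f y <= P ^+ 2 ->
    (P ^+ 2 - f y) * c <= w y * (2 * c * G + s * G ^+ 2 + F) + 4 * n%:R * th * w x * w y].
Proof.
move=> xr yr rho0 c0 PE PT Zm Z0 s G.
have Bx x' : enorm x' < 7 / 8 -> eball 0 1 x' by rewrite /eball /= subr0; lra.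
have [W W0 HW] := ww_bounded.
have s0 : 0 < s.
  apply: enorm_gt0; apply/eqP => xy; move: Z0; rewrite xy enorm0 (subr0_eq xy); lra.
have sc : 0 < s * c by rewrite mulr_gt0.
have wy0 := ww_ge0 u y; have wx0 : 0 < w x by move: Z0; rewrite -/s; lra.
have [|r r0 /and4P[r1 r2 r3 _]] := @pos_lower _ [:: rho; 7 / 8 - enorm x; 7 / 8 - enorm y].
  by rewrite /= rho0 !subr_gt0 xr yr.
pose B (a : R) := a ^+ 2 / 2.
have pB a : peano_at B a a 1.
  move=> e e0; exists 1 => // t _; rewrite [X in `|X|](_ : _ = 0); last by rewrite /B; field.
  by rewrite normr0 mulr_ge0 ?sqr_ge0 // ltW.
have wB x' : enorm x' < 7 / 8 -> 0 <= w x' <= W /\ u x' = B (w x').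
  move=> x'r; split; first by rewrite ww_ge0 ltW // HW // ltW.
  by rewrite /B -(ww_sqr os) //; exact: Bx.
have nb x' h : enorm h < r -> r <= 7 / 8 - enorm x' -> enorm (x' + h) < 7 / 8.
  by move=> hr rr; apply: le_lt_trans (enormD _ _) _; clear -hr rr; lra.
have := @two_point_max _ _ F u f Du os x y w Phi B (w x) 1 (w y) 1 1 W c th r g1 g2
  (Bx _ xr) (Bx _ yr) ltr01 r0 c0.
move=> /(_ ltac:(by rewrite /B expr0n mul0r)) H.
have {H} := H _ _ (fun h hr => wB _ (nb x h hr r2)) (fun h hr => wB _ (nb y h hr r3))
  (HW _ (ltW xr)) wx0 (pB _) (fun wy0 => conj wy0 (pB _)) PE.
have mB : {in `[0, W] &, {mono B : a b / a <= b}}.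
  move=> a b; rewrite !itv_boundlr => /andP[a0 _] /andP[b0 _].
  by rewrite /B ler_pM2r ?invr_gt0 // ler_sqr.
move=> /(_ mB) H.
have {H} [|h k h1 k1|h k h1 k1|//|H0 H1] := H.
- by move=> a _; rewrite /B mul1r mulrC.
- by apply: PT; [exact: lt_le_trans h1 r1|exact: lt_le_trans k1 r1].
- by apply: Zm; [exact: lt_le_trans h1 r1|exact: lt_le_trans k1 r1].
move: H0 H1; rewrite -/s; set px := _ + _ *: g1; set py := _ - _ *: g2 => H0 H1.
have ce : enorm ((c / s) *: (x - y)) = c.
  by rewrite enormZ gtr0_norm ?divr_gt0 // -/s divfK // gt_eqF.
exists (enorm py); split => //; first exact: enorm_ge0.
  have := enormD py (s *: g2); rewrite subrK ce enormZ gtr0_norm //; clear; lra.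
have G0 : 0 <= G by rewrite addr_ge0 ?enorm_ge0.
move=> fP; have [wy|wyp] := leP (w y) 0.
  have wyE : w y = 0 by apply/eqP; rewrite eq_le wy wy0.
  have := H0 wyE; rewrite mul1r wyE mul0r mulr0 addr0 => H2.
  by rewrite (_ : _ - _ = 0) ?mul0r //; apply/eqP; rewrite subr_eq0 eq_le H2.
have {H1} := H1 wyp; rewrite !mul1r.
have pxy : enorm px ^+ 2 - f x <= enorm py ^+ 2 - f y + s * (2 * c * G + s * G ^+ 2 + F).
  have d1 : enorm px ^+ 2 - enorm py ^+ 2 <= s * (2 * c * G + s * G ^+ 2).
    rewrite dot_sqrB.
    have -> : px - py = s *: (g1 + g2).
      by rewrite /px /py opprB addrC addrA subrK addrC scalerDr.
    have -> : px + py = 2 *: ((c / s) *: (x - y)) + s *: (g1 - g2).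
      by rewrite /px /py addrACA -scalerBr -mulr2n scaler_nat.
    set V := _ + s *: (g1 - g2).
    rewrite dotZl ler_pM2l //; apply: le_trans (dot_le _ _) _.
    have -> : 2 * c * G + s * G ^+ 2 = G * (2 * c + s * G) by ring.
    apply: ler_pM; rewrite ?enorm_ge0 ?enormD //.
    apply: le_trans (enormD _ _) _; rewrite enormZ normr_nat ce lerD2l enormZ gtr0_norm //.
    rewrite ler_pM2l //; apply: le_trans (enormD _ _) _; by rewrite enormN.
  have := os_lip os (Bx _ xr) (Bx _ yr); rewrite -/s ler_norml => /andP[+ _]; clear -d1; lra.
set X := enorm px ^+ 2 in pxy *; set Y := enorm py ^+ 2 in fP pxy *; set K := _ + F in pxy *.
move=> H2.
have {H2} H2 : (f x - X) * w y - (f y - Y) * w x <= 4 * n%:R * s * th * (w x * w y).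
  have wxy : 0 < w x * w y by rewrite mulr_gt0.
  have E : ((f x - X) / w x - (f y - Y) / w y) * (w x * w y) = (f x - X) * w y - (f y - Y) * w x.
    by field; rewrite !gt_eqF.
  by rewrite -E ler_pM2r.
have H3 : (X - f x) * w y <= (Y - f y + s * K) * w y by rewrite ler_pM2r.
(* The gain: positivity of the maximum gives w x - w y > s c. Every term now contains [s], which is
   divided out. *)
have H4 : (Y - f y) * (s * c) <= (Y - f y) * (w x - w y).
  by rewrite ler_wpM2l ?subr_ge0 //; move: Z0; rewrite -/s; clear; lra.
rewrite -(ler_pM2l s0); move: H2 H3 H4; clear; lra.
Qed.

End Doubling.

(** * Doubling with weights that blow up at the boundary of a ball *)

Section UniversalLipschitz.
Context {R : realType} {n : nat}.
Implicit Types (x y z h k g : 'rV[R]_n).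

Lemma peano_invX (m : nat) (D : R) : 0 < D ->
  peano_at (fun s : R => s^-1 ^+ m) D (- (m%:R * D^-1 ^+ m.+1)) ((m * m.+1)%:R * D^-1 ^+ m.+2).
Proof.
move=> D0; have := @peano2 R (fun s : R => s^-1 ^+ m) (fun s => - (m%:R * s^-1 ^+ m.+1)) D.
apply; first by exists D => // t; rewrite ltr_norml => /andP[t1 _]; apply: is_derive_invX; lra.
have d := @is_derive_invX R m.+1 D (lt0r_neq0 D0).
have -> : (fun s : R => - (m%:R * s^-1 ^+ m.+1)) = (- m%:R) *: (fun s : R => s^-1 ^+ m.+1).
  by apply/funext => s; rewrite -mulNr.
by apply: is_derive_eq; rewrite -[_ *: _]/(_ * _) natrM; ring.
Qed.

(** With r <= 1/4 both r^2 - |x - z|^2 and |x - z|^2 are at most 1/16, so all second-order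
    contributions, the Peano error included, fit under m (m + 1) rx^(-m-2). *)
Lemma zeta_expand z (r : R) (m : nat) x : 0 < r <= 1 / 4 -> (0 < m)%N ->
  0 < r ^+ 2 - enorm (x - z) ^+ 2 ->
  let rx := r ^+ 2 - enorm (x - z) ^+ 2 in
  exists2 d : R, 0 < d & forall h, enorm h < d ->
    (r ^+ 2 - enorm (x + h - z) ^+ 2)^-1 ^+ m <=
    rx^-1 ^+ m + dot ((2 * m%:R * rx^-1 ^+ m.+1) *: (x - z)) h
    + (m * m.+1)%:R * rx^-1 ^+ m.+2 * enorm h ^+ 2.
Proof.
move=> /andP[r0 r1] m0 rx0 rx; have r2 : r ^+ 2 <= 1 / 16 by nra.
have v0 := sqr_ge0 (enorm (x - z)).
have rx1 : rx <= 1 / 16 by rewrite /rx; lra.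
pose T := (m * m.+1)%:R * rx^-1 ^+ m.+2.
have T0 : 0 < T by rewrite mulr_gt0 ?ltr0n ?muln_gt0 ?m0 // exprn_gt0 // invr_gt0.
have T2 : 0 < T / 2 by lra.
have [d d0 Hd] := peano_invX m rx0 T2.
have := @comp_expand R n (fun s => s^-1 ^+ m) rx (- 2 *: (x - z)) (- 1%:M) 1
  (- (m%:R * rx^-1 ^+ m.+1)) T (T / 2) T2.
case.
  by exists d => // t /Hd; rewrite -/rx ler_norml mul1r => /andP[_]; rewrite -/T; clear; lra.
move=> e e0 He; exists e => // h /He; rewrite mul1r.
have -> : rx + (dot (- 2 *: (x - z)) h + qf (- 1%:M) h) = r ^+ 2 - enorm (x + h - z) ^+ 2.
  rewrite dotZl -[- 1%:M]scaleN1r qfZM qf1 [x + h - z]addrAC enormD_sqr /rx; clear; lra.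
rewrite lerBlDl => /le_trans; apply; rewrite addrA.
rewrite !qfDM !qfZM qf_outer qf1 -[- 1%:M]scaleN1r qfZM qf1 !dotZl.
have H1 : dot (x - z) h ^+ 2 <= 1 / 16 * enorm h ^+ 2.
  apply: (@le_trans _ _ ((enorm (x - z) * enorm h) ^+ 2)); last first.
    by rewrite exprMn ler_wpM2r ?sqr_ge0 //; move: rx0; lra.
  rewrite -[leLHS]real_normK ?num_real //.
  by rewrite ler_pXn2r ?nnegrE ?mulr_ge0 ?enorm_ge0 // dot_norm.
have H2 : m%:R * rx^-1 ^+ m.+1 <= T / 16.
  have -> : T / 16 = m%:R * (m.+1%:R * rx^-1 / 16 * rx^-1 ^+ m.+1).
    by rewrite /T natrM exprS; ring.
  rewrite ler_wpM2l // ler_peMl ?exprn_ge0 ?invr_ge0 ?(ltW rx0) //.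
  have b1 : 16 <= rx^-1 by rewrite -(ler_pM2r rx0) mulVf ?gt_eqF //; clear -v0 r2; lra.
  have a1 : 1 <= m.+1%:R :> R by rewrite ler1n.
  by rewrite ler_pdivlMr // mul1r (le_trans b1) // ler_peMl //; clear -b1; lra.
set h2 := enorm h ^+ 2 in H1 *; have h20 : 0 <= h2 := sqr_ge0 _.
have H3 : m%:R * rx^-1 ^+ m.+1 * h2 <= T / 16 * h2 by rewrite ler_wpM2r.
have H4 : T * (4 * dot (x - z) h ^+ 2) <= T * (1 / 4 * h2).
  by rewrite ler_pM2l //; clear -H1; lra.
rewrite -/T [(- 2 * _) ^+ 2]exprMn.
have := mulr_ge0 (ltW T0) h20; move: H3 H4; clear; lra.
Qed.

(** If s p >= rm, the bound follows from wx > s c. Otherwise the weight changes the slope so little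
    that Q >= c / 2, the excess Q^2 - fy is at least c^2 / 8, and [star] forces [wy], a fortiori
    [wx], to be of order c rm. *)
Lemma doubling_arith (p A F c rm s G g2 wx wy Q fy : R) : 1 <= p -> 0 <= A -> 0 < rm <= 1 / 16 ->
  0 < c -> 0 < F -> 8 * F <= c ^+ 2 -> 0 < s -> 0 <= wy -> s * c < wx - wy ->
  g2 <= p / 2 * (c / rm) -> 0 <= G <= p * (c / rm) -> 0 <= Q -> c - s * g2 <= Q -> fy <= F ->
  (fy <= Q ^+ 2 -> (Q ^+ 2 - fy) * c <= wy * (2 * c * G + s * G ^+ 2 + F) + A * (c / rm / rm) * wx * wy) ->
  (8 * (3 * p + 1 + A))^-1 * c * rm <= wx.
Proof.
move=> p1 A0 /andP[rm0 rm1] c0 F0 cL s0 wy0 Z0 G2 /andP[G0 GG] Q0 QP fF star.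
pose M := 3 * p + 1 + A; have M1 : 1 <= M by rewrite /M; lra.
set c1 := (8 * _)^-1; have c10 : 0 < c1 by rewrite invr_gt0 mulr_gt0 // -/M; lra.
have c11 : c1 <= 1 by rewrite invf_le1 // -/M; clear -M1; lra.
have crr : c / rm * rm = c by rewrite divfK // gt_eqF.
have cr : 0 < c / rm by rewrite divr_gt0.
set q := c / rm in cr GG crr G2 star *.
have [sp|sp] := leP rm (s * p).
  apply: (@le_trans _ _ (s * c)); last by clear -Z0 wy0; lra.
  rewrite mulrAC ler_pM2r //; apply: (@le_trans _ _ (c1 * (s * p))); first by rewrite ler_pM2l.
  rewrite mulrCA ler_piMr ?(ltW s0) // /c1 mulrC ler_pdivrMr ?mul1r; last by rewrite mulr_gt0 // -/M; clear -M1; lra.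
  by clear -A0 p1; lra.
rewrite leNgt; apply/negP => wx0.
have sG : s * q * p <= c.
  by rewrite -crr mulrAC [leRHS]mulrC ler_pM2r // ltW.
have Q2 : c / 2 <= Q.
  apply: le_trans QP; have : s * g2 <= s * (p / 2 * q) by rewrite ler_pM2l.
  by move: sG; clear; lra.
have Qc : c ^+ 2 / 4 <= Q ^+ 2 by move: Q2 c0; clear; nra.
have fQ : fy <= Q ^+ 2 by clear -Qc sG M1 fF QP wy0 s0 cL F0 c0 rm1; lra.
have {star} star := star fQ.
have l1 : c ^+ 2 / 8 * c <= (Q ^+ 2 - fy) * c by rewrite ler_pM2r //; clear -Qc sp fF QP wy0 s0 cL; lra.
have cq : 0 <= c * q by rewrite mulr_ge0 ?(ltW c0) // ltW.
have K1 : 2 * c * G + s * G ^+ 2 + F <= (3 * p + 1) * (c * q).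
  have a1 : c * G <= c * (p * q) by rewrite ler_pM2l.
  have a2 : s * G ^+ 2 <= c * (p * q).
    have pq0 : 0 <= p * q by rewrite mulr_ge0 ?(ltW cr) //; clear -p1; lra.
    apply: (@le_trans _ _ (s * (p * q) ^+ 2)).
      by rewrite ler_pM2l // lerXn2r ?nnegrE.
    rewrite expr2 mulrA ler_wpM2r //.
    by move: sG; clear; lra.
  have a3 : F <= c * q.
    have : c * c <= c * q by rewrite ler_pM2l // -[leLHS]crr ler_piMr ?(ltW cr) //; clear -rm1; lra.
    move: cL F0; rewrite expr2; clear; lra.
  by move: a1 a2 a3; clear; lra.
have wx1 : wx <= c * rm.
  apply: le_trans (ltW wx0) _; by rewrite -mulrA ler_piMl // mulr_ge0 ?(ltW c0) ?(ltW rm0).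
have thw : A * (q / rm) * wx * wy <= wy * (A * (c * q)).
  rewrite [leLHS]mulrC ler_wpM2l // -mulrA ler_wpM2l //.
  have qr : 0 < q / rm by rewrite divr_gt0.
  apply: (@le_trans _ _ (q / rm * (c * rm))); first by rewrite (ler_pM2l qr).
  by rewrite (_ : _ * _ = c * q) //; field; rewrite gt_eqF.
have K2 : wy * (2 * c * G + s * G ^+ 2 + F) <= wy * ((3 * p + 1) * (c * q)) by rewrite ler_wpM2l.
have K3 : c ^+ 2 / 8 * c <= wy * (M * (c * q)).
  by move: l1 star K2 thw; rewrite /M; clear; lra.
have wyx : wy < c1 * c * rm.
  by apply: le_lt_trans wx0; have := mulr_gt0 s0 c0; move: Z0; clear; lra.
have M0 : 0 < M by clear -M1; lra.
have K4 : wy * (M * (c * q)) < c1 * c * rm * (M * (c * q)).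
  have cq0 : 0 < c * q by exact: mulr_gt0.
  by rewrite ltr_pM2r //; exact: mulr_gt0.
have K5 : c1 * c * rm * (M * (c * q)) = c ^+ 2 / 8 * c.
  rewrite /c1 -/M [c1 * c * rm]mulrAC.
  have -> : (8 * M)^-1 * rm * c * (M * (c * q)) = c ^+ 2 * (q * rm) / 8 by field; rewrite gt_eqF.
  by rewrite crr mulrAC.
by move: K3 K4 K5; clear; lra.
Qed.

(** For r <= 1/4 the function r^2 - a^2 has slope at most 1/2 in [a], so a displacement by [rm] at
    most halves it; weights at nearby points are thus comparable. *)
Lemma near_radius (r a b rm : R) : 0 <= a -> 0 <= b -> a < r -> r <= 1 / 4 ->
  rm <= r ^+ 2 - a ^+ 2 -> b <= rm + a -> b < r /\ (r ^+ 2 - a ^+ 2) / 2 <= r ^+ 2 - b ^+ 2.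
Proof.
move=> a0 b0 ar r1 rma bra; have E : r ^+ 2 - a ^+ 2 = (r - a) * (r + a) by ring.
have H : (r - a) * (r + a) <= (r - a) * (1 / 2) by rewrite ler_wpM2l //; lra.
have br : b < r by lra.
split=> //; have [ba|ba] := leP b a; first by nra.
have : (b - a) * (b + a) <= rm * (1 / 2) by apply: ler_pM; clear -ba br bra r1 a0; lra.
nra.
Qed.

Lemma zeta_coef (L zt rx c rm : R) (m : nat) : 0 < L -> 0 < rm <= rx -> 0 <= zt -> L * zt <= c ->
  L * zt * rx^-1 ^+ m <= c * rm^-1 ^+ m.
Proof.
move=> L0 /andP[rm0 rmx] z0 zc; have rx0 := lt_le_trans rm0 rmx.
apply: ler_pM => //.
- by rewrite mulr_ge0 // ltW.
- by rewrite exprn_ge0 // invr_ge0 ltW.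
- by rewrite lerXn2r ?nnegrE ?invr_ge0 ?(ltW rx0) ?(ltW rm0) // lef_pV2.
Qed.

(** Suppose the weighted Lipschitz bound fails for some L >= L0 but holds for 2 L. The failure
    produces a point where [w] is large compared with its distance from the boundary of the ball,
    the bound for 2 L keeps [w] large on a ball around it, and Hopf growth towards the zero [z]
    bounds [L]. *)
Lemma ww_lip_univ (F : R) : (0 < n)%N -> exists2 L1 : R, 0 < L1 &
  forall u f Du, osol F u f Du -> forall z : 'rV[R]_n, enorm z < 1 / 2 -> u z = 0 ->
  forall x y, enorm (x - z) <= 1 / 8 -> enorm (y - z) <= 1 / 8 ->
    `|ww u x - ww u y| <= L1 * enorm (x - y).
Proof.
(* The exponent is matched to the Hopf estimate: w^2 of order (c rm)^2 times a radius to the power 2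
   n yields (c rm^p)^2 exactly when p = n + 1. *)
move=> n0; pose p := n.+1; pose r : R := 1 / 4.
have r01 : 0 < r <= 1 / 4 by rewrite /r; lra.
pose c1 : R := (8 * (3 * p%:R + 1 + 4 * n%:R * (p * p.+1)%:R))^-1.
(* Within c2 rm of the maximum point, the bound for 2 L lets [w] drop by at most half of its lower
   bound c1 c rm; 2^p compares the weights. *)
pose c2 : R := c1 / (4 * (1 + 2 ^+ p)).
have p1 : 1 <= p%:R :> R by rewrite ler1n.
have np0 : 0 <= 4 * n%:R * (p * p.+1)%:R :> R by rewrite !mulr_ge0.
have c10 : 0 < c1 by rewrite invr_gt0 mulr_gt0 //; lra.
have p2 : 0 < 2 ^+ p :> R by rewrite exprn_gt0.
have c20 : 0 < c2 by rewrite divr_gt0 // mulr_gt0 //; lra.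
have c21 : c2 <= 1.
  rewrite ler_pdivrMr ?mul1r; last by lra.
  have : c1 <= 1 by rewrite invf_le1; lra.
  lra.
have c1p : c1 * p%:R <= 1 by rewrite /c1 mulrC ler_pdivrMr; lra.
have [F0|F0] := leP F 0.
  exists 1 => // u f Du os z zr; have Bz : eball 0 1 z by rewrite /eball /= subr0; lra.
  by have := os_gt0 os Bz; have := os_le os Bz; lra.
pose K := c1 ^+ 2 * c2 ^+ (2 * n) / 8.
have K0 : 0 < K by rewrite divr_gt0 // mulr_gt0 // exprn_gt0.
pose L0 := F / K + 8 * F + 1.
have FK : 0 < F / K by rewrite divr_gt0.
have L01 : 1 <= L0 by rewrite /L0; lra.
have L00 : 0 < L0 by lra.
exists (2 * L0 * (64 / 3) ^+ p); first by rewrite mulr_gt0 ?exprn_gt0 //; clear -L01; lra.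
move=> u f Du os z zr uz.
pose ro x := r ^+ 2 - enorm (x - z) ^+ 2.
pose zeta x := (ro x)^-1 ^+ p.
have ro0 x : enorm (x - z) < r -> 0 < ro x.
  move=> xr; rewrite subr_gt0 ltr_pXn2r ?nnegrE ?enorm_ge0 //; clear -r01; lra.
have ro1 x : ro x <= 1 / 16.
  have := sqr_ge0 (enorm (x - z)); rewrite /ro /r; lra.
have zeta1 x : enorm (x - z) < r -> 1 <= zeta x.
  move=> xr; rewrite exprn_ege1 // invf_ge1 ?ro0 //; have := ro1 x; clear; lra.
have rB x : enorm (x - z) < r -> enorm x < 7 / 8.
  move=> xr; rewrite -(subrK z x); apply: le_lt_trans (enormD _ _) _.
  move: xr; rewrite /r; lra.
pose P (L : R) := forall x y, enorm (x - z) < r -> enorm (y - z) < r ->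
  ww u x - ww u y <= enorm (x - y) * (L * (zeta x + zeta y)).
suff PL0 : P L0.
  have z8 x : enorm (x - z) <= 1 / 8 -> zeta x <= (64 / 3) ^+ p.
    move=> xz; have x2 : enorm (x - z) ^+ 2 <= 1 / 64 by have := enorm_ge0 (x - z); nra.
    apply: lerXn2r; rewrite ?nnegrE ?invr_ge0 ?(ltW (ro0 _ _)) //; try (by rewrite /r; lra).
    rewrite -(ler_pM2l (_ : 0 < ro x)); last by rewrite /ro /r; clear -x2; lra.
    by rewrite mulfV ?gt_eqF /ro /r; clear -x2; lra.
  have H x y : enorm (x - z) <= 1 / 8 -> enorm (y - z) <= 1 / 8 ->
      ww u x - ww u y <= 2 * L0 * (64 / 3) ^+ p * enorm (x - y).
    move=> xz yz; apply: le_trans (PL0 x y _ _) _; try by rewrite /r; lra.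
    rewrite mulrC ler_wpM2r ?enorm_ge0 // [leRHS](_ : _ = L0 * (2 * (64 / 3) ^+ p)); last by ring.
    rewrite ler_pM2l //.
    have := z8 x xz; have := z8 y yz; clear; lra.
  move=> x y xz yz; rewrite ler_norml H // andbT lerNl opprB enormB; exact: H.
apply: contrapT => nP0.
have [Lw Lw0 HLw] := ww_lip os.
(* Doubling from [L0]: the bound fails there and holds once the constant exceeds the existential
   constant [Lw], so it changes from false to true at some doubling. *)
have [L LL0 [nPL PL]] : exists2 L, L0 <= L & ~ P L /\ P (2 * L).
  have Pbig L : Lw <= L -> P L.
    move=> LL x y xr yr; have := HLw x y (ltW (rB x xr)) (ltW (rB y yr)).
    rewrite ler_norml => /andP[_ H]; apply: le_trans H _; rewrite mulrC ler_wpM2l ?enorm_ge0 //.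
    apply: (le_trans LL); have := zeta1 x xr; have := zeta1 y yr => z1 z2.
    by rewrite ler_peMr //; clear -z2 z1 LL Lw0; lra.
  apply: contrapT => nex.
  have all j : ~ P (2 ^+ j * L0).
    elim: j => [|j IH]; first by rewrite mul1r.
    move=> PS; apply: nex; exists (2 ^+ j * L0); last by split; rewrite // mulrA -exprS.
    by rewrite ler_peMl ?(ltW L00) // exprn_ege1 // ler1n.
  apply: (all (Num.trunc Lw).+1); apply: Pbig.
  have lw : Lw <= (Num.trunc Lw).+1%:R by rewrite ltW // truncnS_gt.
  apply: le_trans lw _; apply: (@le_trans _ _ (2 ^+ (Num.trunc Lw).+1)); last first.
    by rewrite ler_peMr ?exprn_ge0.
  by rewrite -natrX ler_nat ltnW // ltn_expl.
have L1 : 0 < L by clear -LL0 L00; lra.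
have [x1 [y1 [x1r y1r Z1]]] : exists x y, [/\ enorm (x - z) < r, enorm (y - z) < r &
    0 < ww u x - ww u y - enorm (x - y) * (L * (zeta x + zeta y))].
  apply: contrapT => H; apply: nPL => x y xr yr; rewrite leNgt; apply/negP => lt.
  by apply: H; exists x, y; split; rewrite // subr_gt0.
(* On the slightly smaller sphere where [ro] equals [d], the weight is at least [Lw]; the
   qualitative Lipschitz bound then excludes a positive value, and the maximum is interior. *)
have [d d0 /and5P[dx dy d32 dL _]] :
    exists2 d : R, 0 < d & all (fun t => d <= t) [:: ro x1; ro y1; 1 / 32; L / Lw].
  by apply: pos_lower; rewrite /= !ro0 // !divr_gt0.
pose r' := Num.sqrt (r ^+ 2 - d).
have rd0 : 0 < r ^+ 2 - d by move: d32; rewrite /r; clear; lra.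
have r'0 : 0 < r' by rewrite sqrtr_gt0.
have r'2 : r' ^+ 2 = r ^+ 2 - d by rewrite sqr_sqrtr // ltW.
have rr' : r' < r by rewrite -(@ltr_pXn2r _ 2) ?nnegrE ?(ltW r'0) //; [rewrite r'2; clear -d0; lra|clear -r01; lra].
have inr' x : d <= ro x -> enorm (x - z) <= r'.
  move=> dxx; rewrite -(@ler_pXn2r _ 2) ?nnegrE ?enorm_ge0 ?(ltW r'0) // r'2.
  by move: dxx; rewrite /ro; clear; lra.
have czeta x : enorm (x - z) < r -> {for x, continuous zeta}.
  move=> xr; have := @cont_comp R _ _ ro (fun s : R => s^-1 ^+ p) x.
  apply; last exact: is_derive_cont (is_derive_invX p (lt0r_neq0 (ro0 x xr))).
  apply: cont_sub; first exact: cont_cst.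
  by apply: (@cont_mul R _ (fun y => enorm (y - z))); exact: cont_enormB.
have := @interior_max R n z r' (ww u) (fun x y => L * (zeta x + zeta y)) r'0.
case.
- by move=> x xr; apply: (ww_cont os); apply: rB; exact: le_lt_trans rr'.
- move=> q q1 q2; apply: cont_mul; first exact: cont_cst.
  apply: cont_add; first by apply: cont_fst; apply: czeta; exact: le_lt_trans rr'.
  by apply: cont_snd; apply: czeta; exact: le_lt_trans rr'.
- move=> x y xr yr bd.
  have xr' : enorm (x - z) < r := le_lt_trans xr rr'.
  have yr' : enorm (y - z) < r := le_lt_trans yr rr'.
  have := HLw x y (ltW (rB x xr')) (ltW (rB y yr')); rewrite ler_norml => /andP[_ H].
  rewrite subr_le0; apply: le_trans H _; rewrite mulrC ler_wpM2l ?enorm_ge0 //.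
  have zb x' : enorm (x' - z) = r' -> Lw <= L * zeta x'.
    move=> E; have rE : ro x' = d by rewrite /ro E r'2; clear; lra.
    have dV : 1 <= d^-1 by rewrite invf_ge1 //; clear -d32; lra.
    have : d^-1 <= zeta x'.
      by rewrite /zeta rE /p exprS ler_peMr ?invr_ge0 ?(ltW d0) // exprn_ege1.
    move=> H2; apply: (@le_trans _ _ (L * d^-1)); last by rewrite ler_pM2l.
    by rewrite ler_pdivlMr // mulrC -ler_pdivlMr.
  have zx := zeta1 x xr'; have zy := zeta1 y yr'.
  case: bd => /zb H2; apply: le_trans H2 _; rewrite ler_pM2l //; move: zx zy; clear; lra.
- by exists x1, y1; split => //; exact: inr'.
move=> x [y [xr yr Z0 Zm]].
have xr' : enorm (x - z) < r := lt_trans xr rr'.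
have yr' : enorm (y - z) < r := lt_trans yr rr'.
pose c := L * (zeta x + zeta y).
have zx := zeta1 x xr'; have zy := zeta1 y yr'.
have c0 : 0 < c by rewrite mulr_gt0 //; move: zx zy; clear; lra.
have rx0 := ro0 x xr'; have ry0 := ro0 y yr'.
pose rm := Num.min (ro x) (ro y).
have rm0 : 0 < rm by rewrite lt_min rx0.
have rmx : rm <= ro x by rewrite ge_min lexx.
have rmy : rm <= ro y by rewrite ge_min lexx orbT.
have rm1 : rm <= 1 / 16 := le_trans rmx (ro1 x).
have [dx' dx'0 Hx] := @zeta_expand z r p x r01 isT rx0.
have [dy' dy'0 Hy] := @zeta_expand z r p y r01 isT ry0.
have [|rho rho0 /and5P[h1 h2 h3 h4 _]] := @pos_lower _ [:: dx'; dy'; r' - enorm (x - z); r' - enorm (y - z)].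
  by rewrite /= dx'0 dy'0 !subr_gt0 xr yr.
pose gg x := L *: ((2 * p%:R * (ro x)^-1 ^+ p.+1) *: (x - z)).
pose th := (p * p.+1)%:R * c / rm ^+ 2.
have th1 x' : L * zeta x' <= c -> rm <= ro x' -> 0 < ro x' ->
    L * ((p * p.+1)%:R * (ro x')^-1 ^+ p.+2) <= th.
  move=> zc rr rp.
  have -> : L * ((p * p.+1)%:R * (ro x')^-1 ^+ p.+2) = (p * p.+1)%:R * (L * zeta x' * (ro x')^-1 ^+ 2).
    by rewrite /zeta -addn2 exprD; ring.
  have -> : th = (p * p.+1)%:R * (c * rm^-1 ^+ 2) by rewrite /th exprVn mulrA.
  rewrite ler_wpM2l // zeta_coef ?rm0 // exprn_ge0 // invr_ge0 ltW //.
have cx : L * zeta x <= c by rewrite ler_pM2l //; move: zy; clear; lra.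
have cy : L * zeta y <= c by rewrite ler_pM2l //; move: zx; clear; lra.
have gb x' : L * zeta x' <= c -> rm <= ro x' -> 0 < ro x' -> enorm (x' - z) < r ->
    enorm (gg x') <= p%:R / 2 * (c / rm).
  move=> zc rr rp xz.
  have -> : enorm (gg x') = 2 * p%:R * (L * zeta x' / ro x' * enorm (x' - z)).
    have q0 : 0 <= 2 * p%:R * (ro x')^-1 ^+ p.+1.
      by apply: mulr_ge0; [exact: mulr_ge0|rewrite exprn_ge0 // invr_ge0 ltW].
    by rewrite /gg !enormZ (gtr0_norm L1) (ger0_norm q0) /zeta exprSr; ring.
  have H1 : L * zeta x' * (ro x')^-1 <= c / rm.
    have := @zeta_coef L (zeta x') (ro x') c rm 1 L1; rewrite rm0 rr !expr1; apply => //.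
    by rewrite exprn_ge0 // invr_ge0 ltW.
  have H0 : 0 <= L * zeta x' * (ro x')^-1.
    by rewrite !mulr_ge0 ?exprn_ge0 ?invr_ge0 // ltW.
  have e4 : enorm (x' - z) <= 1 / 4 by rewrite ltW.
  have := ler_pM H0 (enorm_ge0 (x' - z)) H1 e4.
  move=> H2; have H3 : p%:R * (L * zeta x' / ro x' * enorm (x' - z)) <= p%:R * (c / rm * (1 / 4)).
    by rewrite ler_pM2l //; lra.
  by move: H3; clear; rewrite /zeta; lra.
have G1 := gb x cx rmx rx0 xr'; have G2 := gb y cy rmy ry0 yr'.
have := @ww_max R n F u f Du os x y (fun x y => L * (zeta x + zeta y)) c th rho (gg x) (gg y)
  (rB x xr') (rB y yr') rho0 c0 erefl.
case.
- move=> h k hr kr; have := Hx h (lt_le_trans hr h1); have := Hy k (lt_le_trans kr h2).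
  rewrite -/(ro x) -/(ro y) -/(ro (x + h)) -/(ro (y + k)) => E2 E1.
  have := ler_wpM2l (ltW L1) E1; have := ler_wpM2l (ltW L1) E2.
  have := ler_wpM2r (sqr_ge0 (enorm h)) (th1 x cx rmx rx0).
  have := ler_wpM2r (sqr_ge0 (enorm k)) (th1 y cy rmy ry0).
  rewrite /gg !dotZl /c /zeta; clear; lra.
- move=> h k hr kr; apply: Zm; rewrite /cball /=.
    rewrite addrAC; apply: le_trans (enormD _ _) _; move: h3 hr; clear; lra.
  rewrite addrAC; apply: le_trans (enormD _ _) _; move: h4 kr; clear; lra.
- exact: Z0.
set s := enorm (x - y); set G := enorm (gg x) + _; move=> Q [s0 Q0 QP star].
have wy0 := ww_ge0 u y.
have {}Z0 : s * c < ww u x - ww u y by rewrite -subr_gt0.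
have cr : 0 < c / rm by rewrite divr_gt0.
(* The two-point inequality yields a lower bound for [w] in terms of the full slope [c], not merely
   of [L]. *)
have key : c1 * c * rm <= ww u x.
  have By : eball 0 1 y by rewrite /eball /= subr0; have := rB y yr'; clear; lra.
  have GG : 0 <= G <= p%:R * (c / rm).
    by rewrite addr_ge0 ?enorm_ge0 //=; move: G1 G2; rewrite /G; clear; lra.
  have cL : 8 * F <= c ^+ 2.
    have L8 : 8 * F <= L by move: LL0 FK; rewrite /L0; clear; lra.
    have Lc : L <= c by rewrite /c ler_peMr ?(ltW L1) //; move: zx zy; clear; lra.
    have c1' : 1 <= c by apply: le_trans Lc; exact: le_trans LL0.
    by apply: (le_trans L8); apply: (le_trans Lc); rewrite expr2 ler_peMr // ltW.
  have rm01 : 0 < rm <= 1 / 16 by rewrite rm0.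
  have := @doubling_arith p%:R (4 * n%:R * (p * p.+1)%:R) F c rm s G (enorm (gg y)) (ww u x)
    (ww u y) Q (f y) p1 np0 rm01 c0 F0 cL s0 wy0 Z0 G2 GG Q0 QP (os_le os By).
  apply.
  move=> /star; rewrite (_ : 4 * n%:R * th = 4 * n%:R * (p * p.+1)%:R * (c / rm / rm)) //.
  by rewrite /th; field; rewrite gt_eqF.
have rmr : rm <= r ^+ 2 - enorm (x - z) ^+ 2 := rmx.
pose kap := c2 * rm.
have kap0 : 0 < kap by rewrite mulr_gt0.
have kaprm : kap <= rm by rewrite ler_piMl // ltW.
(* This is where the bound for 2 L enters, turning the lower bound at [x] into one on a ball. *)
have near y' : enorm (y' - x) <= kap -> c1 * c * rm / 2 <= ww u y'.
  move=> yx; have t := enorm_triangle x y' z.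
  have [|y'z ro2] := @near_radius r (enorm (x - z)) (enorm (y' - z)) rm (enorm_ge0 _) (enorm_ge0 _)
    xr' (lexx _) rmr.
    by apply: (le_trans t); rewrite lerD2r; exact: le_trans yx kaprm.
  have zy' : zeta y' <= 2 ^+ p * zeta x.
    rewrite /zeta -exprMn lerXn2r ?nnegrE ?invr_ge0 ?mulr_ge0 ?invr_ge0 ?(ltW rx0) ?(ltW (ro0 y' y'z)) //.
    rewrite -[2]invrK -invfM lef_pV2 ?posrE ?ro0 //; last by rewrite mulr_gt0 // invr_gt0.
    by rewrite mulrC.
  have := PL x y' xr' y'z; have : enorm (x - y') <= kap by rewrite enormB.
  move=> H1 H2.
  have H3 : enorm (x - y') * (2 * L * (zeta x + zeta y')) <= kap * (2 * (c * (1 + 2 ^+ p))).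
    apply: ler_pM; rewrite ?enorm_ge0 //.
      by rewrite !mulr_ge0 ?(ltW L1) // addr_ge0 // ?(le_trans ler01) // zeta1.
    rewrite -mulrA ler_pM2l //; apply: (@le_trans _ _ (L * (zeta x * (1 + 2 ^+ p)))).
      by rewrite ler_pM2l // mulrDr mulr1 lerD2l mulrC.
    by rewrite mulrA ler_wpM2r //; move: p2; clear; lra.
  have H4 : kap * (2 * (c * (1 + 2 ^+ p))) = c1 * c * rm / 2.
    by rewrite /kap /c2; field; rewrite gt_eqF //; move: p2; clear; lra.
  by move: H1 H2 H3 H4 key; clear; lra.
pose T0 := (c1 * c * rm / 2) ^+ 2 / 2.
have h0 : 0 < c1 * c * rm / 2 by rewrite divr_gt0 //; apply: mulr_gt0 => //; exact: mulr_gt0.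
have T00 : 0 < T0 by rewrite divr_gt0 // exprn_gt0.
have kT y' : enorm (y' - x) <= kap -> T0 <= u y'.
  move=> yx; rewrite (ww_sqr os) ?ler_pM2r ?invr_gt0 //.
    by rewrite lerXn2r ?nnegrE ?ww_ge0 ?near // ltW.
  rewrite /eball /= subr0 -(subrK x y') -[x in _ - x + x](subrK z x).
  apply: le_lt_trans (enormD _ _) _.
  have := enormD (x - z) z; move: xr' zr yx kaprm rm1; rewrite /r subrK; clear; lra.
have kd : kap < enorm (x - z).
  rewrite ltNge; apply/negP => xz; have := kT z; rewrite enormB uz => /(_ xz).
  by apply/negP; rewrite -ltNge.
have xz1 : enorm x <= enorm (x - z) + enorm z by have := enormD (x - z) z; rewrite subrK.
have := @hopf R n F u f Du os x z kap T0 n0 uz _ _ _ T00 kT.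
have b1 : enorm (x - z) <= 1 by move: xr'; rewrite /r; clear; lra.
have b2 : enorm x + enorm (x - z) < 1 by move: xr' zr xz1; rewrite /r; clear; lra.
rewrite kap0 kd => /(_ isT b1 b2).
apply/negP; rewrite -ltNge.
have cL : L * rm^-1 ^+ p <= c.
  have [E|E] : rm = ro x \/ rm = ro y by rewrite /rm; case: leP; auto.
    by rewrite E.
  by rewrite E.
(* Since c >= L rm^(-p), the right side is at least K L, and L >= L0 > F / K contradicts [hopf]. *)
have E : T0 * kap ^+ (2 * n) = K * (c * rm ^+ p) ^+ 2.
  have -> : kap ^+ (2 * n) = c2 ^+ (2 * n) * (rm ^+ n) ^+ 2.
    by rewrite exprMn -exprM [(n * 2)%N]mulnC.
  by rewrite /T0 /K [rm ^+ p]exprS; field.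
rewrite E; have cLr : L <= c * rm ^+ p.
  by rewrite -ler_pdivrMr ?exprn_gt0 // -exprVn.
have L2 : L <= (c * rm ^+ p) ^+ 2.
  have X1 : 1 <= c * rm ^+ p by apply: le_trans cLr; exact: le_trans LL0.
  by apply: (le_trans cLr); rewrite expr2 ler_peMr // (le_trans ler01).
rewrite mulrC -ltr_pdivrMr //; apply: lt_le_trans L2; move: LL0 F0; rewrite /L0; clear; lra.
Qed.

End UniversalLipschitz.

(** * Sharp Lipschitz constant *)

Section Decay.
Context {R : realType} {n : nat}.
Implicit Types (x y z h k g : 'rV[R]_n).

Definition lip_ball (v : 'rV[R]_n -> R) x0 (r L : R) : Prop :=
  forall x y, enorm (x - x0) <= r -> enorm (y - x0) <= r -> v x - v y <= L * enorm (x - y).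

(** While L^2 >= (1 + eps) f0, the squared slope exceeds [f] by nearly eps L^2 / 2. All errors are
    multiples of eta L^2 or F r, and [eta] is fixed by 45 eta + 4 N eta = eps / 8. *)
Lemma decay_arith (N F L eps eta r f0 fy c s G g2 P wx wy : R) :
  0 <= N -> 0 < F -> 0 < L -> 0 < eps <= 1 -> eta = eps / (8 * (45 + 4 * N)) -> 0 < r ->
  0 < f0 -> (1 + eps) * f0 <= L ^+ 2 -> 16 * F * r <= eps * f0 -> fy <= f0 + F * r ->
  (1 - eta) * L <= c <= L -> 0 < s <= 2 * r -> g2 <= 2 * (eta * L) / r ->
  0 <= G <= 4 * (eta * L) / r ->
  0 <= P -> c - s * g2 <= P -> 0 <= wx <= L * r -> 0 <= wy <= L * r ->
  (fy <= P ^+ 2 -> (P ^+ 2 - fy) * c <= wy * (2 * c * G + s * G ^+ 2 + F) +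
     4 * N * (eta * L / r ^+ 2) * wx * wy) -> False.
Proof.
move=> N0 F0 L0 /andP[e0 e1] etaE r0 f00 fL Fr fy1 /andP[c1 c2] /andP[s0 s1] g2b /andP[G0 G1].
move=> P0 PP /andP[wx0 wx1] /andP[wy0 wy1] star.
have etaN : eta * (45 + 4 * N) = eps / 8 by rewrite etaE; field; rewrite gt_eqF //; clear -N0; lra.
have eta0 : 0 < eta by rewrite etaE divr_gt0 // mulr_gt0 //; clear -N0; lra.
have Neta : 0 <= N * eta by rewrite mulr_ge0 // ltW.
have eta1 : eta <= 1 / 360 by clear -Neta etaN e1 L0; lra.
have ir0 : 0 < r^-1 by rewrite invr_gt0.
have eL : 0 < eta * L by rewrite mulr_gt0.
have sg : s * g2 <= 4 * (eta * L).
  apply: (@le_trans _ _ (s * (2 * (eta * L) / r))); first by rewrite ler_pM2l.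
  rewrite mulrA ler_pdivrMr // ; have := ler_wpM2r (ltW eL) s1; clear; lra.
have P1 : (1 - 5 * eta) * L <= P by clear -sg eL PP P0 c1 fy1 Fr fL; lra.
have L2 : 0 < L ^+ 2 by rewrite exprn_gt0.
have P2 : (1 - 10 * eta) * L ^+ 2 <= P ^+ 2.
  have a0 : 0 <= (1 - 5 * eta) * L by rewrite mulr_ge0 ?(ltW L0) //; clear -eta1; lra.
  apply: (@le_trans _ _ (((1 - 5 * eta) * L) ^+ 2)); last by rewrite lerXn2r ?nnegrE.
  rewrite exprMn ler_pM2r //; have := sqr_ge0 (5 * eta); clear; lra.
have f0L : f0 <= L ^+ 2 - eps / 2 * L ^+ 2.
  have H : (1 + eps) * f0 <= (1 + eps) * (L ^+ 2 - eps / 2 * L ^+ 2).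
    apply: (le_trans fL).
    have : 0 <= eps * (1 - eps) * L ^+ 2 by rewrite !mulr_ge0 ?(ltW e0) ?(ltW L2) //; clear -e1 L0; lra.
    clear; lra.
  by move: H; rewrite ler_pM2l //; clear -Neta eta0 etaN; lra.
have f0L' : f0 <= L ^+ 2 by have := mulr_gt0 e0 L2; clear -f0L; lra.
have Fr2 : 16 * (F * r) <= eps * L ^+ 2.
  by rewrite mulrA; apply: (le_trans Fr); rewrite ler_pM2l.
have Gam : (eps / 2 - 10 * eta) * L ^+ 2 - F * r <= P ^+ 2 - fy by clear -f0L P2 ir0 fy1; lra.
have epsL : 0 < eps * L ^+ 2 by rewrite mulr_gt0.
have et45 : 45 * (eta * L ^+ 2) + 4 * (N * eta * L ^+ 2) = eps * L ^+ 2 / 8.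
  by rewrite -[RHS]mulrAC -etaN; ring.
have NL : 0 <= N * eta * L ^+ 2 by rewrite mulr_ge0 // ltW.
have fP : fy <= P ^+ 2 by clear -NL et45 epsL Gam Fr2; lra.
have {star} star := star fP.
have Gam0 : 0 <= (eps / 2 - 10 * eta) * L ^+ 2 - F * r by clear -NL et45 epsL Fr2; lra.
have c3 : L / 2 <= c by have := mulr_gt0 eta0 L0; have := ler_wpM2r (ltW L0) eta1; clear -c1; lra.
have l1 : ((eps / 2 - 10 * eta) * L ^+ 2 - F * r) * (L / 2) <= (P ^+ 2 - fy) * c.
  by apply: ler_pM => //; clear -L0; lra.
set G' := 4 * (eta * L) / r in G1.
have G'r : G' * r = 4 * (eta * L) by rewrite /G' divfK ?gt_eqF.
have G'0 : 0 <= G' by rewrite /G' divr_ge0 ?(ltW r0) //; clear -c2 c1; lra.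
have K1 : wy * (2 * c * G + s * G ^+ 2 + F) <= L * r * (2 * L * G' + 2 * r * G' ^+ 2 + F).
  apply: ler_pM => //.
    by rewrite !addr_ge0 ?mulr_ge0 ?sqr_ge0 ?(ltW s0) ?(ltW F0) //; clear -c3 star e0 L0 N0; lra.
  rewrite lerD2r lerD //.
    by apply: ler_pM => //; clear -c3 Gam0 s1 s0 c2; lra.
  by apply: ler_pM; rewrite ?sqr_ge0 ?(ltW s0) // lerXn2r ?nnegrE.
have K1E : L * r * (2 * L * G' + 2 * r * G' ^+ 2 + F) =
    L * (8 * (eta * L ^+ 2) + 32 * eta * (eta * L ^+ 2) + F * r).
  have -> : L * r * (2 * L * G' + 2 * r * G' ^+ 2 + F) = L * (2 * L * (G' * r) + 2 * (G' * r) ^+ 2 + F * r) by ring.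
  by rewrite G'r; ring.
have K2 : 4 * N * (eta * L / r ^+ 2) * wx * wy <= L * (4 * (N * eta * L ^+ 2)).
  have q0 : 0 <= 4 * N * (eta * L / r ^+ 2).
    by rewrite mulr_ge0 ?divr_ge0 ?sqr_ge0 ?(ltW eL) //; clear -N0; lra.
  apply: (@le_trans _ _ (4 * N * (eta * L / r ^+ 2) * (L * r) * (L * r))).
    have A : wx * wy <= L * r * (L * r) by exact: ler_pM.
    have := ler_wpM2l q0 A; set Q := 4 * N * _; by rewrite (mulrA Q wx wy) (mulrA Q (L * r)).
  by rewrite (_ : _ * (L * r) = L * (4 * (N * eta * L ^+ 2))) //; field; rewrite gt_eqF.
have K3 : 32 * eta * (eta * L ^+ 2) <= eta * L ^+ 2.
  by apply: ler_piMl; [exact: mulr_ge0 (ltW eta0) (ltW L2)|move: eta1; clear; lra].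
have et0 : 0 < eta * L ^+ 2 by rewrite mulr_gt0.
have : L * (((eps / 2 - 10 * eta) * L ^+ 2 - F * r) / 2) <=
    L * (9 * (eta * L ^+ 2) + F * r + 4 * (N * eta * L ^+ 2)).
  have K4 := ler_wpM2l (ltW L0) K3.
  move: l1 star K1 K2 K4; rewrite K1E; clear; lra.
rewrite ler_pM2l //; move: et45 Fr2 epsL NL et0; clear; lra.
Qed.

Variables (F : R) (u f : 'rV[R]_n -> R) (Du : 'rV[R]_n -> 'rV[R]_n).
Hypothesis os : osol F u f Du.

Lemma sqdist_expand x0 x h : enorm (x + h - x0) ^+ 2 =
  enorm (x - x0) ^+ 2 + 2 * dot (x - x0) h + enorm h ^+ 2.
Proof. by rewrite (_ : x + h - x0 = x - x0 + h) ?enormD_sqr // addrAC. Qed.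

(** The weight (1 - eta) L + eta L (|x - x0|^2 + |y - x0|^2) / r^2 reaches [L] as soon as one point
    is on the sphere, so the old Lipschitz bound excludes maxima there; on the half ball it is at
    most (1 - eta / 2) L. *)
Lemma lip_decay_step x0 (r L eps eta : R) : enorm x0 < 1 / 2 -> u x0 = 0 -> 0 < r <= 1 / 8 ->
  0 < L -> 0 < eps <= 1 -> eta = eps / (8 * (45 + 4 * n%:R)) ->
  (1 + eps) * f x0 <= L ^+ 2 -> 16 * F * r <= eps * f x0 ->
  lip_ball (ww u) x0 r L -> lip_ball (ww u) x0 (r / 2) ((1 - eta / 2) * L).
Proof.
move=> xr ux0 /andP[r0 r1] L0 e01 etaE fL Fr lipL.
have B0 : eball 0 1 x0 by rewrite /eball /= subr0; lra.
have f00 := os_gt0 os B0; have F0 : 0 < F := lt_le_trans f00 (os_le os B0).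
have [e0 e1] := andP e01.
have n0 : 0 <= n%:R :> R by [].
have eta0 : 0 < eta by rewrite etaE divr_gt0 // mulr_gt0 //; lra.
have eta1 : eta <= 1 / 360.
  by rewrite etaE ler_pdivrMr ?mulr_gt0 //; lra.
pose l0 := (1 - eta) * L; pose l1 := eta * L / r ^+ 2.
have l10 : 0 < l1 by rewrite divr_gt0 ?mulr_gt0 // exprn_gt0.
have l1r : l1 * r ^+ 2 = eta * L by rewrite divfK // gt_eqF // exprn_gt0.
have l00 : 0 < l0 by rewrite mulr_gt0 //; lra.
pose q x := enorm (x - x0) ^+ 2; have q0 x : 0 <= q x := sqr_ge0 _.
pose Phi x y := l0 + l1 * (q x + q y).
have P0 x y : 0 < Phi x y by have := mulr_ge0 (ltW l10) (addr_ge0 (q0 x) (q0 y)); rewrite /Phi; clear -l00; lra.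
have sr x : enorm (x - x0) <= r -> enorm x < 7 / 8.
  move=> xx; rewrite -(subrK x0 x); apply: le_lt_trans (enormD _ _) _; clear -xx r1 xr; lra.
have lin x y : enorm (x - x0) <= r -> enorm (y - x0) <= r ->
    0 < ww u x - ww u y - enorm (x - y) * Phi x y -> Phi x y < L.
  move=> xx yy Z; rewrite ltNge; apply/negP => LP; move: Z; apply/negP; rewrite -leNgt subr_le0.
  by apply: le_trans (lipL x y xx yy) _; rewrite mulrC ler_wpM2l ?enorm_ge0.
suff Z0 : forall x y, enorm (x - x0) <= r -> enorm (y - x0) <= r ->
    ww u x - ww u y - enorm (x - y) * Phi x y <= 0.
  move=> x y xx yy; have r2r : r / 2 <= r by clear -os r0; lra.
  have := Z0 x y (le_trans xx r2r) (le_trans yy r2r); rewrite subr_le0 => /le_trans; apply.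
  rewrite mulrC ler_wpM2r ?enorm_ge0 // /Phi.
  have qb x' : enorm (x' - x0) <= r / 2 -> q x' <= r ^+ 2 / 4.
    move=> h; apply: (@le_trans _ _ ((r / 2) ^+ 2)).
      by rewrite /q lerXn2r ?nnegrE ?enorm_ge0 // divr_ge0 // ltW.
    by rewrite exprMn exprVn; clear -os; lra.
  have : l1 * (q x + q y) <= l1 * (r ^+ 2 / 2).
    by rewrite ler_pM2l //; have := qb x xx; have := qb y yy; clear; lra.
  rewrite /l0; move: l1r; clear; lra.
apply: contrapT => nZ.
have [x1 [y1 [x1r y1r Z1]]] : exists x y, [/\ cball x0 r x, cball x0 r y &
    0 < ww u x - ww u y - enorm (x - y) * Phi x y].
  apply: contrapT => H; apply: nZ => x y xx yy; rewrite leNgt; apply/negP => Z.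
  by apply: H; exists x, y.
have := @interior_max R n x0 r (ww u) Phi r0.
have cq x : {for x, continuous q}.
  by apply: (@cont_mul R _ (fun y => enorm (y - x0))); exact: cont_enormB.
case.
- by move=> x xx; apply: (ww_cont os); exact: sr.
- move=> p p1 p2; apply: cont_add; first exact: cont_cst.
  by apply: cont_mul; [exact: cont_cst|apply: cont_add; [exact: cont_fst|exact: cont_snd]].
- move=> x y xx yy bd; rewrite leNgt; apply/negP => /(lin _ _ xx yy); apply/negP; rewrite -leNgt.
  have : l1 * r ^+ 2 <= l1 * (q x + q y).
    rewrite ler_pM2l //; have := q0 x; have := q0 y.
    by case: bd => E; rewrite /q E; clear -os; lra.
  by rewrite /Phi /l0 l1r; clear; lra.
- by exists x1, y1.
move=> x [y [xx yy Zp Zm]].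
have xx' := ltW xx; have yy' := ltW yy.
have cL := lin x y xx' yy' Zp.
have [|rho rho0 /and3P[h1 h2 _]] := @pos_lower _ [:: r - enorm (x - x0); r - enorm (y - x0)].
  by rewrite /= !subr_gt0 xx yy.
have := @ww_max R n F u f Du os x y Phi (Phi x y) l1 rho (2 * l1 *: (x - x0)) (2 * l1 *: (y - x0))
  (sr x xx') (sr y yy') rho0 (P0 x y) erefl.
case.
- move=> h k _ _; rewrite /Phi /q !sqdist_expand !dotZl; clear; lra.
- move=> h k hr kr; apply: Zm; rewrite /cball /=.
    rewrite addrAC; apply: le_trans (enormD _ _) _; move: h1 hr; clear; lra.
  rewrite addrAC; apply: le_trans (enormD _ _) _; move: h2 kr; clear; lra.
- exact: Zp.
set s := enorm (x - y); set G := enorm (_ *: (x - x0)) + _ => P [s0 PP0 PP star].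
have l2 : 0 < 2 * l1 by rewrite mulr_gt0.
have gb x' : enorm (x' - x0) <= r -> enorm (2 * l1 *: (x' - x0)) <= 2 * (eta * L) / r.
  move=> xr'; rewrite enormZ gtr0_norm //; apply: (@le_trans _ _ (2 * l1 * r)).
    by rewrite ler_pM2l.
  by rewrite (_ : _ * _ * r = 2 * (eta * L) / r) // /l1; field; rewrite gt_eqF.
have wb x' : enorm (x' - x0) <= r -> 0 <= ww u x' <= L * r.
  move=> xr'; rewrite ww_ge0 /=; have x00 : enorm (x0 - x0) <= r by rewrite subrr enorm0 ltW.
  have := lipL x' x0 xr' x00; rewrite (ww_eq0 ux0) subr0 => /le_trans; apply.
  by rewrite ler_pM2l.
have By : eball 0 1 y by rewrite /eball /= subr0; apply: (lt_trans (sr y yy')); clear -os; lra.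
apply: (@decay_arith n%:R F L eps eta r (f x0) (f y) (Phi x y) s G (enorm (2 * l1 *: (y - x0))) P
  (ww u x) (ww u y)) => //.
- have := os_lip os By B0; rewrite ler_norml => /andP[_ H].
  have : F * enorm (y - x0) <= F * r by rewrite ler_pM2l.
  clear -H; lra.
- by rewrite (ltW cL) andbT /Phi lerDl mulr_ge0 ?addr_ge0 // ltW.
- rewrite s0 /=; have := enormD (x - x0) (x0 - y); rewrite addrA subrK [enorm (x0 - y)]enormB -/s; clear -h2 h1 rho0; lra.
- exact: gb.
- rewrite /G addr_ge0 ?enorm_ge0 //=; have := gb x xx'; have := gb y yy'; clear; lra.
- exact: wb.
- exact: wb.
Qed.

(** The maximum records that improvement stops at the sharp constant, below which [lip_decay_step]
    no longer applies. *)
Lemma lip_decay_iter x0 (r L1 eps eta : R) : enorm x0 < 1 / 2 -> u x0 = 0 -> 0 < r <= 1 / 8 ->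
  0 < L1 -> 0 < eps <= 1 -> eta = eps / (8 * (45 + 4 * n%:R)) ->
  16 * F * r <= eps * f x0 -> lip_ball (ww u) x0 r L1 ->
  forall j, lip_ball (ww u) x0 (r / 2 ^+ j)
    (Num.max (Num.sqrt ((1 + eps) * f x0)) ((1 - eta / 2) ^+ j * L1)).
Proof.
move=> xr ux0 /andP[r0 r1] L10 e01 etaE Fr lipL.
have B0 : eball 0 1 x0 by rewrite /eball /= subr0; lra.
have f00 := os_gt0 os B0; have F0 : 0 < F := lt_le_trans f00 (os_le os B0).
have [e0 e1] := andP e01.
have n0 : 0 <= n%:R :> R by [].
have eta0 : 0 < eta by rewrite etaE divr_gt0 // mulr_gt0 //; lra.
have eta1 : eta <= 1 / 360 by rewrite etaE ler_pdivrMr ?mulr_gt0 //; lra.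
set la := Num.sqrt _; have ef : 0 < (1 + eps) * f x0 by rewrite mulr_gt0 //; lra.
have la0 : 0 < la by rewrite sqrtr_gt0.
elim=> [|j IH].
  rewrite expr0 divr1 mul1r => x y xx yy; apply: le_trans (lipL x y xx yy) _.
  by rewrite ler_wpM2r ?enorm_ge0 // le_max lexx orbT.
set L := Num.max la _ in IH; have laL : la <= L by rewrite le_max lexx.
have L0 : 0 < L := lt_le_trans la0 laL.
have p2 : 1 <= 2 ^+ j :> R by rewrite exprn_ege1 // ler1n.
have p20 : 0 < 2 ^+ j :> R by exact: exprn_gt0.
have rj : 0 < r / 2 ^+ j <= 1 / 8.
  rewrite divr_gt0 //= ler_pdivrMr //; apply: (le_trans r1); rewrite ler_peMr //; lra.
have H1 : (1 + eps) * f x0 <= L ^+ 2.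
  by rewrite -[leLHS]sqr_sqrtr ?(ltW ef) // lerXn2r ?nnegrE ?(ltW la0) ?(ltW L0).
have H2 : 16 * F * (r / 2 ^+ j) <= eps * f x0.
  apply: le_trans Fr; rewrite mulrA ler_pdivrMr // ler_peMr //.
  by rewrite !mulr_ge0 // ltW.
have H := @lip_decay_step x0 (r / 2 ^+ j) L eps eta xr ux0 rj L0 e01 etaE H1 H2 IH.
move=> x y xx yy; have := H x y; rewrite -mulrA -invfM -exprSr => /(_ xx yy)/le_trans; apply.
rewrite ler_wpM2r ?enorm_ge0 // /L maxr_pMr; last by clear -os eta1; lra.
rewrite ge_max exprS mulrA; apply/andP; split; last by rewrite le_max lexx orbT.
rewrite le_max; apply/orP; left; rewrite ler_piMl ?(ltW la0) //; clear -os eta0; lra.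
Qed.

End Decay.

(** The number of halvings is uniform: the starting constant [L1] is universal and the target is at
    least sqrt fm. *)
Lemma lip_sharp_univ (R : realType) (n : nat) (F fm eps : R) : (0 < n)%N -> 0 < fm -> 0 < eps <= 1 ->
  exists2 r : R, 0 < r <= 1 / 8 &
  forall (u f : 'rV[R]_n -> R) Du, osol F u f Du ->
  forall x0, enorm x0 < 1 / 2 -> u x0 = 0 -> fm <= f x0 ->
  lip_ball (ww u) x0 r (Num.sqrt ((1 + eps) * f x0)).
Proof.
move=> n0 fm0 e01; have [e0 e1] := andP e01.
have [L1 L10 HL] := @ww_lip_univ R n F n0.
pose eta := eps / (8 * (45 + 4 * n%:R)).
have nn : 0 <= n%:R :> R by [].
have eta0 : 0 < eta by rewrite /eta divr_gt0 // mulr_gt0 //; lra.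
have eta1 : eta <= 1 / 360 by rewrite /eta ler_pdivrMr ?mulr_gt0 //; lra.
have [J HJ] : exists J, (1 - eta / 2) ^+ J * L1 <= Num.sqrt fm.
  have q1 : `|1 - eta / 2| < 1 by rewrite ger0_norm; clear -eta1 eta0; lra.
  have d0 : 0 < Num.sqrt fm / L1 by rewrite divr_gt0 // sqrtr_gt0.
  have /cvgrPdist_lt/(_ _ d0)[J _ HJ] := cvg_expr q1.
  exists J; have := HJ J (leqnn J); rewrite /= sub0r normrN ltr_pdivlMr // => /ltW.
  by apply: le_trans; rewrite ler_pM2r // ler_norm.
pose r0 := Num.min (1 / 8) (eps * fm / (16 * (`|F| + 1))).
have F1 : 0 < 16 * (`|F| + 1) by rewrite mulr_gt0 // ltr_wpDl.
have r00 : 0 < r0 by rewrite lt_min !divr_gt0 // mulr_gt0.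
have r01 : r0 <= 1 / 8 by rewrite ge_min lexx.
have p2 : 1 <= 2 ^+ J :> R by rewrite exprn_ege1 // ler1n.
have p20 : 0 < 2 ^+ J :> R by clear -p2; lra.
exists (r0 / 2 ^+ J).
  by rewrite divr_gt0 //= ler_pdivrMr //; apply: (le_trans r01); rewrite ler_peMr.
move=> u f Du os x0 xr ux0 fmf.
have r0b : 0 < r0 <= 1 / 8 by rewrite r00.
have Fr : 16 * F * r0 <= eps * f x0.
  apply: (@le_trans _ _ (eps * fm)); last by rewrite ler_pM2l.
  have : r0 <= eps * fm / (16 * (`|F| + 1)) by rewrite ge_min lexx orbT.
  rewrite ler_pdivlMr // => H; apply: le_trans H; rewrite mulrC ler_pM2l // ler_pM2l //.
  by apply: (le_trans (ler_norm F)); rewrite lerDl.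
have lipL : lip_ball (ww u) x0 r0 L1.
  move=> x y xx yy; have := HL u f Du os x0 xr ux0 x y (le_trans xx r01) (le_trans yy r01).
  by rewrite ler_norml => /andP[].
have := @lip_decay_iter R n F u f Du os x0 r0 L1 eps eta xr ux0 r0b L10 e01 erefl Fr lipL J.
rewrite (max_idPl _) //; apply: (le_trans HJ); apply: ler_wsqrtr; apply: (le_trans fmf).
rewrite ler_peMl //; clear -fmf e01 fm0 n0; lra.
Qed.

(** * Cubic growth bound *)

Section Power.
Context {R : realType}.
Variable a : R.
Hypothesis a01 : 0 < a <= 1.

(** For a < 1, Young's inequality with conjugate exponents 1 / a and 1 / (1 - a). *)
Lemma powR_bernoulli (t : R) : 0 <= t -> t `^ a <= 1 + a * (t - 1).
Proof.
move=> t0; have [a0] := andP a01; rewrite le_eqVlt => /predU1P[->|a1].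
  by rewrite powRr1 // mul1r addrC subrK.
have b0 : 0 < 1 - a by rewrite subr_gt0.
have := @conjugate_powR R (t `^ a) 1 a^-1 (1 - a)^-1.
rewrite powR_ge0 ler01 !invr_gt0 a0 b0 !invrK => /(_ isT isT isT isT).
rewrite addrC subrK => /(_ erefl).
by rewrite mulr1 -powRrM mulfV ?gt_eqF // powRr1 // powR1 mul1r; lra.
Qed.

Lemma powR_tangent (x y : R) : 0 < x -> 0 <= y ->
  y `^ a <= x `^ a + a * (x `^ a / x) * (y - x).
Proof.
move=> x0 y0; have t0 : 0 <= y / x by rewrite divr_ge0 // ltW.
have -> : y `^ a = x `^ a * (y / x) `^ a by rewrite -powRM ?(ltW x0) // mulrC divfK // gt_eqF.
have -> : x `^ a + a * (x `^ a / x) * (y - x) = x `^ a * (1 + a * (y / x - 1)).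
  by field; rewrite gt_eqF.
by rewrite ler_wpM2l ?powR_ge0 // powR_bernoulli.
Qed.

Lemma powR_div_anti (x y : R) : 0 < x <= y -> y `^ a / y <= x `^ a / x.
Proof.
move=> /andP[x0 xy]; have y0 : 0 < y := lt_le_trans x0 xy; have [a0 a1] := andP a01.
rewrite ler_pdivrMr //; apply: le_trans (powR_tangent x0 (ltW y0)) _.
have q0 : 0 <= x `^ a / x by rewrite divr_ge0 ?powR_ge0 // ltW.
have -> : x `^ a / x * y = x `^ a + 1 * (x `^ a / x) * (y - x) by field; rewrite gt_eqF.
by rewrite lerD2l ler_wpM2r ?subr_ge0 // ler_wpM2r.
Qed.

Lemma powR_mono (x y : R) : 0 <= x <= y -> x `^ a <= y `^ a.
Proof.
move=> /andP[x0 xy]; have [a0 _] := andP a01.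
by apply: ge0_ler_powR; rewrite ?nnegrE // ?(ltW a0) // (le_trans x0).
Qed.

Lemma powR_scale (C x : R) : 1 <= C -> 0 <= x -> (C * x) `^ a <= C * x `^ a.
Proof.
move=> C1 x0; have [a0 a1] := andP a01.
have C0 : 0 <= C by exact: le_trans C1.
by rewrite powRM // ler_wpM2r ?powR_ge0 // ler1_powR.
Qed.

End Power.

(** One-dimensional comparison profile: [prof] solves [prof'' = 1 + prof' h] with a decreasing
    [h = prof_h], which makes the two-point inequality strict. *)
Section Profile.
Context {R : realType}.
Variables (a k m W : R).
Hypothesis a01 : 0 < a <= 1.
Hypothesis m0 : 0 < m.
Hypothesis W0 : 0 < W.
Hypothesis kW : k * W <= 1.
Hypothesis mk : (2 + a) * m * W `^ a <= k.

(** The cubic term makes room for [prof_h] to be nonnegative. The term in w^(3+a), dominated by it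
    on [0, W] through [mk], makes [prof_h] decrease, at a rate of order w^(a-1). *)
Definition prof (w : R) : R := w ^+ 2 / 2 + k / 3 * w ^+ 3 - m / (3 + a) * (w ^+ 3 * w `^ a).
Definition prof1 (w : R) : R := w + k * w ^+ 2 - m * (w ^+ 2 * w `^ a).
Definition prof2 (w : R) : R := 1 + 2 * k * w - (2 + a) * m * (w * w `^ a).
(** ([prof2] - 1) / [prof1] with the common factor [w] cancelled, hence finite at 0. *)
Definition prof_h (w : R) : R := (2 * k - (2 + a) * m * w `^ a) / (1 + k * w - m * (w * w `^ a)).

Let a0 : 0 < a. Proof. by case/andP: a01. Qed.
Let a1 : a <= 1. Proof. by case/andP: a01. Qed.

Lemma prof_k (w : R) : 0 <= w <= W -> (2 + a) * m * w `^ a <= k.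
Proof.
move=> wW; apply: le_trans mk; rewrite ler_pM2l; first exact: powR_mono.
by have := a0; move=> ?; rewrite mulr_gt0 // addr_gt0.
Qed.

Lemma prof_m (w : R) : 0 <= w <= W -> m * w `^ a <= k / 2.
Proof.
move=> wW; have := prof_k wW; have : 0 <= m * w `^ a by rewrite mulr_ge0 ?powR_ge0 // ltW.
have := a0; move=> ? p; have : 0 <= a * (m * w `^ a) by rewrite mulr_ge0 // ltW.
lra.
Qed.

Lemma prof_kge0 : 0 <= k.
Proof. by apply: le_trans mk; rewrite !mulr_ge0 ?powR_ge0 ?(ltW m0) // addr_ge0 // ltW. Qed.

Lemma is_derive_pow (j : nat) (w : R) :
  is_derive w (1 : R) (fun t : R => t ^+ j.+1) (j.+1%:R * w ^+ j).
Proof.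
have := @is_deriveX R _ (@id R) j.+1 w 1 1 (is_derive_id _ _).
have -> : (@id R) ^+ j.+1 = (fun t : R => t ^+ j.+1).
  by apply/funext => t; elim: (j.+1) => // i IH; rewrite !exprS -IH.
by move=> d; apply: is_derive_eq; rewrite -[_ *: _]/(_ * _) mulr1.
Qed.

Lemma is_derive_comb3 (c1 c2 c3 w d1 d2 d3 : R) (g1 g2 g3 : R -> R) :
  is_derive w (1 : R) g1 d1 -> is_derive w (1 : R) g2 d2 -> is_derive w (1 : R) g3 d3 ->
  is_derive w (1 : R) (fun t => c1 * g1 t + c2 * g2 t + c3 * g3 t) (c1 * d1 + c2 * d2 + c3 * d3).
Proof.
move=> h1 h2 h3; have z c (g : R -> R) d : is_derive w (1 : R) g d ->
    is_derive w (1 : R) (c *: g) (c *: d) by exact: is_deriveZ.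
exact: (is_deriveD (is_deriveD (z c1 _ _ h1) (z c2 _ _ h2)) (z c3 _ _ h3)).
Qed.

Lemma is_derive_powM (j : nat) (w : R) : 0 < w ->
  is_derive w (1 : R) (fun t : R => t ^+ j.+1 * t `^ a) ((j.+1%:R + a) * (w ^+ j * w `^ a)).
Proof.
move=> w0; have dp := @is_derive1_powR R a w w0.
have := @is_deriveM R _ (fun t : R => t ^+ j.+1) (fun t => t `^ a) w 1 _ _ (is_derive_pow j w) dp.
move=> d; apply: (is_derive_eq d).
have E : w `^ (a - 1) * w = w `^ a by rewrite mulrC mulr_powRB1 // ltW.
rewrite /= -![_ *: _]/(_ * _) -E exprS; ring.
Qed.

Lemma prof_derive (w : R) : 0 < w -> is_derive w (1 : R) prof (prof1 w).
Proof.
move=> w0; have aa := a0; have d := is_derive_comb3 (1 / 2) (k / 3) (- (m / (3 + a)))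
  (is_derive_pow 1 w) (is_derive_pow 2 w) (is_derive_powM 2 w0).
have -> : prof = fun t => 1 / 2 * t ^+ 2 + k / 3 * t ^+ 3 + - (m / (3 + a)) * (t ^+ 3 * t `^ a).
  by apply/funext => t; rewrite /prof mulNr mul1r [2^-1 * _]mulrC.
apply: (is_derive_eq d); rewrite /prof1 expr1; field; rewrite gt_eqF //; lra.
Qed.

Lemma prof1_derive (w : R) : 0 < w -> is_derive w (1 : R) prof1 (prof2 w).
Proof.
move=> w0; have d := is_derive_comb3 1 k (- m)
  (is_derive_pow 0 w) (is_derive_pow 1 w) (is_derive_powM 1 w0).
have -> : prof1 = fun t => 1 * t ^+ 1 + k * t ^+ 2 + - m * (t ^+ 2 * t `^ a).
  by apply/funext => t; rewrite /prof1 mulNr mul1r expr1.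
apply: (is_derive_eq d); rewrite /prof2 expr1 expr0; ring.
Qed.

Lemma prof_peano (w : R) : 0 < w -> peano_at prof w (prof1 w) (prof2 w).
Proof.
move=> w0; apply: peano2; last exact: prof1_derive.
exists w; first by [].
move=> t tw; have wt : 0 < w + t by move: tw; rewrite ltr_norml => /andP[+ _]; lra.
exact: prof_derive.
Qed.

Lemma mvt_pos (g g' : R -> R) (x y : R) : 0 < x < y -> (forall t : R, 0 < t -> is_derive t (1 : R) g (g' t)) ->
  exists2 c, x < c < y & g y - g x = g' c * (y - x).
Proof.
move=> /andP[x0 xy] dg; have [||c] := @MVT R g g' x y xy.
- by move=> t; rewrite in_itv /= => /andP[xt _]; apply: dg; exact: lt_trans xt.
- apply: continuous_in_subspaceT => t; rewrite inE /= in_itv /= => /andP[xt _].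
  by apply: is_derive_cont (dg _ _); exact: lt_le_trans xt.
- by rewrite in_itv /= => cxy E; exists c.
Qed.

Lemma prof1_mono (x y : R) : 0 <= x <= y -> y <= W -> y - x <= prof1 y - prof1 x.
Proof.
move=> /andP[x0 xy] yW.
have J0 y' : 0 <= y' <= W -> y' <= prof1 y'.
  move=> yy; have [y0 _] := andP yy; have := prof_m yy; have := prof_kge0 => k0 H.
  have : 0 <= y' ^+ 2 * (k - m * y' `^ a) by rewrite mulr_ge0 ?sqr_ge0 //; lra.
  rewrite /prof1; lra.
move: x0; rewrite le_eqVlt => /predU1P[x0|x0].
  by rewrite -x0 /prof1 expr0n /= !(mul0r, mulr0) !(addr0, subr0) J0 // yW (le_trans _ xy) // -x0.
move: xy; rewrite le_eqVlt => /predU1P[->|xy]; first by rewrite !subrr.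
have [|c /andP[c1 c2] ->] := mvt_pos (_ : 0 < x < y) prof1_derive; first by rewrite x0.
rewrite -[leLHS]mul1r ler_wpM2r ?subr_ge0 ?(ltW xy) // /prof2.
have c0 : 0 <= c by lra.
have cW : 0 <= c <= W by lra.
have : 0 <= c * (2 * k - (2 + a) * m * c `^ a).
  by rewrite mulr_ge0 //; have := prof_k cW; have := prof_kge0; lra.
lra.
Qed.

Lemma prof0 : prof 0 = 0.
Proof. by rewrite /prof !expr0n /= !(mul0r, mulr0) !(addr0, subr0). Qed.

Lemma prof10 : prof1 0 = 0.
Proof. by rewrite /prof1 !expr0n /= !(mul0r, mulr0) !(addr0, subr0). Qed.

Lemma prof_ge_sq (w : R) : 0 <= w <= W -> w ^+ 2 / 2 <= prof w.
Proof.
move=> ww; have [w0 _] := andP ww; have := prof_m ww; have k0 := prof_kge0.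
have w3 : 0 <= w ^+ 3 by rewrite exprn_ge0.
have p0 : 0 <= m * w `^ a by rewrite mulr_ge0 ?powR_ge0 // ltW.
move=> H; rewrite /prof.
have : m / (3 + a) * (w ^+ 3 * w `^ a) <= k / 3 * w ^+ 3.
  rewrite mulrCA mulrC ler_wpM2r // mulrAC ler_pdivrMr; last by have := a0; lra.
  by apply: (@le_trans _ _ (k / 3 * 3)); [lra|rewrite ler_wpM2l //; have := a0; lra].
lra.
Qed.

Lemma prof_le (w : R) : 0 <= w -> prof w <= w ^+ 2 / 2 + k / 3 * w ^+ 3.
Proof.
move=> w0; rewrite /prof lerBlDr lerDl mulr_ge0 ?divr_ge0 ?(ltW m0) //.
  by have := a0; lra.
by rewrite mulr_ge0 ?powR_ge0 ?exprn_ge0.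
Qed.

Lemma prof_convex (x y : R) : 0 <= x <= W -> 0 <= y <= W ->
  prof x + prof1 x * (y - x) + (y - x) ^+ 2 / 2 <= prof y.
Proof.
move=> xW yW; have [x0 x1] := andP xW; have [y0 y1] := andP yW; have k0 := prof_kge0.
have aa := a0.
move: (x0); rewrite le_eqVlt => /predU1P[E|x0'].
  by rewrite -E prof0 prof10 add0r mul0r add0r subr0 prof_ge_sq.
move: (y0); rewrite le_eqVlt => /predU1P[E|y0'].
  rewrite -E prof0 /prof /prof1 sub0r.
  have := prof_m xW; have x3 : 0 <= x ^+ 3 by rewrite exprn_ge0.
  move=> H.
  have : (2 + a) / (3 + a) * (m * x `^ a) <= 2 / 3 * k.
    have p0 : 0 <= m * x `^ a by rewrite mulr_ge0 ?powR_ge0 // ltW.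
    apply: (@le_trans _ _ (1 * (m * x `^ a))); last by lra.
    by rewrite ler_wpM2r // ler_pdivrMr; lra.
  move=> /(ler_wpM2r x3).
  have -> : (2 + a) / (3 + a) * (m * x `^ a) * x ^+ 3 =
     m * (x ^+ 3 * x `^ a) - m / (3 + a) * (x ^+ 3 * x `^ a) by field; rewrite gt_eqF //; lra.
  lra.
have dG (t : R) : 0 < t -> is_derive t (1 : R) (fun w => prof w - w ^+ 2 / 2) (prof1 t - t).
  move=> t0; have d := prof_derive t0.
  have -> : (fun w => prof w - w ^+ 2 / 2) = fun w => 1 * prof w + (- (1 / 2)) * w ^+ 2 + 0 * w ^+ 1.
    by apply/funext => w; rewrite mul1r mul0r addr0 mulNr mul1r [2^-1 * _]mulrC.
  apply: (is_derive_eq (is_derive_comb3 1 (- (1 / 2)) 0 d (is_derive_pow 1 t) (is_derive_pow 0 t))).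
  by rewrite expr1; field.
have [xy|yx|->] := ltgtP x y; last by rewrite subrr; lra.
- have [|c /andP[c1 c2]] := mvt_pos (_ : 0 < x < y) dG; first by rewrite x0'.
  have cm : c - x <= prof1 c - prof1 x.
    by apply: prof1_mono; [apply/andP; split; lra|lra].
  have : (prof1 x - x) * (y - x) <= (prof1 c - c) * (y - x) by rewrite ler_wpM2r //; clear -a0 a1 cm xy; lra.
  lra.
- have [|c /andP[c1 c2]] := mvt_pos (_ : 0 < y < x) dG; first by rewrite y0'.
  have cm : x - c <= prof1 x - prof1 c.
    by apply: prof1_mono; [apply/andP; split; lra|lra].
  have : (prof1 c - c) * (x - y) <= (prof1 x - x) * (x - y) by rewrite ler_wpM2r //; clear -a0 a1 cm yx; lra.
  lra.
Qed.

Lemma prof1_ge (w : R) : 0 <= w <= W -> w <= prof1 w.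
Proof.
move=> /andP[w0 w1]; have w00 : (0 : R) <= 0 <= w by rewrite w0 lexx.
by have := prof1_mono w00 w1; rewrite prof10 !subr0.
Qed.

Lemma prof_kw (w : R) : 0 <= w <= W -> k * w <= 1.
Proof. by move=> /andP[w0 w1]; apply: le_trans kW; rewrite ler_wpM2l // prof_kge0. Qed.

Lemma prof1_le (w : R) : 0 <= w <= W -> prof1 w <= 2 * w.
Proof.
move=> ww; have := prof_kw ww; have [w0 _] := andP ww => H.
have : 0 <= m * (w ^+ 2 * w `^ a) by rewrite !mulr_ge0 ?powR_ge0 ?sqr_ge0 // ltW.
have : k * w * w <= 1 * w by rewrite ler_wpM2r.
rewrite /prof1; lra.
Qed.

Lemma prof_mono : {in `[0, W] &, {mono prof : x y / x <= y}}.
Proof.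
apply: le_mono_in => x y; rewrite !in_itv /= => /andP[x0 x1] /andP[y0 y1] xy.
have := @prof_convex x y; rewrite x0 x1 y0 y1 => /(_ isT isT).
have xW : 0 <= x <= W by rewrite x0.
have := mulr_ge0 (le_trans x0 (prof1_ge xW)) (ltW (_ : 0 < y - x)); rewrite subr_gt0 => /(_ xy).
have : 0 < (y - x) ^+ 2 by rewrite exprn_gt0 // subr_gt0.
lra.
Qed.

Lemma prof_lip (x y : R) : 0 <= x <= W -> 0 <= y <= W -> prof y - prof x <= 2 * W * `|y - x|.
Proof.
move=> xW yW; have := prof_convex yW xW; have := sqr_ge0 (x - y).
have [y0 y1] := andP yW; have := prof1_le yW; have := prof1_ge yW => p1 p2 p3 p4.
have : prof1 y * (y - x) <= 2 * W * `|y - x|.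
  apply: (@le_trans _ _ (prof1 y * `|y - x|)); first by rewrite ler_wpM2l ?ler_norm //; lra.
  by rewrite ler_wpM2r //; lra.
lra.
Qed.

Lemma prof_surj (v : R) : 0 <= v <= W ^+ 2 / 2 -> exists2 w, 0 <= w <= W & prof w = v.
Proof.
move=> /andP[v0 v1]; have WW : 0 <= W <= W by rewrite lexx ltW.
have vW : v <= prof W := le_trans v1 (prof_ge_sq WW).
have [|||c] := @IVT R prof 0 W v.
- exact: ltW.
- apply/subspace_continuousP => x; rewrite /= in_itv /= => xW.
  apply/cvgrPdist_le => e e0; apply/nbhs_ballP; exists (e / (2 * W)); first by rewrite /= divr_gt0 ?mulr_gt0.
  move=> y; rewrite /ball /= ltr_pdivlMr ?mulr_gt0 // => xy; rewrite in_itv /= => yW.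
  have := prof_lip yW xW; have := prof_lip xW yW; rewrite [`|y - x|]distrC => h1 h2.
  change (`|prof x - prof y| <= e); rewrite ler_norml; lra.
- rewrite prof0 (min_idPl _) ?(max_idPr _) ?v0 ?vW //; exact: le_trans vW.
- by rewrite in_itv /= => cW E; exists c.
Qed.

(** Convexity of prof w - w^2 / 2, tested between [y] and 0, gives sqrt (2 prof y) <= prof1 y; so
    the square root of 2 prof has slope at least 1. Through this the new variable inherits the
    Lipschitz constant of the square root of [u]. *)
Lemma prof_sqrt (x y : R) : 0 <= y <= x -> x <= W ->
  x - y <= Num.sqrt (2 * prof x) - Num.sqrt (2 * prof y).
Proof.
move=> /andP[y0 yx] xW; have x0 := le_trans y0 yx.
have xx : 0 <= x <= W by rewrite x0.
have yy : 0 <= y <= W by rewrite y0 (le_trans yx).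
have := prof_convex yy xx; have z0 : (0 : R) <= 0 <= W by rewrite (ltW W0) lexx.
have := prof_convex yy z0; rewrite prof0 sub0r sqrrN mulrN => H0 H.
have p1 := prof1_ge yy; have p0 := prof_ge_sq yy.
set q := Num.sqrt (2 * prof y).
have q0 : 0 <= q := sqrtr_ge0 _.
have q2 : q ^+ 2 = 2 * prof y by rewrite sqr_sqrtr //; have := sqr_ge0 y; lra.
have qp : q <= prof1 y.
  have p10 : 0 <= prof1 y := le_trans y0 p1.
  rewrite -(@ler_pXn2r _ 2) ?nnegrE // q2.
  have := sqr_ge0 (prof1 y - y); lra.
rewrite lerBrDr -[leLHS]ger0_norm; last by lra.
rewrite -sqrtr_sqr ler_wsqrtr //.
have : q * (x - y) <= prof1 y * (x - y) by rewrite ler_wpM2r // subr_ge0.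
lra.
Qed.

Lemma prof_denom (w : R) : 0 <= w <= W -> 1 <= 1 + k * w - m * (w * w `^ a) <= 2.
Proof.
move=> ww; have := prof_kw ww; have := prof_m ww; have [w0 _] := andP ww.
move=> H1 H2; have k0 := prof_kge0.
have := ler_wpM2r w0 H1; have := mulr_ge0 k0 w0.
have : 0 <= m * (w * w `^ a) by rewrite !mulr_ge0 ?powR_ge0 // ltW.
move=> *; apply/andP; split; lra.
Qed.

Lemma prof2E (w : R) : 0 <= w <= W -> prof2 w = 1 + prof_h w * prof1 w.
Proof.
move=> ww; have /andP[d1 _] := prof_denom ww.
rewrite /prof_h (_ : prof1 w = w * (1 + k * w - m * (w * w `^ a))); last by rewrite /prof1; ring.
by rewrite mulrCA divfK ?gt_eqF //; [rewrite /prof2; ring|lra].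
Qed.

Lemma prof_h_bounds (w : R) : 0 <= w <= W -> 0 <= prof_h w <= 2 * k.
Proof.
move=> ww; have /andP[d1 _] := prof_denom ww; have := prof_k ww; have k0 := prof_kge0.
have : 0 <= (2 + a) * m * w `^ a by rewrite !mulr_ge0 ?powR_ge0 ?(ltW m0) // addr_ge0 // ltW.
move=> p0 p1; rewrite /prof_h divr_ge0 /=; [|lra|lra].
rewrite ler_pdivrMr; last lra.
have : 2 * k * 1 <= 2 * k * (1 + k * w - m * (w * w `^ a)) by rewrite ler_wpM2l //; lra.
lra.
Qed.

(** The numerator decreases and the denominator, which lies between 1 and 2, increases; concavity of
    the power quantifies the drop of the numerator. This is the strict gain of the sharp
    comparison. *)
Lemma prof_h_diff (x y : R) : 0 < y <= x -> x <= W ->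
  m * a * (x `^ a / x) * (x - y) <= prof_h y - prof_h x.
Proof.
move=> /andP[y0 yx] xW; have x0 : 0 < x := lt_le_trans y0 yx.
have xx : 0 <= x <= W by rewrite (ltW x0).
have yy : 0 <= y <= W by rewrite (ltW y0) (le_trans yx).
have k0 := prof_kge0; have aa := a0.
have /andP[dx1 dx2] := prof_denom xx; have /andP[dy1 dy2] := prof_denom yy.
have kx := prof_k xx; have ky := prof_k yy.
have pm : y `^ a <= x `^ a by apply: powR_mono => //; rewrite (ltW y0).
have px := powR_ge0 x a; have py := powR_ge0 y a.
have d0 : 0 <= x - y by rewrite subr_ge0.
have dD : 1 + k * y - m * (y * y `^ a) <= 1 + k * x - m * (x * x `^ a).
  have T := powR_tangent a01 y0 (ltW x0).
  have H1 : y * (x `^ a - y `^ a) <= a * y `^ a * (x - y).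
    have -> : a * y `^ a * (x - y) = y * (a * (y `^ a / y) * (x - y)) by field; rewrite gt_eqF.
    by rewrite ler_pM2l //; lra.
  have H2 : a * y `^ a * (x - y) <= a * x `^ a * (x - y).
    by rewrite ler_wpM2r // ler_pM2l.
  have H3 : m * (x * x `^ a - y * y `^ a) <= m * ((1 + a) * x `^ a * (x - y)).
    by rewrite ler_pM2l //; clear -mk a1 H2 H1; lra.
  have H4 : (2 + a) * m * x `^ a * (x - y) <= k * (x - y) by rewrite ler_wpM2r.
  have H5 : 0 <= m * x `^ a * (x - y) by rewrite !mulr_ge0 // ltW.
  clear -a0 a1 H5 H4 H3; lra.
rewrite /prof_h; set Dx := 1 + k * x - _ in dx1 dx2 dD *; set Dy := 1 + k * y - _ in dy1 dy2 dD *.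
have Ny : (2 * k - (2 + a) * m * y `^ a) / Dx <= (2 * k - (2 + a) * m * y `^ a) / Dy.
  by rewrite ler_wpM2l ?lef_pV2 ?posrE //; clear -dD dy1 dx2 pm ky k0 yy; lra.
have T := powR_tangent a01 x0 (ltW y0).
have T2 : a * (x `^ a / x) * (x - y) <= x `^ a - y `^ a by clear -mk a0 a1 T; lra.
apply: (@le_trans _ _ ((2 * k - (2 + a) * m * y `^ a) / Dx - (2 * k - (2 + a) * m * x `^ a) / Dx)); last by clear -a0 a1 Ny; lra.
rewrite -mulrBl ler_pdivlMr; last lra.
have q0 : 0 <= m * a * (x `^ a / x) * (x - y).
  by rewrite !mulr_ge0 ?invr_ge0 // ltW.
apply: (@le_trans _ _ (m * a * (x `^ a / x) * (x - y) * 2)); first by rewrite ler_wpM2l.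
have := ler_wpM2l (ltW m0) T2.
have : 0 <= a * (m * (x `^ a - y `^ a)) by rewrite !mulr_ge0 ?subr_ge0 // ltW.
clear -kW mk a0 a1; lra.
Qed.

End Profile.

(** * Inequalities and parameters of the sharp comparison *)

Section SharpArith.
Context {R : realType}.

(** Comes from completing a square in [sharp_arith2]: with v = r' / w, C / 16 must beat 25 v - v^2 /
    32 + 4 n, and v^2 / 32 - 25 v + 5000 = 2 (v / 8 - 50)^2; a margin of 50 remains. *)
Definition sharpC (n : R) : R := 16 * (50 * 101 + 4 * n).

(** As B'' = 1 + h B', each quotient splits into - (P - f) / B' - h P. The first part gains because
    B' is larger at [x], the second because [h] is smaller there; the remaining differences are of
    order [s], which cancels. *)
Lemma sharp_arith1 (s n E X Z A h0 wx wy B1x B1y hx hy Px Py fx fy : R) :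
  0 < s -> 0 <= X -> 0 <= Z -> 0 < wy <= wx -> s / 2 <= B1x - B1y -> wx <= B1x <= 2 * wx ->
  wy <= B1y <= 2 * wy -> X / 4 <= Py - fy -> Px - fx <= Py - fy + 25 * Z * s ->
  Px - Py <= (2 * A + 20 * Z) * s -> 0 <= hx -> h0 * s <= hy - hx -> 0 <= h0 -> 1 / 2 <= Py ->
  (fx - (1 + hx * B1x) * Px) / B1x - (fy - (1 + hy * B1y) * Py) / B1y <= 4 * n * s * E ->
  X / (32 * wx ^+ 2) + h0 / 2 <= 25 * Z / wx + hx * (2 * A + 20 * Z) + 4 * n * E.
Proof.
move=> s0 X0 Z0 /andP[wy0 wyx] dB /andP[Bx1 Bx2] /andP[By1 By2] Gy Gx PP hx0 hd h00 Py0 H.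
have wx0 : 0 < wx := lt_le_trans wy0 wyx.
have b1x0 : 0 < B1x := lt_le_trans wx0 Bx1.
have b1y0 : 0 < B1y := lt_le_trans wy0 By1.
have E1 : (fx - (1 + hx * B1x) * Px) / B1x = - ((Px - fx) / B1x) - hx * Px by field; rewrite gt_eqF.
have E2 : (fy - (1 + hy * B1y) * Py) / B1y = - ((Py - fy) / B1y) - hy * Py by field; rewrite gt_eqF.
rewrite E1 E2 in H.
have T1 : X * s / (32 * wx ^+ 2) <= (Py - fy) / B1y - (Py - fy) / B1x.
  have -> : (Py - fy) / B1y - (Py - fy) / B1x = (Py - fy) * ((B1x - B1y) / (B1x * B1y)).
    by field; rewrite !gt_eqF.
  have -> : X * s / (32 * wx ^+ 2) = X / 4 * (s / 2 / (2 * wx * (2 * wx))) by field; rewrite gt_eqF.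
  have w20 : 0 < 2 * wx by rewrite mulr_gt0.
  apply: ler_pM => //; first by rewrite divr_ge0.
    by rewrite divr_ge0 ?mulr_ge0 ?divr_ge0 // ltW.
  apply: ler_pM => //; first by rewrite divr_ge0 // ltW.
    by rewrite invr_ge0 mulr_ge0 // ltW.
  by rewrite lef_pV2 ?posrE ?mulr_gt0 //; apply: ler_pM; clear -By1 Bx2 dB wy0 s0; lra.
have T2 : (Px - fx) / B1x <= (Py - fy) / B1x + 25 * Z * s / wx.
  apply: (@le_trans _ _ ((Py - fy + 25 * Z * s) / B1x)); first by rewrite ler_pM2r ?invr_gt0.
  rewrite mulrDl lerD2l ler_wpM2l ?lef_pV2 //.
  by rewrite !mulr_ge0 // ltW.
have T3 : h0 * s / 2 <= (hy - hx) * Py.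
  have hs0 : 0 <= h0 * s by rewrite mulr_ge0 // ltW.
  have := ler_wpM2r (le_trans (_ : 0 <= 1 / 2 :> R) Py0) hd => /(_ ltac:(clear; lra)).
  have := ler_wpM2l hs0 Py0; clear; lra.
have T4 : hx * (Px - Py) <= hx * (2 * A + 20 * Z) * s by rewrite -mulrA ler_wpM2l.
have : (X / (32 * wx ^+ 2) + h0 / 2) * s <= (25 * Z / wx + hx * (2 * A + 20 * Z) + 4 * n * E) * s.
  have -> : (X / (32 * wx ^+ 2) + h0 / 2) * s = X * s / (32 * wx ^+ 2) + h0 * s / 2 by ring.
  have -> : (25 * Z / wx + hx * (2 * A + 20 * Z) + 4 * n * E) * s =
    25 * Z * s / wx + hx * (2 * A + 20 * Z) * s + 4 * n * s * E by ring.
  by move: H T1 T2 T3 T4; clear; lra.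
by rewrite ler_pM2r.
Qed.

Lemma sharp_arith2 (n E q r' w V C h A k m a : R) : 0 <= n -> 0 < E -> q = r' ^+ 2 -> 0 < w ->
  C = sharpC n ->
  q * E / (32 * w ^+ 2) + m * a * V / 4 <= 25 * (E * r') / w + h * (2 * A + 20 * (E * r')) + 4 * n * E ->
  h <= 2 * k -> 0 <= 2 * A + 20 * (E * r') -> 2 * k * (2 * A + 20 * (E * r')) <= m * a * V / 8 ->
  C * E / 16 <= m * a * V / 8 -> False.
Proof.
move=> n0 E0 -> w0 CE H hk A0 kV CV.
have : h * (2 * A + 20 * (E * r')) <= 2 * k * (2 * A + 20 * (E * r')) by rewrite ler_wpM2r.
pose v := r' / w.
have E1 : r' ^+ 2 * E / (32 * w ^+ 2) = E * (v ^+ 2 / 32) by rewrite /v; field; rewrite gt_eqF.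
have E2 : 25 * (E * r') / w = E * (25 * v) by rewrite /v; field; rewrite gt_eqF.
move=> T; have : E * (v ^+ 2 / 32 + C / 16) <= E * (25 * v + 4 * n).
  by move: H T kV CV; rewrite E1 E2; clear; lra.
rewrite ler_pM2l // CE /sharpC; have := sqr_ge0 (v / 8 - 50); nra.
Qed.

Lemma powR_half_sqr (a x : R) : 0 < a -> 0 <= x -> (x ^+ 2) `^ ((1 + a) / 2) = x * x `^ a.
Proof.
move=> a0 x0; rewrite -powR_mulrn // -powRrM.
have -> : 2%:R * ((1 + a) / 2) = 1 + a by field.
rewrite powRD ?powRr1 //; apply/implyP => /eqP E; exfalso; lra.
Qed.

(** [M] makes the power weight equal to [N] at radius [r]; [m] makes the gain m a w^(a-1) beat
    multiples of [E]; [k] dominates the power term on [0, 4 r]; and [N] is then determined by k (4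
    r) = 1. The gain is bounded below in two ways, by w <= 4 r for the first estimate and by w <= 2
    rq for the second. *)
Lemma sharp_params (a A r N C M m k n q rq E w : R) : 0 < a <= 1 -> 1 <= A -> 0 < r -> 0 <= n ->
  C = sharpC n -> N = a / (48 * C) -> 4 * A ^+ 2 * r <= N -> r <= 1 ->
  M = N / (r * r `^ a) -> m = C * M / a -> k = 12 * m * r `^ a ->
  0 < rq <= 2 * r -> E = M * rq `^ a / rq -> 0 < w <= 4 * r -> w <= 2 * rq ->
  [/\ 0 < E, 2 * k * (2 * A + 20 * (E * rq)) <= m * a * (w `^ a / w) / 8 &
      C * E / 16 <= m * a * (w `^ a / w) / 8].
Proof.
move=> a01 A1 r0 n0 CE NE Ar r1 ME mE kE /andP[q0 q1] EE /andP[w0 w1] w2.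
have [a0 a1] := andP a01.
have C80 : 80 * (10 * 10 * 10) <= C by rewrite CE /sharpC; lra.
have Na : N * (48 * C) = a by rewrite NE divfK // gt_eqF //; clear -C80; lra.
have N0 : 0 < N by rewrite NE divr_gt0 //; lra.
have ra : 0 < r `^ a by rewrite powR_gt0.
have qa : 0 < rq `^ a by rewrite powR_gt0.
have M0 : 0 < M by rewrite ME divr_gt0 // mulr_gt0.
have Mr : M * r `^ a * r = N by rewrite ME; field; rewrite !gt_eqF.
have m0 : 0 < m by rewrite mE divr_gt0 // mulr_gt0 //; clear -C80; lra.
have ma : m * a = C * M by rewrite mE divfK // gt_eqF.
have E0 : 0 < E by rewrite EE divr_gt0 // mulr_gt0.
have Eq : E * rq = M * rq `^ a by rewrite EE divfK // gt_eqF.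
have qar : rq `^ a <= 2 * r `^ a.
  apply: (@le_trans _ _ ((2 * r) `^ a)); last by apply: powR_scale; clear -a1 a0 w1 w0; lra.
  by apply: powR_mono; rewrite // (ltW q0).
have V1 : r `^ a / (4 * r) <= w `^ a / w.
  apply: (@le_trans _ _ ((4 * r) `^ a / (4 * r))); last by apply: powR_div_anti; rewrite // w0.
  rewrite ler_pM2r ?invr_gt0 ?mulr_gt0 //; apply: powR_mono; rewrite // (ltW r0) /=; clear -r0; lra.
have V2 : rq `^ a / (2 * rq) <= w `^ a / w.
  apply: (@le_trans _ _ ((2 * rq) `^ a / (2 * rq))); last by apply: powR_div_anti; rewrite // w0.
  rewrite ler_pM2r ?invr_gt0 ?mulr_gt0 //; apply: powR_mono; rewrite // (ltW q0) /=; clear -q0; lra.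
split=> //.
- apply: (@le_trans _ _ (m * a * (r `^ a / (4 * r)) / 8)); last first.
    by rewrite ler_pM2r ?invr_gt0 // ler_pM2l // mulr_gt0.
  have Z1 : E * rq * r <= 2 * N.
    rewrite Eq -Mr; have : M * (rq `^ a * r) <= M * (2 * r `^ a * r).
      by rewrite ler_pM2l // ler_pM2r.
    clear; lra.
  have Z2 : (2 * A + 20 * (E * rq)) * r <= 41 * N.
    have : A * r <= A ^+ 2 * r by rewrite ler_pM2r // expr2 ler_peMl //; clear -A1; lra.
    clear -Z1 V2 N0 Na C80 a1 mE ME r1 Ar; lra.
  have Z3 : 768 * ((2 * A + 20 * (E * rq)) * r) <= a.
    have : N * (40 * (10 * 10 * 10)) <= N * C by rewrite ler_pM2l //; clear -C80; lra.
    clear -Z2 N0 Na C80; lra.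
  have -> : 2 * k * (2 * A + 20 * (E * rq)) =
      m * r `^ a / (32 * r) * (768 * ((2 * A + 20 * (E * rq)) * r)).
    by rewrite kE; field; rewrite gt_eqF.
  have -> : m * a * (r `^ a / (4 * r)) / 8 = m * r `^ a / (32 * r) * a by field; rewrite gt_eqF.
  by rewrite ler_pM2l // divr_gt0 ?mulr_gt0.
- apply: (@le_trans _ _ (m * a * (rq `^ a / (2 * rq)) / 8)); last first.
    by rewrite ler_pM2r ?invr_gt0 // ler_pM2l // mulr_gt0.
  by rewrite ma EE [leRHS](_ : _ = C * (M * rq `^ a / rq) / 16) //; field; rewrite gt_eqF.
Qed.

End SharpArith.

Section SharpVectors.
Context {R : realType} {n : nat}.
Implicit Types (X Y av : 'rV[R]_n).

(** The linear part of the weight averages 1 + av.X / 2 and 1 + av.Y / 2, the linearizations of sqrt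
    (f / f x0) at the two points. Along X - Y its gradient turns the average into the value at [Y],
    and of the surplus E q at least half survives in |py|. *)
Lemma sharp_vectors X Y av (s c E q A a rq : R) (g1 g2 px py : 'rV[R]_n) :
  s = enorm (X - Y) -> 0 < s -> 0 < a <= 1 -> enorm av <= A -> 0 <= E -> 0 <= rq -> q = rq ^+ 2 ->
  enorm X ^+ 2 + enorm Y ^+ 2 <= q -> 4 * A * rq <= 1 -> E * q <= 1 / 16 ->
  c = (1 + dot av X / 2 + (1 + dot av Y / 2)) / 2 + E * q ->
  g1 = 4^-1 *: av + ((1 + a) * E) *: X -> g2 = 4^-1 *: av + ((1 + a) * E) *: Y ->
  px = (c / s) *: (X - Y) + s *: g1 -> py = (c / s) *: (X - Y) - s *: g2 ->
  [/\ enorm X <= rq, enorm Y <= rq, s <= 2 * rq, `|c - 1| <= A * rq / 2 + E * q &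
   1 + dot av Y / 2 + E * q / 2 <= enorm py /\
   enorm px ^+ 2 - enorm py ^+ 2 <= c * dot av (X - Y) + 20 * (E * rq) * s].
Proof.
move=> sE s0 /andP[a0 a1] avA E0 q0 qE XY Aq Eq cE g1E g2E pxE pyE.
have A0 : 0 <= A := le_trans (enorm_ge0 _) avA.
have le_rq Z : enorm Z ^+ 2 <= q -> enorm Z <= rq.
  by rewrite qE => H; rewrite -(@ler_pXn2r _ 2) ?nnegrE ?enorm_ge0.
have Xq : enorm X <= rq by apply: le_rq; have := sqr_ge0 (enorm Y); lra.
have Yq : enorm Y <= rq by apply: le_rq; have := sqr_ge0 (enorm X); lra.
have X0 := enorm_ge0 X; have Y0 := enorm_ge0 Y.
have s2 : s <= 2 * rq by rewrite sE; have := enormD X (- Y); rewrite enormN; lra.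
have avb Z : enorm Z <= rq -> `|dot av Z| <= A * rq.
  by move=> Zq; apply: le_trans (dot_norm _ _) _; apply: ler_pM; rewrite ?enorm_ge0.
have c1 : `|c - 1| <= A * rq / 2 + E * q.
  rewrite (_ : c - 1 = (dot av X + dot av Y) / 4 + E * q); last by rewrite cE; field.
  have := avb X Xq; have := avb Y Yq; have : 0 <= E * q by rewrite qE mulr_ge0 ?sqr_ge0.
  by rewrite !ler_norml; move=> h1 /andP[h2 h3] /andP[h4 h5]; apply/andP; split; clear -h1 h2 h3 h4 h5; lra.
have ss : dot (X - Y) (X - Y) = s ^+ 2 by rewrite sE enorm_sqr.
have ssE : (c / s) * s ^+ 2 = c * s by field; rewrite gt_eqF.
split=> //; split.
- have D1 : dot py (X - Y) <= enorm py * s by rewrite sE dot_le.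
  have D2 : dot py (X - Y) = c * s - s * dot g2 (X - Y).
    by rewrite pyE dotDl dotNl !dotZl ss ssE.
  have D3 : c - dot g2 (X - Y) <= enorm py.
    by rewrite -(ler_pM2r s0); move: D1; rewrite D2; clear; lra.
  apply: le_trans D3; rewrite g2E dotDl !dotZl cE.
  (* X.Y - |Y|^2 <= |X|^2 / 4; together with the factor 1 + a <= 2 the gradient of the power weight
     costs at most E q / 2. *)
  have XY1 : dot Y (X - Y) <= q / 4.
    rewrite dotDr dotNr -enorm_sqr; have := dot_le Y X; have := sqr_ge0 (enorm X / 2 - enorm Y).
    have := sqr_ge0 (enorm Y); clear -XY; lra.
  have T : (1 + a) * E * dot Y (X - Y) <= E * q / 2.
    have -> : E * q / 2 = 2 * E * (q / 4) by field.
    apply: (@le_trans _ _ ((1 + a) * E * (q / 4))).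
      by rewrite ler_wpM2l // mulr_ge0 //; clear -a0; lra.
    have : (1 + a) * (E * (q / 4)) <= 2 * (E * (q / 4)).
      by rewrite ler_wpM2r ?mulr_ge0 // ?qE ?sqr_ge0 //; clear -a1; lra.
    clear; lra.
  by move: T; rewrite !dotDr !dotNr; clear; lra.
- rewrite dot_sqrB.
  have -> : px - py = s *: (g1 + g2).
    by rewrite pxE pyE opprB addrC addrA subrK addrC scalerDr.
  have -> : px + py = (2 * (c / s)) *: (X - Y) + s *: (g1 - g2).
    by rewrite pxE pyE addrACA -scalerBr -mulr2n -scaler_nat scalerA.
  have g12 : g1 + g2 = 2^-1 *: av + ((1 + a) * E) *: (X + Y).
    rewrite g1E g2E addrACA -scalerDl -scalerDr; congr (_ *: _ + _); by field.
  have gm : g1 - g2 = ((1 + a) * E) *: (X - Y).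
    by rewrite g1E g2E opprD addrACA subrr add0r scalerBr.
  have aE : 0 <= (1 + a) * E <= 2 * E by rewrite mulr_ge0 ?ler_wpM2r //; clear -a1 a0; lra.
  have [aE0 aE1] := andP aE.
  have XYn : enorm (X + Y) <= 2 * rq by have := enormD X Y; clear -Yq Xq; lra.
  have gn : enorm (((1 + a) * E) *: (X + Y)) <= 4 * (E * rq).
    rewrite enormZ ger0_norm //; have : (1 + a) * E * enorm (X + Y) <= 2 * E * (2 * rq).
      by apply: ler_pM; rewrite ?enorm_ge0.
    clear; lra.
  have g12n : enorm (g1 + g2) <= A / 2 + 4 * (E * rq).
    rewrite g12; apply: le_trans (enormD _ _) _; apply: lerD => //.
    by rewrite enormZ gtr0_norm ?invr_gt0 // mulrC ler_wpM2r.
  have gmn : enorm (g1 - g2) <= 2 * E * s by rewrite gm enormZ ger0_norm // -sE ler_wpM2r //; exact: ltW.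
  have DE (t : R) (U V Z : 'rV[R]_n) : dot (s *: U) (t *: V + s *: Z) = s * (t * dot U V) + s * (s * dot U Z).
    by rewrite dotZl dotDr !dotZr mulrDr.
  rewrite DE.
  have D1 : s * (2 * (c / s) * dot (g1 + g2) (X - Y)) = 2 * c * dot (g1 + g2) (X - Y).
    by field; rewrite gt_eqF.
  have c2 : 0 <= c <= 2.
    by move: c1; rewrite ler_norml => /andP[h1 h2]; apply/andP; split; lra.
  have [c20 c22] := andP c2.
  have D2 : 2 * c * dot (g1 + g2) (X - Y) <= c * dot av (X - Y) + 16 * (E * rq) * s.
    rewrite g12 dotDl !dotZl.
    have : (1 + a) * E * dot (X + Y) (X - Y) <= 4 * (E * rq) * s.
      rewrite -dotZl; apply: le_trans (dot_le _ _) _; rewrite -sE ler_wpM2r //; exact: ltW.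
    set T := (1 + a) * E * _ => TT.
    have : c * T <= c * (4 * (E * rq) * s) by rewrite ler_wpM2l.
    have p0 : 0 <= 4 * (E * rq) * s by rewrite !mulr_ge0 // ltW.
    have : c * (4 * (E * rq) * s) <= 2 * (4 * (E * rq) * s) by rewrite ler_wpM2r.
    clear; lra.
  have D3 : dot (g1 + g2) (g1 - g2) <= (A / 2 + 4 * (E * rq)) * (2 * E * s).
    by apply: le_trans (dot_le _ _) _; apply: ler_pM; rewrite ?enorm_ge0.
  have D4 : s * (s * dot (g1 + g2) (g1 - g2)) <= 4 * (E * rq) * s.
    have s20 : 0 <= s * s by rewrite mulr_ge0 // ltW.
    rewrite mulrA; apply: (le_trans (ler_wpM2l s20 D3)).
    have -> : s * s * ((A / 2 + 4 * (E * rq)) * (2 * E * s)) =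
      E * s * (s * s * (A + 8 * (E * rq))) by field.
    have -> : 4 * (E * rq) * s = E * s * (4 * rq) by ring.
    rewrite ler_wpM2l ?mulr_ge0 ?(ltW s0) //.
    have s3 : s * s <= 2 * rq * (2 * rq) by apply: ler_pM => //; exact: ltW.
    apply: (@le_trans _ _ (2 * rq * (2 * rq) * (A + 8 * (E * rq)))).
      by rewrite ler_wpM2r // addr_ge0 // !mulr_ge0.
    have : rq * (4 * A * rq) <= rq * 1 by rewrite ler_wpM2l.
    have : rq * (E * q) <= rq * (1 / 16) by rewrite ler_wpM2l.
    rewrite qE; clear -q0; lra.
  by rewrite D1; move: D2 D4; clear; lra.
Qed.

End SharpVectors.

Lemma sharp_params0 (R : realType) (a r N C M m k n : R) : 0 < a <= 1 -> 0 < r <= 1 / 16 -> 0 <= n ->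
  C = sharpC n -> N = a / (48 * C) -> M = N / (r * r `^ a) -> m = C * M / a ->
  k = 12 * m * r `^ a ->
  [/\ 0 < N <= 1 / (10 * 10 * 10), 0 < M, 0 < m, 0 <= k & [/\ k * (4 * r) <= 1, (2 + a) * m * (4 * r) `^ a <= k,
   0 < r `^ a <= 1 & M * (r * r `^ a) = N]].
Proof.
move=> a01 /andP[r0 r1] n0 CE NE ME mE kE; have [a0 a1] := andP a01.
have C80 : 80 * (10 * 10 * 10) <= C by rewrite CE /sharpC; lra.
have C0 : 0 < C by lra.
have N0 : 0 < N by rewrite NE divr_gt0 // mulr_gt0.
have N1 : N <= 1 / (10 * 10 * 10) by rewrite NE ler_pdivrMr ?mulr_gt0 //; lra.
have ra : 0 < r `^ a by exact: powR_gt0.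
have ra1 : r `^ a <= 1.
  by rewrite -[leRHS](congr1 (fun g => g a) (powR1 R)); apply: powR_mono => //; rewrite (ltW r0) /=; lra.
have M0 : 0 < M by rewrite ME divr_gt0 // mulr_gt0.
have Mr : M * (r * r `^ a) = N by rewrite ME divfK // gt_eqF // mulr_gt0.
have m0 : 0 < m by rewrite mE divr_gt0 // mulr_gt0.
have k0 : 0 <= k by rewrite kE !mulr_ge0 // ltW.
split=> //; first by rewrite N0.
split=> //; last by rewrite ra.
  have -> : k * (4 * r) = 48 * C / a * (M * (r * r `^ a)) by rewrite kE mE; field; rewrite gt_eqF.
  by rewrite Mr NE le_eqVlt; apply/orP; left; apply/eqP; field; rewrite !gt_eqF.
have H : (4 * r) `^ a <= 4 * r `^ a by apply: powR_scale; clear -a1 a0 r0; lra.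
apply: (@le_trans _ _ (3 * m * (4 * r `^ a))); last by rewrite kE; clear; lra.
apply: ler_pM => //; rewrite ?powR_ge0 //; first by rewrite mulr_ge0 ?(ltW m0) //; clear -a0; lra.
by rewrite ler_wpM2r ?(ltW m0) //; clear -a1; lra.
Qed.

(** * The transformed solution and its weight *)

Section SharpGrowth.
Context {R : realType} {n : nat}.
Implicit Types (x y z h k g : 'rV[R]_n).

(** [om] is the inverse of [prof] at u / f x0. The sharp Lipschitz bound, with N / 4 under the root,
    passes to it with N / 8 through [prof_sqrt]. *)
Lemma om_exists (F : R) (u f : 'rV[R]_n -> R) Du x0 (a k m r N : R) : osol F u f Du ->
  0 < a <= 1 -> enorm x0 < 1 / 2 -> u x0 = 0 -> 0 < r <= 1 / 16 -> 0 < N <= 1 / (10 * 10 * 10) -> 0 < m ->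
  k * (4 * r) <= 1 -> (2 + a) * m * (4 * r) `^ a <= k ->
  lip_ball (ww u) x0 (2 * r) (Num.sqrt ((1 + N / 4) * f x0)) ->
  exists om : 'rV[R]_n -> R,
  [/\ om x0 = 0,
   forall x, enorm (x - x0) <= 2 * r -> 0 <= om x <= 4 * r /\ u x = f x0 * prof a k m (om x) &
   forall x y, enorm (x - x0) <= 2 * r -> enorm (y - x0) <= 2 * r ->
     om x - om y <= (1 + N / 8) * enorm (x - y)].
Proof.
move=> os a01 x0r ux0 /andP[r0 r1] /andP[N0 N1] m0 kW mk; set l := Num.sqrt _ => lipw.
have W0 : 0 < 4 * r by rewrite mulr_gt0.
have Bx x : enorm (x - x0) <= 2 * r -> eball 0 1 x.
  move=> xr; rewrite /eball /= subr0 -(subrK x0 x); apply: le_lt_trans (enormD _ _) _; lra.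
have xx0 : enorm (x0 - x0) <= 2 * r by rewrite subrr enorm0 mulr_ge0 // ltW.
have f00 : 0 < f x0 by apply: (os_gt0 os); exact: Bx.
pose sf := Num.sqrt (f x0).
have sf0 : 0 < sf by rewrite sqrtr_gt0.
have sf2 : sf ^+ 2 = f x0 by rewrite sqr_sqrtr // ltW.
have lsf : l <= (1 + N / 8) * sf.
  have p0 : 0 <= (1 + N / 8) * sf by rewrite mulr_ge0 ?(ltW sf0) //; lra.
  rewrite -[leRHS]ger0_norm // -sqrtr_sqr ler_wsqrtr // exprMn sf2 ler_pM2r //.
  have := sqr_ge0 (N / 8); lra.
have uE x : enorm (x - x0) <= 2 * r -> u x / f x0 = (ww u x / sf) ^+ 2 / 2.
  by move=> xr; rewrite (ww_sqr os (Bx x xr)) -sf2 exprMn exprVn mulrAC.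
have /choice[om Hom] : forall x, exists w,
    enorm (x - x0) <= 2 * r -> 0 <= w <= 4 * r /\ prof a k m w = u x / f x0.
  move=> x; have [xr|] := boolP (enorm (x - x0) <= 2 * r); last by exists 0.
  have lw := lipw x x0 xr xx0; rewrite (ww_eq0 ux0) subr0 in lw.
  have w1 : ww u x / sf <= 4 * r.
    rewrite ler_pdivrMr //; apply: (le_trans lw); apply: (@le_trans _ _ ((1 + N / 8) * sf * (2 * r))).
      by apply: ler_pM; rewrite ?sqrtr_ge0 ?enorm_ge0.
    by rewrite mulrAC ler_pM2r // mulrA ler_pM2r //; clear -N1; lra.
  have w0 : 0 <= ww u x / sf by rewrite divr_ge0 ?ww_ge0 // ltW.
  have [|w wW E] := @prof_surj R a k m (4 * r) a01 m0 W0 kW mk (u x / f x0); last by exists w.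
  rewrite (uE x xr) divr_ge0 ?sqr_ge0 //= ler_pM2r ?invr_gt0 //.
  by rewrite lerXn2r ?nnegrE // ltW.
exists om; split.
- have [/andP[h1 h2] h3] := Hom x0 xx0; move: h3; rewrite ux0 mul0r => h3.
  have : om x0 ^+ 2 / 2 <= 0 by rewrite -h3; apply: (prof_ge_sq a01 m0 mk); rewrite h1.
  move=> h4; apply/eqP; rewrite -sqrf_eq0 eq_le sqr_ge0 andbT; clear -h4; lra.
- by move=> x /Hom[h1 h2]; split=> //; rewrite h2 mulrC divfK // gt_eqF.
- move=> x y xr yr; have [xy|/ltW yx] := leP (om x) (om y).
    apply: (@le_trans _ _ 0); first by rewrite subr_le0.
    by rewrite mulr_ge0 ?enorm_ge0 //; clear -N0; lra.
  have wwE z : enorm (z - x0) <= 2 * r -> Num.sqrt (2 * prof a k m (om z)) = ww u z / sf.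
    move=> zr; have [_ ->] := Hom z zr; rewrite uE // mulrC divfK //.
    by rewrite sqrtr_sqr ger0_norm // divr_ge0 ?ww_ge0 // ltW.
  have [/andP[x1 x2] _] := Hom x xr; have [/andP[y1 y2] _] := Hom y yr.
  have yx' : 0 <= om y <= om x by rewrite y1.
  apply: le_trans (prof_sqrt a01 m0 W0 mk yx' x2) _.
  rewrite !wwE // -mulrBl ler_pdivrMr // mulrAC.
  by apply: le_trans (lipw x y xr yr) _; rewrite ler_wpM2r ?enorm_ge0.
Qed.

(** The exponent (1 + a) / 2 is at most 1, so the power is concave in the squared distance and its
    tangent line bounds it from above globally; [tau] keeps the base point positive. *)
Lemma weight_expand (x0 av x y : 'rV[R]_n) (a M tau : R) : 0 < a <= 1 -> 0 < M ->
  let q := enorm (x - x0) ^+ 2 + enorm (y - x0) ^+ 2 + tau ^+ 2 in 0 < q ->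
  let Phi := fun x y : 'rV[R]_n => (1 + dot av (x - x0) / 2 + (1 + dot av (y - x0) / 2)) / 2
    + M * (enorm (x - x0) ^+ 2 + enorm (y - x0) ^+ 2 + tau ^+ 2) `^ ((1 + a) / 2) in
  let E := M * q `^ ((1 + a) / 2) / q in
  forall h k, Phi (x + h) (y + k) <= Phi x y + dot (4^-1 *: av + ((1 + a) * E) *: (x - x0)) h
    + dot (4^-1 *: av + ((1 + a) * E) *: (y - x0)) k + E * (enorm h ^+ 2 + enorm k ^+ 2).
Proof.
move=> a01 M0 q q0 Phi E h k; have [a0 a1] := andP a01.
pose b := (1 + a) / 2; have b01 : 0 < b <= 1 by apply/andP; split; rewrite /b; lra.
have E0 : 0 < E by rewrite divr_gt0 // mulr_gt0 // powR_gt0.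
pose q' := enorm (x + h - x0) ^+ 2 + enorm (y + k - x0) ^+ 2 + tau ^+ 2.
have q'E : q' - q = 2 * dot (x - x0) h + 2 * dot (y - x0) k + enorm h ^+ 2 + enorm k ^+ 2.
  by rewrite /q' /q !sqdist_expand; ring.
have q'0 : 0 <= q' by rewrite /q' !addr_ge0 ?sqr_ge0.
have T := powR_tangent b01 q0 q'0.
have T2 : M * (b * (q `^ b / q) * (q' - q)) = (1 + a) / 2 * E * (q' - q) by rewrite /E /b; ring.
have T3 : (1 + a) / 2 * E * (enorm h ^+ 2 + enorm k ^+ 2) <= E * (enorm h ^+ 2 + enorm k ^+ 2).
  rewrite ler_wpM2r ?addr_ge0 ?sqr_ge0 // ler_piMl ?(ltW E0) //; clear -a01; lra.
have := ler_wpM2l (ltW M0) T; rewrite mulrDr T2 => T4.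
have avD z l : dot av (z + l - x0) = dot av (z - x0) + dot av l by rewrite -dotDr addrAC.
rewrite /Phi -/b -/q' -/q !avD (dotDl (_ *: av) _ h) (dotDl (_ *: av) _ k) !dotZl.
move: T3 T4; rewrite q'E; clear; lra.
Qed.

Lemma sharp_f (F A rq rqa f0 E q s : R) (f : 'rV[R]_n -> R) (x0 D av x y : 'rV[R]_n) :
  0 < f0 -> f x0 = f0 -> F <= A * f0 -> 0 <= A -> 0 <= rqa -> 0 <= rq -> (forall v, dot D v = f0 * dot av v) ->
  0 <= F -> (forall x y, enorm (x - x0) <= rq -> enorm (y - x0) <= rq ->
     `|f x - f y - dot D (x - y)| <= F * enorm (x - y) * rqa) ->
  enorm (x - x0) <= rq -> enorm (y - x0) <= rq -> s = enorm (x - y) ->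
  A * rqa <= E * rq / 4 -> q = rq ^+ 2 ->
  f y / f0 <= 1 + dot av (y - x0) + E * q / 4 /\
  dot av (x - y) - E * rq / 4 * s <= f x / f0 - f y / f0.
Proof.
move=> f00 fx0 FA A0 rqa0 rq0 Dav F0 fD xr yr sE Ar qE.
have x00 : enorm (x0 - x0) <= rq by rewrite subrr enorm0.
split.
- have := fD y x0 yr x00; rewrite fx0 Dav ler_norml => /andP[_ H].
  have e1 : F * enorm (y - x0) * rqa <= f0 * (E * q / 4).
    apply: (@le_trans _ _ (A * f0 * rq * rqa)).
      by rewrite ler_wpM2r //; apply: ler_pM; rewrite ?enorm_ge0.
    have -> : A * f0 * rq * rqa = f0 * rq * (A * rqa) by ring.
    have -> : f0 * (E * q / 4) = f0 * rq * (E * rq / 4) by rewrite qE; ring.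
    by rewrite ler_wpM2l // mulr_ge0 // ltW.
  rewrite ler_pdivrMr //; move: H e1; clear; lra.
- have := fD x y xr yr; rewrite Dav -sE ler_norml => /andP[H _].
  rewrite -mulrBl ler_pdivlMr //.
  have s0 : 0 <= s by rewrite sE enorm_ge0.
  have e1 : F * s * rqa <= f0 * (E * rq / 4 * s).
    apply: (@le_trans _ _ (A * f0 * s * rqa)).
      by rewrite ler_wpM2r // ler_wpM2r.
    have -> : A * f0 * s * rqa = f0 * s * (A * rqa) by ring.
    have -> : f0 * (E * rq / 4 * s) = f0 * s * (E * rq / 4) by ring.
    by rewrite ler_wpM2l // mulr_ge0 // ltW.
  by move: H e1; clear; lra.
Qed.

(** The square of ly = 1 + lv / 2 is at least 1 + lv, the linear part of f / f x0, so the surplus E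
    q survives in py^2 - fy. In the difference of the excesses at the two points the linear terms
    cancel up to (c - 1) dv. *)
Lemma gamma_arith (A rq E q s c ly lv dv Px py fx fy : R) :
  0 < s -> 0 < E -> 0 < rq -> q = rq ^+ 2 -> 1 <= A -> 4 * A * rq <= 1 / 10 -> E * q <= 1 / 16 ->
  A ^+ 2 * rq <= E * rq / 4 ->
  `|c - 1| <= A * rq / 2 + E * q -> `|lv| <= A * rq -> `|dv| <= A * s -> ly = 1 + lv / 2 ->
  0 <= py -> ly + E * q / 2 <= py -> Px - py ^+ 2 <= c * dv + 20 * (E * rq) * s ->
  fy <= 1 + lv + E * q / 4 -> dv - E * rq / 4 * s <= fx - fy ->
  [/\ 1 / 2 <= py ^+ 2, E * q / 4 <= py ^+ 2 - fy, Px - fx <= py ^+ 2 - fy + 25 * (E * rq) * s &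
    Px - py ^+ 2 <= (2 * A + 20 * (E * rq)) * s].
Proof.
move=> s0 E0 q0 qE A1 Aq Eq AE cb lvb dvb lyE py0 pyb PP fyb fxy.
have Eq0 : 0 <= E * q by rewrite qE mulr_ge0 ?sqr_ge0 // ltW.
have lv1 : `|lv| <= 1 / 10 by apply: (le_trans lvb); move: q0 A1 Aq; clear; nra.
have [l1 l2] : ly <= 21 / 20 /\ 19 / 20 <= ly.
  by move: lv1; rewrite lyE ler_norml => /andP[]; clear; split; lra.
have py2 : (ly + E * q / 2) ^+ 2 <= py ^+ 2 by rewrite lerXn2r ?nnegrE //; clear -l2 Eq0; lra.
have lE : 19 / 20 * (E * q) <= ly * (E * q) by rewrite ler_wpM2r.
have E2 := sqr_ge0 (E * q).
have py2' : ly ^+ 2 + 19 / 20 * (E * q) <= py ^+ 2 by move: py2 lE E2; clear; lra.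
have ly2 : ly ^+ 2 = 1 + lv + lv ^+ 2 / 4 by rewrite lyE; field.
have lv2 := sqr_ge0 lv.
split.
- have : (19 / 20) ^+ 2 <= ly ^+ 2 by rewrite lerXn2r ?nnegrE //; clear -l2; lra.
  move: py2' Eq0; clear; lra.
- by move: py2' fyb Eq0 lv2; rewrite ly2; clear; lra.
- have e5 : (c - 1) * dv <= (A * rq / 2 + E * q) * (A * s).
    by apply: le_trans (ler_norm _) _; rewrite normrM; apply: ler_pM.
  have e8 : E * q * A <= E * rq * (1 / 4).
    have Erq : 0 < E * rq by rewrite mulr_gt0.
    have -> : E * q * A = E * rq * (A * rq) by rewrite qE; ring.
    by rewrite ler_pM2l //; move: Aq; clear; lra.
  have e6 : (A * rq / 2 + E * q) * A <= E * rq.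
    by move: AE e8 (mulr_gt0 E0 q0); clear; lra.
  have e9 := ler_wpM2r (ltW s0) e6.
  have : 0 <= E * rq * s by rewrite !mulr_ge0 // ltW.
  by move: PP fxy e5 e9; clear; lra.
- have As : 0 <= A * s by rewrite mulr_ge0 ?(ltW s0) //; clear -A1; lra.
  have c2 : `|c| <= 2.
    have := ler_normD (c - 1) 1; rewrite subrK normr1 => H; apply: (le_trans H).
    have : A * rq <= 1 / 40 by clear -Aq; lra.
    clear -cb Eq; lra.
  have : c * dv <= 2 * (A * s).
    by apply: le_trans (ler_norm _) _; rewrite normrM; apply: ler_pM.
  by move: PP; clear; lra.
Qed.

Lemma peano_scale (g : R -> R) (w g1 g2 c : R) : 0 < c -> peano_at g w g1 g2 ->
  peano_at (fun t => c * g t) w (c * g1) (c * g2).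
Proof.
move=> c0 P e e0; have [d d0 Hd] := P _ (divr_gt0 e0 c0); exists d => // t /Hd H.
have -> : c * g (w + t) - c * g w - c * g1 * t - c * g2 / 2 * t ^+ 2 =
    c * (g (w + t) - g w - g1 * t - g2 / 2 * t ^+ 2) by field.
rewrite normrM gtr0_norm //; have := H; rewrite -(ler_pM2l c0) => /le_trans; apply.
by rewrite mulrA (mulrC c) divfK // gt_eqF.
Qed.

End SharpGrowth.

(** * No positive interior maximum for the sharp weight *)

Section SharpMax.
Context {R : realType} {n : nat}.
Implicit Types (x y z h k g : 'rV[R]_n).

(** Slopes and [f] agree to first order by the choice of [av]. The power weight absorbs the Hoelder
    remainder of the gradient of [f], because A^2 <= M / 4, and leaves an excess E q / 4 at [y];
    this excess and the decrease of [prof_h] then outweigh all errors. *)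
Lemma sharp_max (F : R) (u f : 'rV[R]_n -> R) Du (x0 D av : 'rV[R]_n) (a A r N C M m k tau : R)
    (om : 'rV[R]_n -> R) (x y : 'rV[R]_n) (rho : R) :
  osol F u f Du -> 0 < a <= 1 -> enorm x0 < 1 / 2 -> 1 <= A ->
  F <= A * f x0 ->
  (forall rho x y, rho <= 1 / 4 -> enorm (x - x0) <= rho -> enorm (y - x0) <= rho ->
     `|f x - f y - dot D (x - y)| <= F * enorm (x - y) * rho `^ a) ->
  C = sharpC n%:R -> N = a / (48 * C) -> 0 < r <= 1 / 16 -> 4 * A ^+ 2 * r <= N ->
  M = N / (r * r `^ a) -> m = C * M / a -> k = 12 * m * r `^ a -> 0 < tau <= r ->
  (forall x, enorm (x - x0) <= 2 * r -> 0 <= om x <= 4 * r /\ u x = f x0 * prof a k m (om x)) ->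
  (forall v, dot D v = f x0 * dot av v) -> enorm av <= A ->
  let Phi := fun x y : 'rV[R]_n => (1 + dot av (x - x0) / 2 + (1 + dot av (y - x0) / 2)) / 2
    + M * (enorm (x - x0) ^+ 2 + enorm (y - x0) ^+ 2 + tau ^+ 2) `^ ((1 + a) / 2) in
  om x <= 2 * enorm (x - x0) ->
  enorm (x - x0) < r -> enorm (y - x0) < r -> 0 < om x - om y - enorm (x - y) * Phi x y ->
  0 < rho -> (forall h k, enorm h < rho -> enorm k < rho ->
     om (x + h) - om (y + k) - enorm (x + h - (y + k)) * Phi (x + h) (y + k)
     <= om x - om y - enorm (x - y) * Phi x y) -> False.
Proof.
move=> os a01 x0r A1 FA fD CE NE r01 Ar ME mE kE /andP[t0 t1] omE Dav avA Phi om2 xr yr Z0 rho0 Zm.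
have nn : 0 <= n%:R :> R by [].
have [N01 M0 m0 k0 [kW mk /andP[ra ra1] Mr]] := sharp_params0 a01 r01 nn CE NE ME mE kE.
have [a0 a1] := andP a01; have [r0 r1] := andP r01; have [N0 N1] := andP N01.
have W0 : 0 < 4 * r by rewrite mulr_gt0.
have Bx x' : enorm (x' - x0) <= 2 * r -> eball 0 1 x'.
  move=> x'r; rewrite /eball /= subr0 -(subrK x0 x'); apply: le_lt_trans (enormD _ _) _; clear -x'r W0 r01 NE A1 x0r; lra.
have xr2 : enorm (x - x0) <= 2 * r by clear -xr t1 t0 kE; lra.
have yr2 : enorm (y - x0) <= 2 * r by clear -yr t1 t0; lra.
have f00 : 0 < f x0 by apply: (os_gt0 os); apply: Bx; rewrite subrr enorm0; clear -W0; lra.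
set X := x - x0; set Y := y - x0.
pose q := enorm X ^+ 2 + enorm Y ^+ 2 + tau ^+ 2.
have q0 : 0 < q by rewrite /q; have := exprn_gt0 2 t0; have := sqr_ge0 (enorm X); have := sqr_ge0 (enorm Y); clear; lra.
pose rq := Num.sqrt q; have rq0 : 0 < rq by rewrite sqrtr_gt0.
have qE : q = rq ^+ 2 by rewrite sqr_sqrtr // ltW.
have rq2 : rq <= 2 * r.
  rewrite -(@ler_pXn2r _ 2) ?nnegrE ?(ltW rq0) //; last by rewrite mulr_ge0 // ltW.
  rewrite -qE /q exprMn.
  have sq b : 0 <= b -> b <= r -> b ^+ 2 <= r ^+ 2 by move=> *; rewrite lerXn2r ?nnegrE // ltW.
  have := sq _ (enorm_ge0 X) (ltW xr); have := sq _ (enorm_ge0 Y) (ltW yr).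
  have := sq _ (ltW t0) t1; have := sqr_ge0 r; clear; lra.
pose b := (1 + a) / 2; have b01 : 0 < b <= 1 by apply/andP; split; rewrite /b; move: a0 a1; clear; lra.
have powq : q `^ b = rq * rq `^ a by rewrite qE powR_half_sqr // ltW.
have rqa : 0 < rq `^ a by rewrite powR_gt0.
pose E := M * rq `^ a / rq.
have E0 : 0 < E by rewrite divr_gt0 // mulr_gt0.
have Erq : E * rq = M * rq `^ a by rewrite /E divfK // gt_eqF.
have Eq : E * q = M * q `^ b by rewrite powq qE expr2 mulrA Erq; ring.
have rqra : rq `^ a <= 2 * r `^ a.
  apply: (@le_trans _ _ ((2 * r) `^ a)); last by apply: powR_scale => //; [clear; lra|exact: ltW].
  by apply: powR_mono; rewrite // (ltW rq0).
have EqN : E * q <= 4 * N.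
  rewrite Eq powq -Mr.
  have : M * (rq * rq `^ a) <= M * (2 * r * (2 * r `^ a)).
    by rewrite ler_pM2l //; apply: ler_pM => //; exact: ltW.
  clear; lra.
have A2 : A * r <= N / 4.
  have : A * r <= A ^+ 2 * r by rewrite ler_pM2r // expr2 ler_peMl // (le_trans ler01).
  by move: Ar; clear; lra.
have Arq : 4 * A * rq <= 2 * N.
  have : A * rq <= A * (2 * r) by rewrite ler_wpM2l // (le_trans ler01).
  by move: A2; clear; lra.
pose c := Phi x y.
have cE : c = (1 + dot av X / 2 + (1 + dot av Y / 2)) / 2 + E * q by rewrite Eq.
pose g1 := 4^-1 *: av + ((1 + a) * E) *: X; pose g2 := 4^-1 *: av + ((1 + a) * E) *: Y.
pose s := enorm (x - y).
have XY : X - Y = x - y by rewrite /X /Y opprB addrA subrK.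
have s0 : 0 < s.
  apply: enorm_gt0; apply/eqP => xy; move: Z0; rewrite xy enorm0 (subr0_eq xy).
  by rewrite subrr mul0r subr0 ltxx.
pose px := (c / s) *: (x - y) + s *: g1; pose py := (c / s) *: (x - y) - s *: g2.
have qXY : enorm X ^+ 2 + enorm Y ^+ 2 <= q by rewrite /q lerDl sqr_ge0.
have := @sharp_vectors R n X Y av s c E q A a rq g1 g2 px py.
rewrite XY => SV; have {SV} := SV erefl s0 a01 avA (ltW E0) (ltW rq0) qE qXY.
have Aq1 : 4 * A * rq <= 1 by move: Arq N1; clear; lra.
have Eq16 : E * q <= 1 / 16 by move: EqN N1; clear; lra.
move=> /(_ Aq1 Eq16 cE erefl erefl erefl erefl)[Xq Yq s2 c1 [Py1 PxPy]].
have c12 : 1 / 2 <= c by move: c1; rewrite ler_norml => /andP[+ _]; move: Aq1 Eq16 A1 rq0; clear; lra.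
have c0 : 0 < c by move: c12; clear; lra.
have ZE : om x - om y = om x - om y - s * c + s * c by rewrite subrK.
have sc : s / 2 <= s * c by rewrite ler_pM2l // -div1r.
have omd : s / 2 <= om x - om y by move: Z0 sc; rewrite -/s -/c; clear; lra.
have [/andP[ox0 ox1] uxE] := omE x xr2; have [/andP[oy0 oy1] uyE] := omE y yr2.
have oxp : 0 < om x by move: omd oy0 s0; clear; lra.
have PhiT h k' : Phi (x + h) (y + k') <= c + dot g1 h + dot g2 k' + E * (enorm h ^+ 2 + enorm k' ^+ 2).
  have := @weight_expand R n x0 av x y a M tau a01 M0 q0 h k'.
  have T : E = M * q `^ b / q by rewrite -Eq mulfK ?gt_eqF.
  by rewrite /c /g1 /g2 T.
pose B (w : R) := f x0 * prof a k m w.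
have [|rho' rho'0 /and4P[h1 h3 h4 _]] :=
  @pos_lower _ [:: rho; r - enorm (x - x0); r - enorm (y - x0)].
  by rewrite /= rho0 !subr_gt0 xr yr.
have nbr x' h : enorm h < rho' -> rho' <= r - enorm (x' - x0) -> enorm (x' + h - x0) <= 2 * r.
  move=> hh hr; rewrite addrAC; apply: le_trans (enormD _ _) _; move: hh hr r0; clear; lra.
have pB w : 0 < w -> peano_at B w (f x0 * prof1 a k m w) (f x0 * prof2 a k m w).
  by move=> w0; apply: peano_scale => //; exact: prof_peano.
have oxW : 0 <= om x <= 4 * r by rewrite ox0.
have oyW : 0 <= om y <= 4 * r by rewrite oy0.
have b1x0 : 0 < prof1 a k m (om x) := lt_le_trans oxp (prof1_ge a01 m0 mk oxW).
have := @two_point_max R n F u f Du os x y om Phi B (f x0 * prof1 a k m (om x))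
  (f x0 * prof2 a k m (om x)) (f x0 * prof1 a k m (om y)) (f x0 * prof2 a k m (om y)) (f x0) (4 * r)
  c E rho' g1 g2 (Bx x xr2) (Bx y yr2) f00 rho'0 c0.
move=> /(_ ltac:(by rewrite /B prof0 mulr0)) H.
have {H} H := H _ _ (fun h hr => omE _ (nbr x h hr h3)) (fun h hr => omE _ (nbr y h hr h4)) _ _ (pB _ oxp)
  _ erefl (fun h k' _ _ => PhiT h k')
  (fun h k' hr kr => Zm h k' (lt_le_trans hr h1) (lt_le_trans kr h1)) Z0.
have {H} [||||| H0 H1] := H.
- move=> w1 w2 i1 i2; rewrite /B ler_pM2l //; exact: (prof_mono a01 m0 mk).
- by move=> w ww; rewrite /B -mulrA mulrC [leRHS]mulrC ler_pM2r // mulrC; exact: (prof_ge_sq a01 m0 mk).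
- by move: om2 xr r0; clear; lra.
- by rewrite mulr_gt0.
- move=> oyp; split; last exact: pB.
  by rewrite mulr_gt0 // (lt_le_trans oyp) // (prof1_ge a01 m0 mk oyW).
have rq4 : rq <= 1 / 4 by move: rq2 r1; clear; lra.
have rq1 : rq <= rq `^ a by apply: ger1_powR => //; rewrite rq0 /=; move: rq4; clear; lra.
have AM : A ^+ 2 <= M / 4.
  have : 4 * A ^+ 2 <= M.
    rewrite -(ler_pM2r r0); apply: (le_trans Ar); rewrite -Mr mulrA.
    by rewrite ler_piMr // mulr_ge0 // ltW.
  clear; lra.
have A2A : A <= A ^+ 2 by rewrite expr2 ler_peMl // (le_trans ler01).
have F0 : 0 <= F.
  have Bx' := Bx x xr2; exact: le_trans (ltW (os_gt0 os Bx')) (os_le os Bx').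
have Arqa : A * rq `^ a <= E * rq / 4.
  by rewrite Erq mulrAC ler_pM2r // (le_trans A2A).
have [fy fxy] := @sharp_f R n F A rq (rq `^ a) (f x0) E q s f x0 D av x y f00 erefl FA (le_trans ler01 A1)
  (ltW rqa) (ltW rq0) Dav F0 (fun x' y' => fD rq x' y' rq4) Xq Yq erefl Arqa qE.
have AE : A ^+ 2 * rq <= E * rq / 4.
  have A20 : 0 <= A ^+ 2 := sqr_ge0 A.
  by rewrite Erq [leRHS]mulrAC; apply: ler_pM => //; exact: ltW.
have lvb : `|dot av Y| <= A * rq.
  by apply: le_trans (dot_norm _ _) _; apply: ler_pM; rewrite ?enorm_ge0.
have dvb : `|dot av (x - y)| <= A * s.
  by apply: le_trans (dot_norm _ _) _; rewrite ler_wpM2r // ltW.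
have A10 : 4 * A * rq <= 1 / 10 by move: Arq N1; clear; lra.
have [Py2 PyG GxGy PP] := @gamma_arith R A rq E q s c _ _ _ (enorm px ^+ 2) (enorm py) (f x / f x0) (f y / f x0)
  s0 E0 rq0 qE A1 A10 Eq16 AE c1 lvb dvb erefl (enorm_ge0 _) Py1 PxPy fy fxy.
have Eq0 : 0 <= E * q by rewrite mulr_ge0 // ltW.
(* At a zero the slope bound says |py|^2 <= f y / f x0, which contradicts the positive excess
   directly. *)
have [oyp|oyn] := ltP 0 (om y); last first.
  have oyz : om y = 0 by apply/eqP; rewrite eq_le oyn oy0.
  have := H0 oyz; rewrite mulrC -ler_pdivlMr // -/px -/py -/s => H2.
  have : 0 < E * q by rewrite mulr_gt0.
  move: H2 PyG; rewrite /py; clear; lra.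
have {H0} := H1 oyp; rewrite -/s -/px -/py => HT.
have oyx : 0 < om y <= om x by rewrite oyp /=; move: omd s0; clear; lra.
pose hx := prof_h a k m (om x); pose hy := prof_h a k m (om y).
have /andP[hx0 hxk] := prof_h_bounds a01 m0 kW mk oxW.
have HD := prof_h_diff a01 m0 kW mk oyx ox1.
pose V := om x `^ a / om x.
have V0 : 0 <= m * a * V by rewrite !mulr_ge0 ?invr_ge0 ?powR_ge0 // ltW.
have hd : m * a * V / 2 * s <= hy - hx.
  apply: le_trans HD; rewrite -mulrA [2^-1 * s]mulrC ler_wpM2l //; exact: omd.
have dB : s / 2 <= prof1 a k m (om x) - prof1 a k m (om y).
  have oyx' : 0 <= om y <= om x by rewrite oy0; have /andP[] := oyx.
  exact: le_trans omd (prof1_mono a01 m0 mk oyx' ox1).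
have b1x := prof1_le a01 m0 kW mk oxW; have b1y := prof1_le a01 m0 kW mk oyW.
have gx := prof1_ge a01 m0 mk oxW; have gy := prof1_ge a01 m0 mk oyW.
have := @sharp_arith1 R s n%:R E (E * q) (E * rq) A (m * a * V / 2) (om x) (om y)
  (prof1 a k m (om x)) (prof1 a k m (om y)) hx hy (enorm px ^+ 2) (enorm py ^+ 2)
  (f x / f x0) (f y / f x0) s0 Eq0.
rewrite gx gy b1x b1y mulr_ge0 ?(ltW E0) ?(ltW rq0) // => /(_ isT oyx dB isT isT PyG GxGy PP hx0 hd) SA.
have {SA} := SA _ Py2; rewrite divr_ge0 // => /(_ isT) SA.
have r1' : r <= 1 by move: r1; clear; lra.
have rqr : 0 < rq <= 2 * r by rewrite rq0.
have oxr : 0 < om x <= 4 * r by rewrite oxp.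
have [E0' KV CV] := @sharp_params R a A r N C M m k n%:R q rq E (om x) a01 A1 r0 nn CE NE Ar
  r1' ME mE kE rqr erefl oxr (le_trans om2 (ler_wpM2l (ler0n R 2) Xq)).
have {}SA : E * q / (32 * om x ^+ 2) + m * a * V / 2 / 2 <=
    25 * (E * rq) / om x + hx * (2 * A + 20 * (E * rq)) + 4 * n%:R * E.
  apply: SA; rewrite -(prof2E a01 m0 kW mk oxW) -(prof2E a01 m0 kW mk oyW).
  have e1 P1 fz B1 B2 : 0 < B1 -> (fz / f x0 - B2 * P1) / B1 = (fz - f x0 * B2 * P1) / (f x0 * B1) :> R.
    by move=> B0; field; rewrite !gt_eqF.
  rewrite !e1 //; last exact: lt_le_trans oyp gy.
apply: (@sharp_arith2 R n%:R E q rq (om x) V C hx A k m a nn E0 qE oxp CE) => //.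
- rewrite [q * E]mulrC; move: SA; clear; lra.
- by apply: addr_ge0; apply: mulr_ge0 => //; [exact: le_trans A1|apply: mulr_ge0; exact: ltW].
Qed.

End SharpMax.

(** * Cubic growth from the two-point estimate *)

Section SharpGrowth.
Context {R : realType} {n : nat}.
Implicit Types (x y z h k g : 'rV[R]_n).

Lemma cont_dot x0 av x : {for x, continuous (fun y : 'rV[R]_n => dot av (y - x0))}.
Proof.
apply: (@cont_lip _ _ _ _ 1 (enorm av)) => // y _.
have -> : dot av (y - x0) - dot av (x - x0) = dot av (y - x).
  by rewrite -dotNr -dotDr opprB addrA subrK.
exact: dot_norm.
Qed.

Lemma cont_weight (av x0 : 'rV[R]_n) (M tau b : R) (p : 'rV[R]_n * 'rV[R]_n) : 0 < tau ->
  {for p, continuous (fun q : 'rV[R]_n * 'rV[R]_n =>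
    (1 + dot av (q.1 - x0) / 2 + (1 + dot av (q.2 - x0) / 2)) / 2
    + M * (enorm (q.1 - x0) ^+ 2 + enorm (q.2 - x0) ^+ 2 + tau ^+ 2) `^ b)}.
Proof.
move=> t0.
have cl x : {for x, continuous (fun y : 'rV[R]_n => 1 + dot av (y - x0) / 2)}.
  apply: cont_add; first exact: cont_cst.
  by apply: cont_mul; [exact: cont_dot|exact: cont_cst].
have cq x : {for x, continuous (fun y : 'rV[R]_n => enorm (y - x0) ^+ 2)}.
  by apply: (@cont_mul R _ (fun y => enorm (y - x0))); exact: cont_enormB.
apply: cont_add.
  apply: cont_mul; last exact: cont_cst.
  apply: cont_add; first exact: (@cont_fst R _ _ (fun y => 1 + dot av (y - x0) / 2) p (cl _)).
  exact: (@cont_snd R _ _ (fun y => 1 + dot av (y - x0) / 2) p (cl _)).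
apply: cont_mul; first exact: cont_cst.
apply: (@cont_comp R _ _ (fun q : 'rV[R]_n * 'rV[R]_n => enorm (q.1 - x0) ^+ 2 + enorm (q.2 - x0) ^+ 2 + tau ^+ 2)
  (fun t : R => t `^ b)).
  apply: cont_add; last exact: cont_cst.
  apply: cont_add; first exact: (@cont_fst R _ _ (fun y => enorm (y - x0) ^+ 2) p (cq _)).
  exact: (@cont_snd R _ _ (fun y => enorm (y - x0) ^+ 2) p (cq _)).
have q0 : 0 < enorm (p.1 - x0) ^+ 2 + enorm (p.2 - x0) ^+ 2 + tau ^+ 2.
  by rewrite ltr_wpDl ?addr_ge0 ?sqr_ge0 // exprn_gt0.
by have := @is_derive1_powR R b _ q0; exact: is_derive_cont.
Qed.

(** The estimate om x - om y <= |x - y| Phi x y is used only for y = x0, where it reads om x <= s +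
    K s^2 with s = |x - x0|; substitution into [prof] gives the cubic bound. *)
Lemma sharp_growth (F fm a : R) : (0 < n)%N -> 0 < fm -> 0 < a <= 1 -> 0 <= F ->
  exists C0 r : R, [/\ 0 <= C0, 0 < r <= 1 / 8 & forall (u f : 'rV[R]_n -> R) Du (x0 D : 'rV[R]_n),
    osol F u f Du -> enorm x0 < 1 / 2 -> u x0 = 0 -> fm <= f x0 -> enorm D <= F ->
    (forall rho x y, rho <= 1 / 4 -> enorm (x - x0) <= rho -> enorm (y - x0) <= rho ->
       `|f x - f y - dot D (x - y)| <= F * enorm (x - y) * rho `^ a) ->
    forall x, enorm (x - x0) <= r -> u x <= f x0 / 2 * enorm (x - x0) ^+ 2 + C0 * enorm (x - x0) ^+ 3].
Proof.
move=> n0 fm0 a01 F0; have [a0 a1] := andP a01.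
have nn : 0 <= n%:R :> R by [].
pose A := F / fm + 1; have A1 : 1 <= A by rewrite /A lerDr divr_ge0 // ltW.
pose C : R := sharpC n%:R; pose N := a / (48 * C).
have C0 : 0 < C by rewrite /C /sharpC mulr_gt0 //; lra.
have C1 : 1 <= C by rewrite /C /sharpC; lra.
have N0 : 0 < N by rewrite divr_gt0 // mulr_gt0.
have N1 : N <= 1 by rewrite ler_pdivrMr ?mulr_gt0 //; clear -C1 a01; lra.
have e01 : 0 < N / 4 <= 1 by apply/andP; split; lra.
have [r1 /andP[r10 r11] Hlip] := @lip_sharp_univ R n F fm (N / 4) n0 fm0 e01.
have A20 : 0 < 4 * A ^+ 2 by rewrite mulr_gt0 // exprn_gt0 //; lra.
have [r [r0 rr1 Ar]] : exists r : R, [/\ 0 < r, 2 * r <= r1 & 4 * A ^+ 2 * r <= N].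
  exists (Num.min (r1 / 2) (N / (4 * A ^+ 2))); split.
  - by rewrite lt_min; apply/andP; split; apply: divr_gt0.
  - have : Num.min (r1 / 2) (N / (4 * A ^+ 2)) <= r1 / 2 by rewrite ge_min lexx.
    by clear; lra.
  - by rewrite mulrC -ler_pdivlMr // ge_min lexx orbT.
have r01 : 0 < r <= 1 / 16 by apply/andP; split; clear -rr1 r0 r11; lra.
pose M := N / (r * r `^ a); pose m := C * M / a; pose k := 12 * m * r `^ a.
have [N01 M0 m0 k0 [kW mk /andP[ra ra1] Mr]] :=
  @sharp_params0 R a r N C M m k n%:R a01 r01 nn erefl erefl erefl erefl erefl.
pose K := A + 2 * M; have K0 : 0 <= K by rewrite /K; clear -M0 C0 A1; lra.
have K30 : 0 <= 3 * K / 2 + 3 * k by clear -K0 k0; lra.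
exists (F * (3 * K / 2 + 3 * k)), (Num.min r (1 / (K + 1))).
have K1 : 0 < K + 1 by clear -K0; lra.
split; first exact: mulr_ge0.
  rewrite lt_min r0 divr_gt0 //= ge_min; apply/orP; left; clear -r01; lra.
move=> u f Du x0 D os x0r ux0 fm1 DF fD x; rewrite le_min => /andP[xr xK].
have xr2 : enorm (x - x0) <= 2 * r by clear -xr r01; lra.
set s := enorm (x - x0) in xr xK xr2 *.
have [s0|s0] := leP s 0.
  have sE : s = 0 by apply/eqP; rewrite eq_le s0 enorm_ge0.
  have -> : x = x0 by apply/eqP; rewrite -subr_eq0; apply/eqP; exact: enorm_eq0.
  by rewrite ux0 sE !expr0n /= !mulr0 addr0.
have f00 : 0 < f x0 by clear -fm1 ux0 fm0 n0; lra.
pose av := (f x0)^-1 *: D.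
have FA : F <= A * f x0.
  have : F <= A * fm by rewrite /A mulrDl mul1r divfK ?gt_eqF //; clear -fm0; lra.
  by move=> /le_trans; apply; rewrite ler_wpM2l //; clear -A1; lra.
have avA : enorm av <= A.
  by rewrite /av enormZ gtr0_norm ?invr_gt0 // mulrC ler_pdivrMr // (le_trans DF).
have Dav v : dot D v = f x0 * dot av v by rewrite /av dotZl mulrA mulfV ?gt_eqF // mul1r.
have lipw : lip_ball (ww u) x0 (2 * r) (Num.sqrt ((1 + N / 4) * f x0)).
  by move=> x' y' h1 h2; apply: (Hlip u f Du os x0 x0r ux0 fm1); [apply: le_trans rr1|apply: le_trans rr1].
have [om [om0 omE omL]] := om_exists os a01 x0r ux0 r01 N01 m0 kW mk lipw.
have xx0 : enorm (x0 - x0) <= 2 * r by rewrite subrr enorm0 mulr_ge0 // ltW.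
have om2 x' : enorm (x' - x0) <= 2 * r -> om x' <= 2 * enorm (x' - x0).
  move=> h; have := omL x' x0 h xx0; rewrite om0 subr0 => /le_trans; apply.
  by rewrite ler_wpM2r ?enorm_ge0 //; clear -N1; lra.
have st : 0 < s <= r by rewrite s0.
(* The regularization [tau] is tied to the point being estimated: with tau = s the weight is smooth,
   and at (x, x0) its power part is still of order s^(1+a). *)
pose Phi := fun x y : 'rV[R]_n => (1 + dot av (x - x0) / 2 + (1 + dot av (y - x0) / 2)) / 2
    + M * (enorm (x - x0) ^+ 2 + enorm (y - x0) ^+ 2 + s ^+ 2) `^ ((1 + a) / 2).
have Z0 x' y' : cball x0 r x' -> cball x0 r y' -> om x' - om y' - enorm (x' - y') * Phi x' y' <= 0.
  move=> x'r y'r; rewrite leNgt; apply/negP => Zp.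
  have := @interior_max R n x0 r om Phi r0.
  case.
  - move=> z zr; apply: (@cont_lip _ _ _ _ r (1 + N / 8)) => // y yz.
    have yr : enorm (y - x0) <= 2 * r.
      have := enorm_triangle z y x0; have zr' : enorm (z - x0) <= r := zr; clear -zr' yz; lra.
    have zr2 : enorm (z - x0) <= 2 * r by have zr' : enorm (z - x0) <= r := zr; clear -zr' st; lra.
    rewrite ler_norml omL // andbT lerNl opprB enormB; exact: omL.
  - by move=> p _ _; exact: cont_weight.
  (* On the sphere the power part is at least [N]. The linear part is at least 1 - N / 8, so the
     weight exceeds the Lipschitz constant 1 + N / 8. *)
  - move=> z y zr yr bd; have zr' : enorm (z - x0) <= r := zr; have yr' : enorm (y - x0) <= r := yr.
    rewrite subr_le0; apply: (@le_trans _ _ ((1 + N / 8) * enorm (z - y))).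
      by apply: omL; move: zr' yr' r0; clear; lra.
    rewrite mulrC ler_wpM2l ?enorm_ge0 // /Phi.
    have avb w : enorm (w - x0) <= r -> - (N / 4) <= dot av (w - x0).
      move=> wr; have : `|dot av (w - x0)| <= A * r.
        by apply: le_trans (dot_norm _ _) _; apply: ler_pM; rewrite ?enorm_ge0.
      have : A * r <= A ^+ 2 * r by rewrite ler_pM2r // expr2 ler_peMl //; clear -A1; lra.
      by rewrite ler_norml => h /andP[h1 _]; move: h h1 Ar; clear; lra.
    have : N <= M * (enorm (z - x0) ^+ 2 + enorm (y - x0) ^+ 2 + s ^+ 2) `^ ((1 + a) / 2).
      rewrite -[leLHS]Mr ler_pM2l // -powR_half_sqr ?(ltW r0) //.
      apply: ge0_ler_powR; rewrite ?nnegrE ?sqr_ge0 ?addr_ge0 ?sqr_ge0 //; first by clear -a01; lra.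
      have := sqr_ge0 s; have := sqr_ge0 (enorm (z - x0)); have := sqr_ge0 (enorm (y - x0)).
      by case: bd => ->; clear; lra.
    have := avb z zr'; have := avb y yr'; move: N0; clear; lra.
  - by exists x', y'.
  move=> z [y [zr yr Zzy Zm]].
  have [|rho rho0 /and3P[h1 h2 _]] := @pos_lower _ [:: r - enorm (z - x0); r - enorm (y - x0)].
    by rewrite /= !subr_gt0 zr yr.
  have zr2 : enorm (z - x0) <= 2 * r by move: zr r0; clear; lra.
  apply: (@sharp_max R n F u f Du x0 D av a A r N C M m k s om z y rho os a01 x0r A1 FA fD
    erefl erefl r01 Ar erefl erefl erefl st omE Dav avA (om2 z zr2) zr yr Zzy rho0).
  move=> h k' hr kr; apply: Zm; rewrite /cball /=.
    rewrite addrAC; apply: le_trans (enormD _ _) _; move: h1 hr; clear; lra.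
  rewrite addrAC; apply: le_trans (enormD _ _) _; move: h2 kr; clear; lra.
have oms : om x <= s + K * s ^+ 2.
  have x0c : cball x0 r x0 by rewrite /cball /= subrr enorm0 ltW.
  have := Z0 x x0 xr x0c; rewrite om0 subr0 subr_le0 => /le_trans; apply.
  rewrite /Phi subrr enorm0 expr0n /= addr0 dot0r mul0r addr0 -/s.
  have avs : dot av (x - x0) <= A * s by apply: le_trans (dot_le _ _) _; rewrite ler_wpM2r // ltW.
  have sa : s `^ a <= 1.
    by apply: le_trans ra1; apply: powR_mono; rewrite // (ltW s0).
  have p2 : (s ^+ 2 + s ^+ 2) `^ ((1 + a) / 2) <= 2 * s.
    have -> : s ^+ 2 + s ^+ 2 = 2 * s ^+ 2 by ring.
    apply: le_trans (powR_scale _ _ (sqr_ge0 s)) _; first by apply/andP; split; move: a0 a1; clear; lra.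
      by rewrite ler1n.
    by rewrite powR_half_sqr ?(ltW s0) // ler_pM2l // ler_piMr // ltW.
  have := ler_wpM2l (ltW M0) p2 => p3.
  have : s * ((1 + dot av (x - x0) / 2 + 1) / 2 + M * (s ^+ 2 + s ^+ 2) `^ ((1 + a) / 2))
     <= s * (1 + K * s).
    by rewrite ler_pM2l // /K; have := mulr_ge0 (le_trans ler01 A1) (ltW s0); clear -p3 avs; lra.
  by rewrite (_ : s + K * s ^+ 2 = s * (1 + K * s)) //; ring.
have [ox uE] := omE x xr2; have [ox0 _] := andP ox.
have ox2 : om x <= 2 * s := om2 x xr2.
have Bb := prof_le k a01 m0 ox0.
have o3 : om x ^+ 3 <= 8 * s ^+ 3.
  by rewrite (_ : 8 * s ^+ 3 = (2 * s) ^+ 3); [rewrite lerXn2r ?nnegrE // mulr_ge0 // ltW|rewrite exprMn; ring].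
have o2 : om x ^+ 2 <= s ^+ 2 + 3 * K * s ^+ 3.
  have Ks : K * s <= 1.
    move: xK; rewrite ler_pdivlMr // => h; have : K * s <= s * (K + 1) by clear -ox2 ox0; lra.
    clear -h; lra.
  have e1 : om x ^+ 2 <= (s + K * s ^+ 2) ^+ 2.
    by rewrite lerXn2r ?nnegrE // (le_trans ox0).
  have e2 : 0 <= K * s ^+ 3 by rewrite mulr_ge0 // exprn_ge0 // ltW.
  have : K * s ^+ 3 * (K * s) <= K * s ^+ 3 by rewrite ler_piMr.
  move: e1; clear; lra.
have kx : k / 3 * om x ^+ 3 <= k / 3 * (8 * s ^+ 3) by rewrite ler_wpM2l // divr_ge0.
have s3 : 0 <= s ^+ 3 by rewrite exprn_ge0 // ltW.
have ks3 := mulr_ge0 k0 s3.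
have BB : prof a k m (om x) <= s ^+ 2 / 2 + (3 * K / 2 + 3 * k) * s ^+ 3.
  by move: Bb o2 kx ks3; clear; lra.
rewrite uE; apply: (le_trans (ler_wpM2l (ltW f00) BB)).
have Bx0 : eball 0 1 x0 by rewrite /eball /= subr0; clear -x0r; lra.
have fF : f x0 <= F by exact: (os_le os Bx0).
have : f x0 * ((3 * K / 2 + 3 * k) * s ^+ 3) <= F * ((3 * K / 2 + 3 * k) * s ^+ 3).
  by rewrite ler_wpM2r // mulr_ge0.
clear; lra.
Qed.

End SharpGrowth.

(** * Sliding comparison *)

Section SlideArith.
Context {R : realType}.

(** The one-dimensional solution with a cubic correction, which pays for second-order shifts of the
    distance and for the cubic error in the growth of [u]. *)
Definition gpos (la K t : R) : R := la / 2 * Num.max t 0 ^+ 2 + K * Num.max t 0 ^+ 3.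

(** An upper expansion survives the jump of the second derivative at 0: the larger one-sided
    coefficient [la / 2] is kept also where D <= 0. *)
Lemma gpos_expand (la K D t : R) : 0 <= la -> 0 <= K ->
  gpos la K (D + t) - gpos la K D <=
  (la * Num.max D 0 + 3 * K * Num.max D 0 ^+ 2) * t + (la / 2 + 3 * K * Num.max D 0) * t ^+ 2
  + K * `|t| ^+ 3.
Proof.
move=> la0 K0; rewrite /gpos; have t0 := normr_ge0 t.
have t2 : `|t| ^+ 2 = t ^+ 2 by rewrite real_normK ?num_real.
have t3 : t ^+ 3 <= `|t| ^+ 3 by apply: le_trans (ler_norm _) _; rewrite normrX.
have K3 := ler_wpM2l K0 t3.
have Kt : 0 <= K * `|t| ^+ 3 by rewrite mulr_ge0 // exprn_ge0.
have lt2 : 0 <= la * t ^+ 2 by rewrite mulr_ge0 ?sqr_ge0.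
have [D0|D0] := leP D 0; have [Dt|Dt] := leP (D + t) 0.
- by rewrite !expr0n /= !mulr0 !addr0 subrr mul0r add0r; lra.
- have h : 0 <= D + t <= `|t| by rewrite (ltW Dt) /=; have := ler_norm t; lra.
  have [h1 h2] := andP h.
  have e2 : (D + t) ^+ 2 <= `|t| ^+ 2 by rewrite lerXn2r ?nnegrE.
  have e3 : (D + t) ^+ 3 <= `|t| ^+ 3 by rewrite lerXn2r ?nnegrE.
  have := ler_wpM2l la0 e2; have := ler_wpM2l K0 e3; rewrite t2 !expr0n /= !mulr0 !addr0 subr0 mul0r add0r.
  lra.
- rewrite !expr0n /= !mulr0 addr0 sub0r.
  have [v v0 ->] : exists2 v, 0 <= v & t = - D - v by exists (- (D + t)); [lra|ring].
  have -> : `|- D - v| = D + v by rewrite ler0_norm; [ring|lra].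
  have K1 : 0 <= K * (2 * D ^+ 3 + 6 * (D ^+ 2 * v) + 6 * (D * v ^+ 2) + v ^+ 3).
    by rewrite mulr_ge0 // !addr_ge0 ?exprn_ge0 // mulr_ge0 // ?mulr_ge0 ?exprn_ge0 // ltW.
  have := mulr_ge0 la0 (sqr_ge0 v); move: K1; clear; lra.
- have -> : la / 2 * (D + t) ^+ 2 + K * (D + t) ^+ 3 - (la / 2 * D ^+ 2 + K * D ^+ 3) =
    (la * D + 3 * K * D ^+ 2) * t + (la / 2 + 3 * K * D) * t ^+ 2 + K * t ^+ 3 by field.
  by rewrite lerD2l.
Qed.

(** Boundary points well inside the touching set, r <= 5 p. There kap r^2 p and F r p^2 are
    multiples of kap p^3 and F p^3, and [D] stays above 19/20 of [p]; the coefficients of [K]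
    collect these errors. *)
Lemma slide_up (f0 F C kap K la p r D tau : R) : 0 < f0 -> f0 <= F -> 0 <= C -> 0 <= kap -> 0 < r ->
  r <= 5 * p -> 50 * kap * r <= 1 -> la = f0 - 2 * F * r -> 0 <= la ->
  K = 36 * F * kap + 90 * F + 16 * C ->
  p - kap * r ^+ 2 / 2 <= D -> tau = p + kap / 8 * r ^+ 2 ->
  (f0 + 4 * F * r) / 2 * tau ^+ 2 + C * tau ^+ 3 <= la / 2 * D ^+ 2 + K * D ^+ 3.
Proof.
move=> f00 fF C0 k0 r0 rp kr laE la0 KE Dp tE.
have p0 : 0 < p by lra.
have F0 : 0 < F by lra.
have kr2 : 10 * (kap * r ^+ 2) <= p.
  have : 50 * kap * r * r <= 1 * r by rewrite ler_pM2r.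
  lra.
have kr0 : 0 <= kap * r ^+ 2 by rewrite mulr_ge0 ?sqr_ge0.
have D1 : 19 / 20 * p <= D by lra.
have r2 : r ^+ 2 <= 25 * p ^+ 2.
  have : r ^+ 2 <= (5 * p) ^+ 2 by rewrite lerXn2r ?nnegrE ?mulr_ge0 // ltW.
  by rewrite exprMn; lra.
have p20 : 0 <= p ^+ 2 := sqr_ge0 p.
have p30 : 0 <= p ^+ 3 by rewrite exprn_ge0 // ltW.
have krp : kap * r ^+ 2 * p <= 25 * (kap * p ^+ 3).
  have := ler_wpM2r (ltW p0) (ler_wpM2l k0 r2); lra.
have D2 : p ^+ 2 - 25 * (kap * p ^+ 3) <= D ^+ 2.
  have : (p - kap * r ^+ 2 / 2) ^+ 2 <= D ^+ 2 by rewrite lerXn2r ?nnegrE //; clear -D1 kr0 kr2; lra.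
  have := sqr_ge0 (kap * r ^+ 2); clear -krp; lra.
have D3 : p ^+ 3 / 2 <= D ^+ 3.
  have : (19 / 20 * p) ^+ 3 <= D ^+ 3 by rewrite lerXn2r ?nnegrE //; clear -D1 p0; lra.
  by rewrite exprMn; clear -p30; lra.
have t0 : 0 <= tau by rewrite tE; clear -kr0 kr2; lra.
have t1 : tau <= 2 * p by rewrite tE; clear -kr0 kr2; lra.
have t2 : tau ^+ 2 <= p ^+ 2 + 10 * (kap * p ^+ 3).
  have : 0 <= kap * r ^+ 2 * (p - kap * r ^+ 2) by rewrite mulr_ge0 //; clear -kr0 kr2; lra.
  have := mulr_ge0 k0 p30; move: krp; rewrite tE; clear; lra.
have t2' : tau ^+ 2 <= 4 * p ^+ 2.
  have : tau ^+ 2 <= (2 * p) ^+ 2 by rewrite lerXn2r ?nnegrE //; clear -t1 t0; lra.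
  by rewrite exprMn; clear; lra.
have t3 : tau ^+ 3 <= 8 * p ^+ 3.
  have : tau ^+ 3 <= (2 * p) ^+ 3 by rewrite lerXn2r ?nnegrE //; clear -t1 t0; lra.
  by rewrite exprMn; clear; lra.
have K0 : 0 <= K by rewrite KE !addr_ge0 // !mulr_ge0 // ltW.
have a1 : f0 * tau ^+ 2 <= f0 * p ^+ 2 + 10 * (F * (kap * p ^+ 3)).
  have := ler_wpM2l (ltW f00) t2; have : f0 * (kap * p ^+ 3) <= F * (kap * p ^+ 3).
    by rewrite ler_wpM2r // mulr_ge0.
  clear; lra.
have a2 : F * r * tau ^+ 2 <= 20 * (F * p ^+ 3).
  have : F * r * tau ^+ 2 <= F * (5 * p) * (4 * p ^+ 2).
    by apply: ler_pM; rewrite ?sqr_ge0 ?mulr_ge0 ?ler_pM2l // ltW.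
  clear; lra.
have a3 := ler_wpM2l C0 t3.
have a4 : la * (p ^+ 2 - 25 * (kap * p ^+ 3)) <= la * D ^+ 2 by rewrite ler_wpM2l.
have laF : la <= F by rewrite laE; have := mulr_gt0 F0 r0; clear -fF; lra.
have a5 : la * (kap * p ^+ 3) <= F * (kap * p ^+ 3).
  by apply: ler_wpM2r laF; exact: mulr_ge0.
have a6 : F * r * p ^+ 2 <= 5 * (F * p ^+ 3).
  have : F * r * p ^+ 2 <= F * (5 * p) * p ^+ 2 by rewrite ler_wpM2r // ler_pM2l.
  clear; lra.
have a7 := ler_wpM2l K0 D3.
have a8 : la * p ^+ 2 = f0 * p ^+ 2 - 2 * (F * r * p ^+ 2) by rewrite laE; ring.
move: a1 a2 a3 a4 a5 a6 a7 a8; rewrite KE.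
have := mulr_ge0 (ltW F0) p30; have := mulr_ge0 (ltW F0) (mulr_ge0 k0 p30); have := mulr_ge0 C0 p30.
clear; lra.
Qed.

(** Boundary points near the tangent plane, where the perturbation has raised [D]. The deficit 6 F r
    tau^2 / 2 is at most 3 F r^2 tau / 2, and kap = 12 F / fm makes the gain la kap r^2 tau / 4
    cover it. *)
Lemma slide_low (f0 fm F C kap K la p r D tau : R) : 0 < fm -> 0 < F -> 0 <= C -> 0 < r ->
  kap = 12 * F / fm -> fm / 2 <= la -> la = f0 - 2 * F * r -> C <= K -> 0 < tau <= r / 2 ->
  tau + kap * r ^+ 2 / 4 <= D ->
  (f0 + 4 * F * r) / 2 * tau ^+ 2 + C * tau ^+ 3 <= la / 2 * D ^+ 2 + K * D ^+ 3.
Proof.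
move=> fm0 F0 C0 r0 kE la1 laE CK /andP[t0 t1] Dt.
have k0 : 0 < kap by rewrite kE divr_gt0 // mulr_gt0.
have kr0 : 0 <= kap * r ^+ 2 by rewrite mulr_ge0 ?sqr_ge0 // ltW.
have la0 : 0 <= la by lra.
have D0 : tau <= D by lra.
have D3 : C * tau ^+ 3 <= K * D ^+ 3.
  by apply: ler_pM => //; [rewrite exprn_ge0 // ltW|rewrite lerXn2r ?nnegrE //; clear -kr0 Dt t0; lra].
have D2 : tau ^+ 2 + kap * r ^+ 2 * tau / 2 <= D ^+ 2.
  have : (tau + kap * r ^+ 2 / 4) ^+ 2 <= D ^+ 2 by rewrite lerXn2r ?nnegrE //; clear -kr0 Dt t0; lra.
  have := sqr_ge0 (kap * r ^+ 2); lra.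
have a1 := ler_wpM2l la0 D2.
have r2t : 0 <= r ^+ 2 * tau by rewrite mulr_ge0 ?sqr_ge0 // ltW.
have a2 : 6 * F * (r ^+ 2 * tau) <= la * kap * (r ^+ 2 * tau).
  rewrite ler_wpM2r //; have : fm / 2 * kap <= la * kap by rewrite ler_pM2r.
  have : fm / 2 * kap = 6 * F by rewrite kE; field; rewrite gt_eqF.
  lra.
have a3 : F * r * tau * tau <= F * r * tau * (r / 2) by rewrite ler_wpM2l // !mulr_ge0 // ltW.
have a4 : la * tau ^+ 2 = f0 * tau ^+ 2 - 2 * (F * r * tau * tau) by rewrite laE; ring.
move: a1 a2 a3 a4 D3; clear; lra.
Qed.

(** [la] lies 2 F r below f0, while fx is at least f0 - F r; the remaining F r absorbs the error of
    l2. The terms linear in [D] have the wrong sign as soon as la (H - 2 kap n) >= 6 K, which holds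
    because la >= fm / 2. *)
Lemma slide_interior (f0 fm F K kap la r D fx H n l2 c : R) : 0 < fm -> 0 <= K -> 0 < r <= 1 -> 0 <= D <= 3 * r ->
  fm / 2 <= la -> la = f0 - 2 * F * r -> 0 < f0 <= F -> f0 - F * r <= fx -> 0 <= l2 <= 1 + c * r ^+ 2 -> 0 <= c ->
  c * r * (F + 18 * K) < F -> 2 * kap * n + 12 * K / fm < H ->
  fx <= (la * D + 3 * K * D ^+ 2) * (- H + 2 * kap * n) + (la + 6 * K * D) * l2 -> False.
Proof.
move=> fm0 K0 /andP[r0 r1] /andP[D0 D1] la1 laE /andP[f00 f0F] fxb /andP[l20 l21] c0 cr HH T.
have F0 : 0 < F by lra.
have la0 : 0 <= la by lra.
have g0 : 0 <= la + 6 * K * D by rewrite addr_ge0 // !mulr_ge0.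
have a1 : (la + 6 * K * D) * l2 <= (la + 6 * K * D) * (1 + c * r ^+ 2) by rewrite ler_wpM2l.
have Fr : 0 < F * r by rewrite mulr_gt0.
have KD : K * D <= K * 3.
  by rewrite ler_wpM2l //; clear -D1 r1; lra.
have cr0 : 0 <= c * r ^+ 2 by rewrite mulr_ge0 ?sqr_ge0.
have a2 : (la + 6 * K * D) * (c * r ^+ 2) < F * r.
  apply: (@le_lt_trans _ _ ((F + 18 * K) * (c * r ^+ 2))); first by rewrite ler_wpM2r //; clear -KD Fr f0F f00 laE la1; lra.
  have : c * r * (F + 18 * K) * r < F * r by rewrite ltr_pM2r.
  clear; lra.
have KD2 : 0 <= K * D ^+ 2 by rewrite mulr_ge0 ?sqr_ge0.
have a3 : 12 * K <= fm * (H - 2 * kap * n).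
  have : 12 * K / fm <= H - 2 * kap * n by clear -HH; lra.
  by move=> h; rewrite [leRHS]mulrC -ler_pdivrMr.
have Hp : 0 <= H - 2 * kap * n by have : 0 <= 12 * K / fm by [rewrite divr_ge0 ?mulr_ge0 // ltW]; clear -HH; lra.
have a4 : 6 * K <= la * (H - 2 * kap * n).
  have : fm / 2 * (H - 2 * kap * n) <= la * (H - 2 * kap * n) by rewrite ler_wpM2r.
  clear -a3; lra.
have a5 := ler_wpM2r D0 a4.
have a6 := mulr_ge0 KD2 Hp.
move: T a1 a2 a5 a6 fxb Fr; rewrite laE; clear; lra.
Qed.

End SlideArith.

Section Tproj.
Context {R : realType} {n : nat}.
Implicit Types (x y z h k : 'rV[R]_n).
(** For a unit vector [e], the orthogonal projection onto its complement. *)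
Definition tproj (e : 'rV[R]_n) : 'M[R]_n := 1%:M - e^T *m e.

Lemma qf_tproj e h : qf (tproj e) h = enorm h ^+ 2 - dot e h ^+ 2.
Proof. by rewrite qfDM qf1 mul1r -[- (e^T *m e)]scaleN1r qfZM qf_outer mulN1r. Qed.

Lemma mul_tproj e h : h *m tproj e = h - dot e h *: e.
Proof.
rewrite mulmxBr mulmx1 mulmxA [h *m e^T]mx11_scalar mul_scalar_mx -dot_mulmx.
by rewrite (dotC h).
Qed.

Lemma tr_tproj e : enorm e = 1 -> \tr (tproj e) = n%:R - 1.
Proof. by move=> e1; rewrite linearB /= mxtrace1 tr_outer e1 expr1n. Qed.

Lemma tproj_tr e : (tproj e)^T = tproj e.
Proof. by rewrite linearB /= trmx1 trmx_mul trmxK. Qed.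

End Tproj.

(** Sliding comparison: [D] is a perturbation of the signed distance whose second fundamental form is
    that of the touching set, shifted by [kap]; if the mean curvature exceeds the bound, [gpos (D h)]
    is a supersolution lying above [u] on the boundary of a small ball. *)
Lemma sliding (R : realType) (n : nat) (F : R) (u f : 'rV[R]_n -> R) Du (fm Cg rg : R)
    (z e : 'rV[R]_n) (S0 : 'M[R]_n) :
  osol F u f Du ->
  0 < fm -> (forall x, eball 0 1 x -> fm <= f x) -> 0 <= Cg -> 0 < rg ->
  (forall x0, enorm x0 < 1 / 2 -> u x0 = 0 -> forall x, enorm (x - x0) <= rg ->
     u x <= f x0 / 2 * enorm (x - x0) ^+ 2 + Cg * enorm (x - x0) ^+ 3) ->
  enorm z < 1 / 2 -> enorm e = 1 -> e *m S0 = 0 -> S0^T = S0 ->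
  (forall eps : R, 0 < eps -> exists2 d : R, 0 < d & forall h, enorm h < d -> 0 < u (z + h) ->
     - eps * enorm h ^+ 2 < dot e h - qf S0 h / 2) ->
  (forall d : R, 0 < d -> exists2 h, enorm h < d & 0 < u (z + h)) ->
  forall kap, kap = 12 * F / fm ->
  \tr S0 <= 2 * kap * n%:R + 12 * (36 * F * kap + 90 * F + 16 * Cg) / fm.
Proof.
move=> os fm0 fmf Cg0 rg0 grow zr e1 eS ST HPE cl kap kapE.
pose K := 36 * F * kap + 90 * F + 16 * Cg.
rewrite -/K leNgt; apply/negP => HH.
have Bz : eball 0 1 z by rewrite /eball /= subr0; lra.
have f00 : 0 < f z := os_gt0 os Bz; have fF := os_le os Bz; have fmz := fmf z Bz.
have F0 : 0 < F by lra.
have k0 : 0 < kap by rewrite kapE divr_gt0 // mulr_gt0.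
have K0 : 0 < K.
  rewrite /K; have := mulr_gt0 F0 k0; move: F0 Cg0; clear; lra.
have CK : Cg <= K by rewrite /K; have := mulr_gt0 F0 k0; move: F0 Cg0; clear; lra.
have [c c0 Hc] := qf_bound S0.
have qS h : `|qf S0 h| <= c * enorm h ^+ 2 by rewrite expr2 mulrA; exact: Hc.
have nS h : enorm (h *m S0) <= c * enorm h.
  have [->|/enorm_gt0 h0] := eqVneq (h *m S0) 0; first by rewrite enorm0 mulr_ge0 ?enorm_ge0.
  rewrite -(ler_pM2r h0) -expr2 enorm_sqr; apply: le_trans (ler_norm _) _.
  by apply: le_trans (Hc _ _) _; rewrite mulrAC.
have hSe h : dot (h *m S0) e = 0 by rewrite dot_mul_tr ST eS dot0r.
(* Points up to distance 4 r are used below, where this error is at most 16 kap r^2 / 128 = kap r^2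
   / 8. *)
have eps0 : 0 < kap / 128 by rewrite divr_gt0.
have [dE dE0 HE] := HPE _ eps0.
pose c2 := (2 * kap + c) ^+ 2; have c20 : 0 <= c2 := sqr_ge0 _.
have cp : 0 < c + 1 by rewrite ltr_wpDl.
have c2p : 0 < c2 + 1 by rewrite ltr_wpDl.
have FK : 0 < F + 18 * K by move: F0 K0; clear; lra.
have c2K : 0 < (c2 + 1) * (F + 18 * K) by rewrite mulr_gt0 // ltr_wpDl.
have [r r0 rall] : exists2 r : R, 0 < r & all (fun t => r <= t) [:: (1 / 2 - enorm z) / 8; rg / 8;
    1; (50 * kap)^-1; (50 * (c + 1))^-1; dE / 8; fm / (4 * F); F / (2 * ((c2 + 1) * (F + 18 * K)))].
  apply: pos_lower; rewrite /= !divr_gt0 ?subr_gt0 ?ltr01 ?invr_gt0 ?mulr_gt0 //.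
move: rall => /= /and5P[rz rrg r1 rk /and5P[rc rE rF rc2 _]].
have {}rk : 50 * kap * r <= 1.
  by rewrite mulrC -ler_pdivlMr ?mulr_gt0 // div1r.
have {}rc : 50 * c * r <= 1.
  have : 50 * (c + 1) * r <= 1 by rewrite mulrC -ler_pdivlMr ?mulr_gt0 ?ltr_wpDl // div1r.
  move: r0; clear; lra.
have {}rF : 4 * F * r <= fm by rewrite mulrC -ler_pdivlMr // mulr_gt0.
have {}rc2 : c2 * r * (F + 18 * K) < F.
  have : r * (2 * ((c2 + 1) * (F + 18 * K))) <= F by rewrite -ler_pdivlMr // mulr_gt0.
  have : 0 < r * (F + 18 * K) by rewrite mulr_gt0.
  have : 0 <= c2 * (r * (F + 18 * K)) := mulr_ge0 c20 (ltW (mulr_gt0 r0 FK)).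
  clear; lra.
(* Second-order model of minus the signed distance; [e] points into the touching set. *)
pose P h := dot e h - qf S0 h / 2.
have PB h : enorm h <= 4 * r -> `|P h - dot e h| <= enorm h / 20.
  move=> hr; have h0 := enorm_ge0 h; rewrite (_ : P h - dot e h = - (qf S0 h / 2)); last by rewrite /P; ring.
  rewrite normrN normrM [`|2^-1|]gtr0_norm ?invr_gt0 // ler_pdivrMr //.
  apply: (le_trans (qS h)); rewrite expr2 mulrA.
  have : c * enorm h <= c * (4 * r) by rewrite ler_wpM2l.
  have e3 : c * enorm h <= 1 / 10 -> c * enorm h * enorm h <= 1 / 10 * enorm h.
    by move=> ?; rewrite ler_wpM2r.
  move=> e4; apply: (le_trans (e3 _)); [move: e4 rc|move: h0]; clear; lra.
have dB h : `|dot e h| <= enorm h by apply: le_trans (dot_norm _ _) _; rewrite e1 mul1r.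
have B4 h : enorm h <= 4 * r -> enorm (z + h) < 1 / 2.
  by move=> hr; apply: le_lt_trans (enormD _ _) _; move: rz hr r0; clear; lra.
have inB (x : 'rV[R]_n) : enorm x < 1 / 2 -> eball 0 1 x by rewrite /eball /= subr0; clear; lra.
have fz h : enorm h <= 4 * r -> `|f (z + h) - f z| <= F * enorm h.
  move=> hr; have := os_lip os (inB _ (B4 h hr)) Bz.
  by rewrite addrBK.
have ubound h : enorm h <= r -> 0 < u (z + h) ->
    - (kap / 128 * r ^+ 2) < P h /\
    u (z + h) <= (f z + 4 * F * r) / 2 * (P h + kap / 8 * r ^+ 2) ^+ 2
       + Cg * (P h + kap / 8 * r ^+ 2) ^+ 3.
  move=> hr up; have h0 := enorm_ge0 h.
  have h4 : enorm h <= 4 * r by move: hr r0; clear; lra.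
  have Pl : - (kap / 128 * r ^+ 2) < P h.
    apply: le_lt_trans (HE h _ up); last by move: hr rE r0 dE0; clear; lra.
    rewrite mulNr lerN2 ler_pM2l //; by rewrite lerXn2r ?nnegrE // ltW.
  split => //; set tau := P h + _.
  have kr0 : 0 < kap * r ^+ 2 by rewrite mulr_gt0 // exprn_gt0.
  have t0 : 0 < tau by rewrite /tau; move: Pl kr0; clear; lra.
  have kr1 : kap * r ^+ 2 <= r / 50.
    by rewrite expr2 mulrA; have := ler_wpM2r (ltW r0) rk; clear; lra.
  have t1 : tau <= 2 * r.
    have := PB h h4; have := dB h; rewrite !ler_norml => /andP[_ p1] /andP[_ p2].
    by rewrite /tau; move: p1 p2 kr1 hr r0; clear; lra.
  (* Move back along the normal until the model equals - kap r^2 / 8, just outside the touching set.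
     As [S0] annihilates [e], the model changes by exactly [tau], so [u] vanishes at z + k and the
     cubic growth is applied from there at distance [tau]. *)
  pose k := h - tau *: e.
  have kn : enorm k <= 4 * r.
    apply: le_trans (enormD _ _) _; rewrite enormN enormZ e1 mulr1 gtr0_norm //.
    by move: hr t1 r0; clear; lra.
  have Pk : P k = - (kap / 8 * r ^+ 2).
    rewrite /P /k qfD -[- (tau *: e)]scaleNr qfZ /qf eS dot0l mulr0 addr0 ST dotDr !dotZr.
    by rewrite -enorm_sqr e1 expr1n mulmxDr dotDl hSe addr0 mulr0 addr0 /tau /P /qf; field.
  have uk : u (z + k) = 0.
    apply/eqP; rewrite eq_le (os_ge0 os (inB _ (B4 k kn))) andbT leNgt; apply/negP => uk.
    have := HE k _ uk; rewrite -/(P k) Pk => H.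
    have {}H := H ltac:(by move: kn rE r0 dE0; clear; lra).
    have : enorm k ^+ 2 <= (4 * r) ^+ 2 by rewrite lerXn2r ?nnegrE ?enorm_ge0 // mulr_ge0 // ltW.
    rewrite exprMn -(ler_pM2l eps0); move: H; clear; lra.
  have xk : z + h - (z + k) = tau *: e.
    by rewrite /k opprD addrACA subrr add0r opprB addrCA subrr addr0.
  have xkn : enorm (z + h - (z + k)) = tau by rewrite xk enormZ e1 mulr1 gtr0_norm.
  have := grow (z + k) (B4 k kn) uk (z + h); rewrite xkn => G.
  have {}G := G ltac:(by move: t1 rrg r0; clear; lra).
  apply: (le_trans G); rewrite lerD2r ler_wpM2r ?sqr_ge0 // ler_wpM2r ?invr_ge0 //.
  have := fz k kn; rewrite ler_norml => /andP[_ H].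
  have := ler_wpM2l (ltW F0) kn; move: H; clear; lra.
(* The perturbation is negative at the centre, making [D] negative there, and positive on the
   tangential part of the sphere of radius [r], where the touching set alone gives no room. *)
pose D h := P h + kap * (enorm h ^+ 2 - dot e h ^+ 2 - r ^+ 2 / 2).
pose la := f z - 2 * F * r.
have la1 : fm / 2 <= la by rewrite /la; move: rF fmz; clear; lra.
have la0 : 0 <= la by move: la1 fm0; clear; lra.
pose G h := gpos la K (D h).
pose l h := e - h *m S0 + (2 * kap) *: (h - dot e h *: e).
pose S := kap *: tproj e - 2^-1 *: S0.
have DE h k : D (h + k) = D h + (dot (l h) k + qf S k).
  have -> : D (h + k) = dot e (h + k) - qf S0 (h + k) / 2 + kap * (qf (tproj e) (h + k) - r ^+ 2 / 2).
    by rewrite qf_tproj.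
  have -> : D h = dot e h - qf S0 h / 2 + kap * (qf (tproj e) h - r ^+ 2 / 2) by rewrite qf_tproj.
  rewrite !qfD ST tproj_tr (mulmxDr h S0) (mulmxDr h (tproj e)) mul_tproj /l /S (qfDM (kap *: _)) qfZM -[- (2^-1 *: S0)]scaleNr qfZM.
  by rewrite !dotDl !dotNl !dotZl !dotDl !dotNl !dotZl dotDr; field.
have lnorm h : enorm h <= r -> enorm (l h) ^+ 2 <= 1 + c2 * r ^+ 2.
  move=> hr; set v := (2 * kap) *: (h - dot e h *: e) - h *m S0.
  have -> : l h = e + v by rewrite /l /v [_ *: _ - _]addrC addrA.
  have ev : dot e v = 0.
    rewrite /v dotDr dotNr dotZr dotDr dotNr dotZr -enorm_sqr e1 expr1n mulr1 subrr mulr0 sub0r.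
    by rewrite (dotC e) hSe oppr0.
  rewrite enormD_sqr ev mulr0 addr0 e1 expr1n lerD2l -exprMn lerXn2r ?nnegrE ?enorm_ge0 //.
    by rewrite mulr_ge0 ?addr_ge0 ?mulr_ge0 // ltW.
  have hp : enorm (h - dot e h *: e) <= enorm h.
    rewrite -(@ler_pXn2r _ 2) ?nnegrE ?enorm_ge0 //.
    rewrite enormD_sqr dotNr dotZr enormN enormZ e1 mulr1 real_normK ?num_real // (dotC h e).
    by have := sqr_ge0 (dot e h); clear; lra.
  apply: le_trans (enormD _ _) _; rewrite enormN enormZ gtr0_norm ?mulr_gt0 //.
  rewrite (mulrDl (2 * kap)); apply: lerD; last by apply: (le_trans (nS h)); rewrite ler_wpM2l.
  by rewrite ler_pM2l ?mulr_gt0 // (le_trans hp).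
have cD h : exists2 C : R, 0 <= C & forall k, enorm k < 1 -> `|D (h + k) - D h| <= C * enorm k.
  have [cs cs0 Hs] := qf_bound S; exists (enorm (l h) + cs); first by rewrite addr_ge0 ?enorm_ge0.
  move=> k k1; rewrite DE addrAC subrr add0r; apply: le_trans (ler_normD _ _) _.
  rewrite mulrDl; apply: lerD; first exact: dot_norm.
  apply: (le_trans (Hs _ _)); rewrite ler_piMr ?mulr_ge0 ?enorm_ge0 //; exact: ltW.
have cG h : {for h, continuous G}.
  have cm : {for h, continuous (fun h => Num.max (D h) 0)}.
    have [C C0 HC] := cD h; apply: (@cont_lip _ _ _ _ 1 C) => // y yh.
    have := HC (y - h) yh; rewrite [h + _]addrC subrK; apply: le_trans.
    have [Dy|Dy] := leP (D y) 0; have [Dh|Dh] := leP (D h) 0; rewrite ?subrr ?normr0 // ?sub0r ?subr0 ?normrN.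
    - by rewrite gtr0_norm // distrC; apply: le_trans (ler_norm _); move: Dy; clear; lra.
    - by rewrite gtr0_norm //; apply: le_trans (ler_norm _); move: Dh; clear; lra.
  apply: cont_add; (apply: cont_mul; first exact: cont_cst).
    exact: (cont_mul cm cm).
  exact: (cont_mul cm (cont_mul cm cm)).
have uc h : enorm h <= r -> {for h, continuous (fun h => u (z + h))}.
  move=> hr; have Bh : eball 0 1 (z + h) by apply: inB; apply: B4; move: hr r0; clear; lra.
  have [rx /andP[rx0 _] [_ [C HC] _ _ _]] := osol_lipat os Bh.
  apply: (@cont_lip _ _ _ _ rx C) => // y yh; have := HC (y - h) (ltW yh).
  by rewrite addr0 -addrA [h + _]addrC subrK.
have main h : cball 0 r h -> u (z + h) - G h <= 0.
  have [|||h0 h0r hm] := @compact_max R _ (cball 0 r) (fun h : 'rV[R]_n => u (z + h) - G h).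
  - by exists 0; rewrite /cball /= subrr enorm0 ltW.
  - exact: compact_cball.
  - by move=> k; rewrite /cball /= subr0 => kr; apply: cont_sub; [exact: uc|exact: cG].
  move=> hr; apply: (le_trans (hm h hr)); rewrite leNgt; apply/negP => pos {h hr}.
  have h0r' : enorm h0 <= r by move: h0r; rewrite /cball /= subr0.
  have G0 h : 0 <= G h.
    by rewrite /G /gpos addr_ge0 ?mulr_ge0 ?divr_ge0 ?exprn_ge0 // ?le_max ?lexx ?orbT // ltW.
  have up : 0 < u (z + h0) by have := G0 h0; move: pos; clear; lra.
  have [Pl ub] := ubound h0 h0r' up.
  have h04 : enorm h0 <= 4 * r by move: h0r' r0; clear; lra.
  have Pb := PB h0 h04; have db := dB h0.
  have kr0 : 0 < kap * r ^+ 2 by rewrite mulr_gt0 // exprn_gt0.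
  have kr1 : kap * r ^+ 2 <= r / 50.
    by rewrite expr2 mulrA; have := ler_wpM2r (ltW r0) rk; clear; lra.
  have hsq : dot e h0 ^+ 2 <= enorm h0 ^+ 2.
    rewrite -[leLHS]real_normK ?num_real //; by rewrite lerXn2r ?nnegrE ?enorm_ge0.
  have [hr|hr] := ltP (enorm h0) r; last first.
    have hE : enorm h0 = r by apply/eqP; rewrite eq_le h0r' hr.
    have gD : 0 < D h0 -> G h0 = la / 2 * D h0 ^+ 2 + K * D h0 ^+ 3.
      by move=> d0; rewrite /G /gpos max_l // ltW.
    move: Pb; rewrite hE ler_norml => /andP[Pb1 Pb2].
    (* On the sphere, points at height at least r / 4 are treated by [slide_up]. Otherwise the
       tangential part of h0 has squared length at least 15 r^2 / 16, and [slide_low] applies. *)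
    have [tl|tl] := leP (r / 4) (dot e h0).
      have rp : r <= 5 * P h0 by move: Pb1 tl; clear; lra.
      have Dp : P h0 - kap * r ^+ 2 / 2 <= D h0.
        have : 0 <= kap * (enorm h0 ^+ 2 - dot e h0 ^+ 2) by rewrite mulr_ge0 ?subr_ge0 // ltW.
        by rewrite /D; clear; lra.
      have := @slide_up R (f z) F Cg kap K la (P h0) r (D h0) _ f00 fF Cg0 (ltW k0) r0 rp rk erefl la0
        erefl Dp erefl.
      have Dp0 : 0 < D h0 by move: Dp rp kr1 r0; clear; lra.
      by move: pos ub; rewrite (gD Dp0); clear; lra.
    have tl2 : - (r / 4) <= dot e h0 by move: Pl Pb2 kr1 r0; clear; lra.
    have t2 : dot e h0 ^+ 2 <= r ^+ 2 / 16.
      have : `|dot e h0| <= r / 4 by rewrite ler_norml tl2 ltW.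
      move=> H; rewrite -[leLHS]real_normK ?num_real //.
      have : `|dot e h0| ^+ 2 <= (r / 4) ^+ 2 by rewrite lerXn2r ?nnegrE // divr_ge0 // ltW.
      by rewrite exprMn exprVn; clear; lra.
    have t0 : 0 < P h0 + kap / 8 * r ^+ 2 <= r / 2.
      by apply/andP; split; move: Pl kr0 Pb2 tl kr1 r0; clear; lra.
    have Dl : P h0 + kap / 8 * r ^+ 2 + kap * r ^+ 2 / 4 <= D h0.
      have := ler_wpM2l (ltW k0) t2; rewrite /D hE; move: kr0; clear; lra.
    have := @slide_low R (f z) fm F Cg kap K la (P h0) r (D h0) _ fm0 F0 Cg0 r0 kapE la1 erefl CK t0 Dl.
    have Dp0 : 0 < D h0 by move: Dl t0 kr0 => Dl /andP[t0 _]; move: Dl t0; clear; lra.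
    by move: pos ub; rewrite (gD Dp0); clear; lra.
  have Bx : eball 0 1 (z + h0) by apply: inB; exact: B4.
  pose Dp := Num.max (D h0) 0; have Dp0 : 0 <= Dp by rewrite le_max lexx orbT.
  pose g1 := la * Dp + 3 * K * Dp ^+ 2; pose g2 := la / 2 + 3 * K * Dp.
  (* At an interior maximum [gpos la K (D h)] touches [u] from above; the small [d] takes up the
     cubic remainder of [gpos_expand]. *)
  have fx : f (z + h0) <= 2 * (g1 * \tr S + g2 * enorm (l h0) ^+ 2).
    apply: (@le_of_approx _ _ _ (2 * enorm (l h0) ^+ 2)) => d /andP[d0 d1].
    have := @touch_above_comp R n F u f Du os (z + h0) (gpos la K) (D h0) (l h0) S g1 (g2 + d) Bx up.
    have -> : 2 * (g1 * \tr S + (g2 + d) * enorm (l h0) ^+ 2) =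
       2 * (g1 * \tr S + g2 * enorm (l h0) ^+ 2) + 2 * enorm (l h0) ^+ 2 * d by ring.
    apply.
      exists (d / K); first by rewrite divr_gt0.
      move=> t; rewrite ltr_pdivlMr // => td; apply: (le_trans (gpos_expand _ _ la0 (ltW K0))).
      have := ler_wpM2r (sqr_ge0 t) (ltW td).
      have -> : `|t| ^+ 3 = `|t| * t ^+ 2 by rewrite exprS real_normK ?num_real.
      by rewrite -/Dp -/g1 -/g2; clear; lra.
    exists (r - enorm h0); first by rewrite subr_gt0.
    move=> k kr; have hk : cball 0 r (h0 + k).
      by rewrite /cball /= subr0; apply: le_trans (enormD _ _) _; move: kr; clear; lra.
    have := hm _ hk; rewrite /G DE (addrA z h0 k); clear; lra.
  have D3 : 0 <= Dp <= 3 * r.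
    rewrite Dp0 /= /Dp ge_max; apply/andP; split; last by rewrite mulr_ge0 // ltW.
    have h2 : enorm h0 ^+ 2 <= r ^+ 2 by rewrite lerXn2r ?nnegrE ?enorm_ge0 // ltW.
    have := ler_wpM2l (ltW k0) h2; have := mulr_ge0 (ltW k0) (sqr_ge0 (dot e h0)).
    move: Pb db kr1 h0r' r0; rewrite !ler_norml /D => /andP[_ q1] /andP[_ q2].
    by move: q1 q2; clear; lra.
  have trS : \tr S = kap * (n%:R - 1) - \tr S0 / 2.
    by rewrite /S linearB /= !mxtraceZ tr_tproj // (mulrC _ (\tr S0)).
  have rr1 : 0 < r <= 1 by rewrite r0.
  have ffF : 0 < f z <= F by rewrite f00.
  have fl : f z - F * r <= f (z + h0).
    have := fz h0 h04; rewrite ler_norml => /andP[H _].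
    by have := ler_wpM2l (ltW F0) h0r'; move: H; clear; lra.
  have l2 : 0 <= enorm (l h0) ^+ 2 <= 1 + c2 * r ^+ 2 by rewrite sqr_ge0 lnorm.
  apply: (@slide_interior R (f z) fm F K kap la r Dp (f (z + h0)) (\tr S0) n%:R _ c2 fm0 (ltW K0) rr1
    D3 la1 erefl ffF fl l2 c20 rc2 HH).
  apply: (le_trans fx); rewrite trS.
  have g10 : 0 <= g1 by rewrite /g1 addr_ge0 // !mulr_ge0 ?sqr_ge0 // ltW.
  have := mulr_ge0 g10 (ltW k0); rewrite /g1 /g2; clear; lra.
(* The supersolution vanishes wherever D <= 0, in particular near the centre, and forces [u] to
   vanish there, although [z] is a limit of points where [u] is positive. *)
have D0 : D 0 < 0.
  rewrite /D /P dot0r /qf mul0mx dot0l enorm0; have : 0 < kap * r ^+ 2 by rewrite mulr_gt0 // exprn_gt0.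
  by clear; rewrite expr0n /=; lra.
have [C C0 HC] := cD 0.
have [|d d0 /and4P[d1 d2 d3 _]] := @pos_lower _ [:: 1; r; - D 0 / (C + 1)].
  by rewrite /= ltr01 r0 divr_gt0 ?oppr_gt0 // ltr_wpDl.
have [h hd up] := cl d d0.
have hr : cball 0 r h by rewrite /cball /= subr0 ltW // (lt_le_trans hd).
have Dh : D h <= 0.
  have := HC h (lt_le_trans hd d1); rewrite add0r ler_norml => /andP[_ H].
  have : enorm h * (C + 1) <= - D 0.
    by rewrite -ler_pdivlMr ?ltr_wpDl //; apply: ltW; exact: lt_le_trans hd d3.
  by have := enorm_ge0 h; move: H; clear; lra.
have := main h hr; rewrite /G /gpos max_r // !expr0n /= !mulr0 addr0 subr0.
by apply/negP; rewrite -ltNge.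
Qed.

(** * Geometry of the touching set *)

Section Calculus.
Context {R : realType} {n : nat}.
Implicit Types (x y z h k v G : 'rV[R]_n) (c f : 'rV[R]_n -> R).

(** Differentiability at [z] in the Euclidean norm, with the gradient as explicit data. *)
Definition expansion c z G := forall e : R, 0 < e -> exists2 d : R, 0 < d &
  forall h, enorm h < d -> `|c (z + h) - c z - dot G h| <= e * enorm h.

Lemma diff_grad f x h : differentiable f x -> 'd f x h = dot (grad f x) h.
Proof.
move=> df; rewrite [in LHS](row_sum_delta h) linear_sum /=.
by apply: eq_bigr => i _; rewrite linearZ /= -deriveE // mxE mulrC.
Qed.

Lemma differentiable_expansion f x : differentiable f x -> expansion f x (grad f x).
Proof.
move=> df e e0; have /eqaddoP/(_ e e0) := diff_locally df.
move=> /nbhs_eball[d d0 H]; exists d => // h hd.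
have /= := H h _; rewrite /eball /= subr0 => /(_ hd) Hh.
apply: (@le_trans _ _ (e * `|h|)); last by rewrite ler_wpM2l ?norm_le_enorm // ltW.
by apply: le_trans Hh; rewrite -diff_grad // [z in f z]addrC opprD addrA.
Qed.

Lemma expansion_add c z G c' G' : expansion c z G -> expansion c' z G' ->
  expansion (fun x => c x + c' x) z (G + G').
Proof.
move=> H H' e e0; have e20 : 0 < e / 2 by rewrite divr_gt0.
have [d d0 Hd] := H _ e20; have [d' d0' Hd'] := H' _ e20.
exists (Num.min d d'); first by rewrite lt_min d0.
move=> h; rewrite lt_min => /andP[hd hd'].
rewrite dotDl (_ : _ - _ - _ = (c (z + h) - c z - dot G h) + (c' (z + h) - c' z - dot G' h)); last by ring.
apply: le_trans (ler_normD _ _) _; have := Hd h hd; have := Hd' h hd'; clear; lra.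
Qed.

Lemma expansion_scale a c z G : expansion c z G -> expansion (fun x => a * c x) z (a *: G).
Proof.
move=> H e e0; have a1 : 0 < `|a| + 1 by rewrite ltr_wpDl.
have [|d d0 Hd] := H (e / (`|a| + 1)); first by rewrite divr_gt0.
exists d => // h hd; rewrite dotZl -!mulrBr normrM.
apply: (@le_trans _ _ ((`|a| + 1) * `|c (z + h) - c z - dot G h|)); first by rewrite ler_wpM2r // lerDl.
by rewrite mulrC -ler_pdivlMr // mulrAC Hd.
Qed.

Lemma expansion_cst a z : expansion (fun=> a) z 0.
Proof. by move=> e e0; exists 1 => // h _; rewrite dot0l subrr subr0 normr0 mulr_ge0 ?enorm_ge0 // ltW. Qed.

Lemma expansion_sum (I : Type) (r : seq I) (c : I -> 'rV[R]_n -> R) z (G : I -> 'rV[R]_n) :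
  (forall i, expansion (c i) z (G i)) -> expansion (fun x => \sum_(i <- r) c i x) z (\sum_(i <- r) G i).
Proof.
move=> H; elim: r => [|i r IH].
  by rewrite big_nil (_ : (fun _ => _) = fun=> 0); [exact: expansion_cst|apply/funext => x; rewrite big_nil].
rewrite big_cons (_ : (fun _ => _) = fun x => c i x + \sum_(j <- r) c j x).
  exact: expansion_add.
by apply/funext => x; rewrite big_cons.
Qed.

Lemma expansion_sqr c z G : expansion c z G -> expansion (fun x => c x ^+ 2) z ((2 * c z) *: G).
Proof.
move=> H e e0; pose C := enorm G + 1; have C0 : 0 < C by rewrite ltr_wpDl ?enorm_ge0.
have D0 : 0 < 2 * `|c z| + C by rewrite ltr_wpDl ?mulr_ge0.
have [d1 d10 H1] := H 1 ltr01.
have [|d2 d20 H2] := H (e / (2 * (2 * `|c z| + 1))); first by rewrite divr_gt0 // mulr_gt0 // ltr_wpDl ?mulr_ge0.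
exists (Num.min d1 (Num.min d2 (e / (2 * C ^+ 2)))).
  by rewrite !lt_min d10 d20 divr_gt0 // mulr_gt0 // exprn_gt0.
move=> h; rewrite !lt_min => /and3P[hd1 hd2 hd3]; have h0 := enorm_ge0 h.
rewrite dotZl; set q := c (z + h) - c z.
have q1 : `|q| <= C * enorm h.
  rewrite -[q](subrK (dot G h)); apply: le_trans (ler_normD _ _) _.
  by have := H1 h hd1; have := dot_norm G h; rewrite -/q /C; clear; lra.
have {}H2 : (2 * `|c z| + 1) * `|q - dot G h| <= e / 2 * enorm h.
  rewrite mulrC -ler_pdivlMr ?ltr_wpDl ?mulr_ge0 //; apply: (le_trans (H2 h hd2)).
  by rewrite invfM mulrA (mulrAC (e / 2)).
rewrite (_ : _ - _ - _ = 2 * c z * (q - dot G h) + q ^+ 2); last by rewrite /q; ring.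
apply: le_trans (ler_normD _ _) _; rewrite normrX !normrM [`|2|]ger0_norm //.
have q2 : `|q| ^+ 2 <= C ^+ 2 * enorm h ^+ 2 by rewrite -exprMn lerXn2r ?nnegrE // mulr_ge0 // ltW.
have : enorm h * (2 * C ^+ 2) <= e by rewrite -ler_pdivlMr ?mulr_gt0 ?exprn_gt0 // ltW.
move=> /(ler_wpM2r h0); have := normr_ge0 (q - dot G h); move: H2 q2; clear; lra.
Qed.

Lemma expansion_unique c z G G' : expansion c z G -> expansion c z G' -> G = G'.
Proof.
move=> H H'; apply/eqP; rewrite -subr_eq0; apply/eqP; apply: enorm_eq0; apply/eqP.
rewrite eq_le enorm_ge0 andbT; apply: (@le_of_approx _ _ 0 2) => e /andP[e0 _].
have [d d0 Hd] := H e e0; have [d' d0' Hd'] := H' e e0; rewrite add0r.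
have [->|] := eqVneq (G - G') 0; first by rewrite enorm0 mulr_ge0 // ltW.
move=> /enorm_gt0 l0; set l := G - G' in l0 *.
have [t t0 /and3P[t1 t2 _]] := @pos_lower R [:: d / (2 * enorm l); d' / (2 * enorm l)]
  ltac:(by rewrite /= !divr_gt0 // mulr_gt0).
have tl : enorm (t *: l) = t * enorm l by rewrite enormZ gtr0_norm.
have tl0 : 0 < t * enorm l by rewrite mulr_gt0.
have {}t1 : t * enorm l * 2 <= d by rewrite -mulrA (mulrC _ 2) -ler_pdivlMr ?mulr_gt0.
have {}t2 : t * enorm l * 2 <= d' by rewrite -mulrA (mulrC _ 2) -ler_pdivlMr ?mulr_gt0.
have := Hd (t *: l); have := Hd' (t *: l); rewrite tl.
move=> /(_ (ltac:(by move: tl0 t2; clear; lra))) B /(_ (ltac:(by move: tl0 t1; clear; lra))) A.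
have : `|t * dot l l| <= 2 * e * (t * enorm l).
  rewrite -dotZr {1}/l dotDl dotNl.
  have -> : dot G (t *: l) - dot G' (t *: l) = (c (z + t *: l) - c z - dot G' (t *: l))
    - (c (z + t *: l) - c z - dot G (t *: l)) by ring.
  by apply: le_trans (ler_normB _ _) _; move: A B; clear; lra.
rewrite -enorm_sqr gtr0_norm ?mulr_gt0 ?exprn_gt0 //.
by rewrite (_ : t * enorm l ^+ 2 = enorm l * (t * enorm l)) ?ler_pM2r //; ring.
Qed.

Lemma is_derive_line f x h (t : R) : differentiable f (x + t *: h) ->
  is_derive t (1 : R) (fun s : R => f (x + s *: h)) (dot (grad f (x + t *: h)) h).
Proof.
move=> df.
have E : (fun s : R => s^-1 *: (f (x + (s *: (1 : R) + t) *: h) - f (x + t *: h))) =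
    (fun s : R => s^-1 *: (f (s *: h + (x + t *: h)) - f (x + t *: h))).
  apply/funext => s; congr (_ *: (f _ - _)).
  by rewrite scalerDl addrCA /GRing.scale /= mulr1.
have dv : derivable f (x + t *: h) h := diff_derivable df.
by apply: DeriveDef; [rewrite /derivable /= E|rewrite /derive /= E -diff_grad // -deriveE].
Qed.

Lemma mvt_line f x h : (forall t : R, 0 <= t <= 1 -> differentiable f (x + t *: h)) ->
  exists2 t : R, 0 <= t <= 1 & f (x + h) - f x = dot (grad f (x + t *: h)) h.
Proof.
move=> df; have dd (t : R) : 0 <= t <= 1 -> is_derive t (1 : R) (fun s : R => f (x + s *: h)) (dot (grad f (x + t *: h)) h).
  by move=> /df; exact: is_derive_line.
have [||t tI E] := @MVT_segment R (fun s : R => f (x + s *: h)) (fun t => dot (grad f (x + t *: h)) h) 0 1 ler01.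
- by move=> t /andP[]; rewrite !bnd_simp => t0 t1; apply: dd; rewrite !ltW.
- apply: derivable_within_continuous => t; rewrite in_itv /= => tI.
  by have := dd t tI; case.
exists t; first by move: tI; rewrite in_itv.
by move: E; rewrite scale1r scale0r addr0 subr0 mulr1.
Qed.

(** Rows are gradients of the partial derivatives. The matrix is symmetrized by hand where a
    symmetric form is wanted. *)
Definition hess f z : 'M[R]_n := \matrix_i grad (partial i f) z.

Lemma uniform_expansion (c : 'I_n -> 'rV[R]_n -> R) z (G : 'I_n -> 'rV[R]_n) :
  (forall i, expansion (c i) z (G i)) -> forall e : R, 0 < e -> exists2 d : R, 0 < d &
  forall i h, enorm h < d -> `|c i (z + h) - c i z - dot (G i) h| <= e * enorm h.
Proof.
move=> H e e0; have /choice[d Hd] : forall i, exists d : R, 0 < d /\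
    forall h, enorm h < d -> `|c i (z + h) - c i z - dot (G i) h| <= e * enorm h.
  by move=> i; have [d d0 Hd] := H i e e0; exists d.
have [|r r0 /allP rd] := @pos_lower R [seq d i | i <- enum 'I_n].
  by apply/allP => _ /mapP[i _ ->]; have [] := Hd i.
exists r => // i h hr; have [_] := Hd i; apply; apply: (lt_le_trans hr).
by apply: rd; rewrite map_f // mem_enum.
Qed.

(** The mean value theorem along the segment, for [f] minus its quadratic, reduces the claim to
    first-order expansions of the partial derivatives at [z]. *)
Lemma taylor2 (U : set 'rV[R]_n) f z : open U -> U z -> C2_on U f ->
  forall e : R, 0 < e -> exists2 d : R, 0 < d & forall h, enorm h < d ->
  `|f (z + h) - f z - dot (grad f z) h - qf (hess f z) h / 2| <= e * enorm h ^+ 2.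
Proof.
move=> oU Uz [C1 C2] e e0; have n1 : 0 < n%:R + 1 :> R by rewrite ltr_wpDl.
have [||d d0 Hd] := @uniform_expansion (fun i => partial i f) z (fun i => grad (partial i f) z) _ (e / (n%:R + 1)).
- by move=> i; apply: differentiable_expansion; have [] := C2 i z Uz.
- by rewrite divr_gt0.
have [d' d0' Ud] : exists2 d' : R, 0 < d' & eball z d' `<=` U by apply/nbhs_eball; exact: open_nbhs_nbhs.
exists (Num.min d d'); first by rewrite lt_min d0.
move=> h; rewrite lt_min => /andP[hd hd']; have h0 := enorm_ge0 h.
have th (t : R) : 0 <= t <= 1 -> enorm (t *: h) <= enorm h.
  by move=> /andP[t0 t1]; rewrite enormZ ger0_norm // ler_piMl.
have Ut (t : R) : 0 <= t <= 1 -> U (z + t *: h).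
  by move=> tI; apply: Ud; rewrite /eball /= addrBK (le_lt_trans (th t tI)).
pose a := dot (grad f z) h; pose b := qf (hess f z) h.
pose g (t : R) := f (z + t *: h) - t * a - t ^+ 2 / 2 * b.
have dg (t : R) : 0 <= t <= 1 -> is_derive t (1 : R) g (dot (grad f (z + t *: h)) h - a - t * b).
  move=> tI; have D := is_derive_line (proj1 (C1 _ (Ut t tI))).
  rewrite /g; apply: is_derive_eq; rewrite /GRing.scale /=; by field.
have [||t tI E] := @MVT_segment R g (fun t => dot (grad f (z + t *: h)) h - a - t * b) 0 1 ler01.
- by move=> t /andP[]; rewrite !bnd_simp => t0 t1; apply: dg; rewrite !ltW.
- apply: derivable_within_continuous => t; rewrite in_itv /= => tI.
  by have := dg t tI; case.
have {}tI : 0 <= t <= 1 by move: tI; rewrite in_itv.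
have -> : f (z + h) - f z - dot (grad f z) h - qf (hess f z) h / 2 = g 1 - g 0.
  by rewrite /g scale1r scale0r addr0 -/a -/b; field.
rewrite E subr0 mulr1.
have -> : dot (grad f (z + t *: h)) h - a - t * b =
    \sum_i (partial i f (z + t *: h) - partial i f z - dot (grad (partial i f) z) (t *: h)) * h 0 i.
  rewrite /a /b /qf dot_mul_tr (dotC h (h *m _)) /dot mulr_sumr -!sumrB; apply: eq_bigr => i _.
  rewrite !mxE !mulrBl; congr (_ - _ - _); rewrite mulrA; congr (_ * _).
  by rewrite mulr_sumr; apply: eq_bigr => j _; rewrite !mxE; ring.
apply: (le_trans (ler_norm_sum _ _ _)).
apply: (@le_trans _ _ (\sum_(i < n) e / (n%:R + 1) * enorm h ^+ 2)).
  apply: ler_sum => i _; rewrite normrM expr2 mulrA; apply: ler_pM => //; last exact: coord_le_enorm.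
  have tE : enorm (t *: h) < d := le_lt_trans (th t tI) hd.
  apply: (le_trans (Hd i _ tE)); by rewrite (ler_wpM2l (divr_ge0 (ltW e0) (ltW n1))) ?th.
rewrite sumr_const card_ord -[leLHS]mulr_natl (mulrA n%:R) ler_wpM2r ?sqr_ge0 //.
by rewrite (mulrA n%:R) ler_pdivrMr // mulrC (ler_wpM2l (ltW e0)) // lerDl.
Qed.

End Calculus.

(** * Defining functions and boundary points *)

Section Boundary.
Context {R : realType} {n : nat}.
Implicit Types (x y z h k v w : 'rV[R]_n) (E U : set 'rV[R]_n).

Lemma open_boundary_notin (T : topologicalType) (A : set T) (x : T) : open A -> boundary A x -> ~ A x.
Proof. by by move=> oA [_ niA] Ax; apply: niA; exact: open_nbhs_nbhs. Qed.

Lemma boundary_near (A : set 'rV[R]_n) x (d : R) : boundary A x -> 0 < d -> exists2 h, enorm h < d & A (x + h).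
Proof.
move=> [cA _] d0; have [|y [Ay yx]] := cA (eball x d); first by apply/nbhs_eball; exists d.
by exists (y - x) => //; rewrite addrC subrK.
Qed.

Lemma defining_zero E U phi x : open E -> C2_defining E U phi -> U x -> boundary E x -> phi x = 0.
Proof.
move=> oE [oU [C1 _] _ EU] Ux bx; apply/eqP; rewrite eq_le; apply/andP; split; last first.
  rewrite leNgt; apply/negP => p0; apply: (open_boundary_notin oE bx).
  by have [] : (E `&` U) x by rewrite EU.
rewrite leNgt; apply/negP => p0.
have c : {for x, continuous phi} := differentiable_continuous (proj1 (C1 x Ux)).
have /nbhs_eball[d d0 Hd] : nbhs x (U `&` [set y | 0 < phi y]).
  by apply: filterI; [exact: open_nbhs_nbhs|apply: (c [set t | 0 < t]); exact: lt_nbhsr].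
have [h hd Eh] := boundary_near bx d0.
have [Uh /= ph] : (U `&` [set y | 0 < phi y]) (x + h) by apply: Hd; rewrite /eball /= addrBK.
have [/= ph' _] : ([set x | phi x < 0] `&` U) (x + h) by rewrite -EU.
by have := lt_trans ph ph'; rewrite ltxx.
Qed.

Lemma first_order_sign (phi : 'rV[R]_n -> R) x v : differentiable phi x -> phi x = 0 -> 0 < dot (grad phi x) v ->
  forall d : R, 0 < d -> exists2 t : R, 0 < t < d & forall s : R, 0 < s <= t -> 0 < phi (x + s *: v) /\ phi (x - s *: v) < 0.
Proof.
move=> df p0 a0 d d0; set a := dot _ _ in a0.
have v0 : 0 < enorm v + 1 by rewrite ltr_wpDl ?enorm_ge0.
have [|r r0 Hr] := differentiable_expansion df (_ : 0 < a / (2 * (enorm v + 1))); first by rewrite divr_gt0 // mulr_gt0.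
have [t t0 /and3P[t1 t2 _]] := @pos_lower R [:: d / 2; r / (2 * (enorm v + 1))]
  ltac:(by rewrite /= !divr_gt0 // mulr_gt0).
have {}t2 : t * (enorm v + 1) * 2 <= r by rewrite -mulrA (mulrC _ 2) -ler_pdivlMr ?mulr_gt0.
exists t; first by rewrite t0; move: t1 d0; clear; lra.
move=> s /andP[s0 st].
have sv : s * enorm v < r.
  have := ler_wpM2r (enorm_ge0 v) st; move: t2 t0 r0 (mulr_gt0 t0 v0); clear; lra.
have sa : 0 < s * a by rewrite mulr_gt0.
have bnd : a / (2 * (enorm v + 1)) * (s * enorm v) <= s * a / 2.
  rewrite mulrAC ler_pdivrMr ?mulr_gt0 //; have := enorm_ge0 v; move: sa; clear => sa v0.
  have := mulr_ge0 (ltW sa) v0; move: sa; lra.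
have := Hr (s *: v); have := Hr (- (s *: v)).
rewrite enormN enormZ gtr0_norm // p0 subr0 dotNr dotZr -/a => /(_ sv) A /(_ sv) B.
move: (le_trans A bnd) (le_trans B bnd); rewrite !ler_norml => /andP[_ ?] /andP[? _].
by split; lra.
Qed.

Lemma zero_boundary E U phi x : open E -> C2_defining E U phi -> U x -> phi x = 0 -> boundary E x.
Proof.
move=> oE [oU [C1 _] g0 EU] Ux px.
split; last first.
  move=> /interior_subset Ex; have [/=] : ([set x | phi x < 0] `&` U) x by rewrite -EU.
  by rewrite px ltxx.
move=> B /nbhs_eball[d d0 dB].
have [d' d0' dU] : exists2 d' : R, 0 < d' & eball x d' `<=` U by apply/nbhs_eball; exact: open_nbhs_nbhs.
have gg : 0 < dot (grad phi x) (grad phi x).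
  by rewrite -enorm_sqr exprn_gt0 // enorm_gt0 //; apply/eqP; exact: g0.
have v0 : 0 < enorm (grad phi x) by rewrite enorm_gt0 //; apply/eqP; exact: g0.
have m0 : 0 < Num.min d d' / enorm (grad phi x) by rewrite divr_gt0 // lt_min d0.
have [t /andP[t0 td] Ht] := first_order_sign (proj1 (C1 x Ux)) px gg m0.
have [|_ neg] := Ht t; first by rewrite t0 lexx.
move: td; rewrite ltr_pdivlMr // lt_min => /andP[td td'].
have xt : x - t *: grad phi x - x = - (t *: grad phi x) by rewrite addrAC subrr add0r.
exists (x - t *: grad phi x); split; last by apply: dB; rewrite /eball /= xt enormN enormZ gtr0_norm.
have [] // : (E `&` U) (x - t *: grad phi x).
by rewrite EU; split => //; apply: dU; rewrite /eball /= xt enormN enormZ gtr0_norm.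
Qed.

Lemma enorm_normalize v : v != 0 -> enorm ((enorm v)^-1 *: v) = 1.
Proof.
move=> /enorm_gt0 v0; rewrite enormZ gtr0_norm ?invr_gt0 //; by rewrite mulVf // gt_eqF.
Qed.

Lemma dot_eq1 v w : enorm v = 1 -> enorm w = 1 -> 1 <= dot v w -> v = w.
Proof.
move=> v1 w1 vw; apply/eqP; rewrite -subr_eq0; apply/eqP; apply: enorm_eq0; apply/eqP.
rewrite -sqrf_eq0 eq_le sqr_ge0 andbT enormD_sqr enormN dotNr v1 w1 !expr1n.
by move: vw; clear; lra.
Qed.

(** If the two unit normals differed, then along minus their difference [phi] would become negative
    and [phi'] positive, placing the same point inside and outside [E]. *)
Lemma normal_unique E U phi U' phi' x : open E -> C2_defining E U phi -> C2_defining E U' phi' ->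
  U x -> U' x -> boundary E x ->
  (enorm (grad phi x))^-1 *: grad phi x = (enorm (grad phi' x))^-1 *: grad phi' x.
Proof.
move=> oE dU dU' Ux Ux' bx; have px := defining_zero oE dU Ux bx; have px' := defining_zero oE dU' Ux' bx.
have [oU [C1 _] g0 EU] := dU; have [oU' [C1' _] g0' EU'] := dU'.
have /eqP {}g0 := g0 x Ux; have /eqP {}g0' := g0' x Ux'.
set p := grad phi x in g0 *; set p' := grad phi' x in g0' *.
have s0 := enorm_gt0 g0; have s0' := enorm_gt0 g0'.
set nu := _ *: p; set nu' := _ *: p'.
have pE : p = enorm p *: nu by rewrite /nu scalerA divff ?scale1r // gt_eqF.
have pE' : p' = enorm p' *: nu' by rewrite /nu' scalerA divff ?scale1r // gt_eqF.
have n1 : enorm nu = 1 by exact: enorm_normalize.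
have n1' : enorm nu' = 1 by exact: enorm_normalize.
apply: dot_eq1 => //; rewrite leNgt; apply/negP => lt1.
have a0 : 0 < dot p (nu - nu').
  by rewrite pE dotZl mulr_gt0 // dotDr dotNr -enorm_sqr n1 expr1n subr_gt0.
have a0' : 0 < dot p' (- (nu - nu')).
  by rewrite pE' dotZl mulr_gt0 // opprB dotDr dotNr -enorm_sqr n1' expr1n subr_gt0 dotC.
have [d d0 dU1] : exists2 d : R, 0 < d & eball x d `<=` U `&` U'.
  by apply/nbhs_eball; apply: filterI; exact: open_nbhs_nbhs.
set v := nu - nu' in a0 a0'.
have [v0 v1] : 0 < enorm v + 1 /\ enorm v < enorm v + 1.
  by split; [rewrite ltr_wpDl ?enorm_ge0|rewrite ltrDl].
have m0 : 0 < d / (enorm v + 1) by rewrite divr_gt0.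
have [t /andP[t0 td] Ht] := first_order_sign (proj1 (C1 x Ux)) px a0 m0.
have [t' /andP[t0' _] Ht'] := first_order_sign (proj1 (C1' x Ux')) px' a0' m0.
pose r := Num.min t t'; have r0 : 0 < r by rewrite lt_min t0.
have [|_ neg] := Ht r; first by rewrite r0 ge_min lexx.
have [|pos' _] := Ht' r; first by rewrite r0 ge_min lexx orbT.
have [U1 U2] : (U `&` U') (x - r *: v).
  apply: dU1; rewrite /eball /= addrAC subrr add0r enormN enormZ gtr0_norm //.
  have : r < d / (enorm v + 1) by apply: le_lt_trans td; rewrite ge_min lexx.
  rewrite ltr_pdivlMr //; apply: le_lt_trans; by rewrite ler_pM2l // ltW.
have [Ex _] : (E `&` U) (x - r *: v) by rewrite EU.
have [/= neg' _] : ([set x | phi' x < 0] `&` U') (x - r *: v) by rewrite -EU'.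
by move: pos'; rewrite scalerN => /(lt_trans neg'); rewrite ltxx.
Qed.

(** The intermediate value theorem along the normal produces points of [{phi = 0}] in every tangential direction. *)
Lemma tangential_zero U (phi c : 'rV[R]_n -> R) z v G : open U -> U z -> (forall x, U x -> differentiable phi x) ->
  phi z = 0 -> grad phi z != 0 -> dot (grad phi z) v = 0 -> c z = 0 -> expansion c z G ->
  (forall e : R, 0 < e -> exists2 d : R, 0 < d & forall h, enorm h < d -> phi (z + h) = 0 -> U (z + h) ->
     `|c (z + h)| <= e * enorm h) ->
  dot G v = 0.
Proof.
move=> oU Uz df pz g0 tv cz cG Hc.
set p := grad phi z in g0 tv *; set s := enorm p; have s0 : 0 < s := enorm_gt0 g0.
pose nu := s^-1 *: p; have n1 : enorm nu = 1 by exact: enorm_normalize.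
have pn : dot p nu = s by rewrite dotZr -enorm_sqr -/s expr2 mulrA mulVf ?mul1r // gt_eqF.
pose V := enorm v + 1; have V0 : 0 < V by rewrite ltr_wpDl ?enorm_ge0.
apply/eqP; rewrite -normr_le0; apply: (@le_of_approx _ _ 0 (2 * V + enorm G)) => e /andP[e0 e1].
rewrite add0r.
have [d0 d00 Ud] : exists2 d : R, 0 < d & eball z d `<=` U by apply/nbhs_eball; exact: open_nbhs_nbhs.
have [d1 d10 H1] := Hc e e0; have [d2 d20 H2] := cG e e0.
have [|d3 d30 H3] := differentiable_expansion (df z Uz) (_ : 0 < e * s / (2 * V)).
  by rewrite divr_gt0 // mulr_gt0.
have [t t0 /and5P[t1 t2 t3 t4 _]] := @pos_lower R [:: d0 / (2 * V); d1 / (2 * V); d2 / (2 * V); d3 / (2 * V)]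
  ltac:(by rewrite /= !divr_gt0 // mulr_gt0).
have tE (d : R) : t <= d / (2 * V) -> 0 < d -> t * V < d.
  rewrite ler_pdivlMr ?mulr_gt0 // => H d_gt0; move: (mulr_gt0 t0 V0) H; clear; lra.
have kn (q : R) : `|q| <= e * t -> enorm (t *: v + q *: nu) <= t * V.
  move=> qe; apply: le_trans (enormD _ _) _; rewrite (enormZ t) (enormZ q) n1 mulr1 gtr0_norm // /V.
  have : e * t <= t by rewrite ler_piMl // ltW.
  by move: qe; clear; lra.
(* To first order this is q s, so it changes sign on |q| <= e t; its zero is a boundary candidate
   whose offset from the tangential direction is of smaller order than [t]. *)
pose g (q : R) := phi (z + (t *: v + q *: nu)).
have et0 : 0 < e * t by rewrite mulr_gt0.
have sgn (q : R) : `|q| <= e * t -> `|g q - q * s| <= e * t * s / 2.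
  move=> qe; have kq := kn q qe.
  have := H3 _ (le_lt_trans kq (tE _ t4 d30)).
  rewrite pz subr0 dotDr (dotZr t) (dotZr q) -/p tv mulr0 add0r pn => /le_trans; apply.
  apply: (@le_trans _ _ (e * s / (2 * V) * (t * V))).
    by rewrite ler_wpM2l // divr_ge0 ?mulr_ge0 // ltW.
  by rewrite le_eqVlt; apply/orP; left; apply/eqP; field; rewrite gt_eqF.
have ets : 0 < e * t * s by rewrite mulr_gt0.
have [|||q qI gq] := @IVT R g (- (e * t)) (e * t) 0.
- by move: et0; clear; lra.
- apply: continuous_in_subspaceT => q; rewrite inE /= in_itv /= => /andP[q1 q2].
  have qe : `|q| <= e * t by rewrite ler_norml q1.
  have cp : {for z + (t *: v + q *: nu), continuous phi}.
    apply: differentiable_continuous; apply: df; apply: Ud.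
    by rewrite /eball /= addrBK (le_lt_trans (kn q qe)) // tE.
  apply: (@cont_comp _ _ _ (fun q : R => z + (t *: v + q *: nu))) => //.
  apply: continuousD; first exact: cst_continuous.
  apply: continuousD; first exact: cst_continuous.
  exact: scalel_continuous.
- have := sgn (e * t); have := sgn (- (e * t)).
  rewrite normrN gtr0_norm // lexx => /(_ isT); rewrite ler_norml => /andP[_ A] /(_ isT).
  rewrite ler_norml => /andP[B _]; rewrite ge_min le_max; apply/andP; split; apply/orP; [left|right].
    by move: A ets; clear; lra.
  by move: B ets; clear; lra.
move: qI; rewrite in_itv /= => qI; have {}qI : `|q| <= e * t by rewrite ler_norml.
have kq := kn q qI; set k := t *: v + q *: nu in kq.
have A := H1 k (le_lt_trans kq (tE _ t2 d10)) gq.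
have {}A := A ltac:(by apply: Ud; rewrite /eball /= addrBK (le_lt_trans kq) // tE).
have B := H2 k (le_lt_trans kq (tE _ t3 d20)).
have ek : e * enorm k <= e * (t * V) by rewrite ler_pM2l.
have Gq : `|q * dot G nu| <= e * t * enorm G.
  by rewrite normrM; apply: ler_pM => //; have := dot_norm G nu; rewrite n1 mulr1.
rewrite -(ler_pM2l t0) -[X in X * `|_|](gtr0_norm t0) -normrM.
have -> : t * dot G v = c (z + k) - (c (z + k) - c z - dot G k) - q * dot G nu.
  by rewrite cz /k dotDr (dotZr t) (dotZr q); ring.
apply: le_trans (ler_normB _ _) _; apply: le_trans (lerD (ler_normB _ _) (lexx _)) _.
by move: A B ek Gq; clear; lra.
Qed.

End Boundary.

(** * Divergence of the normal and the second fundamental form *)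

Section Curvature.
Context {R : realType} {n : nat}.
Implicit Types (x y z h k v w e : 'rV[R]_n) (E U : set 'rV[R]_n) (M : 'M[R]_n).

Lemma expansion_near (c c' : 'rV[R]_n -> R) z G : c z = c' z -> (\forall x \near z, c x = c' x) ->
  expansion c z G -> expansion c' z G.
Proof.
move=> cz /nbhs_eball[d d0 Hd] H e e0; have [d' d0' Hd'] := H e e0.
exists (Num.min d d'); first by rewrite lt_min d0.
move=> h; rewrite lt_min => /andP[hd hd']; rewrite -cz -Hd; first exact: Hd'.
by rewrite /eball /= addrBK.
Qed.

Lemma tproj_id e : enorm e = 1 -> e *m tproj e = 0.
Proof. by move=> e1; rewrite mul_tproj -enorm_sqr e1 expr1n scale1r subrr. Qed.

Lemma tproj_idem e : enorm e = 1 -> tproj e *m tproj e = tproj e.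
Proof.
move=> e1; rewrite {2}/tproj mulmxBr mulmx1 mulmxA -[tproj e *m e^T]trmxK trmx_mul trmxK tproj_tr.
by rewrite tproj_id // trmx0 mul0mx subr0.
Qed.

Lemma qf_sandwich e M h : qf (tproj e *m M *m tproj e) h = qf M (h *m tproj e).
Proof. by rewrite /qf !mulmxA dot_mul_tr tproj_tr. Qed.

(** Only on the boundary is [nu] tied to the gradient of [phi], so only tangential derivatives can
    be compared. The normal contribution to the trace vanishes because |nu| = 1 near [z], and the
    tangential trace of the derivative of [nu] is that of the Hessian divided by |grad phi|. *)
Lemma div_normal E U phi z nu : open E -> C2_defining E U phi -> U z -> boundary E z ->
  outer_unit_normal_field E z nu ->
  forall e, e = (enorm (grad phi z))^-1 *: grad phi z ->
  div nu z = (enorm (grad phi z))^-1 * \tr (tproj e *m hess phi z *m tproj e).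
Proof.
move=> oE dU Uz bz [nu1 nuE dnu] e eE; have [oU [C1 C2] g0 EU] := dU.
have /eqP p0 := g0 z Uz; set p := grad phi z in eE p0 *; set s := enorm p in eE *.
have s0 : 0 < s := enorm_gt0 p0; have e1 : enorm e = 1 by rewrite eE; exact: enorm_normalize.
have pE : p = s *: e by rewrite eE scalerA divff ?scale1r // gt_eqF.
have nuphi x : U x -> boundary E x -> outer_unit_normal E x (nu x) ->
    nu x = (enorm (grad phi x))^-1 *: grad phi x.
  by move=> Ux bx [U' [phi' [Ux' dU' ->]]]; apply/esym/(normal_unique oE dU dU' Ux Ux' bx).
have nuz : nu z = e by rewrite eE; apply: nuphi => //; exact: (nbhs_singleton nuE).
pose c i x := nu x 0 i; pose G i := grad (c i) z.
have cG i : expansion (c i) z (G i).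
  apply: differentiable_expansion; apply: (@differentiable_comp _ _ _ _ nu (fun N : 'rV[R]_n => N 0 i)) => //.
  exact: differentiable_coord.
pose J : 'M[R]_n := \matrix_i G i.
have rowJ w : w *m J = \sum_i w 0 i *: G i.
  by rewrite mulmx_sum_row; apply: eq_bigr => i _; rewrite rowK.
have rowM w : w *m hess phi z = \sum_i w 0 i *: grad (partial i phi) z.
  by rewrite mulmx_sum_row; apply: eq_bigr => i _; rewrite rowK.
(* Up to a factor 2 this is the derivative of |nu|^2, which is constant near [z]. *)
have eJ : e *m J = 0.
  have H1 : expansion (fun x => \sum_i c i x ^+ 2) z (\sum_i (2 * c i z) *: G i).
    by apply: expansion_sum => i; exact: expansion_sqr.
  have sq x : enorm (nu x) = 1 -> \sum_i c i x ^+ 2 = 1.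
    move=> n1; rewrite -[RHS](expr1n _ 2) -n1 enorm_sqr; by apply: eq_bigr => i _; rewrite expr2.
  have H2 : expansion (fun x => \sum_i c i x ^+ 2) z 0.
    apply: (@expansion_near (fun=> 1)); last exact: expansion_cst.
      by rewrite sq // nuz.
    by apply: filterS nu1 => x /sq.
  have := expansion_unique H1 H2; rewrite (_ : \sum_i _ = 2 *: (e *m J)).
    by move=> /eqP; rewrite scaler_eq0 pnatr_eq0 => /eqP.
  by rewrite rowJ scaler_sumr; apply: eq_bigr => i _; rewrite scalerA /c nuz.
(* The function w.(s nu - grad phi) is small of higher order on the zero set of [phi]: there grad
   phi = |grad phi| nu, |grad phi| tends to [s], and w.nu vanishes at [z]. Hence its gradient has no
   tangential component. *)
have tang v w : dot e v = 0 -> dot e w = 0 -> dot (w *m (s *: J - hess phi z)) v = 0.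
  move=> ev ew.
  pose a x := \sum_i w 0 i * c i x.
  have aG : expansion a z (w *m J).
    by rewrite rowJ; apply: expansion_sum => i; exact: expansion_scale.
  have aE x : a x = dot (nu x) w by apply: eq_bigr => i _; rewrite mulrC.
  pose b x := \sum_i w 0 i * partial i phi x.
  have bE x : b x = dot (grad phi x) w by apply: eq_bigr => i _; rewrite mulrC mxE.
  have bG : expansion b z (w *m hess phi z).
    rewrite rowM; apply: expansion_sum => i; apply: expansion_scale; apply: differentiable_expansion.
    by have [] := C2 i z Uz.
  have cexp : expansion (fun x => s * a x + (- 1) * b x) z (w *m (s *: J - hess phi z)).
    rewrite mulmxBr -scalemxAr -[- (w *m hess _ _)]scaleN1r.
    by apply: expansion_add; apply: expansion_scale.
  apply: (tangential_zero oU Uz (fun x Ux => proj1 (C1 x Ux)) (defining_zero oE dU Uz bz) p0 _ _ cexp).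
  - by rewrite -/p pE dotZl ev mulr0.
  - by rewrite aE bE nuz -/p pE (dotZl s e) ew !mulr0 addr0.
  have az : a z = 0 by rewrite aE nuz ew.
  move=> eps eps0; pose C := enorm (w *m J) + 1; have C0 : 0 < C by rewrite ltr_wpDl ?enorm_ge0.
  have [d1 d10 H1] := aG 1 ltr01.
  have cq : {for z, continuous (fun x => enorm (grad phi x))}.
    by apply: (@cont_comp _ _ _ (grad phi)); [exact: (proj2 (C1 z Uz))|exact: enorm_continuous].
  have /nbhs_eball[d2 d20 H2] : nbhs z ([set x | `|s - enorm (grad phi x)| < eps / C] `&`
      [set x | boundary E x -> outer_unit_normal E x (nu x)]).
    apply: filterI => //; have /cvgrPdist_lt := cq; apply; by rewrite divr_gt0.
  exists (Num.min d1 d2); first by rewrite lt_min d10.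
  move=> h; rewrite lt_min => /andP[hd1 hd2] phih Uh.
  have [/= q nuh] := H2 (z + h) (ltac:(by rewrite /eball /= addrBK)).
  have bh := zero_boundary oE dU Uh phih.
  have gh : grad phi (z + h) = enorm (grad phi (z + h)) *: nu (z + h).
    rewrite (nuphi _ Uh bh (nuh bh)) scalerA divff ?scale1r // gt_eqF // enorm_gt0 //.
    by apply/eqP; exact: g0.
  rewrite bE gh dotZl -aE mulN1r -mulrBl normrM.
  have ah : `|a (z + h)| <= C * enorm h.
    have := H1 h hd1; rewrite az subr0 => A; rewrite -[a _](subrK (dot (w *m J) h)).
    apply: le_trans (ler_normD _ _) _; have := dot_norm (w *m J) h; rewrite /C; move: A; clear; lra.
  apply: le_trans (ler_pM _ _ (ltW q) ah) _ => //.
  by rewrite mulrA divfK // gt_eqF.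
pose T := tproj e.
have TXT : \tr (T *m (s *: J - hess phi z) *m T) = 0.
  apply: big1 => i _; rewrite -qf_delta qf_sandwich; apply: tang.
    by rewrite dotC dot_mul_tr tproj_tr tproj_id // dot0r.
  by rewrite dotC dot_mul_tr tproj_tr tproj_id // dot0r.
have divJ : div nu z = \tr J by apply: eq_bigr => i _; rewrite !mxE.
have trJ : \tr (T *m J *m T) = \tr J.
  rewrite mxtrace_mulC mulmxA tproj_idem // /T /tproj mulmxBl mul1mx linearB /= -mulmxA mxtrace_mulC.
  by rewrite eJ mul0mx linear0 subr0.
have := TXT; rewrite (mulmxBr T (s *: J)) (mulmxBl (T *m _)) linearB /= -(scalemxAr s T J) -(scalemxAl s (T *m J)) mxtraceZ trJ -divJ => /eqP.
by rewrite subr_eq0 => /eqP <-; rewrite mulrA mulVf ?mul1r // gt_eqF.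
Qed.

(** Dividing the Taylor expansion of [phi] by |grad phi| gives a model of the signed distance with
    the full Hessian. Replacing it by its tangential part [S0] is harmless, since near the boundary
    the normal component of [h] is itself quadratic in |h|. *)
Lemma touching_expansion E z nu : open E -> C2_boundary E -> boundary E z -> outer_unit_normal_field E z nu ->
  exists e (S0 : 'M[R]_n), [/\ enorm e = 1, e *m S0 = 0, S0^T = S0, \tr S0 = div nu z &
  forall eps : R, 0 < eps -> exists2 d : R, 0 < d & forall h, enorm h < d -> E (z + h) ->
     - eps * enorm h ^+ 2 < dot e h - qf S0 h / 2].
Proof.
move=> oE CE bz fnu; have [U [phi [Uz dU]]] := CE z bz.
have := div_normal oE dU Uz bz fnu erefl; have [oU C2 g0 EU] := dU.
have /eqP p0 := g0 z Uz; have := taylor2 oU Uz C2; rewrite (defining_zero oE dU Uz bz).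
move: p0; set p := grad phi z; set M := hess phi z; set s := enorm p.
move=> p0 Tay /=; have s0 : 0 < s := enorm_gt0 p0.
have [e eE] : exists e, e = s^-1 *: p by exists (s^-1 *: p).
rewrite -eE => divE; have e1 : enorm e = 1 by rewrite eE; exact: enorm_normalize.
have pE : p = s *: e by rewrite eE scalerA divff ?scale1r // gt_eqF.
pose S1 : 'M[R]_n := (s^-1 / 2) *: (M + M^T); pose T := tproj e; pose S0 := T *m S1 *m T.
have S1T : S1^T = S1 by rewrite /S1 linearZ linearD /= trmxK addrC.
have qMT h : qf M^T h = qf M h by rewrite /qf dot_mul_tr trmxK dotC.
have qS1 h : qf S1 h = s^-1 * qf M h by rewrite /S1 qfZM qfDM qMT; field; rewrite gt_eqF.
(* [phi] is negative in [E], so [e] is the outer normal, whereas the model of minus the signed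
   distance needs the inner one. *)
exists (- e), S0; split.
- by rewrite enormN.
- by rewrite /S0 !mulmxA !mulNmx tproj_id // !mul0mx oppr0.
- by rewrite /S0 !trmx_mul tproj_tr S1T mulmxA.
- rewrite divE /S0 /S1 -(scalemxAr _ T) -(scalemxAl _ (T *m _)) mxtraceZ (mulmxDr T M) (mulmxDl (T *m M)) linearD /=.
  have -> : T *m M^T *m T = (T *m M *m T)^T by rewrite !trmx_mul tproj_tr mulmxA.
  by rewrite mxtrace_tr /T; field; rewrite gt_eqF.
move=> eps eps0.
have [C0 C00 HC0] := qf_bound S0; have [C1 C10 HC1] := qf_bound S1.
pose K := C0 / 2 + C1 / 2 + eps / 2; have K0 : 0 < K by rewrite /K; move: C00 C10 eps0; clear; lra.
pose L := 5 * C1 + 1; have L0 : 0 < L by rewrite /L; move: C10; clear; lra.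
have [|d1 d10 H1] := Tay (s * eps / 2); first by rewrite divr_gt0 // mulr_gt0.
have [d2 d20 Ud] : exists2 d : R, 0 < d & eball z d `<=` U by apply/nbhs_eball; exact: open_nbhs_nbhs.
exists (Num.min d1 (Num.min d2 (eps / (K * L)))).
  by rewrite !lt_min d10 d20 divr_gt0 // mulr_gt0.
move=> h; rewrite !lt_min => /and3P[hd1 hd2 hd3] Eh; have h0 := enorm_ge0 h.
have {}hd3 : K * L * enorm h <= eps by rewrite mulrC -ler_pdivlMr ?mulr_gt0 // ltW.
have [/= phih _] : ([set x | phi x < 0] `&` U) (z + h).
  by rewrite -EU; split => //; apply: Ud; rewrite /eball /= addrBK.
set tau := dot (- e) h.
have ph : dot p h = - s * tau by rewrite pE dotZl /tau dotNl; ring.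
have t1 : `|tau| <= enorm h by apply: le_trans (dot_norm _ _) _; rewrite enormN e1 mul1r.
have H : - (eps / 2) * enorm h ^+ 2 < tau - qf S1 h / 2.
  rewrite -(ltr_pM2l s0) qS1.
  have -> : s * (tau - s^-1 * qf M h / 2) = s * tau - qf M h / 2 by field; rewrite gt_eqF.
  have := H1 h hd1; rewrite subr0 ph ler_norml => /andP[A _]; move: A phih; clear; lra.
have q0 : `|qf S0 h| <= C0 * enorm h ^+ 2 by rewrite expr2 mulrA; exact: HC0.
have q1 : `|qf S1 h| <= C1 * enorm h ^+ 2 by rewrite expr2 mulrA; exact: HC1.
have h2 := sqr_ge0 (enorm h).
(* If the normal component is large, the linear term dominates and the claim is immediate; otherwise
   it is at most K |h|^2. *)
have [tl|tl] := ltP (C0 / 2 * enorm h ^+ 2) tau.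
  move: q0; rewrite ler_norml => /andP[_ q0]; have := mulr_ge0 (ltW eps0) h2; move: tl q0; clear; lra.
have tK : `|tau| <= K * enorm h ^+ 2.
  move: q1; rewrite !ler_norml /K => /andP[q1 q1']; have := mulr_ge0 C00 h2; have := mulr_ge0 C10 h2.
  have := mulr_ge0 (ltW eps0) h2; move: H tl q1 q1'; clear; move=> *; apply/andP; split; lra.
have hT : h *m T = h + tau *: e by rewrite mul_tproj /tau dotNl scaleNr.
have hTn : enorm (h + tau *: e) <= 2 * enorm h.
  by apply: le_trans (enormD _ _) _; rewrite enormZ e1 mulr1; move: t1; clear; lra.
(* The two forms differ only by terms containing the normal component [tau], hence by order |h|
   |tau|, which is cubic in |h| here. *)
have qd : `|qf S1 h - qf S0 h| <= L * enorm h * `|tau|.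
  rewrite /S0 qf_sandwich -/T hT; set q := h + tau *: e in hTn *.
  have -> : qf S1 h = qf S1 (q + (- tau) *: e) by rewrite /q scaleNr addrK.
  rewrite (qfD _ q) S1T dotZr (qfZ (- tau)) sqrrN (mulmxDr q) dotDl -(addrA (qf S1 q)) [qf S1 q + _]addrC addrK.
  apply: le_trans (ler_normD _ _) _; rewrite (normrM (- tau)) (normrM (tau ^+ 2)) normrN normrX.
  have B1 := HC1 q e; have B2 := HC1 e e.
  have B3 : `|dot (q *m S1) e + dot (q *m S1) e| <= 4 * C1 * enorm h.
    apply: le_trans (ler_normD _ _) _; move: B1; rewrite e1 mulr1.
    have := ler_wpM2l C10 hTn; clear; lra.
  have B4 : `|tau| ^+ 2 * `|qf S1 e| <= `|tau| * (C1 * enorm h).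
    rewrite expr2 -mulrA ler_wpM2l // mulrC.
    by apply: ler_pM => //; move: B2; rewrite e1 !mulr1.
  have B5 : `|tau| * `|dot (q *m S1) e + dot (q *m S1) e| <= `|tau| * (4 * C1 * enorm h).
    by rewrite ler_wpM2l.
  have := mulr_ge0 h0 (normr_ge0 tau); rewrite /L; move: B4 B5; clear; lra.
have qe : `|qf S1 h - qf S0 h| <= eps * enorm h ^+ 2.
  apply: (le_trans qd); apply: (@le_trans _ _ (L * enorm h * (K * enorm h ^+ 2))).
    by rewrite ler_wpM2l // mulr_ge0 // ltW.
  have := ler_wpM2r h2 hd3; clear; lra.
move: qe; rewrite ler_norml => /andP[qe _]; move: qe H; clear; lra.
Qed.

End Curvature.

(** * From the hypotheses to the test inequalities *)

Section Bridge.
Context {R : realType} {n : nat}.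
Implicit Types (x y z h : 'rV[R]_n) (f u : 'rV[R]_n -> R).

Lemma eball_segment x y (r t : R) z : eball z r x -> eball z r y -> 0 <= t <= 1 -> eball z r (x + t *: (y - x)).
Proof.
rewrite /eball /= => xr yr /andP[t0 t1].
have -> : x + t *: (y - x) - z = (1 - t) *: (x - z) + t *: (y - z).
  by apply/rowP => i; rewrite !mxE; ring.
apply: le_lt_trans (enormD _ _) _; rewrite !enormZ !ger0_norm ?subr_ge0 //.
have [->|t0'] := eqVneq t 0; first by rewrite subr0 mul1r mul0r addr0.
have {}t0' : 0 < t by rewrite lt_neqAle eq_sym t0'.
have : t * enorm (y - z) < t * r by rewrite ltr_pM2l.
have : (1 - t) * enorm (x - z) <= (1 - t) * r by rewrite ler_wpM2l ?subr_ge0 // ltW.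
clear; lra.
Qed.

Lemma mvt_eball f x y (r : R) z : (forall x, eball z r x -> differentiable f x) -> eball z r x -> eball z r y ->
  exists2 t : R, 0 <= t <= 1 & f y - f x = dot (grad f (x + t *: (y - x))) (y - x).
Proof.
move=> df xr yr; have [|t tI E] := @mvt_line R n f x (y - x).
  by move=> t tI; apply: df; exact: eball_segment.
by exists t => //; rewrite -E [x + _]addrC subrK.
Qed.

(** The finite number [F] controls each supremum separately because all three are nonnegative. *)
Lemma C1alpha_bounds f (alpha : R) : (0 < n)%N -> C1alpha (eball 0 1) alpha f ->
  let F := fine (C1alpha_norm (eball 0 1) alpha f) in
  [/\ 0 <= F, forall x, eball 0 1 x -> `|f x| <= F, forall x, eball 0 1 x -> enorm (grad f x) <= F &
   forall x y, eball 0 1 x -> eball 0 1 y -> enorm (grad f x - grad f y) <= F * enorm (x - y) `^ alpha].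
Proof.
move=> n0 [_ fin]; rewrite /C1alpha_norm in fin *.
set A := ereal_sup _ in fin *; set B := ereal_sup [set (enorm (grad f x))%:E | x in _] in fin *.
set C := ereal_sup [set _ | p in _] in fin *.
have B0 : eball 0 1 (0 : 'rV[R]_n) by rewrite /eball /= subrr enorm0 ltr01.
have hA x : eball 0 1 x -> (`|f x|%:E <= A)%E by move=> xB; apply: ereal_sup_ubound; exists x.
have hB x : eball 0 1 x -> ((enorm (grad f x))%:E <= B)%E by move=> xB; apply: ereal_sup_ubound; exists x.
have hC x y : eball 0 1 x -> eball 0 1 y -> x <> y ->
    ((enorm (grad f x - grad f y) / enorm (x - y) `^ alpha)%:E <= C)%E.
  by move=> xB yB xy; apply: ereal_sup_ubound; exists (x, y).
have A0 : (0 <= A)%E by apply: le_trans (hA 0 B0); rewrite lee_fin.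
have B00 : (0 <= B)%E by apply: le_trans (hB 0 B0); rewrite lee_fin enorm_ge0.
(* An empty supremum would be -oo. In positive dimension the ball contains two distinct points, so
   the set of difference quotients is nonempty. *)
have C0 : (0 <= C)%E.
  pose w : 'rV[R]_n := (1 / 2) *: 'e_(Ordinal n0).
  have w1 : enorm w = 1 / 2 by rewrite enormZ enorm_delta mulr1 gtr0_norm // divr_gt0.
  have wB : eball 0 1 w by rewrite /eball /= subr0 w1; lra.
  apply: le_trans (hC w 0 wB B0 _); first by rewrite lee_fin divr_ge0 ?enorm_ge0 ?powR_ge0.
  by move=> w0; move: w1; rewrite w0 enorm0; lra.
have Fr : ((A + B + C)%E \is a fin_num) by rewrite ge0_fin_numE // !adde_ge0.
have FE : (fine (A + B + C))%:E = (A + B + C)%E by rewrite fineK.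
split.
- by rewrite fine_ge0 // !adde_ge0.
- move=> x xB; rewrite -lee_fin FE -addeA; apply: le_trans (hA x xB) _.
  by rewrite leeDl // adde_ge0.
- move=> x xB; rewrite -lee_fin FE addeAC; apply: le_trans (hB x xB) _.
  by rewrite leeDr // adde_ge0.
move=> x y xB yB; have [->|/eqP xy] := eqVneq x y.
  by rewrite !subrr enorm0 mulr_ge0 ?powR_ge0 // fine_ge0 // !adde_ge0.
rewrite -ler_pdivrMr; last by rewrite powR_gt0 // enorm_gt0 // subr_eq0; apply/eqP.
rewrite -lee_fin FE; apply: le_trans (hC x y xB yB xy) _.
by rewrite leeDr // adde_ge0.
Qed.

Lemma osol_of_obstacle u f (alpha : R) : (0 < n)%N -> C1alpha (eball 0 1) 1 u -> C1alpha (eball 0 1) alpha f ->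
  (forall x, eball 0 1 x -> 0 < f x) -> obstacle_solution (eball 0 1) f u ->
  osol (fine (C1alpha_norm (eball 0 1) alpha f)) u f (grad u).
Proof.
move=> n0 Cu Cf f0 [u0 ae]; set F := fine _.
have [L0 _ _ uL] := C1alpha_bounds n0 Cu; have [F0 fF gF _] := C1alpha_bounds n0 Cf.
set L := fine _ in L0 uL; rewrite -/F in F0 fF gF.
have du x : eball 0 1 x -> differentiable u x by move=> /(proj1 Cu) [].
have df x : eball 0 1 x -> differentiable f x by move=> /(proj1 Cf) [].
have {}uL x y : eball 0 1 x -> eball 0 1 y -> enorm (grad u x - grad u y) <= L * enorm (x - y).
  by move=> xB yB; rewrite -[X in L * X]powRr1 ?enorm_ge0 // uL.
split => //.
- exists L => // x y xB yB; split; last exact: uL.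
  have [t tI ->] := mvt_eball du xB yB; rewrite -dotNl -dotDl.
  apply: le_trans (dot_norm _ _) _; rewrite expr2 mulrA ler_wpM2r ?enorm_ge0 //.
  apply: (le_trans (uL _ _ (eball_segment xB yB tI) xB)); rewrite addrBK enormZ.
  by move: tI => /andP[t0 t1]; rewrite ler_wpM2l // ger0_norm // ler_piMl // enorm_ge0.
- move=> x y xB yB; have [t tI ->] := mvt_eball df yB xB.
  apply: le_trans (dot_norm _ _) _; rewrite ler_wpM2r ?enorm_ge0 // gF //.
  exact: eball_segment.
- by move=> x /fF; apply: le_trans; exact: ler_norm.
exists [set x | eball 0 1 x /\ ~ ((forall i, derivable (partial i u) x (delta_mx 0 i)) /\
    laplacian u x = f x * \1_(positivity_set (eball 0 1) u) x)].
  exact: lebesgue_null_thin.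
move=> x xB nN; have {nN}[dd lap] : (forall i, derivable (partial i u) x (delta_mx 0 i)) /\
    laplacian u x = f x * \1_(positivity_set (eball 0 1) u) x.
  by apply: contrapT => H; apply: nN.
have sumE : \sum_i partial i (partial i u) x = laplacian u x.
  by apply: eq_bigr => i _; congr (partial i _ x); apply/funext => y; rewrite mxE.
exists (fun i => partial i (partial i u) x); split.
(* [partial i u] is differentiable along e_i at [x], so [u] has a Peano expansion on this line;
   adding it at [t] and [-t] gives the second difference. *)
- move=> i e e0; pose v : 'rV[R]_n := 'e_i.
  have [r0 r00 rB] : exists2 r : R, 0 < r & eball x r `<=` eball 0 1.
    by apply/nbhs_eball; apply: open_nbhs_nbhs; split => //; exact: open_eball.
  have [|||d d0 Hd] := @peano2 R (fun t : R => u (x + t *: v)) (fun t : R => partial i u (x + t *: v)) 0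
      (partial i (partial i u) x) _ _ (e / 2) _; last 1 first.
  + exists d => // t td; have := Hd t td; have := Hd (- t); rewrite normrN => /(_ td).
    rewrite !add0r scale0r addr0 scaleNr sqrrN => A B.
    have -> : u (x + t *: 'e_i) + u (x - t *: 'e_i) - 2 * u x - partial i (partial i u) x * t ^+ 2 =
      (u (x + t *: v) - u x - partial i u x * t - partial i (partial i u) x / 2 * t ^+ 2) +
      (u (x - t *: v) - u x - partial i u x * - t - partial i (partial i u) x / 2 * t ^+ 2).
      by rewrite /v; field.
    apply: le_trans (ler_normD _ _) _; move: A B; clear; lra.
  + exists r0 => // t tr; rewrite add0r.
    have := @is_derive_line R n u x v t; rewrite dot_delta mxE; apply; apply: du; apply: rB.
    by rewrite /eball /= addrBK enormZ enorm_delta mulr1.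
  + have E : (fun s : R => s^-1 *: (partial i u (x + (s *: (1 : R) + 0) *: v) - partial i u (x + 0 *: v))) =
        (fun s : R => s^-1 *: (partial i u (s *: v + x) - partial i u x)).
      apply/funext => s; have -> : s *: (1 : R) + 0 = s by rewrite addr0 /GRing.scale /= mulr1.
      by rewrite scale0r addr0 [x + _]addrC.
    have dv := dd i.
    by apply: DeriveDef; [rewrite /derivable /= E|rewrite /derive /= E].
  + by rewrite divr_gt0.
- move=> ux; rewrite sumE lap indicE mem_set ?mulr1 //.
- rewrite sumE lap indicE; case: (_ \in _); rewrite ?mulr1 // mulr0; exact: ltW (f0 x xB).
Qed.

Lemma C1alpha_taylor f (alpha a rho : R) x0 x y : (0 < n)%N -> C1alpha (eball 0 1) alpha f -> 0 < a -> a <= alpha ->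
  enorm x0 < 1 / 2 -> rho <= 1 / 4 -> enorm (x - x0) <= rho -> enorm (y - x0) <= rho ->
  `|f x - f y - dot (grad f x0) (x - y)| <=
    fine (C1alpha_norm (eball 0 1) alpha f) * enorm (x - y) * rho `^ a.
Proof.
move=> n0 Cf a0 aal x0r r4 xr yr; have [F0 _ _ gH] := C1alpha_bounds n0 Cf.
set F := fine _ in F0 gH *.
have df z : eball 0 1 z -> differentiable f z by move=> /(proj1 Cf) [].
have inB z : enorm (z - x0) <= rho -> eball 0 1 z.
  move=> zr; rewrite /eball /= subr0 -(subrK x0 z); apply: le_lt_trans (enormD _ _) _; move: x0r r4 zr; clear; lra.
have Bx0 : eball 0 1 x0 by rewrite /eball /= subr0; move: x0r; clear; lra.
have rho0 : 0 <= rho := le_trans (enorm_ge0 _) xr.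
have [t tI ->] := mvt_eball df (inB _ yr) (inB _ xr); set k := y + _.
rewrite -dotNl -dotDl; apply: le_trans (dot_norm _ _) _.
rewrite mulrAC ler_wpM2r ?enorm_ge0 //.
have kr : enorm (k - x0) <= rho.
  have -> : k - x0 = (1 - t) *: (y - x0) + t *: (x - x0) by apply/rowP => i; rewrite !mxE; ring.
  move: tI => /andP[t0 t1]; apply: le_trans (enormD _ _) _; rewrite !enormZ !ger0_norm ?subr_ge0 //.
  have : t * enorm (x - x0) <= t * rho by rewrite ler_wpM2l.
  have : (1 - t) * enorm (y - x0) <= (1 - t) * rho by rewrite ler_wpM2l ?subr_ge0.
  clear; lra.
apply: (le_trans (gH _ _ (inB _ kr) Bx0)); rewrite ler_wpM2l //.
have [->|kn] := eqVneq (k - x0) 0.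
  by rewrite enorm0 powR0 ?powR_ge0 // gt_eqF // (lt_le_trans a0).
have {}kn := enorm_gt0 kn.
(* The distance is at most 1/4, so lowering the exponent from [alpha] to [a] only increases the
   power. *)
apply: (@le_trans _ _ (enorm (k - x0) `^ a)).
  by apply: ger_powR => //; rewrite kn /=; move: kr r4; clear; lra.
by apply: ge0_ler_powR; rewrite ?nnegrE ?enorm_ge0 // ltW.
Qed.

Lemma positivity_boundary u (z : 'rV[R]_n) : (forall x, eball 0 1 x -> 0 <= u x) ->
  (forall x, eball 0 1 x -> differentiable u x) -> eball 0 1 z ->
  boundary (positivity_set (eball 0 1) u) z -> u z = 0.
Proof.
move=> u0 du zB [_ nz]; apply/eqP; rewrite eq_le u0 // andbT leNgt; apply/negP => uz; apply: nz.
have c : {for z, continuous u} := differentiable_continuous (du z zB).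
rewrite /interior /=; apply: filterI; first by apply: open_nbhs_nbhs; split => //; exact: open_eball.
by apply: (c [set t | 0 < t]); exact: lt_nbhsr.
Qed.

End Bridge.

(** Stated for arbitrary real parameters, with their relation to [u] and [f] placed after the
    existential, so that the constant is fixed by the parameters alone and can be turned into a
    function. Parameters that no solution realizes receive the value 0. *)
Lemma curvature_bound_exists (R : realType) (n : nat) (fm alpha F : R) : exists C : R,
  (0 < n)%N -> 0 < alpha -> 0 < fm -> forall u f : 'rV[R]_n -> R,
    C1alpha (eball 0 1) 1 u ->
    C1alpha (eball 0 1) alpha f ->
    (forall x, eball 0 1 x -> 0 < f x) ->
    fm = inf [set f x | x in eball 0 1] ->
    F = fine (C1alpha_norm (eball 0 1) alpha f) ->
    obstacle_solution (eball 0 1) f u ->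
    mean_curvature_le (positivity_set (eball 0 1) u) (eball 0 (1 / 2)) C.
Proof.
have [n0|n0] := ltnP 0 n; last by exists 0.
have [al0|al0] := ltP 0 alpha; last by exists 0.
have [fm0|fm0] := ltP 0 fm; last by exists 0.
have [F0|F0] := leP 0 F; last first.
  exists 0 => _ _ _ u f _ Cf _ _ FE; have [] := C1alpha_bounds n0 Cf.
  by rewrite -FE leNgt F0.
(* The profile and the power weight need an exponent at most 1. *)
pose a := Num.min alpha 1.
have a0 : 0 < a by rewrite lt_min al0 ltr01.
have a1 : 0 < a <= 1 by rewrite a0 ge_min lexx orbT.
have aal : a <= alpha by rewrite ge_min lexx.
have [Cg [rg [Cg0 /andP[rg0 _] SG]]] := @sharp_growth R n F fm a n0 fm0 a1 F0.
(* The bound of [sliding] with its parameter [kap] written out as 12 F / fm. *)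
exists (2 * (12 * F / fm) * n%:R + 12 * (36 * F * (12 * F / fm) + 90 * F + 16 * Cg) / fm).
move=> _ _ _ u f Cu Cf f0 fmE FE sol z E rho bz zr oE CE rho0 bE AE nu fnu.
have os : osol F u f (grad u) by rewrite FE; exact: osol_of_obstacle.
have fmf x : eball 0 1 x -> fm <= f x.
  move=> xB; rewrite fmE; apply: ge_inf; last by exists x.
  by exists 0 => _ [y yB <-]; exact: ltW (f0 y yB).
have [_ _ gF _] := C1alpha_bounds n0 Cf; rewrite -FE in gF.
have {}zr : enorm z < 1 / 2 by move: zr; rewrite /eball /= subr0.
have inB (x : 'rV[R]_n) : enorm x < 1 / 2 -> eball 0 1 x by rewrite /eball /= subr0; lra.
have [e [S0 [e1 eS ST <- PE]]] := touching_expansion oE CE bE fnu.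
have uz : u z = 0.
  apply: positivity_boundary bz; [exact: (proj1 sol)| |exact: inB].
  by move=> x /(proj1 Cu) [].
have near0 (d : R) : 0 < d -> exists2 d' : R, 0 < d' & forall h, enorm h < d' -> enorm h < d /\
    (0 < u (z + h) -> E (z + h)).
  move=> d0; have zz : 0 < 1 / 2 - enorm z by rewrite subr_gt0.
  exists (Num.min d (Num.min rho (1 / 2 - enorm z))); first by rewrite !lt_min d0 rho0.
  move=> h; rewrite !lt_min => /and3P[hd hr hz]; split => // up; apply: AE; split.
    by split => //; apply: inB; apply: le_lt_trans (enormD _ _) _; rewrite -ltrBrDl.
  by rewrite /eball /= addrBK.
apply: (@sliding R n F u f (grad u) fm Cg rg z e S0) => //.
- move=> x0 x0r ux0 x xr; apply: (SG u f (grad u) x0 (grad f x0)) => //.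
  + exact: fmf (inB _ x0r).
  + exact: gF (inB _ x0r).
  move=> r x1 y1 r4 x1r y1r; rewrite FE; exact: C1alpha_taylor.
- move=> eps eps0; have [d d0 Hd] := PE eps eps0; have [d' d0' Hd'] := near0 d d0.
  by exists d' => // h /Hd'[hd Eh] up; apply: Hd => //; exact: Eh.
move=> d d0; have [h hd [_ up]] := boundary_near bz d0; by exists h.
Qed.

Theorem theorem1p2 (R : realType) :
  exists C0 : nat -> R -> R -> R -> R,
  forall (n : nat) (alpha : R) (u f : 'rV[R]_n -> R),
    (0 < n)%N ->
    0 < alpha ->
    C1alpha (eball 0 1) 1 u ->
    C1alpha (eball 0 1) alpha f ->
    (forall x, eball 0 1 x -> 0 < f x) ->
    0 < inf [set f x | x in eball 0 1] ->
    obstacle_solution (eball 0 1) f u ->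
    mean_curvature_le (positivity_set (eball 0 1) u) (eball 0 (1 / 2))
      (C0 n (inf [set f x | x in eball 0 1]) alpha
          (fine (C1alpha_norm (eball 0 1) alpha f))).
Proof.
(* The choice is made over quadruples of parameters, before any [u] or [f] is introduced. *)
have /choice[C0 H] (p : nat * R * R * R) := @curvature_bound_exists R p.1.1.1 p.1.1.2 p.1.2 p.2.
exists (fun n m al F => C0 (n, m, al, F)) => n alpha u f n0 al0 Cu Cf f0 m0 sol.
exact: (H (n, _, alpha, _) n0 al0 m0 u f Cu Cf f0 erefl erefl sol).
Qed.
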